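(* Let $\mathcal{A}=(\mathcal{A}_1,\dots,\mathcal{A}_n)$ be a family of finite sets in $(\mathbb{Z}_{\ge 0})^n$ such that (H1) $0\notin\mathcal{A}_j$ for every $1\le j\le n$; (H2) for all $I\subset\{1,\dots,n\}$, if $J_I:=\{j\in\{1,\dots,n\}\mid\exists a\in\mathcal{A}_j:\ a_i=0\ \forall i\in I\}$, then $\#I+\#J_I\ge n$. Let $\mathbf{f}=(f_1,\dots,f_n)$ be a generic family of polynomials in $\mathbb{C}[x_1,\dots,x_n]$ supported on $\mathcal{A}$. Let $M:=MV_n(\mathcal{A}^0)-MV_n(\mathcal{A})+1$, where $\mathcal{A}^0=(\mathcal{A}_1\cup\{0\},\dots,\mathcal{A}_n\cup\{0\})$. For $1\le j\le n$, let $\mathcal{A}_j^{\Delta_M}:=\mathcal{A}_j\cup\{Me_i\}_{i=1}^n$, let $\rho_j^{\Delta_M}$ be the convex function that parameterizes the lower envelope of the polytope $\mathrm{conv}(\mathcal{A}_j^{\Delta_M})$, and let $\overline{\rho_j}^{\Delta_M}$ be its restriction to the projected simplex as defined in the context. Then $$\mathrm{mult}_0(\mathbf{f})=MI'_n(\overline{\rho_1}^{\Delta_M},\dots,\overline{\rho_n}^{\Delta_M}).$$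
   Context: $\mathbb{N}$ denotes the positive integers, and $e_i$ is the $i$th canonical basis vector. A system supported on $\mathcal{A}$ is $\mathbf{f}=(f_1,\dots,f_n)$ with $f_j=\sum_{a\in\mathcal{A}_j}c_{j,a}x^a$ and all $c_{j,a}\in\mathbb{C}\setminus\{0\}$. A statement holds for a generic system supported on $\mathcal{A}$ if it holds for all coefficient vectors in some non-empty Zariski open subset of $\mathbb{C}^{\#\mathcal{A}_1}\times\dots\times\mathbb{C}^{\#\mathcal{A}_n}$. Under (H1) and (H2), the origin is an isolated zero of a generic system supported on $\mathcal{A}$. For an isolated zero $\zeta$ of $\mathbf{f}$, $\mathrm{mult}_\zeta(\mathbf{f})=\dim_{\mathbb{C}}\mathbb{C}[x]_{\mathfrak{m}_\zeta}/(f_1,\dots,f_n)\mathbb{C}[x]_{\mathfrak{m}_\zeta}$, with $\mathfrak{m}_\zeta=(x_1-\zeta_1,\dots,x_n-\zeta_n)$. Mixed volume: $MV_n(\mathcal{A}_1,\dots,\mathcal{A}_n)=\sum_{J\subset\{1,\dots,n\}}(-1)^{n-\#J}\mathrm{Vol}_n\big(\sum_{j\in J}\mathrm{conv}(\mathcal{A}_j)\big)$, with Minkowski sums (the empty $J$ contributes $0$). Lower envelopes and restrictions: let $\pi:\mathbb{R}^n\to\mathbb{R}^{n-1}$ be the projection to the first $n-1$ coordinates. With $Q_j=\mathrm{conv}(\mathcal{A}_j^{\Delta_M})$, $\rho_j^{\Delta_M}:\pi(Q_j)\to\mathbb{R}$ is $\rho_j^{\Delta_M}(x)=\min\{t\in\mathbb{R}:(x,t)\in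 Q_j\}$. Let $\lambda_{ij}=\min\{\mu\in\mathbb{N}\mid\mu e_i\in Q_j\}$ for $1\le i\le n$ and $\Delta_j=\mathrm{conv}\{0,\lambda_{1j}e_1,\dots,\lambda_{nj}e_n\}$; one has $\pi(\Delta_j)\subset\pi(Q_j)$, and $\overline{\rho_j}^{\Delta_M}=\rho_j^{\Delta_M}|_{\pi(\Delta_j)}$. Mixed integral: for convex functions $\rho_j:P_j\to\mathbb{R}$ on polytopes $P_j\subset\mathbb{R}^{n-1}$ ($1\le j\le n$) and non-empty $J\subset\{1,\dots,n\}$, let $(\boxplus'_{j\in J}\rho_j)(x)=\min\{\sum_{j\in J}\rho_j(y_j):y_j\in P_j,\ \sum_{j\in J}y_j=x\}$ for $x\in\sum_{j\in J}P_j$. Then $MI'_n(\rho_1,\dots,\rho_n)=\sum_{k=1}^n(-1)^{n-k}\sum_{J\subset\{1,\dots,n\},\ \#J=k}\int_{\sum_{j\in J}P_j}(\boxplus'_{j\in J}\rho_j)(x)\,dx$. *)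

(* Defs.v *)
From HB Require Import structures.
From mathcomp Require Import all_boot all_order all_algebra finmap.
(* The notations of mpoly are incompatible with those of MathComp-Analysis, and
   both libraries define a constant isMeasure, hence the order below. *)
From mathcomp Require mpoly.
Import -(notations) mpoly.
From mathcomp Require Import all_classical all_reals all_analysis.
From mathcomp Require Import complex.

Set Implicit Arguments.
Unset Strict Implicit.
Unset Printing Implicit Defensive.

Import Order.TTheory GRing.Theory Num.Theory.

Local Open Scope classical_set_scope.
Local Open Scope ring_scope.
Local Open Scope complex_scope.

Section lebesgue_tuple.
Context {R : realType}.
Local Notation Rm := (measurableTypeR R).

Definition tuple_cons n (p : Rm * n.-tuple Rm) : n.+1.-tuple Rm :=
  [tuple of p.1 :: p.2].

Lemma measurable_tuple_cons n : measurable_fun setT (@tuple_cons n).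
Proof. exact: (measurable_cons measurable_fst measurable_snd). Qed.

Section step.
Context n (mu : {sigma_finite_measure set n.-tuple Rm -> \bar R}).

Definition lebesgue_prod : set (n.+1.-tuple Rm) -> \bar R :=
  pushforward (lebesgue_measure \x mu)%E (@tuple_cons n).

Let measurable_pre A : measurable A -> measurable (@tuple_cons n @^-1` A).
Proof.
by move=> mA; rewrite -[X in measurable X]setTI; exact: measurable_tuple_cons.
Qed.

Let lebesgue_prod0 : lebesgue_prod set0 = 0%E.
Proof. by rewrite /lebesgue_prod /pushforward preimage_set0 measure0. Qed.

Let lebesgue_prod_ge0 A : (0 <= lebesgue_prod A)%E.
Proof. exact: (measure_ge0 (lebesgue_measure \x mu)%E). Qed.

Let lebesgue_prod_sigma_additive : semi_sigma_additive lebesgue_prod.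
Proof.
move=> F mF tF mUF; rewrite /lebesgue_prod /pushforward preimage_bigcup.
apply: measure_semi_sigma_additive.
- by move=> k; exact: measurable_pre.
- apply/trivIsetP => /= i j _ _ ij; rewrite -preimage_setI.
  by move/trivIsetP : tF => /(_ _ _ _ _ ij) ->//; rewrite preimage_set0.
- by rewrite -preimage_bigcup; exact: measurable_pre.
Qed.

HB.instance Definition _ := isMeasure.Build _ _ _ lebesgue_prod
  lebesgue_prod0 lebesgue_prod_ge0 lebesgue_prod_sigma_additive.

Let lebesgue_prod_sigma_finite : sigma_finite setT lebesgue_prod.
Proof.
have /sigma_finiteP[F [FT ndF mF]] :=
  sigma_finiteT (lebesgue_measure : {sigma_finite_measure set Rm -> \bar R}).
have /sigma_finiteP[G [GT ndG mG]] := sigma_finiteT mu.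
pose uncons (t : n.+1.-tuple Rm) : Rm * n.-tuple Rm :=
  (thead t, [tuple of behead t]).
have muncons : measurable_fun setT uncons.
  apply: measurable_fun_pair; first exact: measurable_tnth.
  exact: measurable_behead.
have consK : cancel (@tuple_cons n) uncons.
  by move=> [x t]; congr pair; exact: val_inj.
exists (fun k => uncons @^-1` (F k `*` G k)) => [|k].
  apply/esym/seteqP; split => // t _.
  have [i _ Fi] : (\bigcup_i F i) (uncons t).1 by rewrite -FT.
  have [j _ Gj] : (\bigcup_i G i) (uncons t).2 by rewrite -GT.
  exists (maxn i j) => //; split.
  - by move: Fi; exact/subsetPset/ndF/leq_maxl.
  - by move: Gj; exact/subsetPset/ndG/leq_maxr.
have [[mFk Fk] [mGk Gk]] := (mF k, mG k); split.
  by rewrite -[X in measurable X]setTI; apply: muncons => //; exact: measurableX.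
rewrite /lebesgue_prod /pushforward -comp_preimage.
rewrite (_ : uncons \o _ = id) ?preimage_id; last exact/funext.
by rewrite product_measure1E// lte_mul_pinfty// ge0_fin_numE.
Qed.

HB.instance Definition _ := Measure_isSigmaFinite.Build _ _ _ lebesgue_prod
  lebesgue_prod_sigma_finite.

End step.

(* The n-fold product of the Lebesgue measure on R; for n = 0 it is the point
   mass on the one-point space R^0. *)
Fixpoint lebesgue_tuple n : {sigma_finite_measure set n.-tuple Rm -> \bar R} :=
  match n return {sigma_finite_measure set n.-tuple Rm -> \bar R} with
  | 0 => \d_([tuple] : 0.-tuple Rm)
  | m.+1 => lebesgue_prod (lebesgue_tuple m)
  end.

End lebesgue_tuple.

Section integration.
Context {R : realType} {n : nat}.

Definition row_of_tuple (t : n.-tuple (measurableTypeR R)) : 'rV[R]_n :=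
  \row_i tnth t i.

Definition volume (P : set 'rV[R]_n) : R :=
  fine (lebesgue_tuple n (row_of_tuple @^-1` P)).

Definition integral_rV (P : set 'rV[R]_n) (f : 'rV[R]_n -> R) : R :=
  \int[lebesgue_tuple n]_(t in row_of_tuple @^-1` P) f (row_of_tuple t).

End integration.

(* The junk value 0 is only returned when [E] has no least element. *)
Definition set_min {R : realType} (E : set R) : R := xget 0 (E `&` lbound E).

Section convex_geometry.
Context {R : realType}.

Definition conv_hull n (E : set 'rV[R]_n) : set 'rV[R]_n :=
  smallest (@convex_set R 'rV[R]_n) E.

Definition minkowski_sum n (I : finType) (J : {set I})
    (P : I -> set 'rV[R]_n) : set 'rV[R]_n :=
  [set \sum_(j in J) y j | y in
    [set y : I -> 'rV[R]_n | forall j, j \in J -> P j (y j)]].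

(* For n > 0 the term J = set0 is the volume of {0}, that is, 0. *)
Definition mixed_volume n (E : 'I_n -> set 'rV[R]_n) : R :=
  \sum_(J : {set 'I_n})
    (-1) ^+ (n - #|J|) * volume (minkowski_sum J (fun j => conv_hull (E j))).

Definition inf_convolution n (I : finType) (J : {set I})
    (P : I -> set 'rV[R]_n) (rho : I -> 'rV[R]_n -> R) (x : 'rV[R]_n) : R :=
  set_min [set \sum_(j in J) rho j (y j) | y in
    [set y : I -> 'rV[R]_n | (forall j, j \in J -> P j (y j)) /\
                             \sum_(j in J) y j = x]].

(* A function on a polytope is given by its domain [P j] and a total function
   [rho j], whose values outside [P j] are not used. *)
Definition mixed_integral m (P : 'I_m.+1 -> set 'rV[R]_m)
    (rho : 'I_m.+1 -> 'rV[R]_m -> R) : R :=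
  \sum_(1 <= k < m.+2) (-1) ^+ (m.+1 - k) *
    \sum_(J : {set 'I_m.+1} | #|J| == k)
      integral_rV (minkowski_sum J P) (inf_convolution J P rho).

End convex_geometry.

Section supports.
Context {R : realType}.

Definition supp_pts n (B : {fset multinom n}) : set 'rV[R]_n :=
  [set \row_i (a i)%:R | a in [set a : multinom n | a \in B]].

Definition supp_pts0 n (B : {fset multinom n}) : set 'rV[R]_n :=
  0 |` supp_pts B.

Definition supp_pts_simplex n (M : R) (B : {fset multinom n}) :
    set 'rV[R]_n :=
  supp_pts B `|` [set M *: delta_mx 0 i | i in [set: 'I_n]].

(* lambda_i = min {mu in N | mu e_i in Q}, with N the positive integers. *)
Definition axis_min n (Q : set 'rV[R]_n) (i : 'I_n) : R :=
  set_min [set mu | exists2 k : nat, (0 < k)%N & mu = k%:R /\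
                                      Q (mu *: delta_mx 0 i)].

Definition axis_simplex n (Q : set 'rV[R]_n) : set 'rV[R]_n :=
  conv_hull (0 |` [set axis_min Q i *: delta_mx 0 i | i in [set: 'I_n]]).

(* R^m.+1 is seen as R^m x R, the last coordinate being the height. *)
Definition proj_init m (x : 'rV[R]_m.+1) : 'rV[R]_m :=
  \row_(i < m) x 0 (widen_ord (leqnSn m) i).

Definition lower_envelope m (Q : set 'rV[R]_m.+1) (x : 'rV[R]_m) : R :=
  set_min [set z 0 ord_max | z in Q `&` [set z | proj_init z = x]].

End supports.

(* The set J_I of the j such that some a in A_j vanishes at all i in I. *)
Definition meets_coord_subspace n (A : 'I_n -> {fset multinom n})
    (I : {set 'I_n}) : {set 'I_n} :=
  [set j | [exists a : A j, [forall i in I, val a i == 0%N]]]%SET.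

Section systems.
Context {K : fieldType} {n : nat}.
Implicit Type A : 'I_n -> {fset multinom n}.

Definition coef_index A : finType := {j : 'I_n & A j}.

Definition system_of A (c : coef_index A -> K) (j : 'I_n) : mpoly n K :=
  \sum_(a : A j) c (Tagged (fun j => A j) a) *: mpolyX K (val a).

Definition zariski_open (I : finType) (U : set (I -> K)) : Prop :=
  exists S : set (mpoly #|I| K),
    U = [set c | exists2 g, S g & meval (fun k => c (enum_val k)) g != 0].

(* As coefficients of a supported system are nonzero, [U] is only tested on
   vectors without zero entry; two nonempty Zariski open sets always meet
   over an infinite field, so this is never vacuous there. *)
Definition for_generic_system A (Phi : ('I_n -> mpoly n K) -> Prop) : Prop :=
  exists U : set (coef_index A -> K),
    [/\ zariski_open U, U !=set0 &
        forall c, U c -> (forall k, c k != 0) -> Phi (system_of c)].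

End systems.

Section multiplicity.
Context {K : fieldType} {n : nat}.
Implicit Types (zeta : 'I_n -> K) (f : 'I_n -> mpoly n K).

(* The localization at the ideal of [zeta], inside the field of fractions. *)
Definition local_ring zeta : set {fraction mpoly n K} :=
  [set tofrac p / tofrac q | p in [set: mpoly n K] &
                             q in [set q | meval zeta q != 0]].

Definition local_ideal zeta f : set {fraction mpoly n K} :=
  [set \sum_j h j * tofrac (f j) | h in
    [set h : 'I_n -> {fraction mpoly n K} | forall j, local_ring zeta (h j)]].

Definition lin_comb d (b : 'I_d -> {fraction mpoly n K}) (c : 'I_d -> K) :=
  \sum_i tofrac (mpolyC n (c i)) * b i.

(* [local_ring zeta / local_ideal zeta f] has a K-basis of d elements, the
   classes of the [b i]. *)
Definition has_multiplicity zeta f (d : nat) : Prop :=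
  exists b : 'I_d -> {fraction mpoly n K},
    [/\ forall i, local_ring zeta (b i),
        forall c, local_ideal zeta f (lin_comb b c) -> forall i, c i = 0 &
        forall g, local_ring zeta g ->
          exists c, local_ideal zeta f (g - lin_comb b c)].

End multiplicity.

(* Main.v *)
Require Import Defs.
From HB Require Import structures.
From mathcomp Require Import all_boot all_order all_algebra finmap.
From mathcomp Require mpoly.
Import -(notations) mpoly.
From mathcomp Require Import all_classical all_reals all_analysis.
From mathcomp Require Import complex.
From mathcomp Require Import zify ring lra.

Set Implicit Arguments.
Unset Strict Implicit.
Unset Printing Implicit Defensive.

Import Order.TTheory GRing.Theory Num.Theory numFieldNormedType.Exports.

Local Open Scope classical_set_scope.
Local Open Scope ring_scope.

(** Let f be generic with supports A_j, and let A^0_j = A_j together with 0. For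
    a multidegree k let X(k) be the span of the monomials obtained by adding to a
    point of a fixed finite set k_j points of A_j for every j. By a Stanley
    decomposition of the standard monomials of X, the f_j act on X like a regular
    sequence in large degrees, so X(k) / sum_j f_j X(k - e_j) has a constant
    dimension: the n-th difference of #X(k), which Riemann sums identify with
    MV(A).

    By the Chinese remainder theorem, mult_0(f) + MV(A) polynomials are
    independent modulo both the local ideal at 0 and the ideal of f in the torus.
    They remain independent over K[s] modulo the pencil f_j + s c_j, because this
    pencil is flat at s = 0. Counting in X for A^0 gives
    mult_0(f) + MV(A) <= MV(A^0), that is mult_0(f) <= M - 1.

    Hence the local ideal contains all monomials of degree M - 1. By Nakayama's
    lemma it is unchanged if the monomials of degree > M are removed from f and
    multiples of the x_i^M are added. Let B be the resulting family of supports: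
    conv(B^0_j) is the simplex {z >= 0, |z| <= M}, and X(k) for B^0 consists of
    all monomials of degree at most M|k| + c. Those of degree > M(|k| - 1) + c
    already lie in X(k) for B, which gives the reverse inequality
    MV(B^0) <= mult_0(f) + MV(B).

    So mult_0(f) = MV(B^0) - MV(B), an alternating sum over J of the volumes of
    the region between sum_J conv(B_j) and the simplex {z >= 0, |z| <= #J M}. By
    an exchange argument this region lies over sum_J pi(Delta_j), under the graph
    of the inf-convolution of the lower envelopes. *)

(* Every condition on the coefficients c has the form [polycond]: some nonzero polynomial in c does
   not vanish. In one multidegree k the statements on X(k) are of this form, but comparing X with
   the ideal of f in the torus involves all large k, hence countably many polynomials. As the field
   is uncountable, they have a common point c. What is shown at this single point spreads to an open
   set, since a rank condition modulo m^(e+1), m the ideal of the origin, is open in c and controls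
   the whole local ideal once the codimension is at most e.

   Hypothesis (H2) makes the coordinates nilpotent in the local ring at 0: on each coordinate
   subspace it leaves enough equations for a finiteness argument in a smaller torus, and the strata
   are combined by descending induction. The origin is then separated from the torus by a Bezout
   relation in one coordinate.

   The upper bound holds for all supports with (H1) and (H2); the lower bound needs X(k) for the
   enlarged supports to be all polynomials of bounded degree, which is the reason for passing from A
   to B. Volumes enter only as limits of lattice point counts. *)
Declare Scope mnm_scope.
Delimit Scope mnm_scope with M.
Notation "m1 + m2" := (mnm_add m1%M m2%M) : mnm_scope.
Notation "m1 - m2" := (mnm_sub m1%M m2%M) : mnm_scope.
Notation "m *+ k" := (mnm_muln m%M k%N) : mnm_scope.
Notation "m1 <= m2" := (mpoly.lem m1%M m2%M) : mnm_scope.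
Notation "0" := (@mnm0 _) : mnm_scope.
Notation "'e_ i" := (mnm1 i) (at level 8, i at level 2, format "''e_' i") : mnm_scope.
Bind Scope mnm_scope with multinom.

Ltac mnm := rewrite ?(mnmDE, mnmBE, mulmnE, mnm0E, mnm1E).

(** * Stanley decompositions of order ideals of monomials *)

Section Stanley.
Variable q : nat.
Implicit Types (P : multinom q * {set 'I_q}) (a : 'I_q) (u v w : multinom q) (S : multinom
    q -> Prop).

Definition in_piece (P : multinom q * {set 'I_q}) u :=
  forall a, if a \in P.2 then is_true (P.1 a <= u a)%N else u a = P.1 a.

(* The pieces are ordered so that adding a variable never leads to an earlier
   piece; this makes the matrices of [coef_mx] triangular in the limit. *)
Definition decomposable S := exists ps : seq (multinom q * {set 'I_q}),
  [/\ forall u, S u <-> exists2 P, P \in ps & in_piece P u,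
      forall d u s t, (s < size ps)%N -> (t < size ps)%N ->
        in_piece (nth d ps s) u -> in_piece (nth d ps t) u -> s = t &
      forall d u a s t, (s < size ps)%N -> (t < size ps)%N ->
        in_piece (nth d ps s) u -> in_piece (nth d ps t) (u + 'e_a)%M ->
        (s <= t)%N].

Lemma in_piece_base P : in_piece P P.1.
Proof. by move=> a; case: ifP. Qed.

Lemma in_piece_step P a : a \in P.2 -> in_piece P (P.1 + 'e_a)%M.
Proof.
move=> aP b; mnm; case: ifP => bP; first by rewrite leq_addr.
by case: eqP aP bP => [<- ->|]//; rewrite addn0.
Qed.

Lemma decomposable_ext S S' : (forall u, S u <-> S' u) ->
  decomposable S -> decomposable S'.
Proof.
by move=> SS' [ps [h1 h2 h3]]; exists ps; split => // u; rewrite -SS' h1.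
Qed.

Lemma decomposable0 : decomposable (fun=> False).
Proof. by exists [::]; split => // u; split => // -[]. Qed.

Lemma decomposable_cat S1 S2 : decomposable S1 -> decomposable S2 ->
  (forall u, S1 u -> ~ S2 u) -> (forall u a, S2 u -> ~ S1 (u + 'e_a)%M) ->
  decomposable (fun u => S1 u \/ S2 u).
Proof.
move=> [ps [p1 p2 p3]] [qs [q1 q2 q3]] dis arr; exists (ps ++ qs).
have inS1 d s u : (s < size ps)%N -> in_piece (nth d ps s) u -> S1 u.
  by move=> sp h; apply/p1; exists (nth d ps s) => //; exact: mem_nth.
have inS2 d s u : (s < size qs)%N -> in_piece (nth d qs s) u -> S2 u.
  by move=> sp h; apply/q1; exists (nth d qs s) => //; exact: mem_nth.
split.
- move=> u; rewrite p1 q1; split.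
    by case=> -[P Pp Pu]; exists P; rewrite // mem_cat Pp ?orbT.
  by case=> P; rewrite mem_cat => /orP[] Pp Pu; [left|right]; exists P.
- move=> d u s t; rewrite size_cat !nth_cat => sp tp.
  case: ifP => s1; case: ifP => t1.
  + exact: p2.
  + move=> /(inS1 _ _ _ s1) h1 /inS2 h2; exfalso; apply: (dis u h1); apply: h2.
    by lia.
  + move=> /inS2 h2 /(inS1 _ _ _ t1) h1; exfalso; apply: (dis u h1); apply: h2.
    by lia.
  + have sq : (s - size ps < size qs)%N by lia.
    have tq : (t - size ps < size qs)%N by lia.
    by move=> h1 h2; have := q2 d u _ _ sq tq h1 h2; lia.
- move=> d u a s t; rewrite size_cat !nth_cat => sp tp.
  case: ifP => s1; case: ifP => t1.
  + exact: p3.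
  + by move=> *; lia.
  + move=> /inS2 h2 /(inS1 _ _ _ t1) h1; exfalso; apply: (arr u a); last by [].
    by apply: h2; lia.
  + have sq : (s - size ps < size qs)%N by lia.
    have tq : (t - size ps < size qs)%N by lia.
    by move=> h1 h2; have := q3 d u a _ _ sq tq h1 h2; lia.
Qed.

Definition first_coords i u := forall a : 'I_q, (i <= a)%N -> u a = 0%N.
Definition downset S := forall u v, (u <= v)%M -> S v -> S u.

(** Each piece is translated by t in the direction i. The flag [G] decides whether the variable i
    also becomes free, which gives all heights from t on, or stays fixed, which gives the single
    height t. *)
Lemma decomposable_slice (i : 'I_q) S t (G : bool) :
  (forall u, S u -> first_coords i u) -> decomposable S ->
  decomposable (fun u => exists w l, [/\ S w, G || (l == 0%N) &
                                  u = (w + 'e_i *+ (t + l))%M]).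
Proof.
move=> Si [ps [p1 p2 p3]].
pose up (P : multinom q * {set 'I_q}) :=
  ((P.1 + 'e_i *+ t)%M, if G then (i |: P.2)%SET else P.2).
have pi P : P \in ps -> P.1 i = 0%N /\ i \notin P.2.
  move=> Pp; split; first by apply: (Si P.1) => //; apply/p1; exists P => //;
      exact: in_piece_base.
  apply/negP => iP; suff: (P.1 + 'e_i)%M i = 0%N by mnm; rewrite eqxx addn1.
  by apply: Si => //; apply/p1; exists P => //; exact: in_piece_step.
have upE P u : P \in ps -> in_piece (up P) u <->
    exists w l, [/\ in_piece P w, G || (l == 0%N) & u = (w + 'e_i *+ (t + l))%M].
  move=> /pi[Pi iP]; split.
    move=> h; exists (u - 'e_i *+ u i)%M, (u i - t)%N.
    have ti : (t <= u i)%N.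
      have := h i; rewrite /up /=; case: ifP => _; mnm; rewrite eqxx !mul1n Pi//=.
      by move=> ->.
    split.
    - move=> a; case: (eqVneq a i) => [->|ai].
        by rewrite (negbTE iP); mnm; rewrite eqxx !mul1n subnn Pi.
      have := h a; rewrite /up /= (fun_if (fun X : {set 'I_q} =>
          a \in X)) in_setU1 (negbTE ai) /= if_same.
      by mnm; rewrite eq_sym (negbTE ai) mul0n subn0 addn0.
    - have [//|/negbTE G0] := boolP G; have := h i.
      by rewrite /up /= G0 (negbTE iP); mnm; rewrite eqxx !mul1n Pi => ->;
          rewrite add0n subnn.
    - apply/mnmP => a; mnm; case: (eqVneq i a) => [<-|ia];
        last by rewrite !mul0n subn0 addn0.
      by rewrite !mul1n; lia.
  move=> [w [l [Pw Gl ->]]] a; rewrite /up /=.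
  have := Pw a; case: (eqVneq a i) => [->|ai].
    rewrite (negbTE iP) Pi => w0.
    case: ifP => iG; mnm; rewrite eqxx !mul1n w0 ?Pi ?add0n ?leq_addr//.
    have [GT|/negbTE G0] := boolP G; first by move: iG; rewrite GT in_setU1 eqxx.
    by move: Gl; rewrite G0 => /eqP->; rewrite addn0.
  rewrite (fun_if (fun X : {set 'I_q} => a \in X)) in_setU1 (negbTE ai) /= if_same.
  by mnm; rewrite eq_sym (negbTE ai) !mul0n !addn0.
have nthup d s : (s < size ps)%N -> nth (up d) (map up ps) s = up (nth d ps s).
  by move=> sp; rewrite (nth_map d).
have cancw w w' l l' : first_coords i w -> first_coords i w' ->
  (w + 'e_i *+ (t + l))%M = (w' + 'e_i *+ (t + l'))%M -> w = w'.
  move=> wi wi' /mnmP e; apply/mnmP => a; have := e a; mnm.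
  by case: (eqVneq i a) => [<-|]; rewrite ?mul0n ?addn0// wi// wi'.
have dE d s : (s < size ps)%N -> nth d (map up ps) s = up (nth d ps s).
  by move=> sp; rewrite (set_nth_default (up d)) ?size_map// nthup.
have inS d s u : (s < size ps)%N -> in_piece (nth d ps s) u -> first_coords i u.
  by move=> sp h; apply/Si/p1; exists (nth d ps s) => //; exact: mem_nth.
exists (map up ps); rewrite size_map; split.
- move=> u; split.
    move=> [w [l [/p1[P Pp Pw] Gl ->]]]; exists (up P); first exact: map_f.
    by apply/upE => //; exists w, l.
  move=> [_ /mapP[P Pp ->]] /(upE _ _ Pp)[w [l [Pw Gl ->]]]; exists w, l; split => //.
  by apply/p1; exists P.
- move=> d u s s' sp sp'; rewrite !dE// => /upE;
    move=> /(_ (mem_nth _ sp))[w [l [hw _ uE]]].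
  move=> /upE; move=> /(_ (mem_nth _ sp'))[w' [l' [hw' _ uE']]].
  apply: (p2 d w) => //; rewrite (cancw w w' l l')//; [exact: inS hw|exact: inS hw'|].
  by rewrite -uE.
- move=> d u a s s' sp sp'; rewrite !dE// => /upE;
    move=> /(_ (mem_nth _ sp))[w [l [hw _ uE]]].
  move=> /upE; move=> /(_ (mem_nth _ sp'))[w' [l' [hw' _ uE']]].
  have wi := inS _ _ _ sp hw; have wi' := inS _ _ _ sp' hw'.
  case: (eqVneq a i) => [ai|ai].
    have ww' : w = w'.
      apply/mnmP => b; move: uE'; rewrite uE ai => /mnmP/(_ b); mnm.
      by case: (eqVneq i b) => [<-|]; rewrite ?mul0n ?addn0// wi// wi'.
    by rewrite (p2 d w s s') // ww'.
  apply: (p3 d w a) => //; suff -> : (w + 'e_a)%M = w' by [].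
  apply/mnmP => b; move: uE'; rewrite uE => /mnmP/(_ b); mnm.
  case: (eqVneq i b) => [<-|]; rewrite ?mul0n ?addn0//.
  by rewrite (negbTE ai) addn0 wi// wi'// addn0.
Qed.

Definition slice S (i : 'I_q) t u := first_coords i u /\ S (u + 'e_i *+ t)%M.

Lemma slice_first S (i : 'I_q) t u : slice S i t u -> first_coords i u.
Proof. by case. Qed.

Lemma slice_downset S (i : 'I_q) t : downset S -> downset (slice S i t).
Proof.
move=> dS u v uv [vi Sv]; split.
  by move=> a ia; have /mnm_lepP/(_ a) := uv; rewrite vi// leqn0 => /eqP.
by apply: dS Sv; apply/mnm_lepP => a; mnm; rewrite leq_add2r; exact/mnm_lepP.
Qed.

Lemma slice_decr S (i : 'I_q) t t' u : downset S -> (t <= t')%N ->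
  slice S i t' u -> slice S i t u.
Proof.
move=> dS tt [ui Su]; split => //; apply: dS Su; apply/mnm_lepP => a; mnm.
by rewrite leq_add2l leq_mul2l tt orbT.
Qed.

Lemma first_coords_split (i : 'I_q) u : first_coords i.+1 u ->
  first_coords i (u - 'e_i *+ u i)%M /\ (u - 'e_i *+ u i + 'e_i *+ u i = u)%M.
Proof.
move=> ui; split => [a ia|].
  mnm; case: (eqVneq i a) => [<-|ia']; first by rewrite mul1n subnn.
  by rewrite ui // ltn_neqAle; apply/andP; split.
apply/mnmP => a; mnm; case: (eqVneq i a) => [<-|_]; rewrite ?mul1n ?subnK//.
Qed.

(** A form of Dickson's lemma, by induction on the number of variables: the heights from some T1 on
    are controlled by one diagonal chain of slices, and each of the finitely many heights below T1
    by a chain of its own. *)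
Lemma downset_stable i (S : nat -> multinom q -> Prop) : (i <= q)%N ->
  (forall t, downset (S t)) -> (forall t u, S t u -> first_coords i u) ->
  (forall t t' u, (t <= t')%N -> S t' u -> S t u) ->
  exists T, forall t u, (T <= t)%N -> S T u -> S t u.
Proof.
elim: i S => [|i IH] S iq dS fS mS.
  have [[t St]|St] := pselect (exists t, ~ S t 0%M).
    exists t => t' u _ Stu; suff u0 : u = 0%M by rewrite u0 in Stu.
    by apply/mnmP => a; mnm; apply: (fS t u Stu).
  exists 0%N => t u _ S0u; suff -> : u = 0%M by apply: contrapT => h; apply: St; exists t.
  by apply/mnmP => a; mnm; apply: (fS _ u S0u).
pose i' := Ordinal iq.
(* In the diagonal chain the height of the slice grows together with the index, so stability from T1
   on treats all heights at least T1 at once. *)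
have [T1 T1P] : exists T, forall t u, (T <= t)%N ->
    slice (S T) i' T u -> slice (S t) i' t u.
  apply: (IH (fun t => slice (S t) i' t)); first exact: ltnW.
  - by move=> t; exact: slice_downset.
  - by move=> t u [].
  - move=> t t' u tt' /(slice_decr (dS _) tt')[ui Su]; split => //; exact: mS Su.
have Tl l : exists T, forall t u, (T <= t)%N ->
    slice (S T) i' l u -> slice (S t) i' l u.
  apply: (IH (fun t => slice (S t) i' l)); first exact: ltnW.
  - by move=> t; exact: slice_downset.
  - by move=> t u [].
  - by move=> t t' u tt' [ui Su]; split => //; exact: mS Su.
have [T2 T2P] := choice Tl.
pose T := (T1 + \sum_(l < T1) T2 l)%N.
have T2T (l : nat) : (l < T1)%N -> (T2 l <= T)%N.
  by move=> lT; rewrite /T (bigD1 (Ordinal lT)) //=; lia.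
exists T => t u Tt Su.
have [ui uE] := first_coords_split (fS T u Su : first_coords i'.+1 u).
move: Su; rewrite -uE; set w := (_ - _)%M; set l := u i' => Su.
have [lT|Tl'] := ltnP l T1.
  suff [] : slice (S t) i' l w by [].
  apply: (T2P l); first exact: leq_trans (T2T _ lT) Tt.
  by split => //; exact: mS (T2T _ lT) Su.
suff : slice (S (maxn t l)) i' l w.
  by case=> _; apply: mS; rewrite leq_maxl.
suff h : slice (S (maxn t l)) i' (maxn t l) w.
  by apply: slice_decr h => //; rewrite leq_maxr.
apply: (T1P); first by rewrite /T in Tt; lia.
apply: (slice_decr (t' := l)) => //; split => //; apply: mS Su; rewrite /T; lia.
Qed.

(** The slices in the last variable decrease with the height and are constant from some T on: there
    the variable is free, and below T there remain finitely many slices, decomposable by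
    induction. *)
Lemma downset_decomposable_first i S : (i <= q)%N -> downset S ->
  (forall u, S u -> first_coords i u) -> decomposable S.
Proof.
elim: i S => [|i IH] S iq dS fS.
  have [S0|S0] := pselect (S 0%M).
    exists [:: (0%M, finset.set0)]; split.
    - move=> u; split.
        move=> Su; exists (0%M, finset.set0); rewrite ?mem_head// => a /=;
            rewrite finset.in_set0.
        by rewrite (fS u Su)// mnm0E.
      case=> P; rewrite inE => /eqP-> h; suff -> : u = 0%M by [].
      by apply/mnmP => a; have := h a; rewrite /= finset.in_set0.
    - by move=> d u [|?] [|?].
    - by move=> d u a [|?] [|?].
  apply: decomposable_ext decomposable0 => u; split => // Su; apply: S0.
  by apply: dS Su; apply/mnm_lepP => a; mnm.
pose i' := Ordinal iq.
have [T TP] : exists T, forall t u, (T <= t)%N -> slice S i' T u -> slice S i' t u.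
  apply: (downset_stable (i := i)); first exact: ltnW.
  - by move=> t; exact: slice_downset.
  - by move=> t u [].
  - by move=> t t' u; exact: slice_decr.
have decs t : decomposable (slice S i' t).
  by apply: IH; [exact: ltnW|exact: slice_downset|move=> u []].
(* Heights are added from the top downward, each new slice being put in front: adding a variable can
   only raise the height, so it never leads back to an earlier piece. *)
suff : forall d, (d <= T)%N -> decomposable (fun u => S u /\ (T - d <= u i')%N).
  by move=> /(_ T (leqnn _)); apply: decomposable_ext => u; rewrite subnn; intuition.
elim=> [_|d IHd dT].
  apply: decomposable_ext (decomposable_slice T true (@slice_first S i' T) (decs T)).
  move=> u; rewrite subn0; split.
    move=> [w [l [wS _ ->]]].
    have [wi Sw] : slice S i' (T + l) w by apply: TP wS; rewrite leq_addr.
    by split => //; mnm; rewrite eqxx wi// mul1n leq_addr.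
  move=> [Su Tu]; have [ui uE] := first_coords_split (fS u Su : first_coords i'.+1 u).
  exists (u - 'e_i' *+ u i')%M, (u i' - T)%N; split => //.
    by apply: (slice_decr dS Tu); split; rewrite ?uE.
  by rewrite subnKC.
have := decomposable_cat (decomposable_slice (T - d.+1) false (@slice_first S i' _) (decs
    (T - d.+1)%N)) (IHd (ltnW dT)).
move=> h; apply: decomposable_ext (h _ _) => {h}.
- move=> u; split.
    case; last by case=> Su Tu; split => //; lia.
    move=> [w [l [[wi Sw] /eqP l0 ->]]]; rewrite l0 addn0; split => //.
    by mnm; rewrite eqxx wi// mul1n.
  move=> [Su Tu]; have [Tdu|uTd] := leqP (T - d)%N (u i'); first by right.
  left; have [ui uE] := first_coords_split (fS u Su : first_coords i'.+1 u).
  have uiE : (T - d.+1 + 0)%N = u i' by lia.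
  exists (u - 'e_i' *+ u i')%M, 0%N; rewrite uiE; split => //.
  by split => //; rewrite (_ : (T - d.+1)%N = u i') ?uE//; lia.
- move=> u [w [l [[wi _] /eqP -> ->]]] [_]; mnm; rewrite eqxx wi//; lia.
- move=> u a [Su Tu] [w [l [[wi _] /eqP -> /mnmP/(_ i')]]]; mnm; rewrite eqxx wi//; lia.
Qed.

Lemma downset_decomposable S : downset S -> decomposable S.
Proof.
move=> dS; apply: (downset_decomposable_first (leqnn q)) => // u _ a.
by rewrite leqNgt ltn_ord.
Qed.

End Stanley.

(** * Modules of lattice points and their standard monomials *)

Lemma subm_add N (k : multinom N) j : (0 < k j)%N -> (k - 'e_j + 'e_j)%M = k.
Proof. by move=> kj; rewrite submK// lep1mP -lt0n. Qed.

Definition mnm_of N (E : 'I_N -> nat) : multinom N := Multinom (mktuple E).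

Lemma mnm_ofE N (E : 'I_N -> nat) i : mnm_of E i = E i.
Proof. exact: mnmE. Qed.

Lemma mdeg_ge N (u : multinom N) i : (u i <= mdeg u)%N.
Proof. by rewrite mdegE (bigD1 i) //= leq_addr. Qed.

(* A family of supports is encoded by indices a : 'I_q, the exponent [ex a] being
   in the support number [blk a]. *)
Section Weights.
Variables (n q : nat) (blk : 'I_q -> 'I_n) (ex : 'I_q -> multinom n).
Implicit Types (u v w : multinom q) (a b : 'I_q) (i j : 'I_n).

(** A vector [u] is read as a monomial in auxiliary variables y_a, one for each index: [wpt] is its
    image under the substitution of x^(ex a) for y_a, and [wdg] its multidegree when y_a has degree
    e_(blk a). *)
Definition wpt u : multinom n := \big[@mnm_add n/@mnm0 n]_a (ex a *+ u a)%M.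
Definition wdg u : multinom n := \big[@mnm_add n/@mnm0 n]_a ('e_(blk a) *+ u a)%M.

Lemma wptE u i : wpt u i = (\sum_a ex a i * u a)%N.
Proof. by rewrite /wpt mnm_sumE; apply: eq_bigr => a _; mnm. Qed.

Lemma wdgE u j : wdg u j = (\sum_(a | blk a == j) u a)%N.
Proof.
rewrite /wdg mnm_sumE [RHS]big_mkcond; apply: eq_bigr => a _; mnm.
by case: eqP => _; rewrite ?mul1n ?mul0n.
Qed.

Lemma wptD u v : wpt (u + v)%M = (wpt u + wpt v)%M.
Proof.
apply/mnmP => i; mnm; rewrite !wptE -big_split; apply: eq_bigr => a _; mnm.
by rewrite mulnDr.
Qed.

Lemma wdgD u v : wdg (u + v)%M = (wdg u + wdg v)%M.
Proof. by apply/mnmP => i; mnm; rewrite !wdgE -big_split; apply: eq_bigr => a _; mnm. Qed.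

Lemma sum_mnm1 (F : 'I_q -> nat) a (P : pred 'I_q) :
  (\sum_(b | P b) F b * ('e_a)%M b = if P a then F a else 0)%N.
Proof.
rewrite big_mkcond (bigD1 a) //= big1 ?addn0; last first.
  by move=> b ba; rewrite mnm1E eq_sym (negbTE ba) muln0 if_same.
by rewrite mnm1E eqxx muln1.
Qed.

Lemma sum_mnm1_1 a (P : pred 'I_q) : (\sum_(b | P b) ('e_a)%M b = P a)%N.
Proof.
have := sum_mnm1 (fun=> 1%N) a P; under eq_bigr do rewrite mul1n.
by move=> ->; case: (P a).
Qed.

Lemma wpt1 a : wpt 'e_a = ex a.
Proof. by apply/mnmP => i; rewrite wptE sum_mnm1. Qed.

Lemma wdg1 a : wdg 'e_a = ('e_(blk a))%M.
Proof.
apply/mnmP => j; rewrite wdgE mnm1E.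
by rewrite sum_mnm1_1.
Qed.

Lemma wpt0 : wpt 0 = 0%M.
Proof. by apply/mnmP => i; rewrite wptE mnm0E big1// => a _; mnm; rewrite muln0. Qed.

Lemma wdg0 : wdg 0 = 0%M.
Proof. by apply/mnmP => i; rewrite wdgE mnm0E big1// => a _; mnm. Qed.

Lemma mdeg_wdg u : mdeg (wdg u) = mdeg u.
Proof.
rewrite !mdegE; under eq_bigr do rewrite wdgE.
rewrite (exchange_big_dep xpredT)//=; apply: eq_bigr => a _.
by rewrite (big_pred1 (blk a)).
Qed.

End Weights.

Definition finite_of_size (T : eqType) (P : T -> Prop) (N : nat) :=
  exists s : seq T, [/\ uniq s, size s = N & forall x, P x <-> x \in s].

(** * Standard monomials, their pieces and the Hilbert function *)

Section Standard.
Variables (n q : nat) (blk : 'I_q -> 'I_n) (ex : 'I_q -> multinom n).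
Variables (p : nat) (gpt gdg : 'I_p -> multinom n).
Variable Z : multinom n -> multinom n -> Prop.
Local Notation E := ('I_p * multinom q)%type.
Local Notation wpt := (wpt ex).
Local Notation wdg := (wdg blk).
Implicit Types (e f : E) (u v w : multinom q) (k x : multinom n).
Implicit Types (a b : 'I_q) (i j : 'I_n).

Hypothesis Zadd : forall w k x, Z k x -> Z (k + wdg w)%M (x + wpt w)%M.

Definition pt e := (gpt e.1 + wpt e.2)%M.
Definition dg e := (gdg e.1 + wdg e.2)%M.
Definition addE e w : E := (e.1, (e.2 + w)%M).
(* [Z] is a submodule: [X k x] and [~ Z k x] describe the monomials x of degree k
   in the quotient. *)
Definition lattice_module k x := exists2 e, dg e = k & pt e = x.
Local Notation X := lattice_module.

Lemma ptD e w : pt (addE e w) = (pt e + wpt w)%M.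
Proof. by rewrite /pt /= wptD addmA. Qed.

Lemma dgD e w : dg (addE e w) = (dg e + wdg w)%M.
Proof. by rewrite /dg /= wdgD addmA. Qed.

Lemma lattice_module_add w k x : X k x -> X (k + wdg w)%M (x + wpt w)%M.
Proof. by case=> e <- <-; exists (addE e w); rewrite ?dgD ?ptD. Qed.

(** A position-over-term order on the monomials of the free module over K[y] with basis the
    generators. *)
Definition ltE e f := (e.1 < f.1)%N || (e.1 == f.1) && (e.2 < f.2)%O.

Lemma ltE_total e f : e != f -> ltE e f || ltE f e.
Proof.
case: e f => [c u] [d v]; rewrite /ltE /= xpair_eqE negb_and.
case: (ltngtP c d) => //= cd; rewrite ?orbT//; have {cd} -> : c = d by exact: val_inj.
by rewrite !eqxx /=; case: ltgtP.
Qed.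

Lemma ltE_add e f w : ltE e f -> ltE (addE e w) (addE f w).
Proof. by rewrite /ltE /= ltmc_add2l. Qed.

Lemma ltE_wf : well_founded ltE.
Proof.
suff h N (c : 'I_p) u : (c < N)%N -> Acc ltE (c, u).
  by move=> [c u]; exact: (h c.+1).
elim: N c u => [c u c0|N IHN c u cN]; first by exfalso; move: c0; rewrite ltn0.
refine (@well_founded_ind _ _ (@ltom_wf q) (fun u => Acc ltE (c, u)) _ u) => {}u IHu.
constructor=> -[d v]; rewrite /ltE /= => /orP[dc|/andP[/eqP-> vu]].
  by apply: IHN; apply: leq_trans dc _.
exact: IHu.
Qed.

Definition same e f := dg e = dg f /\ pt e = pt f.

(** Normal forms of the toric presentation of X/Z over K[y]: among all ways to write one monomial in
    one degree, the least is kept. Hence monomials of the quotient correspond to standard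
    elements. *)
Definition standard e := ~ Z (dg e) (pt e) /\ forall f, same f e -> ~~ ltE f e.

Lemma standard_exists e : ~ Z (dg e) (pt e) ->
  exists f, [/\ standard f, same f e & (f == e) || ltE f e].
Proof.
move: e; refine (@well_founded_ind _ _ ltE_wf (fun e => ~ Z (dg e) (pt e) ->
  exists f, [/\ standard f, same f e & (f == e) || ltE f e]) _) => e IH nZ.
have [st|] := pselect (standard e); first by exists e; rewrite eqxx.
move=> /not_andP[//|/existsNP[f /not_implyP[fe /negP/negPn flt]]].
have [|g [gst [gf1 gf2] gflt]] := IH _ flt; first by rewrite fe.1 fe.2.
exists g; split => //; first by split; rewrite ?gf1 ?gf2 ?fe.1 ?fe.2.
apply/orP; right; case/orP: gflt => [/eqP->//|].
move: flt; rewrite /ltE.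
case/orP=> [h1|/andP[/eqP <- h1]]; case/orP=> [h2|/andP[/eqP h2 h3]].
- by rewrite (ltn_trans h2 h1).
- by rewrite h2 h1.
- by rewrite h2.
- by rewrite h2 eqxx (lt_trans h3 h1) orbT.
Qed.

Lemma standard_inj e f : standard e -> standard f -> same e f -> e = f.
Proof.
move=> [_ he] [_ hf] ef; apply/eqP/negPn/negP => /ltE_total /orP[].
  by apply/negP/hf.
by apply/negP/he; case: ef => h1 h2; split.
Qed.

Lemma standard_down e w : standard (addE e w) -> standard e.
Proof.
move=> [nZ mi]; split => [Ze|f [fe1 fe2]].
  by apply: nZ; rewrite dgD ptD; exact: Zadd.
apply/negP => /(@ltE_add _ _ w); apply/negP/mi.
by split; rewrite !(dgD, ptD) ?fe1 ?fe2.
Qed.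

Lemma standard_downset c : downset (fun u => standard (c, u)).
Proof.
move=> u v /submK uv sv; apply: (@standard_down _ (v - u)%M).
by rewrite /addE /= addmC uv.
Qed.

Definition pieces : 'I_p -> seq (multinom q * {set 'I_q}) :=
  projT1 (choice (fun c => downset_decomposable (@standard_downset c))).

Lemma piecesP c : [/\ forall u, standard (c, u) <-> exists2 P,
    P \in pieces c & in_piece P u,
      forall d u s t, (s < size (pieces c))%N -> (t < size (pieces c))%N ->
        in_piece (nth d (pieces c) s) u -> in_piece (nth d (pieces c) t) u -> s = t &
      forall d u a s t, (s < size (pieces c))%N -> (t < size (pieces c))%N ->
        in_piece (nth d (pieces c) s) u -> in_piece (nth d (pieces c) t) (u + 'e_a)%M ->
        (s <= t)%N].
Proof. by rewrite /pieces; case: choice => ps h; exact: h. Qed.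

Definition idx e := find (fun P => `[< in_piece P e.2 >]) (pieces e.1).
Definition pc e := nth (0%M, finset.set0) (pieces e.1) (idx e).

Lemma idx_lt e : standard e -> (idx e < size (pieces e.1))%N.
Proof.
case: e => c u; have [h _ _] := piecesP c => /h[P Pc Pu]; rewrite -has_find.
by apply/hasP; exists P => //; apply/asboolP.
Qed.

Lemma pc_in e : standard e -> in_piece (pc e) e.2.
Proof. by move=> /idx_lt; rewrite -has_find => /(nth_find (0%M, finset.set0)) /asboolP. Qed.

Lemma pc_mem e : standard e -> pc e \in pieces e.1.
Proof. by move=> /idx_lt; exact: mem_nth. Qed.

Lemma pc_std e v : standard e -> in_piece (pc e) v -> standard (e.1, v).
Proof.
by move=> /pc_mem pe ev; have [h _ _] := piecesP e.1; apply/h; exists (pc e).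
Qed.

Lemma idx_eq e f s : standard e -> (s < size (pieces e.1))%N ->
  in_piece (nth (0%M, finset.set0) (pieces e.1) s) e.2 -> idx e = s.
Proof.
move=> se sp es; have [_ h _] := piecesP e.1.
by apply: (h _ e.2 _ _ (idx_lt se) sp) es; exact: pc_in.
Qed.

Lemma idx_same e f : standard e -> f.1 = e.1 -> in_piece (pc e) f.2 -> idx f = idx e.
Proof.
case: f => c v se /= -> ev; have sf := pc_std se ev.
by apply: (idx_eq (c, v)) => //=; exact: idx_lt.
Qed.

Lemma pc_same e f : standard e -> f.1 = e.1 -> in_piece (pc e) f.2 -> pc f = pc e.
Proof. by move=> se fe ef; rewrite /pc (idx_same se)// fe. Qed.

Lemma idx_mono e a : standard (addE e 'e_a) -> (idx e <= idx (addE e 'e_a))%N.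
Proof.
move=> sf; have se := standard_down sf; have [_ _ h] := piecesP e.1.
by apply: (h (0%M, finset.set0) e.2 a);
  [exact: idx_lt|exact: (idx_lt sf)|exact: pc_in|exact: (pc_in sf)].
Qed.

Definition all_elts d : seq E :=
  [seq (c, bmnm mm) | c <- enum 'I_p, mm <- enum {: bmultinom q d.+1}].

Definition std_seq k : seq E :=
  [seq e <- all_elts (mdeg k) | (dg e == k) && `[< standard e >]].

Lemma mdeg_dg e : (mdeg e.2 <= mdeg (dg e))%N.
Proof. by rewrite /dg mdegD mdeg_wdg leq_addl. Qed.

Lemma std_seqP k e : reflect (standard e /\ dg e = k) (e \in std_seq k).
Proof.
rewrite mem_filter; apply: (iffP andP).
  by case=> /andP[/eqP ? /asboolP ?].
case=> se ek; rewrite ek eqxx; split; first by apply/asboolP.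
have ed : (mdeg e.2 < (mdeg k).+1)%N by rewrite -ek ltnS mdeg_dg.
case: e ed {se ek} => c u /= ed.
by apply/allpairsP; exists (c, BMultinom ed); rewrite !mem_enum.
Qed.

Lemma std_seq_uniq k : uniq (std_seq k).
Proof.
apply: filter_uniq; apply: allpairs_uniq; rewrite ?enum_uniq//.
by move=> [c u] [d v] _ _ /= [-> /val_inj ->].
Qed.

Lemma std_seq_count k :
  finite_of_size (fun x => X k x /\ ~ Z k x) (size (std_seq k)).
Proof.
exists (map pt (std_seq k)); split; last 1 first.
- move=> x; split.
    move=> [[e ek ex'] nZ]; have [|f [sf [f1 f2] _]] := @standard_exists e.
      by rewrite ek ex'.
    by apply/mapP; exists f; rewrite -?ex' ?f2//; apply/std_seqP; rewrite f1.
  move=> /mapP[e /std_seqP[[nZ se] ek] ->]; split; last by rewrite -ek.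
  by exists e.
- rewrite map_inj_in_uniq ?std_seq_uniq// => e f /std_seqP[se ek] /std_seqP[sf fk] ef.
  by apply: standard_inj => //; split => //; rewrite ek.
- by rewrite size_map.
Qed.

(* A piece with a free variable in the block j is reduced along one of them, the
   pivot, by means of f_j. *)
Definition piv (s : {set 'I_q}) j := [pick a in s | blk a == j].

Definition reducible j e :=
  if piv (pc e).2 j is Some a then ((pc e).1 a < e.2 a)%N else false.

(** The monomial model of the quotient of X/Z by the first i equations: [reducible j] marks the
    elements that f_j eliminates, those lying strictly above the base of their piece in the
    direction of the pivot of the block j. *)
Definition reds (i : nat) k :=
  [seq e <- std_seq k | ~~ [exists j : 'I_n, (j < i)%N && reducible j e]].

Lemma pivP s j a : piv s j = Some a -> a \in s /\ blk a = j.
Proof. by rewrite /piv; case: pickP => // b /andP[bs /eqP bj] [<-]. Qed.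

(** An element whose piece has no free variable in the block j has the same degree in the direction
    j as the base of the piece. From this bound on, each block therefore has a free variable. *)
Definition piece_bound : nat :=
  \max_(c < p) \max_(P <- pieces c) \max_(j < n) ((gdg c + wdg P.1)%M j).+1.

Lemma piece_boundP e j : standard e -> ((gdg e.1 + wdg (pc e).1)%M j < piece_bound)%N.
Proof.
move=> se; rewrite /piece_bound.
apply: (bigop.bigmax_sup e.1) => //.
apply: (bigop.bigmax_sup_seq _ (pc_mem se)) => //.
exact: (bigop.bigmax_sup j).
Qed.

Lemma dg_in_piece e j : standard e -> piv (pc e).2 j = None ->
  dg e j = (gdg e.1 + wdg (pc e).1)%M j.
Proof.
move=> se; rewrite /piv; case: pickP => // h _; rewrite /dg !mnmDE !wdgE.
congr addn; apply: eq_bigr => a /eqP aj; have := pc_in se a.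
by have := h a; rewrite aj eqxx andbT => ->.
Qed.

Lemma piv_exists e j : standard e -> (piece_bound <= dg e j)%N ->
  exists a, piv (pc e).2 j = Some a.
Proof.
move=> se le; case E : piv => [a|]; first by exists a.
by have := piece_boundP j se; rewrite -dg_in_piece// ltnNge le.
Qed.

Lemma dg_gt_base e j : standard e -> (piece_bound <= dg e j)%N ->
  exists b, [/\ b \in (pc e).2, blk b = j & ((pc e).1 b < e.2 b)%N].
Proof.
move=> se le; apply: contrapT => h; have := piece_boundP j se.
suff -> : (gdg e.1 + wdg (pc e).1)%M j = dg e j by rewrite ltnNge le.
rewrite /dg !mnmDE !wdgE; congr addn; apply: eq_bigr => a /eqP aj.
have := pc_in se a; case: ifPn => // ap; rewrite leq_eqVlt => /orP[/eqP//|lt].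
by exfalso; apply: h; exists a.
Qed.

(** The count behind an exact sequence for multiplication by f_i. Adding the pivot of the block i
    stays in the piece and does not affect reducibility in other blocks, so it is a bijection from
    degree k - e_i onto the elements of degree k that f_i eliminates. The successor in the bound
    leaves room for k - e_i. *)
Lemma reds_rec i k : (forall j, (piece_bound.+1 <= k j)%N) ->
  size (reds i k) = (size (reds i.+1 k) + size (reds i (k - 'e_i)))%N.
Proof.
move=> kb; have k0 : (0 < k i)%N by apply: leq_trans (kb i).
have exS e : [exists j : 'I_n, (j < i.+1)%N && reducible j e] =
             reducible i e || [exists j : 'I_n, (j < i)%N && reducible j e].
  apply/existsP/orP => [[j /andP[]]|].
    rewrite ltnS leq_eqVlt => /orP[/eqP/val_inj->|ji] rj; first by left.
    by right; apply/existsP; exists j; rewrite ji.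
  case=> [ri|/existsP[j /andP[ji rj]]]; first by exists i; rewrite ltnSn.
  by exists j; rewrite (ltn_trans ji).
rewrite -(count_predC (reducible i) (reds i k)) addnC; congr addn.
  rewrite -size_filter -filter_predI; congr size; apply: eq_filter => e /=.
  by rewrite exS negb_or.
rewrite -size_filter.
pose phi e := if piv (pc e).2 i is Some a then addE e 'e_a else e.
have phiP e : standard e -> (piece_bound <= dg e i)%N -> exists a,
    [/\ piv (pc e).2 i = Some a, phi e = addE e 'e_a, standard (phi e) & pc (phi e) = pc e].
  move=> se be; have [a pa] := piv_exists se be; exists a.
  have [aP _] := pivP pa.
  have inp : in_piece (pc e) (addE e 'e_a).2.
    move=> b; have := pc_in se b; rewrite /=; mnm; case: ifPn => bP.
      by move=> h; apply: leq_trans h _; rewrite leq_addr.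
    by case: eqP aP bP => [->->|_ _ _ ->]//; rewrite addn0.
  rewrite /phi pa; split => //; first exact: (pc_std se inp).
  by apply: pc_same.
have dgk e : e \in reds i (k - 'e_i)%M ->
    [/\ standard e, dg e = (k - 'e_i)%M & (piece_bound <= dg e i)%N].
  rewrite mem_filter => /andP[_ /std_seqP[se ek]]; split => //; rewrite ek; mnm.
  by rewrite eqxx; have := kb i; lia.
rewrite -(size_map phi (reds i _)); apply/perm_size/uniq_perm.
- exact/filter_uniq/filter_uniq/std_seq_uniq.
- rewrite map_inj_in_uniq; first exact/filter_uniq/std_seq_uniq.
  move=> e f /dgk[se _ be] /dgk[sf _ bf].
  have [a [pa pe spe pce]] := phiP e se be; have [b [pb pf spf pcf]] := phiP f sf bf.
  move=> ef; have : pc e = pc f by rewrite -pce -pcf ef.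
  move=> pef; move: pb; rewrite -pef pa => -[ab].
  rewrite pe pf ab in ef; have e1 := congr1 fst ef; have := congr1 snd ef.
  rewrite /= => /eqP; rewrite eqm_add2r => /eqP e2.
  by case: (e) (f) e1 e2 => [c u] [d v] /= -> ->.
move=> f; rewrite mem_filter; apply/andP/mapP.
  move=> [rf]; rewrite mem_filter => /andP[nf /std_seqP[sf fk]].
  move: (rf); rewrite /reducible; case pa : piv => [a|//] lta.
  have [aP ai] := pivP pa.
  pose e : E := (f.1, (f.2 - 'e_a)%M).
  have fe : f = addE e 'e_a.
    by rewrite /addE /= subm_add; [case: (f)|apply: leq_trans lta].
  have se : standard e by apply: (@standard_down _ 'e_a); rewrite -fe.
  have inp : in_piece (pc f) e.2.
    move=> b; have := pc_in sf b; rewrite /=; mnm; case: ifPn => bP.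
      by case: eqP => [<- _|_]; rewrite ?subn0//; lia.
    by case: eqP aP bP => [->->|_ _ _ ->]//; rewrite subn0.
  have pef : pc e = pc f by apply: pc_same.
  have dge : dg e = (k - 'e_i)%M by rewrite -fk fe dgD wdg1 ai addmK.
  exists e; last by rewrite /phi pef pa.
  rewrite mem_filter; apply/andP; split; last by apply/std_seqP.
  apply: contra nf => /existsP[j /andP[ji rj]]; apply/existsP; exists j; rewrite ji /=.
  move: rj; rewrite /reducible pef; case: piv => // b /leq_trans; apply.
  by rewrite fe /=; mnm; rewrite leq_addr.
move=> [e ered ->]; have [se ek be] := dgk _ ered.
have [a [pa pe spe pce]] := phiP e se be; have [aP ai] := pivP pa.
split.
  rewrite /reducible pce pa pe /=; mnm; rewrite eqxx addn1 ltnS.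
  by have := pc_in se a; rewrite aP.
rewrite mem_filter; apply/andP; split; last first.
  by apply/std_seqP; split => //; rewrite pe dgD ek wdg1 ai subm_add.
move: ered; rewrite mem_filter => /andP[ne _]; apply: contra ne.
move=> /existsP[j /andP[ji rj]]; apply/existsP; exists j; rewrite ji /=.
move: rj; rewrite /reducible pce pe; case pb : piv => [b|//] /=; mnm.
have [_ bj] := pivP pb; case: eqP => [ab|_]; last by rewrite addn0.
by move: ji; rewrite -bj -ab ai ltnn.
Qed.

Lemma piv_uniq s j a b : piv s j = Some a -> b \in s -> b != a ->
  forall i, piv s i = Some b -> i != j.
Proof.
move=> pa bs ba i pb; apply/eqP => ij; move: pb; rewrite ij pa => -[ab].
by rewrite ab eqxx in ba.
Qed.

Definition pivdeg e := (\sum_(a | [exists j, piv (pc e).2 j == Some a]) e.2 a)%N.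

Lemma pivdeg_le e : (pivdeg e <= mdeg e.2)%N.
Proof. by rewrite mdegE /pivdeg [leqLHS]big_mkcond; apply: leq_sum => a _; case: ifP. Qed.

Lemma reducible_down e j a : standard e -> piv (pc e).2 j = Some a ->
  ((pc e).1 a < e.2 a)%N ->
  let f : E := (e.1, (e.2 - 'e_a)%M) in
  [/\ e = addE f 'e_a, standard f & in_piece (pc e) f.2].
Proof.
move=> se pa lt f; have [aP aj] := pivP pa.
have ef : e = addE f 'e_a.
  by rewrite /addE /f /= subm_add; [case: (e)|exact: leq_trans lt].
split => //; first by apply: (@standard_down _ 'e_a); rewrite -ef.
move=> b; have := pc_in se b; rewrite /=; mnm; case: ifPn => bP.
  by case: eqP => [<- _|_]; rewrite ?subn0//; lia.
by case: eqP aP bP => [->->|_ _ _ ->]//; rewrite subn0.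
Qed.

(* Specializing the coefficient of index a to a power of t with exponent [om a]
   and letting t tend to 0 makes [coef_mx] unitriangular. *)
Section Degeneration.
Variables (i : nat) (k : multinom n).
Let W := (mdeg k).+1.
Let om a := (W ^ (q - a.+1))%N.
Let wt e := (e.1 * W ^ q + \sum_a e.2 a * om a)%N.

Lemma wt_add e a : wt (addE e 'e_a) = (wt e + om a)%N.
Proof.
rewrite /wt /= -addnA; congr addn.
under eq_bigr do rewrite mnmDE mulnDl.
rewrite big_split /=; congr addn; under eq_bigr do rewrite mulnC.
by rewrite (sum_mnm1 om).
Qed.

(** All exponents occurring in degree k are below W, so expansion in base W, with the index of the
    generator as leading digit, turns the order into a comparison of integers. *)
Lemma wt_lt e f : dg e = k -> dg f = k -> ltE e f -> (wt e < wt f)%N.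
Proof.
move=> ek fk; have de : (mdeg e.2 < W)%N by rewrite /W -ek ltnS mdeg_dg.
have df : (mdeg f.2 < W)%N by rewrite /W -fk ltnS mdeg_dg.
have W0 : (0 < W)%N by [].
case/orP => [lt|/andP[/eqP e1 lt]].
  rewrite /wt; suff h : (\sum_a e.2 a * om a < W ^ q)%N.
    have : (e.1.+1 * W ^ q <= f.1 * W ^ q)%N by rewrite leq_mul2r lt orbT.
    by rewrite mulSn; lia.
  have [q0|q0] := posnP q.
    rewrite big1 ?expn_gt0// => a _; exfalso; have := ltn_ord a.
    by rewrite [X in (_ < X)%N]q0.
  apply: (@leq_ltn_trans (mdeg e.2 * W ^ q.-1)%N).
    rewrite mdegE big_distrl /=; apply: leq_sum => a _; rewrite leq_mul2l.
    by apply/orP; right; apply: leq_pexp2l => //; have := ltn_ord a; lia.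
  have -> : (W ^ q = W * W ^ q.-1)%N by rewrite -expnS prednK.
  by rewrite ltn_mul2r expn_gt0 W0 /= de.
(* For equal generators the total degrees agree, so the monomial order reduces to the lexicographic
   one. *)
have md : mdeg e.2 = mdeg f.2.
  have : mdeg (dg e) = mdeg (dg f) by rewrite ek fk.
  by rewrite /dg !mdegD !mdeg_wdg e1 => /addnI.
rewrite /wt e1 ltn_add2l.
move/(ltmcP md): lt => [a eqa lta].
have tl u : (mdeg u < W)%N -> (\sum_(b : 'I_q | (a < b)%N) u b * om b < om a)%N.
  move=> du; have [->|] := eqVneq (\sum_(b : 'I_q | (a < b)%N) u b * om b)%N 0%N.
    by rewrite /om expn_gt0.
  move=> _; suff : (\sum_(b : 'I_q | (a < b)%N) u b * om b * W < om a * W)%N.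
    by rewrite -big_distrl /= ltn_mul2r => /andP[].
  apply: (@leq_ltn_trans (mdeg u * om a)%N); last first.
    by rewrite mulnC ltn_mul2l du expn_gt0.
  rewrite mdegE big_distrl /= [leqRHS](bigID (fun b : 'I_q => (a < b)%N)) /=.
  apply: leq_trans (leq_addr _ _); apply: leq_sum => b ab.
  rewrite -mulnA leq_mul2l /om -expnSr.
  by apply/orP; right; apply: leq_pexp2l => //; have := ltn_ord b; lia.
have spl u : (\sum_b u b * om b = \sum_(b : 'I_q | (b < a)%N) u b * om b + u a * om a
    + \sum_(b : 'I_q | (a < b)%N) u b * om b)%N.
  rewrite (bigID (fun b : 'I_q => (b < a)%N)) /= -addnA; congr addn.
  rewrite (bigD1 a) ?ltnn//=; congr addn; apply: eq_bigl => b.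
  by rewrite -leqNgt ltn_neqAle andbC eq_sym.
rewrite !spl; have -> : (\sum_(b : 'I_q | (b < a)%N) f.2 b * om b =
                         \sum_(b : 'I_q | (b < a)%N) e.2 b * om b)%N.
  by apply: eq_bigr => b ba; rewrite eqa.
rewrite -!addnA ltn_add2l; apply: leq_trans (leq_addr _ _).
apply: (@leq_trans ((e.2 a).+1 * om a)%N); last by rewrite leq_mul2r lta orbT.
by rewrite mulSn addnC ltn_add2r; exact: tl.
Qed.

Let bl := [seq e <- std_seq k | [exists j : 'I_n, (j < i)%N && reducible j e]].
Let N := size bl.
Let elt (l : 'I_N) : E := tnth (in_tuple bl) l.

Let eltP l : [/\ standard (elt l), dg (elt l) = k &
  exists j : 'I_n, (j < i)%N && reducible j (elt l)].
Proof.
have : elt l \in bl by exact: mem_tnth.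
by rewrite mem_filter => /andP[/existsP ex' /std_seqP[]].
Qed.

Let elt_inj : injective elt.
Proof.
move=> l l' h; apply: val_inj; apply/eqP.
have e0 := elt l.
move: h; rewrite /elt !(tnth_nth e0) /= => /eqP.
by rewrite nth_uniq ?ltn_ord// filter_uniq// std_seq_uniq.
Qed.

Let jaP l : exists ja : 'I_n * 'I_q, [/\ (ja.1 < i)%N, piv (pc (elt l)).2 ja.1 = Some ja.2 &
  ((pc (elt l)).1 ja.2 < (elt l).2 ja.2)%N].
Proof.
have [_ _ [j /andP[ji]]] := eltP l; rewrite /reducible.
by case pa : piv => [a|//] lt; exists (j, a).
Qed.

Let jj l := (projT1 (cid (jaP l))).1.
Let aa l := (projT1 (cid (jaP l))).2.
Let sr l : E := ((elt l).1, ((elt l).2 - 'e_(aa l))%M).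

Let jjP l : [/\ (jj l < i)%N, piv (pc (elt l)).2 (jj l) = Some (aa l),
  ((pc (elt l)).1 (aa l) < (elt l).2 (aa l))%N & blk (aa l) = jj l].
Proof.
rewrite /jj /aa; case: cid => -[j a] /= [h1 h2 h3]; split => //.
by have [] := pivP h2.
Qed.

Let srP l : [/\ elt l = addE (sr l) 'e_(aa l), standard (sr l),
  in_piece (pc (elt l)) (sr l).2 & pc (sr l) = pc (elt l)].
Proof.
have [_ pa lt _] := jjP l; have [se _ _] := eltP l.
have [h1 h2 h3] := reducible_down se pa lt.
by split => //; apply: pc_same.
Qed.

Let dg_sr l : (dg (sr l) + 'e_(jj l))%M = k.
Proof.
have [_ _ _ <-] := jjP l; have [h _ _ _] := srP l; have [_ <- _] := eltP l.
by rewrite h dgD wdg1.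
Qed.

Let dg_sr_add l a : blk a = jj l -> dg (addE (sr l) 'e_a) = k.
Proof. by move=> aj; rewrite dgD wdg1 aj dg_sr. Qed.

(** Encodes the lexicographic pair formed by the index of the piece and the opposite of the degree
    in the pivots, the latter being less than W in degree k. *)
Let key e := (idx e * W + (W - pivdeg e))%N.

(** Replacing the pivot by another variable of its block moves to a later piece, by [idx_mono], or
    stays in the same one; in that case the new variable is free but is no pivot, and the degree in
    the pivots drops by one. *)
Let key_lt l a : blk a = jj l -> a != aa l -> standard (addE (sr l) 'e_a) ->
  (key (elt l) < key (addE (sr l) 'e_a))%N.
Proof.
move=> aj aal sf; set f := addE _ _ in sf *.
have [el ss inp ps] := srP l; have [se ek _] := eltP l; have [_ pa lt bj] := jjP l.
have ie : idx (sr l) = idx (elt l) by apply: idx_same.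
have dge : (pivdeg (elt l) < W)%N.
  by apply: leq_ltn_trans (pivdeg_le _) _; rewrite /W ltnS -ek mdeg_dg.
have dgf : (pivdeg f < W)%N.
  by apply: leq_ltn_trans (pivdeg_le _) _; rewrite /W ltnS -(dg_sr_add aj) mdeg_dg.
have := idx_mono sf; rewrite ie leq_eqVlt => /orP[/eqP ief|lti]; last first.
  have : ((idx (elt l)).+1 * W <= idx f * W)%N by rewrite leq_mul2r lti orbT.
  by rewrite /key mulSn; lia.
have pf : pc f = pc (elt l) by rewrite /pc ief.
have aP : a \in (pc (elt l)).2.
  have := pc_in sf a; rewrite pf; case: ifPn => // aP.
  have := inp a; rewrite (negbTE aP) /f /=; mnm; rewrite eqxx => ->; lia.
have naj : [exists j, piv (pc (elt l)).2 j == Some a] = false.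
  apply/negbTE/existsP => -[j /eqP pj]; have [_ aj'] := pivP pj.
  by have := piv_uniq pa aP aal pj; rewrite -aj' aj eqxx.
suff : (pivdeg (elt l) = (pivdeg f).+1)%N by rewrite /key ief ltn_add2l => h; lia.
have eE : (elt l).2 = ((sr l).2 + 'e_(aa l))%M := congr1 snd el.
rewrite /pivdeg pf eE /f /=.
under eq_bigr do rewrite mnmDE.
under [in RHS]eq_bigr do rewrite mnmDE.
rewrite !big_split /= !sum_mnm1_1 /= naj addn0.
suff -> : [exists j, piv (pc (elt l)).2 j == Some (aa l)] by rewrite addn1.
by apply/existsP; exists (jj l); rewrite pa.
Qed.

Section Ring.
Variable (K : fieldType).

(** Coefficients of the products x^(src l) f_(J l) at the monomials x^(tgt l'). The ring is
    arbitrary because c is taken in K, among indeterminates, and among powers of one variable. *)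
Definition coef_mx (R : nzRingType) M (J : 'I_M -> 'I_n) (src tgt : 'I_M -> multinom n)
    (c : 'I_q -> R) : 'M[R]_M :=
  \matrix_(l, l') \sum_(a | (blk a == J l) && ((src l + ex a)%M == tgt l')) c a.

Let Nt : 'M[{poly K}]_N := coef_mx jj (pt \o sr) (pt \o elt) (fun a => 'X^(om a)).
(** The matrix [Nt] with rows and columns rescaled by the weights; by [wt_le] the truncated
    subtraction in the exponent is a true one. *)
Let Nr : 'M[{poly K}]_N := \matrix_(l, l')
  \sum_(a | (blk a == jj l) && ((pt (sr l) + ex a)%M == pt (elt l')))
     'X^(wt (sr l) + om a - wt (elt l')).

(** Both elements represent the same monomial in the same degree, and [elt l'] is the least
    representative. *)
Let wt_le l l' a : blk a = jj l -> (pt (sr l) + ex a)%M = pt (elt l') ->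
  (wt (elt l') <= wt (sr l) + om a)%N /\
  ((wt (sr l) + om a == wt (elt l'))%N = (elt l' == addE (sr l) 'e_a)).
Proof.
move=> aj pe; rewrite -wt_add.
have [[_ mi] ek _] := eltP l'.
have fk := dg_sr_add aj.
have : same (addE (sr l) 'e_a) (elt l') by split; rewrite ?fk ?ek// ptD wpt1.
move=> /mi nlt; have [->|ne] := eqVneq (elt l') (addE (sr l) 'e_a).
  by rewrite leqnn eqxx.
have := ltE_total ne; rewrite (negbTE nlt) orbF => lt.
have := wt_lt ek fk lt => h; split; first exact: ltnW.
by apply/negbTE; rewrite neq_ltn h orbT.
Qed.

Let scaling : diag_mx (\row_l 'X^(wt (sr l))) *m Nt = Nr *m diag_mx (\row_l 'X^(wt (elt
    l))).
Proof.
apply/matrixP => l l'; rewrite mul_diag_mx mul_mx_diag !mxE.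
rewrite big_distrr big_distrl /=; apply: eq_bigr => a /andP[/eqP aj /eqP pe].
by rewrite -!exprD subnK//; have [] := wt_le aj pe.
Qed.

(** In the limit only those terms of a product survive that are already in normal form. *)
Let Nr0 l l' : (Nr l l').[0] =
  \sum_(a | (blk a == jj l) && (elt l' == addE (sr l) 'e_a)) 1.
Proof.
rewrite mxE horner_sum [LHS]big_mkcond [RHS]big_mkcond; apply: eq_bigr => a _ /=.
case: eqP => //= aj; rewrite hornerXn.
case: eqP => [pe|npe].
  have [le eq] := wt_le aj pe; rewrite -eq; case: eqP => [->|ne].
    by rewrite subnn expr0.
  by rewrite expr0n; case: eqP => //; lia.
case: eqP => // el; exfalso; apply: npe; by rewrite el ptD wpt1.
Qed.

(** It suffices to find one specialization with nonzero determinant: powers of one variable, then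
    rescaling by weights, then the value at 0, which is triangular with respect to [key]. *)
Lemma coef_mx_det : \det (coef_mx jj (pt \o sr) (pt \o elt)
   (fun a => mpolyX K 'e_a)) != 0.
Proof.
pose h : {rmorphism mpoly q K -> {poly K}} := mmap polyC (fun a : 'I_q => 'X^(om a)).
suff : \det Nt != 0.
  apply: contra_neq => d0; have := congr1 h d0; rewrite rmorph0 -det_map_mx => <-.
  congr (\det _); apply/matrixP => l l'; rewrite !mxE rmorph_sum; apply: eq_bigr => a _.
  by rewrite /h /= mmapX mmap1U.
have dd (v : 'rV[{poly K}]_N) : (forall l, v 0 l != 0) -> \det (diag_mx v) != 0.
  by move=> h0; rewrite det_diag; apply/prodf_neq0 => l _; exact: h0.
suff : \det Nr != 0.
  move=> nr; have := congr1 (fun M => \det M) scaling; rewrite !det_mulmx => e.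
  apply: contra_neq nr => nt; move: e; rewrite nt mulr0 => /esym/eqP.
  rewrite mulf_eq0 => /orP[/eqP//|]; apply: contraTeq => _; apply: dd => l.
  by rewrite mxE; apply/monic_neq0/monicXn.
suff : \det (map_mx (horner_eval (0 : K)) Nr) != 0.
  by apply: contra_neq => d0; rewrite det_map_mx d0 rmorph0.
apply/det0P => -[v v0 vN].
(* Triangularity is used without sorting: at the element of least key in the support of a vector of
   the left kernel, the column of this element receives a contribution from its own row only. *)
have [l0 vl0 lmin] : exists2 l0, v 0 l0 != 0 &
    forall l, v 0 l != 0 -> (key (elt l0) <= key (elt l))%N.
  have [l vl] : exists l, v 0 l != 0.
    apply: contrapT => nl; move/eqP: v0; apply; apply/rowP => l; rewrite mxE.
    by apply/eqP/negPn/negP => vl; apply: nl; exists l.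
  by case: (arg_minnP (fun l => key (elt l)) (vl : [pred l | v 0 l != 0] l)) =>
      m /= vm mm; exists m.
move/rowP/(_ l0): vN; rewrite !mxE; apply/eqP.
rewrite (bigD1 l0) //= big1 ?addr0; last first.
  move=> l ll0; have [->|vl] := eqVneq (v 0 l) 0; first by rewrite mul0r.
  rewrite mxE /horner_eval Nr0 big1 ?mulr0// => a /andP[/eqP aj /eqP el].
  exfalso; have [se _ _] := eltP l0; rewrite el in se.
  have [aal|aal] := eqVneq a (aa l).
    have [el' _ _ _] := srP l; rewrite aal -el' in el.
    by rewrite (elt_inj el) eqxx in ll0.
  by have := key_lt aj aal se; rewrite -el ltnNge lmin.
have [el0 _ _ _] := srP l0; have [_ _ _ bj] := jjP l0.
rewrite mxE /horner_eval Nr0 (big_pred1 (aa l0)) ?mulr1// => a /=.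
apply/andP/eqP => [[_ /eqP]|->]; last by rewrite bj eqxx -el0.
by rewrite {1}el0 => /(congr1 snd) /= /eqP; rewrite eqm_add2l eq_mnm1 => /eqP->.
Qed.

End Ring.

(** A nonsingular minor for generic c: it eliminates M monomials modulo the first i equations, so
    that [size (reds i k)] of them span the quotient. *)
Lemma degeneration : exists M (J : 'I_M -> 'I_n) (src tgt : 'I_M -> multinom n),
  [/\ (M + size (reds i k) = size (std_seq k))%N,
      forall l, (J l < i)%N /\ exists2 k', (k' + 'e_(J l))%M = k & X k' (src l),
      injective tgt, forall l, X k (tgt l) /\ ~ Z k (tgt l) &
      forall K : fieldType, \det (coef_mx J src tgt (fun a => mpolyX K 'e_a)) != 0].
Proof.
exists N, jj, (pt \o sr), (pt \o elt); split.
- by rewrite -(count_predC (fun e => [exists j : 'I_n,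
    (j < i)%N && reducible j e]) (std_seq k))
    /N !size_filter.
- move=> l; have [? _ _ _] := jjP l; split => //; exists (dg (sr l)); first exact: dg_sr.
  by exists (sr l).
- move=> l l' /= h; apply: elt_inj; have [se ek _] := eltP l; have [sf fk _] := eltP l'.
  by apply: standard_inj => //; split => //; rewrite ek fk.
- move=> l /=; have [[nZ se] ek _] := eltP l; split; last by rewrite -ek.
  by exists (elt l).
- by move=> K; exact: coef_mx_det.
Qed.

End Degeneration.

(** Distinct standard elements of one degree are distinct lattice points, all in a cube of dimension
    n whose side is linear in the total degree. *)
Lemma std_seq_growth : exists c, forall k,
  (size (std_seq k) <= (c * (mdeg k).+1) ^ n)%N.
Proof.
pose c := (\sum_c mdeg (gpt c) + \sum_a mdeg (ex a)).+1.
exists c => k; set B := (c * (mdeg k).+1)%N.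
have ptB e i : e \in std_seq k -> (pt e i < B)%N.
  move=> /std_seqP[_ ek]; rewrite /pt mnmDE wptE.
  have h1 : (gpt e.1 i <= \sum_c mdeg (gpt c))%N.
    by rewrite (bigD1 e.1) //=; apply: leq_trans (mdeg_ge _ i) (leq_addr _ _).
  have h2 : (\sum_a ex a i * e.2 a <= (\sum_a mdeg (ex a)) * mdeg k)%N.
    rewrite big_distrl /=; apply: leq_sum => a _; apply: leq_mul; first exact: mdeg_ge.
    by rewrite -ek; apply: leq_trans (mdeg_dg e); exact: mdeg_ge.
  rewrite /B /c; move: h1 h2; set s1 := (\sum_c _)%N; set s2 := (\sum_a mdeg _)%N.
  by move=> h1 h2; nia.
have [B0|B0] := posnP B.
  case E : (std_seq k) => [//|e s]; have em : e \in std_seq k by rewrite E mem_head.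
  have [n0|n0] := posnP n; last by have := ptB e (Ordinal n0) em; rewrite B0.
  rewrite -E n0 expn0 leqNgt; apply/negP.
  have := std_seq_uniq k; rewrite E /=; case: s E => [//|f s] E.
  move=> /andP[]; rewrite inE negb_or => /andP[/eqP ef _] _ _; apply: ef.
  have /std_seqP[sf fk] : f \in std_seq k by rewrite E !inE eqxx orbT.
  have /std_seqP[se ek] := em; apply: (standard_inj se sf); split; first by rewrite ek.
  by apply/mnmP => i; exfalso; have := ltn_ord i; rewrite [X in (_ < X)%N]n0.
pose F e : {ffun 'I_n -> 'I_B.-1.+1} := [ffun i => inord (pt e i)].
rewrite -(size_map F).
have : uniq (map F (std_seq k)).
  rewrite map_inj_in_uniq ?std_seq_uniq// => f g fi gi fg.
  have [sf fk] := std_seqP _ _ fi; have [sg gk] := std_seqP _ _ gi.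
  apply: standard_inj => //; split; first by rewrite fk.
  apply/mnmP => i; move/ffunP/(_ i): fg; rewrite !ffunE => /(congr1 val).
  by rewrite /= !inordK ?prednK ?ptB.
move=> /card_uniqP <-; apply: leq_trans (max_card _) _.
by rewrite card_ffun !card_ord prednK.
Qed.

(* A piece with two free variables al j, be j in every block has no further one by
   the bound on the number of standard monomials, and the differences of exponents
   ex (al j) - ex (be j) are independent, as standard monomials of the same degree
   are distinct points. *)
Section TwoType.
Variables (e : E) (al be : 'I_n -> 'I_q) (od : option 'I_q).
Hypothesis se : standard e.
Hypothesis alP : forall j, al j \in (pc e).2 /\ blk (al j) = j.
Hypothesis beP : forall j, be j \in (pc e).2 /\ blk (be j) = j.
Hypothesis albe : forall j, al j != be j.
Hypothesis dP : forall d, od = Some d ->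
    [/\ d \in (pc e).2, d != al (blk d) & d != be (blk d)].

(** The degree T_j added to the base in the block j is distributed over its two free variables, t_j
    at [al j] and the rest at [be j]. If there is a third variable [od], it receives s, which is
    taken off at [be] in its block so that the degree is unchanged. *)
Definition sh_elt (T t : 'I_n -> nat) (s : nat) : E := (e.1, mnm_of (fun a => (pc e).1 a +
  if a == al (blk a) then t (blk a) else
  if a == be (blk a) then T (blk a) - t (blk a) - (if omap blk od == Some (blk a) then s
      else 0)
  else if od == Some a then s else 0)%N).

Lemma sh_elt_in T t s : in_piece (pc e) (sh_elt T t s).2.
Proof.
move=> a; rewrite mnm_ofE; case: ifPn => aP; first exact: leq_addr.
have ne b : b \in (pc e).2 -> (a == b) = false by move=> bP; apply: contraNF aP => /eqP->.
rewrite !ne ?(alP _).1 ?(beP _).1//.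
case: eqP => [/dP[aP' _ _]|_]; last by rewrite addn0.
by rewrite aP' in aP.
Qed.

Lemma sh_elt_std T t s : standard (sh_elt T t s).
Proof. exact: (pc_std se (sh_elt_in _ _ _)). Qed.

Lemma sh_elt_pc T t s : pc (sh_elt T t s) = pc e.
Proof. by apply: pc_same => //; exact: sh_elt_in. Qed.

Lemma sh_elt_idx T t s : idx (sh_elt T t s) = idx e.
Proof. by apply: idx_same => //; exact: sh_elt_in. Qed.

Lemma sh_elt_dg T t s : (forall j, t j + s <= T j)%N -> forall j,
  dg (sh_elt T t s) j = ((gdg e.1 + wdg (pc e).1)%M j + T j)%N.
Proof.
move=> tT j; rewrite /dg !mnmDE !wdgE -addnA; congr addn.
under eq_bigr do rewrite mnm_ofE.
rewrite big_split /=; congr addn.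
have [alj balj] := alP j; have [bej bbej] := beP j.
rewrite (bigD1 (al j)) ?balj//= eqxx.
rewrite (bigD1 (be j)) /=; last by rewrite bbej eqxx eq_sym albe.
rewrite bbej eqxx eq_sym (negbTE (albe j)).
have := tT j.
case E : (omap blk od == Some j).
  case Ed : od E => [d|//] /= /eqP [jd]; have [dp da db] := dP Ed.
  rewrite (bigD1 d) /=; last by rewrite jd eqxx -jd da db.
  rewrite (negbTE da) (negbTE db) eqxx big1 => [|a]; first by lia.
  move=> /andP[/andP[/andP[/eqP aj aa] ab] ad].
  rewrite aj (negbTE aa) (negbTE ab); case: eqP => // -[da'].
  by rewrite da' eqxx in ad.
rewrite big1 => [|a]; first by lia.
move=> /andP[/andP[/eqP aj aa] ab].
rewrite aj (negbTE aa) (negbTE ab); case: eqP => // Ed.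
by move: E; rewrite Ed /= aj eqxx.
Qed.

Lemma sh_elt_al T t s j : (sh_elt T t s).2 (al j) = ((pc e).1 (al j) + t j)%N.
Proof. by rewrite mnm_ofE (alP j).2 eqxx. Qed.

Lemma sh_elt_d T t s d : od = Some d -> (sh_elt T t s).2 d = ((pc e).1 d + s)%N.
Proof. by move=> od_d; have [_ da db] := dP od_d;
    rewrite mnm_ofE (negbTE da) (negbTE db) od_d eqxx. Qed.

(** A third free variable would give (B+1)^(n+1) standard elements in one degree, one power more
    than the growth of the Hilbert function allows. *)
Lemma no_third : od = None.
Proof.
case Eo : od => [d|//]; exfalso; have [c cP] := std_seq_growth.
set D0 := mdeg (gdg e.1 + wdg (pc e).1)%M.
(* With these constants the growth bound in degree [kT] is at most (C (B+1))^n = B (B+1)^n, which is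
   less than (B+1)^(n+1). *)
set C := (c * (D0 + 2 * n + 1))%N; set B := (C ^ n)%N.
pose T : 'I_n -> nat := fun=> (2 * B)%N.
pose kT : multinom n := mnm_of (fun j => (gdg e.1 + wdg (pc e).1)%M j + 2 * B)%N.
pose F (x : {ffun 'I_n -> 'I_B.+1} * 'I_B.+1) : E := sh_elt T (fun j => x.1 j) x.2.
have FP y : F y \in std_seq kT.
  apply/std_seqP; split; first exact: sh_elt_std.
  apply/mnmP => j; rewrite /F sh_elt_dg /kT ?mnm_ofE// => i.
  by have := ltn_ord (y.1 i); have := ltn_ord y.2; rewrite /T; lia.
have Finj : injective F.
  move=> [t s] [t' s'] h; congr pair.
    apply/ffunP => j; apply: val_inj; have := congr1 (fun f : E => f.2 (al j)) h.
    by rewrite !sh_elt_al => /addnI.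
  by apply: val_inj; have := congr1 (fun f : E => f.2 d) h;
      rewrite !(sh_elt_d _ _ _ Eo) => /addnI.
have : (B.+1 ^ n * B.+1 <= size (std_seq kT))%N.
  have <- : #|{: {ffun 'I_n -> 'I_B.+1} * 'I_B.+1}| = (B.+1 ^ n * B.+1)%N.
    by rewrite card_prod card_ffun !card_ord.
  rewrite cardE -(size_map F); apply: uniq_leq_size.
    by rewrite map_inj_uniq// enum_uniq.
  by move=> f /mapP[x _ ->].
move=> /leq_trans/(_ (cP kT)).
have -> : mdeg kT = (D0 + 2 * B * n)%N.
  rewrite /D0 !mdegE; under eq_bigr do rewrite mnm_ofE.
  by rewrite big_split /= sum_nat_const card_ord mulnC.
have h : (c * (D0 + 2 * B * n).+1 <= C * B.+1)%N.
  by rewrite /C -(mulnA c) leq_mul2l; apply/orP; right; nia.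
have hn : ((c * (D0 + 2 * B * n).+1) ^ n <= (C * B.+1) ^ n)%N.
  by have [->|n0] := posnP n; rewrite ?expn0 ?leq_exp2r.
move=> /leq_trans/(_ hn).
rewrite expnMn mulnC leq_mul2r expn_eq0 /=.
by rewrite /B ltnn.
Qed.

End TwoType.

(** As the element is irreducible, the pivot of each block is at its base value, so the large degree
    of the block must come from another free variable; [no_third] excludes further ones. *)
Lemma reds_piece e k : (forall j, (piece_bound <= k j)%N) -> e \in reds n k ->
  exists al be : 'I_n -> 'I_q, forall j,
   [/\ al j \in (pc e).2 /\ blk (al j) = j, be j \in (pc e).2 /\ blk (be j) = j,
       al j != be j, e.2 (al j) = (pc e).1 (al j) &
       forall a, a \in (pc e).2 -> blk a = j -> a = al j \/ a = be j].
Proof.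
move=> kb; rewrite mem_filter => /andP[nr /std_seqP[se ek]].
have nrj j : ~~ reducible j e.
  by apply: contra nr => rj; apply/existsP; exists j; rewrite ltn_ord.
have /choice[al alP] : forall j, exists a, piv (pc e).2 j = Some a.
  by move=> j; apply: piv_exists => //; rewrite ek.
have /choice[be beP] : forall j, exists b,
    [/\ b \in (pc e).2, blk b = j & ((pc e).1 b < e.2 b)%N].
  by move=> j; apply: dg_gt_base => //; rewrite ek.
have alj j : e.2 (al j) = (pc e).1 (al j).
  have := nrj j; rewrite /reducible alP -leqNgt => le; apply/eqP; rewrite eqn_leq le /=.
  by have := pc_in se (al j); rewrite (pivP (alP j)).1.
have albe j : al j != be j.
  by have [_ _ lt] := beP j; apply: contraTneq lt => <-; rewrite alj ltnn.
have h1 j : al j \in (pc e).2 /\ blk (al j) = j by have := pivP (alP j).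
have h2 j : be j \in (pc e).2 /\ blk (be j) = j by have [] := beP j.
exists al, be => j; split => // a ap aj.
have [->|aal] := eqVneq a (al j); first by left.
have [->|abe] := eqVneq a (be j); first by right.
suff : Some a = None :> option 'I_q by [].
by apply: (@no_third e al be (Some a)) => // _ [<-]; rewrite aj.
Qed.

(** An irreducible element is determined by its generator and its piece: the pivots are at their
    base values and the degree fixes the one remaining free exponent of each block. Conversely a
    piece that occurs in one large degree occurs in all of them. *)
Lemma reds_const k k' : (forall j, (piece_bound <= k j)%N) ->
  (forall j, (piece_bound <= k' j)%N) -> size (reds n k) = size (reds n k').
Proof.
move=> kb kb'.
pose F (e : E) := (e.1, idx e).
have FU k1 : (forall j, (piece_bound <= k1 j)%N) -> uniq (map F (reds n k1)).
  move=> kb1; rewrite map_inj_in_uniq; first exact/filter_uniq/std_seq_uniq.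
  move=> e f er fr [ef1 ef2].
  have pef : pc e = pc f by rewrite /pc ef2 ef1.
  have [al [be ab]] := reds_piece kb1 er; have [al' [be' ab']] := reds_piece kb1 fr.
  move: er; rewrite mem_filter => /andP[ne /std_seqP[se ek]].
  move: fr; rewrite mem_filter => /andP[nf /std_seqP[sf fk]].
  have nrj j : ~~ reducible j f.
    by apply: contra nf => rj; apply/existsP; exists j; rewrite ltn_ord.
  have nrj' j : ~~ reducible j e.
    by apply: contra ne => rj; apply/existsP; exists j; rewrite ltn_ord.
  have pvE j : exists a, piv (pc e).2 j = Some a by apply: piv_exists => //; rewrite ek.
  have [pv pvP] := choice pvE.
  have eq_pv j : e.2 (pv j) = f.2 (pv j).
    have h1 := nrj' j; have h2 := nrj j; move: h1 h2; rewrite /reducible -pef pvP -!leqNgt.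
    have pj := (pivP (pvP j)).1.
    have := pc_in se (pv j); have := pc_in sf (pv j); rewrite -pef pj /=; lia.
  have eq_ne a : a != be (blk a) -> a != al (blk a) -> e.2 a = f.2 a.
    move=> nb na; have := pc_in se a; have := pc_in sf a; rewrite -pef; case: ifPn.
      move=> ap _ _; have [_ _ _ _ h] := ab (blk a); case: (h a ap erefl) => E'.
        by rewrite -E' eqxx in na.
      by rewrite -E' eqxx in nb.
    by move=> _ -> ->.
  have eq2 : e.2 = f.2.
    apply/mnmP => a.
    have [a_pv|a_pv] := eqVneq a (pv (blk a)); first by rewrite a_pv eq_pv.
    have [ap|nap] := boolP (a \in (pc e).2); last first.
      have := pc_in se a; have := pc_in sf a; rewrite -pef (negbTE nap).
      by move=> -> ->.
    have : dg e (blk a) = dg f (blk a) by rewrite ek fk.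
    rewrite /dg !mnmDE !wdgE ef1 => /addnI.
    rewrite (bigD1 a) //= [RHS](bigD1 a) //=.
    have -> : (\sum_(b | (blk b == blk a) && (b != a)) e.2 b =
               \sum_(b | (blk b == blk a) && (b != a)) f.2 b)%N.
      apply: eq_bigr => b /andP[/eqP bl ba].
      have [bp|nbp] := boolP (b \in (pc e).2); last first.
        by have := pc_in se b; have := pc_in sf b; rewrite -pef (negbTE nbp) => -> ->.
      have [_ _ _ _ h] := ab (blk a).
      have [pvm pvb] := pivP (pvP (blk a)).
      have b_pv : b = pv (blk a).
        move/eqP: a_pv => a_pv; move/eqP: ba => ba.
        by case: (h _ pvm pvb) => E1; case: (h b bp bl) => E2; case: (h a ap erefl) => E3;
            congruence.
      by rewrite b_pv eq_pv.
    by move/addIn.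
  by case: (e) (f) ef1 eq2 => [c u] [c' u'] /= -> ->.
have sub k1 k2 : (forall j, (piece_bound <= k1 j)%N) ->
    (forall j, (piece_bound <= k2 j)%N) ->
    {subset map F (reds n k1) <= map F (reds n k2)}.
  move=> kb1 kb2 x /mapP[e er ->]; have [al [be ab]] := reds_piece kb1 er.
  have h1 j : al j \in (pc e).2 /\ blk (al j) = j by have [] := ab j.
  have h2 j : be j \in (pc e).2 /\ blk (be j) = j by have [] := ab j.
  have h3 j : al j != be j by have [] := ab j.
  move: er; rewrite mem_filter => /andP[ne /std_seqP[se ek]].
  have pvE j : exists a, piv (pc e).2 j = Some a by apply: piv_exists => //; rewrite ek.
  have [pv pvP] := choice pvE.
  (* The free variable that is not the pivot; all the additional degree is put there, so that the
     shifted element is irreducible. *)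
  pose be' j := if pv j == al j then be j else al j.
  have [g1 g2] : (forall j, pv j \in (pc e).2 /\ blk (pv j) = j) /\
                 (forall j, be' j \in (pc e).2 /\ blk (be' j) = j).
    by split => j; [have := pivP (pvP j)|rewrite /be'; case: ifP].
  have g3 j : pv j != be' j by rewrite /be'; case: ifP => [/eqP->//|->].
  pose T j := (k2 j - (gdg e.1 + wdg (pc e).1)%M j)%N.
  have ef : forall d, @None 'I_q = Some d ->
      [/\ d \in (pc e).2, d != pv (blk d) & d != be' (blk d)] by [].
  have T0 j : (0 + 0 <= T j)%N by [].
  have fk : dg (sh_elt e pv be' None T (fun=> 0%N) 0) = k2.
    apply/mnmP => j; rewrite sh_elt_dg// /T subnKC//.
    by apply: leq_trans (kb2 j); exact: ltnW (piece_boundP j se).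
  apply/mapP; exists (sh_elt e pv be' None T (fun=> 0%N) 0); last by rewrite /F sh_elt_idx.
  rewrite mem_filter; apply/andP; split; last by apply/std_seqP; split => //;
      exact: sh_elt_std.
  apply/existsP => -[j /andP[_]]; rewrite /reducible sh_elt_pc// pvP.
  by rewrite sh_elt_al// addn0 ltnn.
have sz : size (map F (reds n k)) = size (map F (reds n k')).
  by apply/perm_size/uniq_perm; rewrite ?FU// => x; apply/idP/idP; exact: sub.
by move: sz; rewrite !size_map.
Qed.

(** Here r i k is the expected dimension in degree k modulo the first i equations. The last clause
    provides, when D is positive, one edge vector in each block such that these vectors generate a
    lattice of full rank. *)
Theorem lattice_module_core : exists (k0 : nat) (r : nat -> multinom n -> nat) (D : nat),
 [/\ forall k, finite_of_size (fun x => X k x /\ ~ Z k x) (r 0%N k),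
     forall (i : 'I_n) k, (forall j, (k0 <= k j)%N) ->
         r i k = (r i.+1 k + r i (k - 'e_i)%M)%N,
     forall (i : nat) k, exists M (J : 'I_M -> 'I_n) (src tgt : 'I_M -> multinom n),
      [/\ (M + r i k = r 0 k)%N,
      forall l, (J l < i)%N /\ exists2 k', (k' + 'e_(J l))%M = k & X k' (src l),
      injective tgt, forall l, X k (tgt l) /\ ~ Z k (tgt l) &
      forall K : fieldType, \det (coef_mx J src tgt (fun a => mpolyX K 'e_a)) != 0],
     forall k, (forall j, (k0 <= k j)%N) -> r n k = D &
     (0 < D)%N -> exists al be : 'I_n -> 'I_q,
       (forall j, blk (al j) = j /\ blk (be j) = j) /\
       forall z : 'I_n -> int,
         (forall i, \sum_j z j * ((ex (al j) i)%:Z - (ex (be j) i)%:Z) = 0) ->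
         forall j, z j = 0].
Proof.
exists piece_bound.+1, (fun (i : nat) k => size (reds i k)),
  (size (reds n (mnm_of (fun=> piece_bound)))).
have r0 k : size (reds 0 k) = size (std_seq k).
  congr size; rewrite /reds (eq_filter (a2 := predT)) ?filter_predT// => e /=.
  by apply/negP => /existsP[].
split.
- by move=> k; rewrite r0; exact: std_seq_count.
- exact: reds_rec.
- by move=> i k; rewrite r0; exact: degeneration.
- by move=> k kb; apply: reds_const => j; rewrite ?mnm_ofE// ltnW.
set k := mnm_of _ => D0.
have kb j : (piece_bound <= k j)%N by rewrite mnm_ofE.
case Er : (reds n k) D0 => [//|e s] _.
have er : e \in reds n k by rewrite Er mem_head.
have [al [be ab]] := reds_piece kb er.
have h1 j : al j \in (pc e).2 /\ blk (al j) = j by have [] := ab j.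
have h2 j : be j \in (pc e).2 /\ blk (be j) = j by have [] := ab j.
have h3 j : al j != be j by have [] := ab j.
have se : standard e by move: er; rewrite mem_filter => /andP[_ /std_seqP[]].
exists al, be; split => [j|z hz j]; first by rewrite (h1 j).2 (h2 j).2.
(* A relation z between the edges gives two ways, [t] and [t'], of distributing the same degree with
   t - t' = z. Both elements are standard and represent the same monomial, so they coincide and z =
   0. *)
pose T j := (2 * `|z j|)%N.
pose t j : nat := if 0 <= z j then (2 * `|z j|)%N else 0%N.
pose t' j : nat := `|z j|%N.
have tT i : (t i + 0 <= T i)%N by rewrite /t /T; case: ifP; lia.
have tT' i : (t' i + 0 <= T i)%N by rewrite /t' /T; lia.
have tz i : (t i)%:Z - (t' i)%:Z = z i by rewrite /t /t'; case: ifP; lia.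
suff h : sh_elt e al be None T t 0 = sh_elt e al be None T t' 0.
  have := congr1 (fun f : E => f.2 (al j)) h.
  by rewrite !sh_elt_al// => /addnI; have := tz j; lia.
apply: standard_inj; [exact: sh_elt_std|exact: sh_elt_std|split].
  by apply/mnmP => i; rewrite !sh_elt_dg.
apply/mnmP => i; rewrite /pt !mnmDE; congr addn.
have wE t1 : (forall j, (t1 j <= T j)%N) -> (wpt (sh_elt e al be None T t1 0).2 i)%:Z =
   (wpt (pc e).1 i)%:Z + \sum_l (T l)%:Z * (ex (be l) i)%:Z +
       \sum_l (t1 l)%:Z * ((ex (al l) i)%:Z - (ex (be l) i)%:Z).
  move=> t1T; rewrite !wptE.
  under eq_bigr do rewrite mnm_ofE mulnDr.
  rewrite big_split /= PoszD -!addrA; congr (_ + _).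
  rewrite -big_split /= (partition_big blk xpredT)//= -natz natr_sum.
  apply: eq_bigr => l _; rewrite (bigD1 (al l)) ?(h1 l).2//= eqxx.
  rewrite (bigD1 (be l)) /=; last by rewrite (h2 l).2 eqxx eq_sym h3.
  rewrite (h2 l).2 eqxx eq_sym (negbTE (h3 l)) subn0 big1 ?addn0.
    have := t1T l; rewrite natz; nia.
  by move=> a /andP[/andP[/eqP -> na] nb]; rewrite (negbTE na) (negbTE nb) muln0.
have tT0 l : (t l <= T l)%N by have := tT l; rewrite addn0.
have tT0' l : (t' l <= T l)%N by have := tT' l; rewrite addn0.
apply/eqP; rewrite -eqz_nat (wE t)// (wE t')//.
rewrite -subr_eq0 opprD addrACA subrr add0r -sumrB; apply/eqP.
rewrite -[RHS](hz i); apply: eq_bigr => l _; by rewrite -mulrBl tz.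
Qed.

End Standard.

(** * Codimensions and generic conditions *)

Section Codim.
Variables (K : fieldType) (L : lmodType K).
Implicit Types (E W : L -> Prop) (d : nat).

Definition subspace W := W 0 /\ forall a x y, W x -> W y -> W (a *: x + y).

(** The two bounds on dim E/(E cap W) are kept as separate predicates, since E may be infinite
    dimensional and finiteness of the codimension is part of what has to be proved. *)
Definition codim_le E W d := exists b : 'I_d -> L, (forall i, E (b i)) /\
  forall v, E v -> exists c : 'I_d -> K, W (v - \sum_i c i *: b i).

Definition codim_ge E W d := exists b : 'I_d -> L, (forall i, E (b i)) /\
  forall c : 'I_d -> K, W (\sum_i c i *: b i) -> forall i, c i = 0.

Lemma subspaceD W x y : subspace W -> W x -> W y -> W (x + y).
Proof. by move=> [_ h] wx wy; rewrite -[x]scale1r; exact: h. Qed.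

Lemma subspaceZ W a x : subspace W -> W x -> W (a *: x).
Proof. by move=> [h0 h] wx; rewrite -[_ *: _]addr0; exact: h. Qed.

Lemma subspaceN W x : subspace W -> W x -> W (- x).
Proof. by move=> sW; rewrite -scaleN1r; exact: subspaceZ. Qed.

Lemma subspaceB W x y : subspace W -> W x -> W y -> W (x - y).
Proof. by move=> sW wx /(subspaceN sW); exact: subspaceD. Qed.

Lemma subspace_sum W (I : Type) (r : seq I) (P : pred I) (F : I -> L) :
  subspace W -> (forall i, P i -> W (F i)) -> W (\sum_(i <- r | P i) F i).
Proof.
move=> sW h; apply: (big_ind W) => //; first exact: sW.1.
by move=> x y; exact: subspaceD.
Qed.

Lemma codim_le_ge E W d e : subspace W -> codim_le E W d -> codim_ge E W e ->
  (e <= d)%N.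
Proof.
move=> sW [b [_ bP]] [x [xE xP]]; rewrite leqNgt; apply/negP => de.
have /choice[M MP] i := bP _ (xE i).
pose A : 'M[K]_(e, d) := \matrix_(i, j) M i j.
have kA : (kermx A != 0).
  rewrite kermx_eq0 /row_free; apply/negP => /eqP rA; have := rank_leq_col A.
  by rewrite rA leqNgt de.
have [i ri] : exists i, row i (kermx A) != 0.
  apply: contrapT => nr; move/eqP: kA; apply; apply/row_matrixP => i; rewrite row0.
  by apply/eqP/negPn/negP => ri; apply: nr; exists i.
have vA : row i (kermx A) *m A = 0 by rewrite -row_mul mulmx_ker row0.
set v := row _ _ in ri vA.
suff : forall i, v 0 i = 0.
  move=> v0; move/eqP: ri; apply; apply/rowP => l; rewrite v0 mxE//.
apply: xP; have -> : \sum_l v 0 l *: x l =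
    \sum_l v 0 l *: (x l - \sum_j M l j *: b j) + \sum_j (v *m A) 0 j *: b j.
  have -> : \sum_j (v *m A) 0 j *: b j = \sum_l v 0 l *: \sum_j M l j *: b j.
    under eq_bigr do rewrite mxE scaler_suml.
    rewrite exchange_big; apply: eq_bigr => l _ /=; rewrite scaler_sumr.
    by apply: eq_bigr => j _; rewrite scalerA [A l j]mxE.
  by rewrite -big_split; apply: eq_bigr => l _; rewrite /= -scalerDr subrK.
rewrite vA; under [in X in _ + X]eq_bigr do rewrite mxE scale0r.
rewrite big1_eq addr0; apply: subspace_sum => // l _; exact: subspaceZ.
Qed.

Lemma independent_extend E W d (b : 'I_d -> L) : subspace W ->
  (forall i, E (b i)) -> (forall c : 'I_d -> K, W (\sum_i c i *: b i) ->
      forall i, c i = 0) ->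
  (forall v : L, E v -> exists c : 'I_d ->
      K, W (v - \sum_i c i *: b i)) \/ codim_ge E W d.+1.
Proof.
move=> sW bE bP.
have [sp|nsp] := pselect (forall v : L, E v -> exists c : 'I_d ->
    K, W (v - \sum_i c i *: b i)); first by left.
right; have {nsp}[v [Ev nv]] : exists v : L, E v /\ forall c : 'I_d ->
    K, ~ W (v - \sum_i c i *: b i).
  apply: contrapT => h; apply: nsp => v Ev; apply: contrapT => h'; apply: h; exists v.
  by split => // c Wc; apply: h'; exists c.
exists (fun i => if unlift ord0 i is Some j then b j else v); split.
  by move=> i; case: unliftP.
move=> c; rewrite big_ord_recl unlift_none.
under eq_bigr do rewrite liftK.
move=> Wc; have c0 : c ord0 = 0.
  apply/eqP/negPn/negP => c0; apply: (nv (fun i => - (c ord0)^-1 * c (lift ord0 i))).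
  have := subspaceZ (c ord0)^-1 sW Wc; rewrite scalerDr scalerA mulVf// scale1r.
  congr W; congr +%R; rewrite scaler_sumr -sumrN; apply: eq_bigr => i _.
  by rewrite scalerA mulNr scaleNr opprK.
move: Wc; rewrite c0 scale0r add0r => /bP h i.
by case: (unliftP ord0 i) => [j ->|->].
Qed.

Lemma codim_basis E W d : subspace W -> codim_le E W d -> codim_ge E W d ->
  exists b : 'I_d -> L, [/\ forall i, E (b i),
    forall c : 'I_d -> K, W (\sum_i c i *: b i) -> forall i, c i = 0 &
    forall v : L, E v -> exists c : 'I_d -> K, W (v - \sum_i c i *: b i)].
Proof.
move=> sW le [b [bE bP]]; exists b; split => //.
case: (independent_extend sW bE bP) => // ge.
by have := codim_le_ge sW le ge; rewrite ltnn.
Qed.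

(** Lower bounds are obtained by contradiction from this: the second case supplies a spanning family
    that is too small. *)
Lemma codim_dichotomy E W d : subspace E -> subspace W ->
  codim_ge E W d \/ exists2 t, (t < d)%N & codim_le E W t /\ codim_ge E W t.
Proof.
move=> sE sW; elim: d => [|d [[b [bE bP]]|[t td tE]]].
- by left; exists (fun=> 0); split => [[]|c _ []].
- by case: (independent_extend sW bE bP) => [sp|]; [right; exists d => //; split;
    exists b|left].
- by right; exists t => //; rewrite ltnW.
Qed.

Lemma codim_le_trans E W W' s t : subspace W ->
  codim_le E W' t -> codim_le W' W s -> (forall v, W' v -> E v) -> codim_le E W (t + s).
Proof.
move=> sW [b [bE bP]] [b' [bE' bP']] WE.
exists (fun i : 'I_(t + s) => match fintype.split i with inl j => b j | inr j =>
    b' j end); split.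
  by move=> i; case: splitP => j _ //; exact/WE/bE'.
move=> v /bP[c /bP'[c' h]];
    exists (fun i : 'I_(t + s) => match fintype.split i with inl j => c j | inr j =>
        c' j end).
move: h; congr W; rewrite big_split_ord /= opprD addrA; congr (_ - _ - _).
  by apply: eq_bigr => i _; rewrite -[lshift _ i]/(unsplit (inl i)) unsplitK.
by apply: eq_bigr => i _; rewrite -[rshift _ i]/(unsplit (inr i)) unsplitK.
Qed.

Lemma codim_ge_sub E W W' s d : subspace E -> subspace W -> subspace W' ->
  (forall v, W' v -> E v) -> codim_ge E W d -> codim_le W' W s -> codim_ge E W' (d - s).
Proof.
move=> sE sW sW' WE gd ls; case: (codim_dichotomy (d - s) sE sW') => // -[t td [lt _]].
by have := codim_le_ge sW (codim_le_trans sW lt ls WE) gd; lia.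
Qed.

Lemma codim_exact E W d : subspace E -> subspace W -> codim_le E W d ->
  exists2 t, (t <= d)%N & codim_le E W t /\ codim_ge E W t.
Proof.
move=> sE sW le; case: (codim_dichotomy d.+1 sE sW) => [ge|[t td h]].
  by have := codim_le_ge sW le ge; rewrite ltnn.
by exists t.
Qed.

End Codim.

Section Polycond.
Variables (K : fieldType) (q : nat).
Implicit Types (P Q : ('I_q -> K) -> Prop).

(** Genericity with a single polynomial as witness, which can be multiplied, specialized and pulled
    back. *)
Definition polycond P := exists2 G : mpoly q K, G != 0 & forall c, meval c G != 0 -> P c.

Lemma polycondT P : (forall c, P c) -> polycond P.
Proof. by move=> h; exists 1; rewrite ?oner_neq0. Qed.

Lemma polycondW P Q : (forall c, P c -> Q c) -> polycond P -> polycond Q.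
Proof. by move=> PQ [G G0 GP]; exists G => // c /GP/PQ. Qed.

Lemma polycondI P Q : polycond P -> polycond Q -> polycond (fun c => P c /\ Q c).
Proof.
move=> [G G0 GP] [H H0 HQ]; exists (G * H); first by rewrite mulf_neq0.
by move=> c; rewrite mevalM mulf_eq0 negb_or => /andP[/GP ? /HQ ?].
Qed.

Lemma polycond_seq (T : eqType) (s : seq T) (P : T -> ('I_q -> K) -> Prop) :
  (forall t, t \in s -> polycond (P t)) -> polycond (fun c => forall t, t \in s -> P t c).
Proof.
elim: s => [_|t s IH h]; first exact: polycondT.
have := polycondI (h t (mem_head _ _)) (IH _); case.
  by move=> u us; apply: h; rewrite inE us orbT.
move=> G G0 GP; exists G => // c /GP[h1 h2] u; rewrite inE => /orP[/eqP->//|]; exact: h2.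
Qed.

Lemma polycond_fin (T : finType) (P : T -> ('I_q -> K) -> Prop) :
  (forall t, polycond (P t)) -> polycond (fun c => forall t, P t c).
Proof.
move=> h; have := @polycond_seq _ (enum T) P (fun t _ => h t).
by apply: polycondW => c hc t; apply: hc; rewrite mem_enum.
Qed.

End Polycond.

Section Supported.
Variables (K : fieldType) (n : nat).
Implicit Types (P Q R : multinom n -> Prop) (u v : mpoly n K) (m : multinom n).

Definition supported P v := forall m, mcoeff m v != 0 -> P m.

Lemma supported_subspace P : subspace (supported P).
Proof.
split=> [m|a u v Pu Pv m]; first by rewrite mcoeff0 eqxx.
rewrite mcoeffD mcoeffZ; have [u0|/Pu//] := eqVneq (mcoeff m u) 0.
by rewrite u0 mulr0 add0r => /Pv.
Qed.

Lemma supported_0 P : supported P 0.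
Proof. by have [] := supported_subspace P. Qed.

Lemma supportedD P u v : supported P u -> supported P v -> supported P (u + v).
Proof. exact: (subspaceD (supported_subspace P)). Qed.

Lemma supportedB P u v : supported P u -> supported P v -> supported P (u - v).
Proof. exact: (subspaceB (supported_subspace P)). Qed.

Lemma supportedZ P a v : supported P v -> supported P (a *: v).
Proof. exact: (subspaceZ _ (supported_subspace P)). Qed.

Lemma supported_sum P (I : Type) (r : seq I) (Q : pred I) (F : I -> mpoly n K) :
  (forall i, Q i -> supported P (F i)) -> supported P (\sum_(i <- r | Q i) F i).
Proof. exact: (@subspace_sum _ _ (supported P) I r Q F (supported_subspace P)). Qed.

Lemma supportedX P m : P m -> supported P (mpolyX K m).
Proof. by move=> Pm m'; rewrite mcoeffX; case: (m =P m') => [<-//|_]; rewrite eqxx. Qed.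

Lemma supportedW P Q v : (forall m, P m -> Q m) -> supported P v -> supported Q v.
Proof. by move=> PQ Pv m /Pv/PQ. Qed.

Lemma supportedM P Q R u v : (forall m m', P m -> Q m' -> R (m + m')%M) ->
  supported P u -> supported Q v -> supported R (u * v).
Proof.
move=> h Pu Qv m; rewrite -mcoeff_msupp => /msuppM_le /allpairsP[[a b] /= [au bv ->]].
by apply: h; [apply: Pu|apply: Qv]; rewrite -mcoeff_msupp.
Qed.

Lemma supported0 v : supported (fun=> False) v -> v = 0.
Proof.
move=> h; apply/mpolyP => m; rewrite mcoeff0; apply/eqP/negPn/negP; exact: h.
Qed.

Lemma supported_expand (s : seq (multinom n)) v : uniq s ->
    supported (fun m => m \in s) v ->
  v = \sum_(m <- s) mcoeff m v *: mpolyX K m.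
Proof.
move=> us hv; apply/mpolyP => m; rewrite raddf_sum /=.
under eq_bigr do rewrite mcoeffZ mcoeffX.
have [ms|nms] := boolP (m \in s).
  rewrite (bigD1_seq m) //= eqxx mulr1 big1 ?addr0// => m' /negbTE ->.
  by rewrite mulr0.
have -> : mcoeff m v = 0 by apply/eqP/negPn; apply: contra nms => /hv.
rewrite big_seq big1// => m' m's; case: eqP m's nms => [->->//|_ _ _].
by rewrite mulr0.
Qed.

End Supported.

(** * Generic sparse systems acting on modules of lattice points *)

Section GenericModule.
Variables (K : fieldType) (n q : nat) (blk : 'I_q -> 'I_n) (ex : 'I_q -> multinom n).
Variables (p : nat) (gpt gdg : 'I_p -> multinom n).
Variable Z : multinom n -> multinom n -> Prop.
Local Notation X := (lattice_module blk ex gpt gdg).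
Local Notation P := (mpoly n K).
Implicit Types (c : 'I_q -> K) (k x : multinom n) (i j : 'I_n).

Definition sparse_sys c j : P := \sum_(a | blk a == j) c a *: mpolyX K (ex a).

(** The monomials of X in degree k - e_j, written without subtraction so that there are none when
    k_j = 0. *)
Definition below j k x := exists2 k', (k' + 'e_j)%M = k & X k' x.

Definition relations c (i : nat) k (v : P) := exists h : 'I_n -> P,
  (forall j, (j < i)%N -> supported (below j k) (h j)) /\
  supported (Z k) (v - \sum_(j < n | (j < i)%N) sparse_sys c j * h j).

Hypothesis Zadd : forall w k x, Z k x -> Z (k + wdg blk w)%M (x + wpt ex w)%M.
Hypothesis ZX : forall k x, Z k x -> X k x.

Lemma relations_subspace c (i : nat) k : subspace (relations c i k).
Proof.
split.
  exists (fun=> 0); split => [j _|]; first exact: supported_0.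
  rewrite big1 ?subr0; first exact: supported_0.
  by move=> j _; rewrite mulr0.
move=> a u v [h [hs hv]] [h' [hs' hv']]; exists (fun j => a *: h j + h' j); split.
  by move=> j ji; apply: supportedD; [apply: supportedZ; exact: hs|exact: hs'].
have -> : a *: u + v - \sum_(j < n | (j < i)%N) sparse_sys c j * (a *: h j + h' j) =
  a *: (u - \sum_(j < n | (j < i)%N) sparse_sys c j * h j) +
  (v - \sum_(j < n | (j < i)%N) sparse_sys c j * h' j).
  under eq_bigr do rewrite mulrDr -scalerAr.
  by rewrite big_split /= -scaler_sumr scalerBr opprD addrACA.
by apply: supportedD => //; exact: supportedZ.
Qed.

Lemma below_add a j k x : blk a = j -> below j k x -> X k (x + ex a)%M.
Proof.
move=> aj [k' <- /(lattice_module_add 'e_a)].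
by rewrite wdg1 wpt1 aj.
Qed.

Lemma supported_sys_mul c j k h : supported (below j k) h ->
    supported (X k) (sparse_sys c j * h).
Proof.
move=> hs; rewrite /sparse_sys mulr_suml; apply: supported_sum.
move=> a /eqP aj; rewrite -scalerAl; apply: supportedZ.
apply: (supportedM (P := eq (ex a))) hs; last by exact: supportedX.
by move=> _ m <- /(below_add aj); rewrite addmC.
Qed.

Lemma relations_sub c (i : nat) k v : relations c i k v -> supported (X k) v.
Proof.
move=> [h [hs hv]]; rewrite -(subrK (\sum_(j < n | (j < i)%N) sparse_sys c j * h j) v).
apply: supportedD.
  by apply: supportedW hv; exact: ZX.
apply: supported_sum.
by move=> j ji; apply: supported_sys_mul; exact: hs.
Qed.

Lemma mcoeff_sys_mul c j s t : mcoeff t (sparse_sys c j * mpolyX K s) =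
  \sum_(a | (blk a == j) && ((s + ex a)%M == t)) c a.
Proof.
rewrite /sparse_sys mulr_suml raddf_sum /= [LHS]big_mkcond [RHS]big_mkcond /=.
apply: eq_bigr => a _; case: eqP => //= _.
rewrite -scalerAl -mpolyXD mcoeffZ mcoeffX addmC.
by case: eqP => _; rewrite ?mulr1 ?mulr0.
Qed.

(** Inverting the matrix removes all target monomials from an element by means of the equations; the
    r monomials outside Z that are no targets remain. *)
Lemma relations_span c (i : nat) k r N M (J : 'I_M -> 'I_n) (src tgt : 'I_M -> multinom n) :
  finite_of_size (fun x => X k x /\ ~ Z k x) N -> (M + r)%N = N ->
  (forall l, (J l < i)%N /\ below (J l) k (src l)) -> injective tgt ->
  (forall l, X k (tgt l) /\ ~ Z k (tgt l)) ->
  \det (coef_mx blk ex J src tgt c) != 0 ->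
  codim_le (supported (X k)) (relations c i k) r.
Proof.
move=> [s [us ss sP]] MrN Jsrc tinj tY dM.
pose T := [seq tgt l | l <- enum 'I_M].
pose rest := [seq x <- s | x \notin T].
have sr : size rest = r.
  have -> : size rest = (size s - count (mem T) s)%N.
    by rewrite size_filter -(count_predC (mem T)) addKn.
  have -> : count (mem T) s = M.
    rewrite -size_filter -[RHS](card_ord M) cardE -(size_map tgt).
    apply/perm_size/uniq_perm;
        [exact: filter_uniq|by rewrite map_inj_uniq ?enum_uniq|move=> x].
    rewrite mem_filter; apply/andP/idP => [[]//|xT]; split => //.
    by apply/sP; move/mapP: xT => [l _ ->].
  by rewrite ss -MrN addKn.
have rX x : x \in rest -> X k x by rewrite mem_filter => /andP[_ /sP[]].
pose b (l : 'I_r) : P := mpolyX K (nth 0%M rest l).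
exists b; split.
  by move=> l; apply: supportedX; apply/rX/mem_nth; rewrite sr.
move=> v Xv.
pose A := coef_mx blk ex J src tgt c.
pose w : 'rV[K]_M := (\row_l mcoeff (tgt l) v) *m invmx A.
have uA : A \in unitmx by rewrite unitmxE unitfE.
have wA : w *m A = \row_l mcoeff (tgt l) v by rewrite mulmxKV.
pose phi l := sparse_sys c (J l) * mpolyX K (src l).
pose v' := v - \sum_l w 0 l *: phi l.
have phiX l : supported (X k) (phi l).
  by apply: supported_sys_mul; apply: supportedX; have [] := Jsrc l.
have v'X : supported (X k) v'.
  apply: supportedB => //.
  apply: supported_sum.
  by move=> l _; exact: supportedZ.
have v't l : mcoeff (tgt l) v' = 0.
  rewrite mcoeffB raddf_sum /=; under eq_bigr do rewrite mcoeffZ mcoeff_sys_mul.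
  have := congr1 (fun B : 'rV[K]_M => B 0 l) wA; rewrite /= [RHS]mxE => <-.
  rewrite [(_ *m _) _ _]mxE; apply/eqP; rewrite subr_eq0; apply/eqP.
  by apply: eq_bigr => l' _; rewrite [A l' l]mxE.
exists (fun l => mcoeff (nth 0%M rest l) v').
have v'E : supported (Z k) (v' - \sum_(l < r) mcoeff (nth 0%M rest l) v' *: b l).
  have -> : \sum_(l < r) mcoeff (nth 0%M rest l) v' *: b l =
            \sum_(x <- rest) mcoeff x v' *: mpolyX K x.
    by rewrite (big_nth 0%M) sr big_mkord.
  move=> m; rewrite mcoeffB raddf_sum /=; under eq_bigr do rewrite mcoeffZ mcoeffX.
  have [mr|mr] := boolP (m \in rest).
    rewrite (bigD1_seq m) //=; last exact: filter_uniq.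
    rewrite eqxx mulr1 big1 ?addr0 ?subrr ?eqxx// => x /negbTE ->; by rewrite mulr0.
  rewrite big_seq big1 ?subr0; last first.
    by move=> x xr; case: eqP xr mr => [->->//|_ _ _]; rewrite mulr0.
  move=> mv; apply: contrapT => nZ; have Xm := v'X m mv.
  have ms : m \in s by apply/sP.
  move: mr; rewrite mem_filter ms andbT negbK => /mapP[l _ E].
  by move: mv; rewrite E v't eqxx.
exists (fun j => \sum_(l | J l == j) w 0 l *: mpolyX K (src l)); split.
  move=> j ji; apply: supported_sum.
  move=> l /eqP <-; apply: supportedZ.
  by apply: supportedX; have [] := Jsrc l.
move: v'E; congr supported; rewrite /v' addrAC; congr (_ - _).
under [RHS]eq_bigr do rewrite mulr_sumr.
rewrite (exchange_big_dep xpredT)//=; apply: eq_bigr => l _.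
rewrite (big_pred1 (J l)); first by rewrite scalerAr.
move=> j /=; apply/andP/eqP => [[_ /eqP->//]|->]; by rewrite (Jsrc l).1 eqxx.
Qed.

Lemma coef_mx_polycond M (J : 'I_M -> 'I_n) (src tgt : 'I_M -> multinom n) :
  \det (coef_mx blk ex J src tgt (fun a => mpolyX K 'e_a)) != 0 ->
  polycond (fun c => \det (coef_mx blk ex J src tgt c) != 0).
Proof.
move=> d0; exists (\det (coef_mx blk ex J src tgt (fun a => mpolyX K 'e_a))) => // c.
suff -> : meval c (\det (coef_mx blk ex J src tgt (fun a => mpolyX K 'e_a))) =
          \det (coef_mx blk ex J src tgt c) by [].
rewrite -det_map_mx; congr (\det _); apply/matrixP => l l'; rewrite !mxE raddf_sum /=.
by apply: eq_bigr => a _; rewrite mevalXU.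
Qed.

Section Lower.
Variables (c : 'I_q -> K) (k0 : nat) (r : nat -> multinom n -> nat).
Hypothesis r0 : forall k, finite_of_size (fun x => X k x /\ ~ Z k x) (r 0%N k).
Hypothesis rrec : forall i k, (forall j, (k0 <= k j)%N) ->
  r i k = (r i.+1 k + r i (k - 'e_i)%M)%N.

Definition spans (i : nat) k := codim_le (supported (X k)) (relations c i k) (r i k).

Lemma relations0 k v : relations c 0 k v <-> supported (Z k) v.
Proof.
split=> [[h [_]]|vZ]; first by rewrite big_pred0 ?subr0.
exists (fun=> 0); split => //; rewrite big_pred0 ?subr0//.
Qed.

(** Upper bounds for fewer equations in lower degrees give the lower bound. Multiplication by f_i
    sends relations of degree k - e_i to relations of degree k, so adjoining f_i enlarges the
    relations by at most r i (k - e_i) dimensions, and [rrec] says that this is exactly the loss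
    allowed. *)
Lemma relations_lower (i : nat) k : (i <= n)%N -> (forall j, (k0 < k j)%N) ->
  (forall (i' : nat) k', (i' < i)%N -> (k' <= k)%M -> (forall j, (k0 <= k' j)%N) ->
      spans i' k') ->
  codim_ge (supported (X k)) (relations c i k) (r i k).
Proof.
elim: i => [_ kk _|i IH ni kk sp].
  have [s [us <- sP]] := r0 k.
  exists (fun l => mpolyX K (nth 0%M s l)); split.
    by move=> l; apply: supportedX; have /sP[] : nth 0%M s l \in s by exact: mem_nth.
  move=> cc /relations0 vZ l; apply/eqP/negPn/negP => cl.
  have /sP[_ nZ] : nth 0%M s l \in s by exact: mem_nth.
  apply/nZ/vZ; rewrite raddf_sum /=; under eq_bigr do rewrite mcoeffZ mcoeffX.
  rewrite (bigD1 l) //= eqxx mulr1 big1 ?addr0// => l' l'l.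
  by rewrite nth_uniq// [(_ == _)%N](negbTE l'l) mulr0.
pose i' := Ordinal ni.
have kk' j : (k0 <= k j)%N by exact: ltnW.
have ge : codim_ge (supported (X k)) (relations c i k) (r i k).
  by apply: IH => //; [exact: ltnW|move=> *; apply: sp => //; exact: ltnW].
have sge : spans i (k - 'e_i')%M.
  apply: sp => //; first exact: lem_subr.
  move=> j; mnm; have := kk j; case: (i' == j); lia.
have -> : r i.+1 k = (r i k - r i (k - 'e_i')%M)%N by rewrite (rrec i')// addnK.
apply: codim_ge_sub ge _; [exact: supported_subspace|exact: relations_subspace|
  exact: relations_subspace|exact: relations_sub|].
have kE : (k - 'e_i' + 'e_i')%M = k by apply: subm_add; exact: leq_ltn_trans (kk i').
have [b [bX bP]] := sge.
exists (fun l => sparse_sys c i' * b l); split.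
  move=> l; exists (fun j => if j == i' then b l else 0); split.
    move=> j _; case: eqP => [->|_]; last exact: supported_0.
    by apply: supportedW (bX l) => x Xx; exists (k - 'e_i')%M.
  rewrite (bigD1 i') //= eqxx big1 ?addr0 ?subrr; first exact: supported_0.
  by move=> j /andP[_ /negbTE ->]; rewrite mulr0.
move=> v [h [hs hv]].
have hi : supported (X (k - 'e_i')%M) (h i').
  apply: supportedW (hs i' (ltnSn i)) => x [k' k'E Xx].
  by rewrite -k'E addmK.
have [cc [h' [hs' hv']]] := bP _ hi; exists cc.
exists (fun j => h j + sparse_sys c i' * h' j); split.
  move=> j ji; apply: supportedD; first exact/hs/ltnW.
  rewrite /sparse_sys mulr_suml; apply: supported_sum.
  move=> a /eqP ai; rewrite -scalerAl; apply: supportedZ.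
  apply: (supportedM (P := eq (ex a))) (hs' j ji); last by exact: supportedX.
  move=> _ m <- [k' k'E /(lattice_module_add 'e_a)]; rewrite wdg1 wpt1 ai => Xm.
  exists (k' + 'e_i')%M; last by rewrite (addmC (ex a)).
  by rewrite -addmA (addmC (mnm1 i')) addmA k'E kE.
have -> : v - \sum_l cc l *: (sparse_sys c i' * b l) - \sum_(j < n | (j < i)%N)
     sparse_sys c j * (h j + sparse_sys c i' * h' j) =
   (v - \sum_(j < n | (j < i.+1)%N) sparse_sys c j * h j) + sparse_sys c i' *
   (h i' - \sum_l cc l *: b l - \sum_(j < n | (j < i)%N) sparse_sys c j * h' j).
  have -> : \sum_(j < n | (j < i.+1)%N) sparse_sys c j * h j = sparse_sys c i' * h i' +
      \sum_(j < n | (j < i)%N) sparse_sys c j * h j.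
    rewrite (bigD1 i') ?ltnSn//=; congr (_ + _); apply: eq_bigl => j.
    by rewrite ltnS leq_eqVlt -val_eqE /=; case: ltngtP.
  under eq_bigr do rewrite scalerAr.
  under [X in _ - _ - X = _]eq_bigr do rewrite mulrDr mulrCA.
  rewrite big_split /= -!mulr_sumr.
  set A := \sum_(j < n | _) _; set B := \sum_(j < n | _) _; set C := \sum_l _.
  by ring.
apply: supportedD => //.
rewrite /sparse_sys mulr_suml; apply: supported_sum.
move=> a /eqP ai; rewrite -scalerAl; apply: supportedZ.
apply: (supportedM (P := eq (ex a))) hv'; last by exact: supportedX.
move=> _ m <- /(@Zadd 'e_a); rewrite wdg1 wpt1 ai kE; by rewrite addmC.
Qed.

End Lower.

End GenericModule.

Lemma finite_of_size_uniq (T : eqType) (P : T -> Prop) N N' :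
  finite_of_size P N -> finite_of_size P N' -> N = N'.
Proof.
move=> [s [us <- sP]] [t [ut <- tP]]; apply/perm_size/uniq_perm => // x.
by apply/idP/idP => [/sP/tP|/tP/sP].
Qed.

Lemma finite_of_size_ext (T : eqType) (P Q : T -> Prop) N :
  (forall x, P x <-> Q x) -> finite_of_size P N -> finite_of_size Q N.
Proof. by move=> PQ [s [us ss sP]]; exists s; split => // x; rewrite -PQ. Qed.

Lemma finite_of_size_split (T : eqType) (P Q : T -> Prop) N :
  finite_of_size P N -> exists M M', [/\ finite_of_size (fun x => P x /\ Q x) M,
    finite_of_size (fun x => P x /\ ~ Q x) M' & (M + M')%N = N].
Proof.
move=> [s [us ss sP]].
exists (size [seq x <- s | `[< Q x >]]), (size [seq x <- s | ~~ `[< Q x >]]); split.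
- exists [seq x <- s | `[< Q x >]]; split; rewrite ?filter_uniq// => x.
  by rewrite mem_filter; split=> [[/sP -> /asboolP ->]|/andP[/asboolP ? /sP ?]].
- exists [seq x <- s | ~~ `[< Q x >]]; split; rewrite ?filter_uniq// => x.
  by rewrite mem_filter; split=> [[/sP -> /asboolPn ->]|/andP[/asboolPn ? /sP ?]].
- by rewrite !size_filter count_predC.
Qed.

Lemma finite_of_size_inj (T U : eqType) (P : T -> Prop) (Q : U -> Prop) (f : T -> U) N N' :
  (forall x y, P x -> P y -> f x = f y -> x = y) -> (forall x, P x -> Q (f x)) ->
  finite_of_size P N -> finite_of_size Q N' -> (N <= N')%N.
Proof.
move=> fi PQ [s [us <- sP]] [t [_ <- tQ]]; rewrite -(size_map f); apply: uniq_leq_size.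
  by rewrite map_inj_in_uniq// => x y /sP Px /sP Py; exact: fi.
by move=> _ /mapP[x /sP Px ->]; exact/tQ/PQ.
Qed.

(** * Iterated differences of the Hilbert function *)

Section Telescope.
Variables (n : nat) (N : nat).
Implicit Types (g h : multinom n -> int) (k : multinom n) (i j : 'I_n) (S : {set 'I_n}).

Definition box_shift k S := (k + mnm_of (fun j => if j \in S then N else 0%N))%M.

Definition diffop j h k := h (k + 'e_j *+ N)%M - h k.

Definition diffops l h := foldl (fun g j => diffop j g) h l.

Lemma diffops_expand l h k : uniq l -> diffops l h k =
  \sum_(S : {set 'I_n} | S \subset [set x in l]%SET) (-1) ^+ (size l - #|S|) * h (box_shift
      k S).
Proof.
rewrite /diffops; elim: l h => [h _|j l IH h /andP[jl ul]] /=.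
  have -> : [set x in [::]]%SET = finset.set0 :> {set 'I_n}.
    by apply/setP => x; rewrite !inE.
  rewrite (big_pred1 finset.set0); last by move=> S; rewrite finset.subset0.
  rewrite cards0 expr0 mul1r /box_shift; congr h; apply/mnmP => i; mnm.
  by rewrite mnm_ofE finset.in_set0 addn0.
rewrite IH// [RHS](bigID (fun S : {set 'I_n} => j \in S)) /=.
have jL : j \notin [set x in l]%SET by rewrite inE.
under eq_bigr do rewrite mulrBr.
rewrite sumrB; congr (_ + _); last first.
  rewrite -sumrN; apply: eq_big => S.
    apply/idP/andP => [Sl|[Sl jS]].
      split; last by apply: contra jL => /(fintype.subsetP Sl).
      by apply: fintype.subset_trans Sl _; apply/fintype.subsetP => x; rewrite !inE => ->;
          rewrite orbT.
    apply/fintype.subsetP => x xS; have := fintype.subsetP Sl x xS; rewrite !inE.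
    by case: eqP => // xj; rewrite xj (negbTE jS) in xS.
  move=> Sl; have : (#|S| <= size l)%N.
    by apply: leq_trans (subset_leq_card Sl) _; rewrite cardsE; exact: card_size.
  by move=> ?; rewrite subSn// exprS mulN1r mulNr.
rewrite [RHS](reindex_onto (fun S : {set 'I_n} => j |: S)%SET (fun S => S :\ j)%SET) /=;
    last first.
  by move=> S /andP[_ jS]; rewrite finset.setD1K.
apply: eq_big => S.
  apply/idP/andP => [Sl|[/andP[Sl _] /eqP jS]].
    have jS : j \notin S by apply: contra jL => /(fintype.subsetP Sl).
    rewrite finset.setU11 andbT finset.setU1K//; split => //.
    apply/fintype.subsetP => x; rewrite !inE => /orP[->//|/(fintype.subsetP Sl)].
    by rewrite inE => ->; rewrite orbT.
  have jS' : j \notin S by rewrite -jS !inE eqxx.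
  apply/fintype.subsetP => x xS; have := fintype.subsetP Sl x;
      rewrite !inE xS orbT => /(_ isT).
  by case: eqP => // xj; rewrite xj (negbTE jS') in xS.
move=> Sl; have jS : j \notin S by apply: contra jL => /(fintype.subsetP Sl).
rewrite cardsU1 jS add1n subSS; congr (_ * h _); apply/mnmP => x; mnm;
    rewrite !mnm_ofE !inE -addnA.
congr addn; rewrite (eq_sym j); case: eqP => [->|_] /=; last by rewrite mul0n addn0.
by rewrite (negbTE jS) mul1n.
Qed.

Lemma diffops_sum l (g : multinom n -> int) M (c : 'I_M -> multinom n) k :
  diffops l (fun k => \sum_t g (k + c t)%M) k = \sum_t diffops l g (k + c t)%M.
Proof.
rewrite /diffops; elim: l g => [//|j l IH g] /=; rewrite -IH.
congr (foldl _ _ l k); apply/funext => k'; rewrite /diffop -sumrB.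
by apply: eq_bigr => t _; rewrite -!addmA (addmC (c t)).
Qed.

Lemma diffops_ext (k0 : nat) l g h : (forall k, (forall j, (k0 <= k j)%N) -> g k = h k) ->
  forall k, (forall j, (k0 <= k j)%N) -> diffops l g k = diffops l h k.
Proof.
rewrite /diffops; elim: l g h => [//|j l IH g h gh] /= k kk; apply: IH => // k' kk'.
rewrite /diffop !gh// => i; mnm; apply: leq_trans (kk' i) _; exact: leq_addr.
Qed.

(** By the recursion a difference of step N of r_i in the direction i is a sum of N values of
    r_(i+1). After all n directions there are N^n values of r_n, each equal to D. *)
Lemma telescope (k0 : nat) (r : nat -> multinom n -> nat) D :
  (forall (i : 'I_n) k, (forall j, (k0 <= k j)%N) ->
      r i k = (r i.+1 k + r i (k - 'e_i)%M)%N) ->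
  (forall k, (forall j, (k0 <= k j)%N) -> r n k = D) ->
  forall k, (forall j, (k0 <= k j)%N) ->
  \sum_(S : {set 'I_n}) (-1) ^+ (n - #|S|) * (r 0%N (box_shift k S))%:Z = (D * N ^ n)%N%:Z.
Proof.
move=> rrec rD k kk.
suff h (i : nat) : (i <= n)%N -> forall k, (forall j, (k0 <= k j)%N) ->
    diffops (drop (n - i) (enum 'I_n)) (fun k => (r (n - i)%N k)%:Z) k = (D * N ^ i)%N%:Z.
  have := h n (leqnn n) k kk; rewrite subnn drop0 diffops_expand ?enum_uniq// => <-.
  rewrite size_enum_ord; apply: eq_bigl => S; apply/esym/fintype.subsetP => x _.
  by rewrite inE mem_enum.
elim: i => [_ k' kk'|i IH ni k' kk'].
  by rewrite subn0 drop_oversize ?size_enum_ord// /diffops /= rD// expn0 muln1.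
have ni' : (n - i.+1 < n)%N by lia.
pose a := Ordinal ni'.
have -> : drop (n - i.+1) (enum 'I_n) = a :: drop (n - i) (enum 'I_n).
  rewrite (drop_nth a) ?size_enum_ord//; congr cons; last by congr drop; lia.
  by apply: val_inj; rewrite /= nth_enum_ord.
rewrite -[LHS]/(diffops (drop (n - i) (enum 'I_n)) (diffop a (fun k =>
    (r (n - i.+1)%N k)%:Z)) k').
have ex k1 : (forall j, (k0 <= k1 j)%N) -> diffop a (fun k => (r (n - i.+1)%N k)%:Z) k1 =
   \sum_(t < N) (r (n - i)%N (k1 + 'e_a *+ t.+1)%M)%:Z.
  move=> kk1; rewrite /diffop; elim: (N) => [|N' IHN].
    by rewrite big_ord0 mulm0n addm0 subrr.
  rewrite big_ord_recr /= -IHN.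
  have := rrec a (k1 + 'e_a *+ N'.+1)%M; rewrite /=.
  have -> : (n - i.+1).+1 = (n - i)%N by lia.
  move=> ->; last by move=> j; mnm; apply: leq_trans (kk1 j) _; exact: leq_addr.
  rewrite mulmSr addmA addmK PoszD.
  set u := (r (n - i)%N _)%:Z; lia.
rewrite (diffops_ext (k0 := k0) _ ex)// (diffops_sum _ (fun k => (r (n - i)%N k)%:Z)).
rewrite (eq_bigr (fun=> (D * N ^ i)%N%:Z)).
  by rewrite sumr_const card_ord -mulr_natr natz -PoszM expnSr mulnA.
move=> t _; apply: IH; first exact: ltnW.
by move=> j; mnm; apply: leq_trans (kk' j) _; exact: leq_addr.
Qed.

End Telescope.

Section Packaged.
Variables (n q : nat) (blk : 'I_q -> 'I_n) (ex : 'I_q -> multinom n).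
Implicit Types (k x : multinom n) (i j : 'I_n).

Definition large (k0 : nat) k := forall j, (k0 <= k j)%N.

(** The exact codimension D: the upper bounds come from the degeneration, and [relations_lower]
    turns them into the matching lower bound. The same D is the n-th difference of the counting
    function. *)
Theorem module_generic p (gpt gdg : 'I_p -> multinom n) (Z : multinom n -> multinom n ->
    Prop) :
  (forall w k x, Z k x -> Z (k + wdg blk w)%M (x + wpt ex w)%M) ->
  (forall k x, Z k x -> lattice_module blk ex gpt gdg k x) ->
  exists (k0 D : nat) (cnt : multinom n -> nat),
  [/\ forall k, finite_of_size (fun x => lattice_module blk ex gpt gdg k x /\
      ~ Z k x) (cnt k),
      forall N k, large k0 k -> \sum_(S : {set 'I_n}) (-1) ^+ (n - #|S|) *
         (cnt (box_shift N k S))%:Z = (D * N ^ n)%N%:Z,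
      forall (K : fieldType) k, large k0 k -> polycond (fun c : 'I_q -> K =>
        codim_le (supported (lattice_module blk ex gpt gdg k)) (relations blk ex gpt gdg Z
            c n k) D /\
        codim_ge (supported (lattice_module blk ex gpt gdg k)) (relations blk ex gpt gdg Z
            c n k) D),
      forall k, large k0 k -> exists M (J : 'I_M -> 'I_n) (src tgt : 'I_M -> multinom n),
      [/\ (M + D)%N = cnt k,
      forall l, below blk ex gpt gdg (J l) k (src l),
      injective tgt, forall l, lattice_module blk ex gpt gdg k (tgt l) /\ ~ Z k (tgt l) &
      forall K : fieldType, \det (coef_mx blk ex J src tgt (fun a => mpolyX K 'e_a)) != 0] &
     (0 < D)%N -> exists al be : 'I_n -> 'I_q,
       (forall j, blk (al j) = j /\ blk (be j) = j) /\
       forall z : 'I_n -> int,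
         (forall i, \sum_j z j * ((ex (al j) i)%:Z - (ex (be j) i)%:Z) = 0) ->
         forall j, z j = 0].
Proof.
move=> Zadd ZX.
have [k0 [r [D [r0 rrec rdata rD Dpos]]]] := lattice_module_core gpt gdg Zadd.
exists k0.+1, D, (r 0%N); split => //.
- by move=> N k kk; apply: (telescope N rrec rD (k := k)) => j; exact: ltnW.
- move=> K k kk; have kk' : large k0 k by move=> j; exact: ltnW.
  have sp (i : nat) k' : polycond (fun c : 'I_q -> K => spans blk ex gpt gdg Z c r i k').
    have [M [J [src [tgt [MrN Js ti tY dM]]]]] := rdata i k'.
    apply: polycondW (coef_mx_polycond (dM K)) => c.
    exact: (relations_span (r0 k') MrN Js ti tY).
  (* The lower bound in degree k uses upper bounds only in degrees below k, which are finitely many,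
     so the condition on c is still given by one polynomial. *)
  have fin := polycond_fin (fun x : 'I_n * bmultinom n (mdeg k).+1 => sp x.1 (bmnm x.2)).
  apply: polycondW (polycondI (sp n k) fin) => c [h1 h2]; rewrite -(rD k)//; split => //.
  apply: (relations_lower Zadd ZX r0 rrec (leqnn n)) => // i' k' i'n k'k _.
  have dk : (mdeg k' < (mdeg k).+1)%N.
    by rewrite ltnS !mdegE; apply: leq_sum => j _; exact/mnm_lepP.
  exact: (h2 (Ordinal i'n, BMultinom dk)).
- move=> k kk; have [M [J [src [tgt [MrN Js ti tY dM]]]]] := rdata n k.
  exists M, J, src, tgt; split => //; first by rewrite -(rD k)// => j; exact: ltnW.
  by move=> l; have [] := Js l.
Qed.

End Packaged.

(** * Koszul syzygies and flatness of the pencil *)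

Section Koszul.
Variables (R : comNzRingType) (n : nat) (f : 'I_n -> R).
Implicit Types (S T : {set 'I_n}) (z w : {set 'I_n} -> R) (i j : 'I_n).

(** A function on subsets lists the coordinates of an element of the exterior algebra. Then [kdiff]
    is contraction with f, the Koszul differential, [kwedge h] is exterior multiplication by h, and
    [ksign] is the sign of inserting j in increasing order. *)
Definition ksign j S : R := (-1) ^+ #|[set i in S | (i < j)%N]%SET|.
Definition kdiff z S : R := \sum_(j | j \notin S) ksign j S * f j * z (j |: S)%SET.
Definition kwedge (h : 'I_n -> R) z S : R :=
  \sum_(j in S) ksign j (S :\ j)%SET * h j * z (S :\ j)%SET.

Lemma ksign_sq j S : ksign j S * ksign j S = 1.
Proof. by rewrite /ksign -exprD addnn -mul2n exprM sqrrN !expr1n. Qed.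

Lemma ksignU i j S : j \notin S -> ksign i (j |: S)%SET = (-1) ^+ (j < i)%N * ksign i S.
Proof.
move=> jS; rewrite /ksign -exprD; congr (_ ^+ _).
have [ji|ij] := boolP (j < i)%N.
  have -> : [set x in j |: S | (x < i)%N]%SET = (j |: [set x in S | (x < i)%N])%SET.
    by apply/setP => x; rewrite !inE; case: eqP => [->|]; rewrite ?ji.
  by rewrite cardsU1 inE (negbTE jS).
congr #|pred_of_set _|; apply/setP => x; rewrite !inE; case: eqP => [->|//].
by rewrite (negbTE ij) !andbF.
Qed.

Lemma sum_antisym (F : 'I_n -> 'I_n -> R) :
  (forall i j, F i j = - F j i) -> (forall i, F i i = 0) -> \sum_i \sum_j F i j = 0.
Proof.
move=> anti F0.
have sp i : \sum_j F i j = \sum_(j < n | (j < i)%N) F i j - \sum_(j < n | (i < j)%N) F j i.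
  rewrite (bigID (fun j : 'I_n => (j < i)%N)) /=; congr (_ + _).
  rewrite (bigD1 i) ?ltnn//= F0 add0r -sumrN; apply: eq_big => [j|j _]; last exact: anti.
  by rewrite -leqNgt ltn_neqAle eq_sym andbC.
under eq_bigr do rewrite sp.
rewrite sumrB; apply/eqP; rewrite subr_eq0; apply/eqP.
by rewrite (exchange_big_dep xpredT).
Qed.

Lemma kdiff2 z S : kdiff (kdiff z) S = 0.
Proof.
pose F i j := if (i \notin S) && (j \notin (i |: S)%SET) then
  ksign i S * f i * (ksign j (i |: S)%SET * f j * z (j |: (i |: S))%SET) else 0.
have -> : kdiff (kdiff z) S = \sum_i \sum_j F i j.
  rewrite /kdiff [LHS]big_mkcond; apply: eq_bigr => i _; rewrite /F.
  case: ifPn => iS /=; last by rewrite big1.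
  by rewrite mulr_sumr big_mkcond.
apply: sum_antisym => [i j|i]; last by rewrite /F !inE eqxx andbF.
rewrite /F !inE; case: (eqVneq i j) => [->|ij]; first by rewrite ?eqxx ?andbF ?oppr0.
rewrite /= andbC; case: ifP => [/andP[jS iS]|]; last by rewrite oppr0.
rewrite !ksignU// finset.setUCA.
have -> : (-1) ^+ (i < j)%N = - (-1) ^+ (j < i)%N :> R.
  have : (i != j :> nat) by []; case: ltngtP => //= _ _; by rewrite ?expr0 ?expr1 ?opprK.
by ring.
Qed.

(** The homotopy formula: multiplication by an element of the ideal of f is null-homotopic on the
    Koszul complex. *)
Lemma kdiff_wedge h z S :
  kdiff (kwedge h z) S + kwedge h (kdiff z) S = (\sum_j h j * f j) * z S.
Proof.
pose G i j := if (i \in S) && (j \notin S) then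
  ksign j (S :\ i)%SET * ksign i (S :\ i)%SET * f j * h i * z (j |: S :\ i)%SET else 0.
have e1 : kdiff (kwedge h z) S = \sum_(j | j \notin S) h j * f j * z S - \sum_i \sum_j G i
    j.
  rewrite exchange_big /= /kdiff [LHS]big_mkcond [X in X - _]big_mkcond -sumrB.
  apply: eq_bigr => j _; case: ifPn => jS; last first.
    by rewrite big1 ?subr0// => i _; rewrite /G (negbTE jS) andbF.
  rewrite /kwedge (bigD1 j) ?finset.setU11//= finset.setU1K// mulrDr; congr (_ + _).
    have := ksign_sq j S; set e := ksign j S => ee.
    by transitivity (e * e * (h j * f j * z S)); [ring|rewrite ee mul1r].
  rewrite mulr_sumr -sumrN [LHS]big_mkcond; apply: eq_bigr => i _.
  rewrite /G jS andbT !inE; case: (eqVneq i j) => [->|ij];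
      first by rewrite (negbTE jS) oppr0.
  rewrite andbT /=; case: ifP => [iS|]; last by rewrite oppr0.
  have jSi : j \notin (S :\ i)%SET by rewrite !inE negb_and jS orbT.
  have -> : ((j |: S) :\ i = j |: (S :\ i))%SET.
    by apply/setP => x; rewrite !inE; case: (eqVneq x j) => [->|];
        rewrite ?orbF// eq_sym ij.
  rewrite ksignU// -{1}(finset.setD1K iS) ksignU ?inE ?eqxx//.
  have -> : (-1) ^+ (i < j)%N = - (-1) ^+ (j < i)%N :> R.
    have : (i != j :> nat) by []; case: ltngtP => //= _ _; by rewrite ?expr0 ?expr1 ?opprK.
  have := sqrrN (1 : R); have : ((-1) ^+ (j < i)%N * (-1) ^+ (j < i)%N = 1 :> R).
    by case: (_ < _)%N; rewrite ?expr0 ?expr1 ?mulrNN mulr1.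
  set e := (-1) ^+ _ => ee _.
  rewrite -[RHS]mulr1 -ee; ring.
have e2 : kwedge h (kdiff z) S = \sum_(j in S) h j * f j * z S + \sum_i \sum_j G i j.
  rewrite /kwedge [LHS]big_mkcond [X in X + _]big_mkcond -big_split /=.
  apply: eq_bigr => i _; case: ifPn => iS; last first.
    by rewrite big1 ?addr0// => j _; rewrite /G (negbTE iS).
  rewrite /kdiff (bigD1 i) ?inE ?eqxx//= mulrDr finset.setD1K//; congr (_ + _).
    have := ksign_sq i (S :\ i)%SET; set e := ksign _ _ => ee.
    by transitivity ((e * e) * (h i * f i * z S)); [ring|rewrite ee mul1r].
  rewrite mulr_sumr [LHS]big_mkcond; apply: eq_bigr => j _.
  rewrite /G iS !inE negb_and negbK; case: (eqVneq j i) => [->|ji] /=.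
    by rewrite iS.
  by rewrite andbT; case: ifP => // jS; ring.
rewrite e1 e2 addrACA addNr addr0 mulr_suml.
rewrite [RHS](bigID (fun j => j \in S)) /= addrC; congr (_ + _).
Qed.

Lemma kdiffD z w S : kdiff (fun T => z T + w T) S = kdiff z S + kdiff w S.
Proof. by rewrite /kdiff -big_split; apply: eq_bigr => j _; rewrite mulrDr. Qed.

Lemma kdiffM a z S : kdiff (fun T => a * z T) S = a * kdiff z S.
Proof. by rewrite /kdiff mulr_sumr; apply: eq_bigr => j _; rewrite mulrCA. Qed.

Variables (Sig : R -> Prop) (I : nat -> R -> Prop) (x : nat -> R).
Hypothesis Sig1 : Sig 1.
Hypothesis SigM : forall a b, Sig a -> Sig b -> Sig (a * b).
Hypothesis I0 : forall i : nat, I i 0.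
Hypothesis ID : forall (i : nat) a b, I i a -> I i b -> I i (a + b).
Hypothesis IM : forall (i : nat) a b, I i b -> I i (a * b).
Hypothesis IS : forall (i : nat) v, I i.+1 v <-> exists u a, I i u /\ v = u + x i * a.
Hypothesis reg : forall (i : nat) v, (i < n)%N -> I i (x i * v) -> I i v.
Hypothesis xf : forall i : nat, (i < n)%N -> exists s (h : 'I_n ->
    R), Sig s /\ s * x i = \sum_j h j * f j.

Let Isum (i : nat) (T : Type) (r : seq T) (P : pred T) (F : T -> R) :
  (forall t, P t -> I i (F t)) -> I i (\sum_(t <- r | P t) F t).
Proof. by move=> h; apply: (big_ind (I i)) => //; exact: ID. Qed.

Let IN (i : nat) v : I i v -> I i (- v).
Proof. by move=> iv; rewrite -mulN1r; exact: IM. Qed.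

(** Depth sensitivity of Koszul homology: up to [Sig], the ideal of f contains the regular sequence
    x_0, ..., x_(n-1). In descending induction on i, a cycle z modulo I_i gives the cycle y = h
    wedge z modulo I_(i+1), since dy is s x_i z up to I_i. Applying d to a primitive of y shows that
    x_i times z is x_i times a boundary, up to [Sig] and I_i, and x_i is cancelled by regularity. *)
Lemma koszul_acyclic (i k : nat) z : (i <= n)%N -> (i < k)%N ->
  (forall S, #|S|.+1 = k -> I i (kdiff z S)) ->
  exists s w, Sig s /\ forall S, #|S| = k -> I i (s * z S - kdiff w S).
Proof.
move=> ni; have {ni} : exists2 d, (d + i)%N = n & true by exists (n - i)%N => //; lia.
move=> [d dn _]; elim: d i dn k z => [|d IH] i dn k z ik hz.
  exists 1, (fun=> 0); split => // S Sk; exfalso.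
  by have := max_card S; rewrite Sk card_ord; move: ik dn; rewrite add0n => ? ?; lia.
have ni : (i < n)%N by lia.
have [s [h [ss sx]]] := xf ni.
pose y := kwedge h z.
have hy S : #|S| = k -> I i (s * x i * z S - kdiff y S).
  move=> Sk; rewrite sx -kdiff_wedge addrAC subrr add0r; apply: Isum => j jS.
  by apply: IM; apply: hz; rewrite -Sk [in RHS](cardsD1 j) jS.
have di : (d + i.+1)%N = n by lia.
have [||s' [w' [ss' hw']]] := IH i.+1 di k.+1 y; first by lia.
  move=> S [Sk]; apply/IS; exists (- (s * x i * z S - kdiff y S)), (s * z S); split.
    exact/IN/hy.
  by rewrite opprB mulrA (mulrC (x i)) subrK.
have {hw'}/choice[ua hua] T : exists ua : R * R, #|T| = k.+1 ->
    I i ua.1 /\ s' * y T - kdiff w' T = ua.1 + x i * ua.2.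
  have [Tk|nTk] := pselect (#|T| = k.+1); last by exists (0, 0).
  by have [u [a [iu e]]] := (IS _ _).1 (hw' T Tk); exists (u, a).
exists (s' * s), (fun T => (ua T).2); split; first exact: SigM.
move=> S Sk; apply: (reg ni).
have -> : x i * (s' * s * z S - kdiff (fun T => (ua T).2) S) =
    s' * (s * x i * z S - kdiff y S) + kdiff (fun T => (ua T).1) S.
  have key : kdiff (fun T => s' * y T) S =
     kdiff (kdiff w') S + kdiff (fun T => (ua T).1) S + x i * kdiff (fun T => (ua T).2) S.
    rewrite -kdiffM -!kdiffD /kdiff; apply: eq_bigr => j jS; congr (_ * _).
    have [|_ e] := hua (j |: S)%SET; first by rewrite cardsU1 jS Sk.
    by rewrite -addrA -e addrC subrK.
  move: key; rewrite kdiffM kdiff2 add0r => key.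
  by rewrite !mulrBr key; ring.
apply: ID; first exact/IM/hy.
apply: Isum => j jS; apply: IM; have [|//] := hua (j |: S)%SET.
by rewrite cardsU1 jS Sk.
Qed.

Definition alternating (B : 'I_n -> 'I_n -> R) :=
  (forall i j, B i j = - B j i) /\ forall i, B i i = 0.

(** The acyclicity in degree 1 with I_0 = 0: a 2-chain is the same as an alternating matrix. *)
Lemma koszul_syzygies (v : 'I_n -> R) : (forall a, I 0 a -> a = 0) ->
  \sum_j f j * v j = 0 ->
  exists s B, [/\ Sig s, alternating B & forall j, s * v j = \sum_i f i * B i j].
Proof.
move=> I00 fv; pose z S := \sum_(j in S) v j.
have [|s [w [ss hw]]] := @koszul_acyclic 0 1 z (leq0n _) isT.
  move=> S [/eqP]; rewrite cards_eq0 => /eqP->; rewrite [kdiff _ _](_ : _ = 0)//.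
  rewrite -[RHS]fv /kdiff; apply: eq_big => j; first by rewrite finset.in_set0.
  move=> _; rewrite /z finset.setU0 big_set1 /ksign.
  by rewrite (_ : finset _ = finset.set0) ?cards0 ?expr0 ?mul1r//; apply/setP => y;
      rewrite !inE.
exists s, (fun i j => if i == j then 0 else ksign i [set j]%SET * w [set i; j]%SET);
    split => //.
  split=> [i j|i]; last by rewrite eqxx.
  rewrite (eq_sym j); case: eqVneq => [_|ij]; first by rewrite oppr0.
  rewrite (finset.setUC [set j]%SET) -mulNr; congr (_ * _).
  have k1 (i' j' : 'I_n) : ksign i' [set j']%SET = (-1) ^+ (j' < i')%N.
    have := ksignU i' (_ : j' \notin finset.set0); rewrite finset.setU0 => ->;
        last by rewrite finset.in_set0.
    rewrite /ksign (_ : finset _ = finset.set0) ?cards0 ?expr0 ?mulr1//.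
    by apply/setP => y; rewrite !inE.
  rewrite !k1; have : (i != j :> nat) by [].
  by case: ltngtP => //= _ _; rewrite ?expr0 ?expr1 ?opprK.
move=> j; have := hw [set j]%SET; rewrite cards1 => /(_ erefl)/I00/eqP.
rewrite subr_eq0 => /eqP; rewrite /z big_set1 => ->.
rewrite /kdiff [LHS]big_mkcond; apply: eq_bigr => i _; rewrite inE.
by case: eqVneq => _; rewrite ?mulr0//= mulrAC mulrA mulrC -mulrA mulrCA.
Qed.

End Koszul.

Section Flat.
Variables (R : idomainType) (n : nat) (f c : 'I_n -> R) (Sig : R -> Prop).
Hypothesis Sig1 : Sig 1.
Hypothesis SigM : forall a b, Sig a -> Sig b -> Sig (a * b).
Hypothesis syz : forall v : 'I_n -> R, \sum_j f j * v j = 0 ->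
  exists s B, [/\ Sig s, alternating B & forall j, s * v j = \sum_i f i * B i j].

(* Flatness at s = 0 holds since the syzygies of f are Koszul up to elements of
   [Sig], and Koszul syzygies lift to the pencil. *)
Definition pencil j : {poly R} := (f j)%:P + (c j)%:P * 'X.

(** The constant terms of h form a syzygy of f, which is Koszul up to an element s. Subtracting the
    Koszul syzygy of the pencil with the same matrix leaves coefficients divisible by the
    variable. *)
Lemma pencil_flat (y : {poly R}) (h : 'I_n -> {poly R}) :
  'X * y = \sum_j pencil j * h j ->
  exists s h', Sig s /\ s%:P * y = \sum_j pencil j * h' j.
Proof.
move=> e; pose v j := (h j)`_0.
have /syz[s [B [ss [anti B0] sv]]] : \sum_j f j * v j = 0.
  have := congr1 (fun p : {poly R} => p.[0]) e.
  rewrite hornerM hornerX mul0r horner_sum => e0; rewrite [RHS]e0; apply: eq_bigr => j _.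
  by rewrite hornerM hornerD hornerM !hornerC hornerX mulr0 addr0 horner_coef0.
have hE j : exists k, h j = (v j)%:P + 'X * k.
  have : root (h j - (v j)%:P) 0 by rewrite rootE hornerD hornerN hornerC horner_coef0
      subrr.
  by move=> /factor_theorem[k]; rewrite subr0 => hk; exists k;
      rewrite mulrC -hk addrC subrK.
have /choice[k hk] := hE.
exists s, (fun j => s%:P * k j - \sum_i (c i)%:P * (B i j)%:P); split => //.
apply: (mulfI (_ : 'X != 0)); first by rewrite polyX_eq0.
rewrite mulrCA e mulr_sumr.
(* The lifted Koszul syzygy: alternation of B makes it one for every family, in particular for the
   pencil. *)
have z0 : \sum_j pencil j * \sum_i pencil i * (B i j)%:P = 0.
  under eq_bigr do rewrite mulr_sumr.
  apply: sum_antisym => [i j|i]; last by rewrite B0 mulr0 mulr0.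
  by rewrite (anti j) polyCN; ring.
rewrite -[LHS]subr0 -[X in _ - X]z0 -sumrB mulr_sumr; apply: eq_bigr => j _.
rewrite hk; have -> : \sum_i pencil i * (B i j)%:P = (s * v j)%:P +
    'X * \sum_i (c i)%:P * (B i j)%:P.
  rewrite sv rmorph_sum mulr_sumr -big_split; apply: eq_bigr => i _ /=.
  by rewrite /pencil polyCM; ring.
by rewrite polyCM; ring.
Qed.

Lemma pencil_flatn e (y : {poly R}) (h : 'I_n -> {poly R}) :
  'X^e * y = \sum_j pencil j * h j ->
  exists s, Sig s /\ exists h' : 'I_n -> R, s * y.[0] = \sum_j f j * h' j.
Proof.
elim: e y h => [|e IH] y h.
  rewrite expr0 mul1r => yE; exists 1; split => //; exists (fun j => (h j).[0]).
  rewrite mul1r yE horner_sum; apply: eq_bigr => j _.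
  by rewrite hornerM hornerD hornerM !hornerC hornerX mulr0 addr0.
rewrite exprS -mulrA => /pencil_flat[s [h' [ss]]]; rewrite mulrCA => /IH.
move=> [s' [ss' [h2 e2]]]; exists (s' * s); split; first exact: SigM.
by exists h2; rewrite -e2 hornerM hornerC mulrA.
Qed.

End Flat.

(** * One polynomial in each coordinate: a regular sequence *)

Section Univariate.
Variables (K : fieldType) (n : nat).
Local Notation P := (mpoly n K).
Implicit Types (u v : P) (m s : multinom n) (i j : 'I_n) (p w : {poly K}).

Lemma mcoeffXM s v m : mcoeff m (mpolyX K s * v) = if (s <= m)%M then mcoeff (m - s)%M v
    else 0.
Proof.
rewrite mulrC; case: ifPn => [sm|nsm]; first by rewrite -{1}(submK sm) addmC mcoeffMX.
apply/eqP/negPn; apply: contra nsm;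
    rewrite -mcoeff_msupp => /msuppM_le /allpairsP[[a b] /= [_ bs ->]].
by move: bs; rewrite msuppX inE => /eqP->; exact: lem_addl.
Qed.

Definition uni i p : P := (map_poly (mpolyC n (R:=K)) p).[mpolyX K 'e_i].

Lemma uniE i p : uni i p = \sum_(d < size p) p`_d *: mpolyX K ('e_i *+ d)%M.
Proof.
rewrite /uni horner_coef size_map_inj_poly ?mpolyC0//; last exact: can_inj (@mpolyCK _ _).
by apply: eq_bigr => d _; rewrite coef_map /= mul_mpolyC mpolyXn.
Qed.

Lemma uniM i p w : uni i (p * w) = uni i p * uni i w.
Proof. by rewrite /uni rmorphM hornerM. Qed.

Lemma uniD i p w : uni i (p + w) = uni i p + uni i w.
Proof. by rewrite /uni rmorphD hornerD. Qed.

Lemma uniXn i d : uni i 'X^d = mpolyX K ('e_i *+ d)%M.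
Proof. by rewrite /uni map_polyXn hornerXn mpolyXn. Qed.

Lemma uniC i a : uni i a%:P = mpolyC n a.
Proof. by rewrite /uni map_polyC hornerC. Qed.

(** The coefficient of x_i^t when v is expanded in powers of x_i, as a polynomial in the other
    variables. *)
Definition strip i (t : nat) v : P :=
  \sum_(m <- msupp v | m i == t) mcoeff m v *: mpolyX K (m - 'e_i *+ t)%M.

Lemma mcoeff_strip i (t : nat) v m :
  mcoeff m (strip i t v) = if m i == 0%N then mcoeff (m + 'e_i *+ t)%M v else 0.
Proof.
rewrite /strip raddf_sum /=; under eq_bigr do rewrite mcoeffZ mcoeffX.
case: ifPn => [/eqP mi|mi]; last first.
  rewrite big1// => m' /eqP m't; case: eqP => [E|]; last by rewrite mulr0.
  by move: mi; rewrite -E; mnm; rewrite eqxx mul1n m't subnn.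
have [ms|ms] := boolP ((m + 'e_i *+ t)%M \in msupp v); last first.
  rewrite (memN_msupp_eq0 ms) big_seq_cond big1// => m' /andP[m's /eqP m't].
  case: eqP => [E|]; last by rewrite mulr0.
  have : (m + 'e_i *+ t)%M = m'.
    rewrite -E submK//; apply/mnm_lepP => j; mnm; case: eqP => [<-|_] //.
    by rewrite mul1n m't.
  by move=> E'; rewrite E' m's in ms.
rewrite big_mkcond (bigD1_seq (m + 'e_i *+ t)%M) ?msupp_uniq//=.
have -> : (m + 'e_i *+ t)%M i == t by mnm; rewrite eqxx mi mul1n.
rewrite addmK eqxx mulr1 big1 ?addr0// => m' ne.
case: eqP => // m't; case: eqP => [E|]; last by rewrite mulr0.
case/eqP: ne; rewrite -E submK//; apply/mnm_lepP => j; mnm; case: eqP => [<-|_] //.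
by rewrite mul1n m't.
Qed.

Lemma strip_is_linear i t : linear (strip i t).
Proof.
move=> a u v; apply/mpolyP => m; rewrite mcoeffD mcoeffZ !mcoeff_strip.
by case: ifP => _; rewrite ?mulr0 ?addr0 // mcoeffD mcoeffZ.
Qed.

HB.instance Definition _ i t :=
    GRing.isLinear.Build K P P _ (strip i t) (strip_is_linear i t).

Lemma strip_mulX i t j d v : i != j ->
  strip i t (mpolyX K ('e_j *+ d)%M * v) = mpolyX K ('e_j *+ d)%M * strip i t v.
Proof.
move=> ij; apply/mpolyP => m; rewrite mcoeff_strip !mcoeffXM mcoeff_strip.
have -> : ('e_j *+ d <= m + 'e_i *+ t)%M = ('e_j *+ d <= m)%M.
  apply/mnm_lepP/mnm_lepP => h l; have := h l; mnm; case: (eqVneq j l) => [<-|//].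
    by rewrite (negbTE ij) mul0n addn0.
  by rewrite (negbTE ij) mul0n addn0.
have -> : ((m - 'e_j *+ d)%M i == 0%N) = (m i == 0%N).
  by mnm; move: ij; rewrite eq_sym => /negbTE ->; rewrite mul0n subn0.
case: ifP => mi; last by rewrite if_same.
case: ifP => // dm.
by congr mcoeff; apply/mnmP => l; have /mnm_lepP/(_ l) := dm; mnm; lia.
Qed.

Lemma strip_mulXi i t d v :
  strip i t (mpolyX K ('e_i *+ d)%M * v) = if (d <= t)%N then strip i (t - d)%N v else 0.
Proof.
apply/mpolyP => m; rewrite mcoeff_strip mcoeffXM.
case: (boolP (m i == 0%N)) => [/eqP mi|mi]; last first.
  by case: ifP => _; rewrite ?mcoeff0// mcoeff_strip (negbTE mi).
have -> : ('e_i *+ d <= m + 'e_i *+ t)%M = (d <= t)%N.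
  apply/mnm_lepP/idP => [/(_ i)|dt l]; mnm; first by rewrite eqxx mi !mul1n.
  case: (eqVneq i l) => [<-|_]; last by rewrite mul0n.
  by rewrite !mul1n (leq_trans dt)// leq_addl.
case: ifP => dt; last by rewrite mcoeff0.
rewrite mcoeff_strip mi eqxx; congr mcoeff; apply/mnmP => l; mnm.
by case: (i == l); lia.
Qed.

Lemma strip_uni i t j p v : i != j -> strip i t (uni j p * v) = uni j p * strip i t v.
Proof.
move=> ij; rewrite uniE !mulr_suml linear_sum; apply: eq_bigr => d _.
by rewrite -!scalerAl linearZ /= strip_mulX.
Qed.

Lemma strip_unii i t p v :
  strip i t (uni i p * v) = \sum_(d < size p | (d <= t)%N) p`_d *: strip i (t - d)%N v.
Proof.
rewrite uniE mulr_suml linear_sum [RHS]big_mkcond; apply: eq_bigr => d _ /=.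
by rewrite -scalerAl linearZ /= strip_mulXi; case: ifP => //; rewrite scaler0.
Qed.

Lemma strip_sum i v : v = \sum_(t < msize v) strip i t v * mpolyX K ('e_i *+ t)%M.
Proof.
apply/mpolyP => m; rewrite raddf_sum /=.
under eq_bigr do rewrite mulrC mcoeffXM mcoeff_strip.
have z (t : nat) : (if ('e_i *+ t <= m)%M then if (m - 'e_i *+ t)%M i == 0%N then
    mcoeff (m - 'e_i *+ t +
        'e_i *+ t)%M v else 0 else 0) = if t == m i then mcoeff m v else 0.
  have -> : ('e_i *+ t <= m)%M = (t <= m i)%N.
    apply/mnm_lepP/idP => [/(_ i)|dt l]; mnm; first by rewrite eqxx mul1n.
    by case: (eqVneq i l) => [<-|_]; rewrite ?mul0n ?mul1n.
  mnm; rewrite eqxx mul1n subn_eq0; case: (ltngtP t (m i)) => //= tm.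
  congr mcoeff; apply/mnmP => l; mnm; rewrite tm.
  by case: (eqVneq i l) => [<-|_]; rewrite ?mul0n ?mul1n; lia.
under eq_bigr do rewrite z.
have [ms|ms] := boolP (m \in msupp v); last first.
  by rewrite (memN_msupp_eq0 ms) big1// => t _; rewrite if_same.
have mlt : (m i < msize v)%N.
  by apply: leq_ltn_trans (msize_mdeg_lt ms); exact: mdeg_ge.
rewrite (bigD1 (Ordinal mlt)) //= eqxx big1 ?addr0// => t /negbTE tm.
by rewrite -val_eqE /= in tm; rewrite tm.
Qed.

Variable w : 'I_n -> {poly K}.
Hypothesis w0 : forall i, w i != 0.

Definition uni_nth (l : nat) : P := if insub l is Some i then uni i (w i) else 0.

Fixpoint uni_ideal (l : nat) v : Prop := match l with
  | 0 => v = 0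
  | l'.+1 => exists u a, uni_ideal l' u /\ v = u + uni_nth l' * a
  end.

Lemma uni_ideal0 l : uni_ideal l 0.
Proof. by elim: l => //= l IH; exists 0, 0; rewrite mulr0 addr0. Qed.

Lemma uni_idealD l u v : uni_ideal l u -> uni_ideal l v -> uni_ideal l (u + v).
Proof.
elim: l u v => [u v -> ->|l IH u v] /=; first by rewrite addr0.
move=> [u1 [a1 [h1 ->]]] [u2 [a2 [h2 ->]]]; exists (u1 + u2), (a1 + a2).
by split; [exact: IH|rewrite mulrDr addrACA].
Qed.

Lemma uni_idealM l u v : uni_ideal l v -> uni_ideal l (u * v).
Proof.
elim: l u v => [u v ->|l IH u v] /=; first by rewrite mulr0.
move=> [v1 [a [h ->]]]; exists (u * v1), (u * a).
by split; [exact: IH|rewrite mulrDr mulrCA].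
Qed.

Lemma uni_ideal_sum l (T : Type) (r : seq T) (Q : pred T) (F : T -> P) :
  (forall t, Q t -> uni_ideal l (F t)) -> uni_ideal l (\sum_(t <- r | Q t) F t).
Proof.
by move=> h; apply: (big_ind (uni_ideal l)) => //; [exact: uni_ideal0|exact: uni_idealD].
Qed.

Lemma uni_idealZ l a v : uni_ideal l v -> uni_ideal l (a *: v).
Proof. by move=> h; rewrite -mul_mpolyC; exact: uni_idealM. Qed.

Lemma uni_ideal_strip (l : nat) i t v : (l <= i)%N -> uni_ideal l v ->
    uni_ideal l (strip i t v).
Proof.
elim: l v => [v _ ->|l IH v li] /=; first by rewrite linear0.
move=> [u [a [hu ->]]]; exists (strip i t u), (strip i t a); split.
  by apply: IH => //; exact: ltnW.
rewrite linearD; congr (_ + _); rewrite /uni_nth; case: insubP => [j _ jl|]; last first.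
  by rewrite mul0r linear0 mul0r.
by rewrite /= strip_uni//; apply: contraTneq li => ->; rewrite -jl ltnn.
Qed.

(** The earlier generators do not involve x_l, so membership may be tested on coefficients of powers
    of x_l. With p = w_l of degree d, the coefficient of x_l^(t+d) in the product is p_d times that
    of x_l^t in v plus contributions of higher coefficients of v, which gives a downward induction
    on t. *)
Lemma uni_ideal_regular (l : nat) v : (l < n)%N -> uni_ideal l (uni_nth l * v) ->
    uni_ideal l v.
Proof.
move=> ln; pose i := Ordinal ln.
have -> : uni_nth l = uni i (w i) by rewrite /uni_nth insubT.
move=> h; pose p := w i; pose d := (size p).-1.
have sp : size p = d.+1 by rewrite prednK// size_poly_gt0 w0.
have pd : p`_d != 0 by rewrite -lead_coefE lead_coef_eq0 w0.
rewrite (strip_sum i v); apply: uni_ideal_sum => t _; rewrite mulrC; apply: uni_idealM.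
move: {t}(t : nat) => t.
have [r] := ubnP (msize v - t)%N; elim: r t => // r IH t tr.
have [vt|tv] := leqP (msize v) t.
  have -> : strip i t v = 0.
    rewrite /strip big_seq_cond big1// => m /andP[/msize_mdeg_lt mv /eqP mt].
    by have := mdeg_ge m i; rewrite mt; lia.
  exact: uni_ideal0.
have := uni_ideal_strip (t + d) (leqnn l : (l <= i)%N) h.
rewrite strip_unii -/p.
have dp : (d < size p)%N by rewrite sp.
rewrite (bigD1 (Ordinal dp)) /=; last by rewrite leq_addl.
rewrite addnK => hd.
have : uni_ideal l (p`_d *: strip i t v).
  have := uni_idealD hd (uni_idealZ (-1) (@uni_ideal_sum l _ (index_enum _)
    (fun e : 'I_(size p) => (e <= t + d)%N && (e != Ordinal dp))
    (fun e : 'I_(size p) => p`_e *: strip i (t + d - e)%N v) _)).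
  rewrite scaleN1r addrK; apply => e /andP[et ne]; apply: uni_idealZ; apply: IH.
  have ed : (e < d)%N.
    rewrite ltn_neqAle -val_eqE /= in ne *; rewrite ne /=.
    by have := ltn_ord e; rewrite [X in (_ < X)%N]sp.
  by lia.
by move=> /(uni_idealZ (p`_d)^-1); rewrite scalerA mulVf// scale1r.
Qed.

End Univariate.

Section LocalIdeals.
Variables (K : fieldType) (n : nat).
Local Notation P := (mpoly n K).
Implicit Types (u v s : P) (m : multinom n) (i j : 'I_n) (p : {poly K}) (w : 'I_n ->
    {poly K}) (f : 'I_n -> P).

Definition ideal_mem f v := exists h : 'I_n -> P, v = \sum_j f j * h j.

(** The contraction to K[x] of the ideal generated by f in the localization at [Sig]. The choice
    [unit_at0] gives the local ring at the origin, the choice [monomial] the torus. *)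
Definition loc (Sig : P -> Prop) f v := exists s, Sig s /\ ideal_mem f (s * v).

Definition unit_at0 s := mcoeff 0%M (s : P) != 0.
Definition monomial (s : P) := exists m, s = mpolyX K m.

Definition mult_set (Sig : P -> Prop) := Sig 1 /\ forall a b, Sig a -> Sig b -> Sig (a * b).

Lemma unit_at0_mult : mult_set unit_at0.
Proof.
split; first by rewrite /unit_at0 mcoeff1 eqxx oner_neq0.
have e u : mcoeff 0%M u = meval (fun=> 0) u.
  rewrite mevalE; have [us|us] := boolP (0%M \in msupp u).
    rewrite (bigD1_seq 0%M) ?msupp_uniq//= big1 ?mulr1 => [|i _];
        last by rewrite mnm0E expr0.
    rewrite big1 ?addr0// => m m0; have [i mi] : exists i, m i != 0%N.
      apply: contrapT => h; move/eqP: m0; apply; apply/mnmP => i; rewrite mnm0E.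
      by apply/eqP/negPn/negP => mi; apply: h; exists i.
    by rewrite (bigD1 i) //= expr0n (negbTE mi) mul0r mulr0.
  rewrite (memN_msupp_eq0 us) big_seq big1// => m ms.
  have [i mi] : exists i, m i != 0%N.
    apply: contrapT => h; have m0 : m = 0%M.
      by apply/mnmP => i; rewrite mnm0E; apply/eqP/negPn/negP => mi; apply: h; exists i.
    by rewrite -m0 ms in us.
  by rewrite (bigD1 i) //= expr0n (negbTE mi) mul0r mulr0.
by move=> a b; rewrite /unit_at0 !e mevalM => a0 b0; rewrite mulf_neq0.
Qed.

Lemma monomial_mult : mult_set monomial.
Proof.
split; first by exists 0%M; rewrite mpolyX0.
by move=> _ _ [a ->] [b ->]; exists (a + b)%M; rewrite mpolyXD.
Qed.

Lemma ideal_memD f u v : ideal_mem f u -> ideal_mem f v -> ideal_mem f (u + v).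
Proof.
move=> [h ->] [h' ->]; exists (fun j => h j + h' j).
by rewrite -big_split; apply: eq_bigr => j _; rewrite mulrDr.
Qed.

Lemma ideal_memM f u v : ideal_mem f v -> ideal_mem f (u * v).
Proof.
move=> [h ->]; exists (fun j => u * h j); rewrite mulr_sumr.
by apply: eq_bigr => j _; rewrite mulrCA.
Qed.

Lemma ideal_mem_gen f j : ideal_mem f (f j).
Proof.
exists (fun i => (i == j)%:R); rewrite (bigD1 j) //= eqxx mulr1 big1 ?addr0//.
by move=> i /negbTE ->; rewrite mulr0.
Qed.

Lemma ideal_mem0 f : ideal_mem f 0.
Proof. by exists (fun=> 0); rewrite big1// => j _; rewrite mulr0. Qed.

Lemma ideal_loc Sig f v : mult_set Sig -> ideal_mem f v -> loc Sig f v.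
Proof. by move=> [S1 _] fv; exists 1; rewrite mul1r. Qed.

Lemma locM Sig f u v : loc Sig f v -> loc Sig f (u * v).
Proof. by move=> [s [ss sv]]; exists s; split => //; rewrite mulrCA; exact: ideal_memM. Qed.

Lemma loc_unit Sig f s v : mult_set Sig -> Sig s -> loc Sig f (s * v) -> loc Sig f v.
Proof.
move=> [_ SM] ss [t [st tv]]; exists (t * s); split; first exact: SM.
by rewrite -mulrA.
Qed.

Lemma locD Sig f u v : mult_set Sig -> loc Sig f u -> loc Sig f v -> loc Sig f (u + v).
Proof.
move=> [_ SM] [s [ss su]] [t [st tv]]; exists (t * s); split; first exact: SM.
rewrite mulrDr -mulrA; apply: ideal_memD; first exact: ideal_memM.
by rewrite (mulrC t) -mulrA; exact: ideal_memM.
Qed.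

Lemma loc_subspace Sig f : mult_set Sig -> subspace (loc Sig f).
Proof.
move=> mS; split; first by exists 1; split; [exact: mS.1|rewrite mul1r; exact: ideal_mem0].
by move=> a u v lu lv; apply: locD => //; rewrite -mul_mpolyC; exact: locM.
Qed.

(** A nonzero polynomial in each coordinate expresses that the quotient is finite dimensional; these
    polynomials are the regular sequence for the Koszul argument. *)
Lemma loc_syzygies Sig f w : mult_set Sig -> (forall i, w i != 0) ->
  (forall i, loc Sig f (uni i (w i))) -> forall v : 'I_n -> P, \sum_j f j * v j = 0 ->
  exists s B, [/\ Sig s, alternating B & forall j, s * v j = \sum_i f i * B i j].
Proof.
move=> [S1 SM] w0 lw v.
apply: (@koszul_syzygies _ _ f Sig (uni_ideal w) (uni_nth w)) => //.
- exact: uni_ideal0.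
- by move=> l a b; exact: uni_idealD.
- by move=> l a b; exact: uni_idealM.
- exact: uni_ideal_regular.
- move=> l ln; have [s [ss [h e]]] := lw (Ordinal ln); exists s, h; split => //.
  rewrite /uni_nth insubT e; by apply: eq_bigr => j _; rewrite mulrC.
Qed.

(** If all coefficients are divisible by the d-th power of the variable, flatness allows cancelling
    it in both localizations; the value at 0 of the cancelled combination lies in both local ideals,
    so all its coefficients vanish and divisibility improves to d + 1. *)
Lemma pencil_independent f (c0 : 'I_n -> K) w0 wT N (eta : 'I_N -> P) :
  (forall i, w0 i != 0) -> (forall i, loc unit_at0 f (uni i (w0 i))) ->
  (forall i, wT i != 0) -> (forall i, loc monomial f (uni i (wT i))) ->
  (forall th : 'I_N -> K, loc unit_at0 f (\sum_i th i *: eta i) ->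
     loc monomial f (\sum_i th i *: eta i) -> forall i : 'I_N, th i = 0) ->
  forall (th : 'I_N -> {poly K}) (h : 'I_n -> {poly P}),
  \sum_i map_poly (mpolyC n (R:=K)) (th i) * (eta i)%:P =
    \sum_j pencil f (fun j => mpolyC n (c0 j)) j * h j ->
  forall i : 'I_N, th i = 0.
Proof.
move=> w00 lw0 wT0 lwT ind th h e.
have div d : forall i : 'I_N, exists t, th i = 'X^d * t.
  elim: d => [i|d IH]; first by exists (th i); rewrite expr0 mul1r.
  have [t tE] := choice IH.
  pose y : {poly P} := \sum_i map_poly (mpolyC n (R:=K)) (t i) * (eta i)%:P.
  have ye : 'X^d * y = \sum_j pencil f (fun j => mpolyC n (c0 j)) j * h j.
    rewrite -e /y mulr_sumr; apply: eq_bigr => i _.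
    by rewrite tE rmorphM /= map_polyXn mulrA.
  have y0 : y.[0] = \sum_i (t i)`_0 *: eta i.
    rewrite /y horner_sum; apply: eq_bigr => i _.
    by rewrite hornerM hornerC horner_coef0 coef_map /= mul_mpolyC.
  have loc_of Sig w : mult_set Sig -> (forall i, w i != 0) ->
      (forall i, loc Sig f (uni i (w i))) -> loc Sig f (\sum_i (t i)`_0 *: eta i).
    move=> mS wn lw; have [S1 SM] := mS.
    have [s [ss [h' e']]] := pencil_flatn S1 SM (loc_syzygies mS wn lw) ye.
    by exists s; split => //; exists h'; rewrite -y0.
  have t0 := ind _ (loc_of _ _ unit_at0_mult w00 lw0) (loc_of _ _ monomial_mult wT0 lwT).
  move=> i; have : root (t i) 0 by rewrite rootE horner_coef0 t0.
  move=> /factor_theorem[k]; rewrite subr0 => tk; exists k.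
  by rewrite tE tk exprSr -mulrA (mulrC 'X).
move=> i; apply/eqP/negPn/negP => thi; have [t tE] := div (size (th i)) i.
have t0 : t != 0 by apply: contra_neq thi => t0; rewrite tE t0 mulr0.
have := congr1 (fun p : {poly K} => size p) tE.
rewrite mulrC size_mulXn//; have := size_poly_gt0 t; rewrite t0; lia.
Qed.

End LocalIdeals.

(** * Counting along the pencil *)

Section PencilCount.
Variables (K : fieldType) (n : nat).
Local Notation P := (mpoly n K).
Variables (f : 'I_n -> P) (c0 : 'I_n -> K) (N : nat) (eta : 'I_N -> P).
Variables (V : seq (multinom n)) (M : nat) (J : 'I_M -> 'I_n) (src tgt : 'I_M ->
    multinom n).
Hypothesis uV : uniq V.
Hypothesis etaV : forall i, supported (fun m => m \in V) (eta i).
Hypothesis srcV : forall l, src l \in V.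
Hypothesis rowV : forall l, supported (fun m => m \in V) (f (J l) * mpolyX K (src l)).
Hypothesis tgtV : forall l, tgt l \in V.
Hypothesis dM : \det (\matrix_(l, l') mcoeff (tgt l')
   (f (J l) * mpolyX K (src l) + c0 (J l) *: mpolyX K (src l))) != 0.
Hypothesis ind : forall (th : 'I_N -> {poly K}) (h : 'I_n -> {poly P}),
  \sum_i map_poly (mpolyC n (R:=K)) (th i) * (eta i)%:P =
    \sum_j pencil f (fun j => mpolyC n (c0 j)) j * h j -> forall i, th i = 0.

Let row l m : {poly K} := (mcoeff m (f (J l) * mpolyX K (src l)))%:P +
   (c0 (J l) * mcoeff m (mpolyX K (src l)))%:P * 'X.

(** The M rows of the pencil and the N elements [eta] are independent over K[s] inside the free
    module on V: a relation has no [eta] part by [ind], and the rows are independent because their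
    determinant does not vanish at s = 1. *)
Lemma pencil_count : (M + N <= size V)%N.
Proof.
rewrite leqNgt; apply/negP => VMN.
(* If V were too small, padding with zero columns would give a singular square matrix, hence a
   kernel vector with entries in K[s]. *)
pose Q : 'M[{poly K}]_(M + N) := \matrix_(r, s) if (s < size V)%N then
  match fintype.split r with inl l => row l (nth 0%M V s)
  | inr i => (mcoeff (nth 0%M V s) (eta i))%:P end else 0.
have dQ : \det Q = 0.
  rewrite -det_tr; apply/eqP/det0P; exists (delta_mx 0 (Ordinal VMN)).
    apply/eqP => /rowP/(_ (Ordinal VMN)); rewrite !mxE !eqxx /=.
    by apply/eqP; rewrite oner_neq0.
  by rewrite -rowE; apply/rowP => s; rewrite !mxE /= ltnn.
move/eqP/det0P: dQ => [v v0 vQ].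
pose al l := v 0 (lshift N l); pose th i := v 0 (rshift M i).
have rel m : m \in V -> \sum_l al l * row l m + \sum_i th i * (mcoeff m (eta i))%:P = 0.
  move=> mV; have sV : (index m V < M + N)%N.
    by apply: leq_ltn_trans VMN; rewrite index_size.
  move/rowP: vQ => /(_ (Ordinal sV)); rewrite !mxE big_split_ord /= => e.
  rewrite -[RHS]e; congr (_ + _); apply: eq_bigr => l _;
      rewrite !mxE /= index_mem mV nth_index//.
    by rewrite -[lshift _ _]/(unsplit (inl l)) unsplitK.
  by rewrite -[rshift _ _]/(unsplit (inr l)) unsplitK.
pose emb := map_poly (mpolyC n (R:=K)).
pose h j : {poly P} := - \sum_(l | J l == j) emb (al l) * (mpolyX K (src l))%:P.
have coefE (a : {poly K}) (A B : P) d m : mcoeff m ((emb a * (A%:P + B%:P * 'X))`_d) =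
   (a * ((mcoeff m A)%:P + (mcoeff m B)%:P * 'X))`_d.
  rewrite !mulrDr !mulrA !coefD mcoeffD !coefMC !coefMX !coefMC coef_map /= mcoeffCM.
  by case: ifP => _; rewrite ?mcoeff0// coef_map /= mcoeffCM.
have th0 : forall i, th i = 0.
  apply: (ind (h := h)).
  have -> : \sum_j pencil f (fun j => mpolyC n (c0 j)) j * h j = - \sum_l emb (al l) *
     ((f (J l) * mpolyX K (src l))%:P + (c0 (J l) *: mpolyX K (src l))%:P * 'X).
    under eq_bigr do rewrite /h mulrN mulr_sumr.
    rewrite sumrN (exchange_big_dep xpredT)//=; congr (- _); apply: eq_bigr => l _.
    rewrite (big_pred1 (J l)) => [|j]; last by rewrite /= eq_sym.
    by rewrite /pencil -mul_mpolyC !polyCM; ring.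
  apply/eqP; rewrite -addr_eq0; apply/eqP/polyP => d; apply/mpolyP => m.
  rewrite coef0 mcoeff0 coefD !coef_sum mcoeffD !raddf_sum /=.
  under eq_bigr do rewrite -[X in _ * X]addr0 -(mul0r 'X) -(polyC0 P) coefE mcoeff0 polyC0
      mul0r addr0.
  under [X in _ + X]eq_bigr do rewrite coefE.
  have [mV|mV] := boolP (m \in V).
    rewrite -!coef_sum -coefD -[RHS](coef0 _ d).
    transitivity ((\sum_l al l * row l m + \sum_i th i * (mcoeff m (eta i))%:P)`_d);
        last by rewrite rel.
    rewrite [in RHS]addrC !coefD !coef_sum; congr (_ + _).
    by apply: eq_bigr => l _; rewrite /row mcoeffZ.
  have z (u : P) : supported (fun m => m \in V) u -> mcoeff m u = 0.
    by move=> hu; apply/eqP/negPn; apply: contra mV => /hu.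
  rewrite big1 => [|i _]; last by rewrite (@z _ (@etaV i))// polyC0 mulr0 coef0.
  rewrite big1 ?addr0// => l _; rewrite mcoeffZ (@z _ (@rowV l)) (@z (mpolyX K (src l))).
    by rewrite mulr0 polyC0 mul0r addr0 mulr0 coef0.
  exact: supportedX.
have al0 l : al l = 0.
  pose T : 'M[{poly K}]_M := \matrix_(l, l') row l (tgt l').
  have dT : \det T != 0.
    (* At s = 1 the pencil is f_j + c_j, the system with constant terms for which the minor is known
       to be nonsingular. *)
    apply: contraNneq dM => d0; have := congr1 (horner_eval 1) d0.
    rewrite rmorph0 -det_map_mx => <-; apply/eqP; congr (\det _); apply/matrixP => i i'.
    by rewrite !mxE -[RHS]/((row i (tgt i')).[1]) /row hornerD hornerM !hornerC hornerX
        mulr1 mcoeffD mcoeffZ.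
  have : (\row_l al l) *m T = 0.
    apply/rowP => l'; rewrite !mxE; have := rel _ (tgtV l').
    under [X in _ + X]eq_bigr do rewrite th0 mul0r.
    by rewrite big1_eq addr0 => e; rewrite -[RHS]e; apply: eq_bigr => i _; rewrite !mxE.
  move=> aT; apply/eqP/negPn/negP => al_n; move/negP: dT; apply; apply/det0P.
  exists (\row_l al l) => //; apply: contraNneq al_n => /rowP/(_ l).
  by rewrite !mxE => ->.
move/eqP: v0; apply; apply/rowP => r; rewrite mxE; case: (split_ordP r) => i ->.
  exact: al0.
exact: th0.
Qed.

End PencilCount.

(** * Modules generated by the lattice points of a cube *)

Section Box.
Variables (n q : nat) (blk : 'I_q -> 'I_n) (ex : 'I_q -> multinom n) (b : nat).
Implicit Types (k x : multinom n) (i j : 'I_n) (a : 'I_q).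

(** The generators are all points of the cube of side b, placed in degree 0; a large b absorbs
    rounding errors and remainders modulo the lattices that occur. *)
Definition box_gens (l : 'I_#|{: {ffun 'I_n -> 'I_b.+1}}|) : multinom n :=
  mnm_of (fun i => enum_val l i).
Definition box_module := lattice_module blk ex box_gens (fun=> 0%M).

Lemma box_moduleP k x : box_module k x <-> exists (u : multinom q) (y : multinom n),
  [/\ wdg blk u = k, forall i, (y i <= b)%N & x = (y + wpt ex u)%M].
Proof.
split=> [[[l u] <- <-]|[u [y [<- yb ->]]]].
  exists u, (box_gens l); split; rewrite /dg /= ?add0m// => i.
  by rewrite mnm_ofE -ltnS ltn_ord.
exists (enum_rank [ffun i => inord (y i) : 'I_b.+1], u); first by rewrite /dg add0m.
rewrite /pt /=; congr mnm_add; apply/mnmP => i.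
by rewrite mnm_ofE enum_rankK ffunE inordK// ltnS.
Qed.

Definition divisible_by a k x := exists k' x',
  [/\ (k' + 'e_(blk a))%M = k, (x' + ex a)%M = x & box_module k' x'].

(** The clause on [divisible_by] says that generic f together with x^(ex a) generate X in large
    degrees. It results from applying [module_generic] with Z the multiples of x^(ex a). *)
Lemma box_generic : exists (k0 D : nat) (cnt : multinom n -> nat),
  [/\ forall k, finite_of_size (box_module k) (cnt k),
      forall N k, large k0 k -> \sum_(S : {set 'I_n}) (-1) ^+ (n - #|S|) *
         (cnt (box_shift N k S))%:Z = (D * N ^ n)%N%:Z,
      forall (K : fieldType) k, large k0 k -> polycond (fun c : 'I_q -> K =>
        codim_le (supported (box_module k))
          (relations blk ex box_gens (fun=> 0%M) (fun _ _ => False) c n k) D /\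
        codim_ge (supported (box_module k))
          (relations blk ex box_gens (fun=> 0%M) (fun _ _ => False) c n k) D),
      forall (K : fieldType) k a, large k0 k -> polycond (fun c : 'I_q -> K =>
        codim_le (supported (box_module k))
          (relations blk ex box_gens (fun=> 0%M) (divisible_by a) c n k) 0) &
     (0 < D)%N -> exists al be : 'I_n -> 'I_q,
       (forall j, blk (al j) = j /\ blk (be j) = j) /\
       forall z : 'I_n -> int,
         (forall i, \sum_j z j * ((ex (al j) i)%:Z - (ex (be j) i)%:Z) = 0) ->
         forall j, z j = 0] /\
  forall k, large k0 k -> exists M (J : 'I_M -> 'I_n) (src tgt : 'I_M -> multinom n),
    [/\ (M + D)%N = cnt k, forall l, below blk ex box_gens (fun=> 0%M) (J l) k (src l),
    forall l, box_module k (tgt l) &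
    forall K : fieldType,
        \det (coef_mx blk ex J src tgt (fun a => mpolyX K (mnm1 a))) != 0].
Proof.
have [k0 [D [cnt [c1 c2 c3 c4 c5]]]] :=
  @module_generic n q blk ex _ box_gens (fun=> 0%M) (fun _ _ => False) (fun _ _ _ h =>
      h) (fun _ _ h => False_ind _ h).
have c1' k : finite_of_size (box_module k) (cnt k).
  by apply: finite_of_size_ext (c1 k) => x; split => [[]//|h]; split.
have divX a k x : divisible_by a k x -> box_module k x.
  move=> [k' [x' [<- <- /(lattice_module_add 'e_a)]]].
  by rewrite wdg1 wpt1.
have divadd a w k x : divisible_by a k x ->
    divisible_by a (k + wdg blk w)%M (x + wpt ex w)%M.
  move=> [k' [x' [<- <- /(lattice_module_add w) h]]].
  exists (k' + wdg blk w)%M, (x' + wpt ex w)%M; split => //.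
    by rewrite -!addmA (addmC (wdg blk w)).
  by rewrite -!addmA (addmC (wpt ex w)).
have /choice[ka kaP] a : exists ka, forall (K : fieldType) k, large ka k ->
    polycond (fun c : 'I_q -> K =>
        codim_le (supported (box_module k))
          (relations blk ex box_gens (fun=> 0%M) (divisible_by a) c n k) 0).
  have [k1 [D1 [cnt1 [e1 e2 e3 _ _]]]] :=
    @module_generic n q blk ex _ box_gens (fun=> 0%M) (divisible_by a) (divadd a) (divX a).
  have cntE (k : multinom n) : (0 < k (blk a))%N ->
      (cnt1 k + cnt (k - mnm1 (blk a))%M)%N = cnt k.
    move=> ka; have [M [M' [h1 h2 <-]]] := finite_of_size_split (divisible_by a k) (c1' k).
    rewrite (finite_of_size_uniq (e1 k) h2) addnC; congr addn.
    apply/eqP; rewrite eqn_leq; apply/andP; split.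
      apply: (finite_of_size_inj (f := fun x => (x + ex a)%M)) (c1' _) h1.
        by move=> x y _ _ /eqP; rewrite eqm_add2r => /eqP.
      move=> x Xx; have dx : divisible_by a k (x + ex a)%M.
        by exists (k - 'e_(blk a))%M, x; split; rewrite ?subm_add.
      by split => //; exact: divX dx.
    apply: (finite_of_size_inj (f := fun x => (x - ex a)%M)) h1 (c1' _).
      move=> _ _ [_ [k' [x [_ <- _]]]] [_ [k'' [y [_ <- _]]]].
      by rewrite !addmK => ->.
    by move=> _ [_ [k' [x [<- <- Xx]]]]; rewrite !addmK.
  (* The quotient by the multiples of x^(ex a) is counted by cnt(k) - cnt(k - e_j), with j the block
     of a; the n-th differences of both terms are D, so they cancel. *)
  have D10 : D1 = 0%N.
    pose k : multinom n := mnm_of (fun=> (k0 + k1).+1).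
    have kk0 : large k0 k by move=> j; rewrite mnm_ofE; lia.
    have kk0' : large k0 (k - 'e_(blk a))%M by move=> j; mnm; rewrite mnm_ofE; lia.
    have kk1 : large k1 k by move=> j; rewrite mnm_ofE; lia.
    have := e2 1%N k kk1; rewrite exp1n muln1.
    have -> : \sum_(S : {set 'I_n}) (-1) ^+ (n - #|S|) * (cnt1 (box_shift 1 k S))%:Z =
       \sum_(S : {set 'I_n}) (-1) ^+ (n - #|S|) * (cnt (box_shift 1 k S))%:Z -
       \sum_(S : {set 'I_n}) (-1) ^+ (n - #|S|) * (cnt (box_shift 1 (k - 'e_(blk a))%M
           S))%:Z.
      rewrite -sumrB; apply: eq_bigr => S _; rewrite -mulrBr; congr (_ * _).
      have kS : (0 < (box_shift 1 k S) (blk a))%N by rewrite /box_shift; mnm;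
          rewrite !mnm_ofE; lia.
      rewrite -(cntE _ kS).
      have -> : (box_shift 1 k S - 'e_(blk a))%M = box_shift 1 (k - 'e_(blk a))%M S.
        apply/mnmP => j; rewrite /box_shift; mnm; rewrite !mnm_ofE; case: (blk a == j); lia.
      by rewrite PoszD addrK.
    by rewrite (c2 1%N k kk0) (c2 1%N _ kk0') subrr => /esym/eqP; rewrite eqz_nat => /eqP.
  exists k1 => K k kk; apply: polycondW (e3 K k kk) => c [+ _].
  by rewrite D10.
exists (k0 + \sum_a ka a)%N, D, cnt; split; last first.
  move=> k kk; have [|M [J [src [tgt [MD Js ti tX dM]]]]] := c4 k.
    by move=> j; apply: leq_trans (kk j); exact: leq_addr.
  by exists M, J, src, tgt; split => // l; have [] := tX l.
split => //.
- by move=> N k kk; apply: c2 => j; apply: leq_trans (kk j); exact: leq_addr.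
- by move=> K k kk; apply: c3 => j; apply: leq_trans (kk j); exact: leq_addr.
- move=> K k a kk; apply: kaP => j; apply: leq_trans (kk j).
  by rewrite (bigD1 a) //= addnA addnAC leq_addl.
Qed.

End Box.

(** * Independence modulo the ideal in the torus *)

Section TorusLower.
Variables (K : fieldType) (n q : nat) (blk : 'I_q -> 'I_n) (ex : 'I_q ->
    multinom n) (b : nat).
Local Notation P := (mpoly n K).
Variable c : 'I_q -> K.
Local Notation f := (sparse_sys blk ex c).
Local Notation X := (box_module blk ex b).
Local Notation rel Z := (relations blk ex (@box_gens n b) (fun=> 0%M) Z c n).
Local Notation W := (rel (fun _ _ => False)).
Implicit Types (k x : multinom n) (i j : 'I_n) (a : 'I_q) (u v : P).
Variables (k0 D : nat).
Hypothesis leD : forall k, large k0 k -> codim_le (supported (X k)) (W k) D.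
Hypothesis geD : forall k, large k0 k -> codim_ge (supported (X k)) (W k) D.
Hypothesis div0 : forall k a, large k0 k ->
  codim_le (supported (X k)) (rel (divisible_by blk ex b a) k) 0.

Lemma box_relationsP k v : W k v <-> exists h : 'I_n -> P,
  (forall j, supported (below blk ex (@box_gens n b) (fun=> 0%M) j k) (h j)) /\
  v = \sum_j f j * h j.
Proof.
have E (h : 'I_n -> P) : \sum_(j < n | (j < n)%N) f j * h j = \sum_j f j * h j.
  by apply: eq_bigl => j; rewrite ltn_ord.
split=> [[h [hs /supported0/eqP]]|[h [hs ->]]].
  rewrite subr_eq0 E => /eqP ->; exists h; split => // j; exact: hs.
exists h; split; first by move=> j _; exact: hs.
by rewrite E subrr; exact: supported_0.
Qed.

Lemma box_relations_subspace k : subspace (W k).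
Proof. exact: relations_subspace. Qed.

Lemma below_shift k a j m : below blk ex (@box_gens n b) (fun=> 0%M) j k m ->
  below blk ex (@box_gens n b) (fun=> 0%M) j (k + 'e_(blk a))%M (ex a + m)%M.
Proof.
move=> [k' <- /(lattice_module_add 'e_a)]; rewrite wdg1 wpt1 => h.
exists (k' + 'e_(blk a))%M; last by rewrite (addmC (ex a)).
by rewrite -!addmA (addmC (mnm1 (blk a))).
Qed.

Lemma box_relations_mul k a v : W k v -> W (k + 'e_(blk a))%M (mpolyX K (ex a) * v).
Proof.
move=> /box_relationsP[h [hs ->]]; apply/box_relationsP.
exists (fun j => mpolyX K (ex a) * h j); split.
  move=> j; apply: (supportedM (P := eq (ex a))) (hs j); last exact: supportedX.
  by move=> _ m <-; exact: below_shift.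
by rewrite mulr_sumr; apply: eq_bigr => j _; rewrite mulrCA.
Qed.

(** Multiplication by x^(ex a) maps X(k)/W(k) onto the quotient in the next degree by [div0]; both
    have dimension D, so it is also injective. *)
Lemma peel k a v : large k0 k -> supported (X k) v ->
  W (k + 'e_(blk a))%M (mpolyX K (ex a) * v) -> W k v.
Proof.
move=> kk Xv Wv; apply: contrapT => nW.
have sW := box_relations_subspace k.
(* With a nonzero kernel element v the quotient by W + K v has dimension less than D, and its image
   would still be everything. *)
pose W' (u : P) := exists l, W k (u - l *: v).
have sW' : subspace W'.
  split; first by exists 0; rewrite scale0r subr0; exact: sW.1.
  move=> d u1 u2 [l1 h1] [l2 h2]; exists (d * l1 + l2).
  have -> : d *: u1 + u2 - (d * l1 + l2) *: v = d *: (u1 - l1 *: v) + (u2 - l2 *: v).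
    by rewrite scalerBr scalerDl scalerA opprD addrACA.
  exact: sW.2.
have kk' : large k0 (k + 'e_(blk a))%M by move=> j; mnm;
    apply: leq_trans (kk j) (leq_addr _ _).
case: (codim_dichotomy D (@supported_subspace K n (X k)) sW') =>
    [[y [yX yi]]|[t tD [[y [yX yP]] _]]].
  suff : codim_ge (supported (X k)) (W k) D.+1.
    by move=> h; have := codim_le_ge sW (leD kk) h; rewrite ltnn.
  exists (fun i : 'I_D.+1 => if unlift ord0 i is Some j then y j else v); split.
    by move=> i'; case: unliftP.
  move=> d; rewrite big_ord_recl unlift_none; under eq_bigr do rewrite liftK.
  move=> h; have d0 (i : 'I_D) : d (lift ord0 i) = 0.
    apply: (yi (fun i : 'I_D => d (lift ord0 i))); exists (- d ord0).
    by rewrite scaleNr opprK addrC.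
  have dv : d ord0 = 0.
    apply/eqP/negPn/negP => dn; apply: nW; move: h; under eq_bigr do rewrite d0 scale0r.
    rewrite big1_eq addr0 => /(subspaceZ (d ord0)^-1 sW).
    by rewrite scalerA mulVf// scale1r.
  by move=> i'; case: (unliftP ord0 i') => [j ->|->].
suff : codim_le (supported (X (k + 'e_(blk a))%M)) (W (k + 'e_(blk a))%M) t.
  by move=> h; have := codim_le_ge (box_relations_subspace _) h (geD kk');
      rewrite leqNgt tD.
exists (fun i : 'I_t => mpolyX K (ex a) * y i); split.
  move=> i; apply: (supportedM (P := eq (ex a))) (yX i); last exact: supportedX.
  by move=> _ m <- /(lattice_module_add (mnm1 a)); rewrite wdg1 wpt1 (addmC (ex a)).
move=> u uX; have [z [_ zP]] := div0 a kk'; have [d] := zP u uX.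
rewrite big_ord0 subr0 => -[h [hs hz]].
set g := \sum_(j < n | _) _ in hz.
have Wg : W (k + 'e_(blk a))%M g.
  by exists h; split => //; rewrite subrr; exact: supported_0.
pose u' : P := \sum_(m <- msupp (u - g)) mcoeff m (u - g) *: mpolyX K (m - ex a)%M.
have u'E : mpolyX K (ex a) * u' = u - g.
  rewrite [RHS]mpolyE mulr_sumr; apply: eq_big_seq => m.
  rewrite mcoeff_msupp => /hz [k' [x' [_ <- _]]].
  by rewrite addmK -scalerAr -mpolyXD addmC.
have u'X : supported (X k) u'.
  rewrite /u' big_seq; apply: supported_sum => m;
      rewrite mcoeff_msupp => /hz [k' [x' [ke <- Xx]]].
  apply: supportedZ; apply: supportedX; rewrite addmK.
  by move/eqP: ke; rewrite eqm_add2r => /eqP <-.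
have [e [l We]] := yP _ u'X; exists e.
have -> : u - \sum_i e i *: (mpolyX K (ex a) * y i) =
   g + mpolyX K (ex a) * (u' - \sum_i e i *: y i - l *: v) + l *: (mpolyX K (ex a) * v).
  rewrite !mulrBr u'E -scalerAr.
  have -> : mpolyX K (ex a) * (\sum_i e i *: y i) = \sum_i e i *: (mpolyX K (ex a) * y i).
    by rewrite mulr_sumr; apply: eq_bigr => i _; rewrite scalerAr.
  by ring.
apply: (subspaceD (box_relations_subspace _));
    last exact: (subspaceZ _ (box_relations_subspace _)).
by apply: (subspaceD (box_relations_subspace _)) => //; exact: box_relations_mul.
Qed.

Lemma peel_many k U v : large k0 k -> supported (X k) v ->
  W (k + wdg blk U)%M (mpolyX K (wpt ex U) * v) -> W k v.
Proof.
move=> kk Xv; have [N] := ubnP (mdeg U); elim: N U => // N IH U UN.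
have [->|] := eqVneq U 0%M; first by rewrite wdg0 wpt0 addm0 mpolyX0 mul1r.
rewrite -mdeg_eq0 mdegE sum_nat_eq0 negb_forall => /existsP[a /= Ua].
rewrite -(@subm_add _ U a) ?lt0n// wdgD wptD wdg1 wpt1.
rewrite addmA addmC mpolyXD => h; apply: (IH (U - 'e_a)%M).
  by have := UN; rewrite -{1}(@subm_add _ U a) ?lt0n// mdegD mdeg1; lia.
apply: (peel (a := a)).
- by move=> j; mnm; apply: leq_trans (kk j) (leq_addr _ _).
- apply: (supportedM (P := eq (wpt ex (U - 'e_a)%M))) Xv; last exact: supportedX.
  by move=> _ m <- /(lattice_module_add (U - mnm1 a)%M); rewrite (addmC (wpt ex _)).
- by rewrite addmC; move: h; congr W; rewrite mulrA (mulrC (mpolyX K (ex a))).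
Qed.

Hypothesis edges : (0 < D)%N -> exists al be : 'I_n -> 'I_q,
  [/\ forall j, blk (al j) = j, forall j, blk (be j) = j &
   let Dl := \matrix_(j, i) ((ex (al j) i)%:Z - (ex (be j) i)%:Z) : 'M[int]_n in
   \det Dl != 0 /\ (`|\det Dl| <= b)%N].

(** The D independent elements of X(k)/W(k) stay independent in the torus. Given x^p v in the ideal
    of f with arbitrary multipliers, a large product of points of the supports times v is a relation
    inside X, and [peel_many] removes this product. *)
Lemma torus_lower : codim_ge (fun _ : P => True) (loc (@monomial K n) f) D.
Proof.
have [D0|D0] := posnP D.
  by rewrite D0; exists (fun=> 0); split => // d _ [].
have [al [be [alj bej]]] := edges D0.
set Dl := \matrix_(j, i) _ => /= -[dn0 db].
pose k : multinom n := mnm_of (fun=> k0.+1).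
have kk : large k0 k by move=> j; rewrite mnm_ofE.
have [y [yX yi]] := geD kk; exists y; split => // d ld; apply: yi.
move: ld; set v := \sum_i _ => ld.
have vX : supported (X k) v by rewrite /v; apply: supported_sum => i _;
    exact: supportedZ (yX i).
move: v vX ld => v vX [_ [[p ->] [h hE]]].
pose G (u w : 'I_n -> nat) : multinom q :=
  \big[@mnm_add q/@mnm0 q]_i (mnm1 (al i) *+ u i + mnm1 (be i) *+ w i)%M.
have GD (u w : 'I_n -> nat) : wdg blk (G u w) = mnm_of (fun i => u i + w i)%N.
  have -> : wdg blk (G u w) = \big[@mnm_add n/@mnm0 n]_i (mnm1 i *+ (u i + w i)%N)%M.
    rewrite (big_morph (wdg blk) (@wdgD n q blk) (@wdg0 n q blk)); apply: eq_bigr => i _.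
    rewrite wdgD.
    have E (a : 'I_q) r : wdg blk (mnm1 a *+ r)%M = (mnm1 (blk a) *+ r)%M.
      by elim: r => [|r IH]; rewrite ?mulm0n ?wdg0// !mulmS wdgD wdg1 IH.
    rewrite !E alj bej; apply/mnmP => s; mnm; lia.
  apply/mnmP => s; rewrite mnm_ofE mnm_sumE (bigD1 s)//= big1 => [|r rs]; mnm.
    by rewrite eqxx; lia.
  by rewrite (negPf rs); lia.
have GP (u w : 'I_n -> nat) (s : 'I_n) : (wpt ex (G u w) s)%:Z =
    \sum_i ((u i)%:Z * (ex (al i) s)%:Z + (w i)%:Z * (ex (be i) s)%:Z) :> int.
  rewrite (big_morph (wpt ex) (@wptD n q ex) (@wpt0 n q ex)) mnm_sumE.
  rewrite -[LHS]natz natr_sum; apply: eq_bigr => i _; rewrite wptD.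
  have E (a : 'I_q) r : wpt ex (mnm1 a *+ r)%M = (ex a *+ r)%M.
    by elim: r => [|r IH]; rewrite ?mulm0n ?wpt0// !mulmS wptD wpt1 IH.
  rewrite !E; mnm; rewrite natz; lia.
pose U T := G (fun=> T) (fun=> T).
(* After multiplication by the product of all x^(ex (al i)) x^(ex (be i)) to a high power T, the
   monomial x^m x^(-p) lies in X in the degree required of a multiplier of f_j. *)
have key j m : exists T0, forall T, (T0 <= T)%N ->
    exists2 x, (x + p)%M = (m + wpt ex (U T))%M &
   below blk ex (@box_gens n b) (fun=> 0%M) j (k + wdg blk (U T))%M x.
  pose ka i := (k - mnm1 j)%M i.
  (* The vector z is reduced modulo the lattice of the edges: division by the determinant and the
     adjugate write it as t times the edge matrix plus a remainder r. The entries of r are less than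
     |det| and so lie in the cube; T absorbs the signs of t. *)
  pose z s : int := (m s)%:Z - (p s)%:Z - \sum_i (ka i)%:Z * (ex (al i) s)%:Z.
  pose dt := \det Dl.
  pose t i : int := \sum_s (z s %/ dt)%Z * (\adj Dl) s i.
  exists (\sum_i `|t i|)%N => T TT.
  have tT i : (`|t i| <= T)%N by apply: leq_trans TT; rewrite (bigD1 i)//= leq_addr.
  pose r : multinom n := mnm_of (fun s => `|(z s %% dt)%Z|%N).
  pose u' := G (fun i => (ka i + absz (T%:Z + t i)%R)%N) (fun i => absz (T%:Z - t i)%R).
  exists (r + wpt ex u')%M.
    have zt s : z s = (r s)%:Z + \sum_i t i * ((ex (al i) s)%:Z - (ex (be i) s)%:Z).
      rewrite {1}(divz_eq (z s) dt) addrC mnm_ofE gez0_abs ?modz_ge0//; congr (_ + _).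
      have := mul_adj_mx Dl => /matrixP aD.
      transitivity (\sum_s' (z s' %/ dt)%Z * (\adj Dl *m Dl) s' s).
        rewrite (bigD1 s)//= big1 => [|s' ss]; rewrite aD !mxE ?eqxx ?mulr1n ?addr0//.
        by rewrite (negPf ss) mulr0.
      under eq_bigr do rewrite mxE mulr_sumr.
      rewrite exchange_big /=; apply: eq_bigr => i _; rewrite mulr_suml;
          apply: eq_bigr => s' _.
      by rewrite mulrA; congr (_ * _); rewrite mxE.
    apply/mnmP => s; apply/eqP; rewrite -eqz_nat; apply/eqP; mnm.
    rewrite !PoszD !GP.
    have := zt s; rewrite /z => /eqP; rewrite subr_eq => /eqP e1.
    have e2 : \sum_i ((ka i + absz (T%:Z + t i)%R)%N%:Z * (ex (al i) s)%:Z +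
        (absz (T%:Z - t i)%R)%:Z * (ex (be i) s)%:Z) =
      \sum_i (ka i)%:Z * (ex (al i) s)%:Z +
          \sum_i t i * ((ex (al i) s)%:Z - (ex (be i) s)%:Z)
       + \sum_i (T%:Z * (ex (al i) s)%:Z + T%:Z * (ex (be i) s)%:Z).
      rewrite -!big_split /=; apply: eq_bigr => i _; have := tT i => ti.
      rewrite PoszD !gez0_abs; [ring|lia|lia].
    rewrite e2; lia.
  exists (k - mnm1 j + wdg blk (U T))%M.
    by apply/mnmP => s; mnm; rewrite /k !mnm_ofE; case: eqP => _; lia.
  apply/box_moduleP; exists u', r; split => //.
    rewrite /U !GD; apply/mnmP => i; mnm; rewrite !mnm_ofE /ka; mnm; have := tT i;
        have ki : k i = k0.+1 by rewrite mnm_ofE.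
    by rewrite ?ki; case: (j == i); lia.
  move=> s; rewrite mnm_ofE; apply: leq_trans db.
  rewrite -lez_nat gez0_abs ?modz_ge0//.
  by apply: ltW; exact: ltz_mod.
have [T TP] : exists T, forall j m, m \in msupp (h j) ->
   exists2 x, (x + p)%M = (m + wpt ex (U T))%M &
   below blk ex (@box_gens n b) (fun=> 0%M) j (k + wdg blk (U T))%M x.
  have /choice[T0 T0P] : forall jm : 'I_n * multinom n, exists T0, forall T,
      (T0 <= T)%N -> exists2 x, (x + p)%M = (jm.2 + wpt ex (U T))%M &
   below blk ex (@box_gens n b) (fun=> 0%M) jm.1 (k + wdg blk (U T))%M x.
    by move=> [j m]; exact: key.
  exists (\sum_j \sum_(m <- msupp (h j)) T0 (j, m))%N => j m mh.
  apply: (T0P (j, m)); rewrite (bigD1 j)//= (big_rem m)//= -addnA; exact: leq_addr.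
apply: (@peel_many k (U T)) => //.
pose h' j : P := \sum_(m <- msupp (h j)) mcoeff m (h j) *: mpolyX K ((m +
    wpt ex (U T)) - p)%M.
have hx j : mpolyX K p * h' j = mpolyX K (wpt ex (U T)) * h j.
  rewrite [in RHS](mpolyE (h j)) !mulr_sumr; apply: eq_big_seq => m mh.
  have [x xe _] := TP j m mh.
  by rewrite -xe addmK -!scalerAr -!mpolyXD addmC xe addmC.
apply/box_relationsP; exists h'; split.
  move=> j; rewrite /h' big_seq; apply: supported_sum => m mh.
  have [x xe bx] := TP j m mh; apply: supportedZ; apply: supportedX.
  by have -> : (m + wpt ex (U T) - p)%M = x by rewrite -xe addmK.
have p0 : mpolyX K p != 0 by rewrite -msupp_eq0 msuppX.
apply: (mulfI p0); rewrite mulrCA hE !mulr_sumr; apply: eq_bigr => j _.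
by rewrite mulrCA -hx mulrCA.
Qed.

End TorusLower.

(** * Common points of countably many generic conditions *)

Section Generic.
Variable K : fieldType.

Definition psubst r s (h : 'I_r -> mpoly s K) (G : mpoly r K) : mpoly s K :=
  comp_mpoly (mktuple h) G.

Lemma psubstX r s (h : 'I_r -> mpoly s K) m :
  psubst h (mpolyX K m) = \prod_i h i ^+ m i.
Proof. by rewrite /psubst comp_mpolyX; apply: eq_bigr => i _; rewrite tnth_mktuple. Qed.

Lemma psubstE r s (h : 'I_r -> mpoly s K) G :
  psubst h G = \sum_(m <- msupp G) mcoeff m G *: psubst h (mpolyX K m).
Proof. exact: comp_mpolyEX. Qed.

Lemma meval_psubst r s v (h : 'I_r -> mpoly s K) G :
  meval v (psubst h G) = meval (fun i => meval v (h i)) G.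
Proof. by rewrite /psubst comp_mpoly_meval; apply: meval_eq => i; rewrite tnth_mktuple. Qed.

Lemma psubst_psubst r s t (g : 'I_s -> mpoly t K) (h : 'I_r -> mpoly s K) G :
  psubst g (psubst h G) = psubst (fun i => psubst g (h i)) G.
Proof.
rewrite [psubst h G]psubstE {1}/psubst raddf_sum /= [RHS]psubstE; apply: eq_bigr => m _.
rewrite comp_mpolyZ !psubstX rmorph_prod; congr (_ *: _); apply: eq_bigr => i _.
by rewrite rmorphXn.
Qed.

Lemma psubst_id r (G : mpoly r K) : psubst (fun i => mpolyX K (mnm1 i)) G = G.
Proof. exact: comp_mpoly_id. Qed.

Lemma psubst_ext r s (h h' : 'I_r -> mpoly s K) G : h =1 h' -> psubst h G = psubst h' G.
Proof. by move=> hh; congr psubst; exact/funext. Qed.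

Lemma psubst1 r s (h : 'I_r -> mpoly s K) i : psubst h (mpolyX K (mnm1 i)) = h i.
Proof.
rewrite psubstX (bigD1 i)//= mnm1E eqxx expr1 big1 ?mulr1// => j ji.
by rewrite mnm1E eq_sym (negPf ji) expr0.
Qed.

Lemma polycond_pull r s (io : 'I_r -> 'I_s) (P : ('I_r -> K) -> Prop) : injective io ->
  polycond P -> polycond (fun c : 'I_s -> K => P (fun i => c (io i))).
Proof.
move=> ii [G G0 GP]; exists (psubst (fun i => mpolyX K (mnm1 (io i))) G).
  apply: contra_neq G0 => e.
  pose g k : mpoly r K := if [pick i | io i == k] is Some i then mpolyX K (mnm1 i) else 0.
  have := congr1 (psubst g) e; rewrite psubst_psubst [psubst g 0]comp_mpoly0 => <-.
  rewrite -[LHS]psubst_id; apply: psubst_ext => i; rewrite psubst1 /g.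
  by case: pickP => [j /eqP/ii ->//|/(_ i)]; rewrite eqxx.
move=> c; rewrite meval_psubst => h; apply: GP; move: h; congr (_ != 0).
by apply: meval_eq => i; rewrite mevalXU.
Qed.

Lemma poly_roots_seq (p : {poly K}) : p != 0 -> exists s : seq K, forall t, root p t ->
    t \in s.
Proof.
have [N] := ubnP (size p); elim: N p => // N IH p pN p0.
have [[a /factor_theorem[q pq]]|h] := pselect (exists a, root p a); last first.
  by exists [::] => t rt; exfalso; apply: h; exists t.
have q0 : q != 0 by apply: contra_neq p0 => q0; rewrite pq q0 mul0r.
have [|s sP] := IH q _ q0.
  by move: pN; rewrite pq size_Mmonic ?monicXsubC// size_XsubC addn2 /=.
by exists (a :: s) => t; rewrite pq rootM root_XsubC inE orbC => /orP[->//|/sP ->];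
    rewrite orbT.
Qed.

Definition subst1 q (j : 'I_q) (t : K) (i : 'I_q) : mpoly q K :=
  if i == j then mpolyC q t else mpolyX K (mnm1 i).

(** Regard H as a polynomial in the other variables with coefficients in K[x_j]; p is the
    coefficient containing the leading monomial of H, and H can vanish only where p does. *)
Lemma subst1_neq0 q (j : 'I_q) (H : mpoly q K) : H != 0 ->
  exists2 p : {poly K}, p != 0 & forall t, psubst (subst1 j t) H = 0 -> root p t.
Proof.
move=> H0.
pose drop (m : multinom q) : multinom q := mnm_of (fun i => if i == j then 0%N else m i).
have dropE t m : psubst (subst1 j t) (mpolyX K m) = t ^+ (m j) *: mpolyX K (drop m).
  rewrite psubstX (bigD1 j)//= /subst1 eqxx -rmorphXn /= mul_mpolyC; congr (_ *: _).
  have dj : drop m j = 0%N by rewrite mnm_ofE eqxx.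
  rewrite [RHS]mpolyXE_id [RHS](bigD1 j)//= dj expr0 mul1r.
  by apply: eq_bigr => i /negPf ij; rewrite ij;
      have -> : drop m i = m i by rewrite mnm_ofE ij.
pose m0 := mlead H.
have m0H : m0 \in msupp H by exact: mlead_supp.
pose p : {poly K} := \sum_(m <- msupp H | drop m == drop m0) mcoeff m H *: 'X^(m j).
exists p => [|t e].
  apply: contraTneq m0H => p0; rewrite mcoeff_msupp negbK.
  have := congr1 (fun p : {poly K} => p`_(m0 j)) p0; rewrite coef0 coef_sum => <-.
  have [m0H|m0H] := boolP (m0 \in msupp H); last first.
    exfalso; move: m0H; rewrite mlead_supp//.
  rewrite (big_rem m0)//= eqxx coefZ coefXn eqxx mulr1 big_seq_cond big1 ?addr0//.
  move=> m /andP[mr /eqP dm]; rewrite coefZ coefXn; case: eqP => [e|];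
      last by rewrite mulr0.
  exfalso; have mm : m = m0.
    apply/mnmP => i; have [->|ij] := eqVneq i j; first by rewrite e.
    by have := congr1 (fun m : multinom q => m i) dm; rewrite /= !mnm_ofE (negPf ij).
  by move: mr; rewrite mm mem_rem_uniq// inE eqxx.
have := congr1 (mcoeff (drop m0)) e; rewrite mcoeff0 psubstE raddf_sum /= => {}e.
rewrite rootE -[X in _ == X]e /p horner_sum big_mkcond; apply/eqP; apply: eq_bigr => m _.
rewrite dropE !mcoeffZ mcoeffX; case: eqP => _; last by rewrite !mulr0.
by rewrite hornerZ hornerXn mulr1.
Qed.

Hypothesis uncountableK : forall B : set K, countable B -> exists t, ~ B t.

(** The coordinates are fixed one after the other. Each step has to avoid the roots of countably
    many nonzero univariate polynomials. *)
Lemma countable_generic q (P : nat -> ('I_q -> K) -> Prop) :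
  (forall k, polycond (P k)) -> exists c, forall k, P k c.
Proof.
move=> hP.
have /choice[G GP] k : exists G : mpoly q K, G != 0 /\ forall c, meval c G != 0 -> P k c.
  by have [G G0 GP] := hP k; exists G.
pose h (j : nat) (c : 'I_q ->
    K) (i : 'I_q) := if (i < j)%N then mpolyC q (c i) else mpolyX K (mnm1 i).
suff [c cP] : exists c, forall k, psubst (h q c) (G k) != 0.
  exists c => k; apply: (GP k).2; apply: contra_neq (cP k) => e.
  rewrite psubstE; move: e; rewrite mevalE => e.
  transitivity (mpolyC q (\sum_(m <- msupp (G k)) mcoeff m (G k) * \prod_i c i ^+ m i)).
    rewrite raddf_sum /=; apply: eq_bigr => m _.
    rewrite psubstX mpolyCM mul_mpolyC rmorph_prod /=; congr (_ *: _).
    by apply: eq_bigr => i _; rewrite /h ltn_ord rmorphXn.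
  by rewrite e mpolyC0.
suff /(_ q (leqnn q)) : forall j, (j <= q)%N ->
    exists c, forall k, psubst (h j c) (G k) != 0 by [].
elim=> [_|j IH jq].
  exists (fun=> 0) => k; have := (GP k).1; rewrite -{1}(psubst_id (G k)).
  by congr (_ != 0); apply: psubst_ext => i; rewrite /h.
have [c cP] := IH (ltnW jq); pose jo := Ordinal jq.
have /choice[p pP] k : exists p : {poly K}, p != 0 /\
    forall t, psubst (subst1 jo t) (psubst (h j c) (G k)) = 0 -> root p t.
  by have [p] := @subst1_neq0 q jo _ (cP k); exists p.
have [t tP] : exists t, ~ (\bigcup_k [set t | root (p k) t]) t.
  apply: uncountableK; apply: bigcup_countable => // k _; apply: finite_set_countable.
  have [s sP] := poly_roots_seq (pP k).1.
  by apply: (@sub_finite_set _ _ [set` s]); [exact: sP|exact: finite_seq].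
exists (fun i => if i == jo then t else c i) => k.
apply/eqP => e; apply: tP; exists k => //; apply: (pP k).2.
rewrite psubst_psubst -[RHS]e; apply: psubst_ext => i; rewrite /h.
have [ij|ij] := eqVneq i jo.
  have -> : (i < j)%N = false by rewrite ij /= ltnn.
  have -> : (i < j.+1)%N by rewrite ij /=.
  by rewrite psubst1 /subst1 ij eqxx.
have -> : (i < j.+1)%N = (i < j)%N.
  by rewrite ltnS leq_eqVlt; case: eqP => // e'; case/eqP: ij; apply/val_inj.
case: ltnP => _; first by rewrite /psubst comp_mpolyC.
by rewrite psubst1 /subst1 (negPf ij).
Qed.

End Generic.

(** The real segment from 0 to 1 has positive Lebesgue measure, so it is not countable. *)
Lemma complex_uncountable (R : realType) (B : set R[i]) : countable B -> exists t, ~ B t.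
Proof.
move=> cB; apply: contrapT => h.
have hB (t : R[i]) : B t by apply: contrapT => nB; apply: h; exists t.
have : countable `[0%R, 1%R : R]%classic.
  have /countable_injP[f fi] := cB; apply/countable_injP;
      exists (fun x => f (real_complex R x)).
  by move=> x y _ _ /fi; rewrite !inE => /(_ (hB _) (hB _)) [].
move=> /countable_lebesgue_measure0;
    rewrite lebesgue_measure_itv /= lte_fin ltr01 oppr0 adde0.
by move=> /eqP; rewrite onee_eq0.
Qed.

(** * Multiplicity at the origin: upper bound *)

Section MultBound.
Variables (K : fieldType) (n q : nat) (blk : 'I_q -> 'I_n) (ex : 'I_q -> multinom n).
Local Notation P := (mpoly n K).

(* The family of supports A^0: the index [rshift q j] is the point 0 of A^0_j. *)
Definition blk0 (a : 'I_(q + n)) : 'I_n :=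
  match fintype.split a with inl a => blk a | inr j => j end.
Definition ex0 (a : 'I_(q + n)) : multinom n :=
  match fintype.split a with inl a => ex a | inr j => 0%M end.

Lemma blk0_l a : blk0 (lshift n a) = blk a.
Proof. by rewrite /blk0 -[lshift n a]/(unsplit (inl a)) unsplitK. Qed.
Lemma blk0_r j : blk0 (rshift q j) = j.
Proof. by rewrite /blk0 -[rshift q j]/(unsplit (inr j)) unsplitK. Qed.
Lemma ex0_l a : ex0 (lshift n a) = ex a.
Proof. by rewrite /ex0 -[lshift n a]/(unsplit (inl a)) unsplitK. Qed.
Lemma ex0_r j : ex0 (rshift q j) = 0%M.
Proof. by rewrite /ex0 -[rshift q j]/(unsplit (inr j)) unsplitK. Qed.

Lemma sparse_sys0 (c : 'I_(q + n) -> K) j : sparse_sys blk0 ex0 c j =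
  sparse_sys blk ex (fun a => c (lshift n a)) j + mpolyC n (c (rshift q j)).
Proof.
rewrite /sparse_sys big_mkcond big_split_ord /=; congr (_ + _).
  rewrite [RHS]big_mkcond; apply: eq_bigr => a _.
  by rewrite blk0_l ex0_l.
rewrite (bigD1 j)//= big1 => [|i ij]; rewrite blk0_r ?ex0_r.
  by rewrite eqxx mpolyX0 -mul_mpolyC mulr1 addr0.
by rewrite (negPf ij).
Qed.

Variables (i0 : 'I_n) (c : 'I_(q + n) -> K) (b k0 DV : nat) (cnt : multinom n -> nat).
Local Notation f := (sparse_sys blk ex (fun a => c (lshift n a))).
Local Notation X := (box_module blk0 ex0 b).
Hypothesis cntP : forall k, finite_of_size (X k) (cnt k).
Hypothesis rows : forall k, large k0 k -> exists M (J : 'I_M -> 'I_n) (src tgt : 'I_M ->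
    multinom n),
  [/\ (M + DV)%N = cnt k, forall l,
      below blk0 ex0 (@box_gens n b) (fun=> 0%M) (J l) k (src l),
      forall l, X k (tgt l) & \det (coef_mx blk0 ex0 J src tgt c) != 0].
Hypothesis exhaust : forall x, exists k1, forall k, large k1 k -> X k x.
Variables (mu DL r : nat) (u : 'I_n -> {poly K}).
Hypothesis w0 : forall i, loc (@unit_at0 K n) f (uni i 'X^r).
Hypothesis u0 : forall i, (u i).[0] != 0.
Hypothesis wT : forall i, loc (@monomial K n) f (uni i (u i)).
Hypothesis mult0 : codim_ge (fun _ : P => True) (loc (@unit_at0 K n) f) mu.
Hypothesis multT : codim_ge (fun _ : P => True) (loc (@monomial K n) f) DL.

Lemma mult_bound : (mu + DL <= DV)%N.
Proof.
have [e0 [_ e0P]] := mult0; have [eT [_ eTP]] := multT.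
have sub0 := loc_subspace f (@unit_at0_mult K n).
have subT := loc_subspace f (@monomial_mult K n).
have un0 i : u i != 0 by apply: contraNneq (u0 i) => ->; rewrite horner0.
have /Bezout_eq1_coprimepP[[x y] /= xy1] : coprimep ('X^r : {poly K}) (u i0).
  apply: coprimep_expl;
      rewrite coprimep_sym -[X in coprimep _ X]subr0 -polyC0 coprimep_XsubC.
  by rewrite rootE.
(* By Bezout E lies in the ideal in the torus and 1 - E in the ideal at the origin; the single
   coordinate [i0] suffices to separate them. *)
pose E : P := uni i0 (y * u i0).
have E1 : 1 - E = uni i0 (x * 'X^r).
  rewrite /E; apply/eqP; rewrite subr_eq -uniD xy1 -polyC1 uniC mpolyC1 //.
have ET v : loc (@monomial K n) f (E * v) by rewrite mulrC; apply: locM; rewrite /E uniM;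
    exact: locM.
have E0 v : loc (@unit_at0 K n) f ((1 - E) * v) by rewrite E1 mulrC; apply: locM;
    rewrite uniM; exact: locM.
pose eta (i : 'I_(mu + DL)) : P :=
    match fintype.split i with inl i => E * e0 i | inr i => (1 - E) * eT i end.
have etaE th : \sum_i th i *: eta i = E * (\sum_i th (lshift DL i) *: e0 i) +
   (1 - E) * (\sum_i th (rshift mu i) *: eT i).
  rewrite big_split_ord /= !mulr_sumr; congr (_ + _); apply: eq_bigr => i _; rewrite /eta.
    by rewrite -[lshift _ _]/(unsplit (inl i)) unsplitK scalerAr.
  by rewrite -[rshift _ _]/(unsplit (inr i)) unsplitK scalerAr.
have ind (th : 'I_(mu + DL) -> K) : loc (@unit_at0 K n) f (\sum_i th i *: eta i) ->
    loc (@monomial K n) f (\sum_i th i *: eta i) -> forall i, th i = 0.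
  rewrite etaE; set s := \sum_i _; set t := \sum_i _ => l0 lT.
  have ls : loc (@unit_at0 K n) f s.
    have -> : s = E * s + (1 - E) * t + (1 - E) * s - (1 - E) * t by ring.
    apply: (subspaceB sub0) (E0 t); exact: (subspaceD sub0).
  have lt : loc (@monomial K n) f t.
    have -> : t = E * s + (1 - E) * t + E * t - E * s by ring.
    apply: (subspaceB subT) (ET s); exact: (subspaceD subT).
  move=> i; case: (split_ordP i) => i' ->;
      [exact: (e0P (fun i => th (lshift DL i)))|exact: (eTP (fun i => th (rshift mu i)))].
have w00 (i : 'I_n) : ('X^r : {poly K}) != 0 by rewrite -size_poly_eq0 size_polyXn.
have indep := pencil_independent (c0 := fun j => c (rshift q j)) w00 w0 un0 wT ind.
have [k kk etaX] : exists2 k, large k0 k & forall i, supported (X k) (eta i).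
  have [k1 k1P] := choice exhaust.
  pose N := (k0 + \sum_i \sum_(m <- msupp (eta i)) k1 m)%N.
  exists (mnm_of (fun=> N)) => [j|i m]; first by rewrite mnm_ofE leq_addr.
  rewrite -mcoeff_msupp => mi; apply: k1P => j;
      rewrite mnm_ofE /N (bigD1 i)//= (big_rem m)//=; lia.
have [V [uV sV VP]] := cntP k.
have [M [J [src [tgt [MD Js Xt dM]]]]] := rows kk.
rewrite -(leq_add2l M) MD -sV.
have inX m : X k m -> m \in V by move/VP.
have supV v : supported (X k) v -> supported (fun m => m \in V) v by exact: supportedW.
have srcX l k' m : (k' + mnm1 (J l))%M = k -> X k' m -> X k m.
  move=> <- /(lattice_module_add (mnm1 (rshift q (J l)))); rewrite wdg1 wpt1.
  by rewrite blk0_r ex0_r addm0.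
have sX l : X k (src l) by have [k' k'E Xk'] := Js l; exact: srcX k'E Xk'.
apply: (@pencil_count K n f (fun j => c (rshift q j)) _ eta V M J src tgt) => //.
- by move=> i; exact/supV/etaX.
- by move=> l; exact/inX.
- move=> l; apply: supV; rewrite /sparse_sys mulr_suml; apply: supported_sum => a /eqP aj.
  rewrite -scalerAl -mpolyXD; apply: supportedZ; apply: supportedX.
  have [k' k'E] := Js l; rewrite -k'E => /(lattice_module_add (mnm1 (lshift n a))).
  by rewrite wdg1 wpt1 blk0_l ex0_l aj (addmC (ex a)).
- by move=> l; exact/inX.
- move: dM; congr (_ != 0); congr (\det _); apply/matrixP => l l'; rewrite !mxE.
  rewrite -mul_mpolyC -mulrDl -sparse_sys0 /sparse_sys mulr_suml raddf_sum /= big_mkcondr.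
  apply: eq_bigr => a _; rewrite -scalerAl -mpolyXD mcoeffZ mcoeffX (addmC (ex0 a)).
  by case: eqP => _; rewrite ?mulr1 ?mulr0.
Qed.

End MultBound.

Section TorusFinite.
Variables (K : fieldType) (n q : nat) (blk : 'I_q -> 'I_n) (ex : 'I_q ->
    multinom n) (b : nat).
Local Notation P := (mpoly n K).
Variables (c : 'I_q -> K) (k : multinom n) (D : nat).
Local Notation f := (sparse_sys blk ex c).
Local Notation X := (box_module blk ex b).
Local Notation W := (relations blk ex (@box_gens n b) (fun=> 0%M) (fun _ _ => False) c n).
Hypothesis leD : codim_le (supported (X k)) (W k) D.
Hypothesis Db : (D <= b)%N.
Hypothesis blk_onto : forall j, exists a, blk a = j.

(** As D is at most b, the D + 1 monomials x^s x_i^t with t at most D all lie in X(k), hence are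
    dependent modulo relations. This gives a polynomial in x_i, whose factor x_i^m is invertible in
    the torus. *)
Lemma torus_finite i : exists2 u : {poly K}, u.[0] != 0 & loc (@monomial K n) f (uni i u).
Proof.
have sW : subspace (W k) by exact: box_relations_subspace.
have [al alP] := choice blk_onto.
have [U Uk] : exists U, wdg blk U = k.
  exists (\big[@mnm_add q/@mnm0 q]_j (mnm1 (al j) *+ k j)%M).
  rewrite (big_morph (wdg blk) (@wdgD n q blk) (@wdg0 n q blk)); apply/mnmP => s.
  have E (a : 'I_q) r : wdg blk (mnm1 a *+ r)%M = (mnm1 (blk a) *+ r)%M.
    by elim: r => [|r IH]; rewrite ?mulm0n ?wdg0// !mulmS wdgD wdg1 IH.
  rewrite mnm_sumE (bigD1 s)//= big1 => [|r rs]; rewrite E alP; mnm.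
    by rewrite eqxx; lia.
  by rewrite (negPf rs); lia.
pose s := wpt ex U.
have sX t : (t <= b)%N -> X k (s + mnm1 i *+ t)%M.
  move=> tb; apply/box_moduleP; exists U, (mnm1 i *+ t)%M; split => //;
      last by rewrite addmC.
  by move=> j; mnm; case: eqP => _; lia.
pose B (t : 'I_D.+1) : P := mpolyX K (s + mnm1 i *+ t)%M.
have BX t : supported (X k) (B t).
  by apply: supportedX; apply: sX; apply: leq_trans Db; rewrite -ltnS.
have [th [t thn] Wth] : exists2 th : 'I_D.+1 ->
    K, exists t, th t != 0 & W k (\sum_t th t *: B t).
  apply: contrapT => h.
  have ge : codim_ge (supported (X k)) (W k) D.+1.
    exists B; split => // th Wth t; apply/eqP/negPn/negP => tn; apply: h; exists th => //.
    by exists t.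
  by have := codim_le_ge sW leD ge; rewrite ltnn.
pose p := \poly_(t < D.+1) th (inord t).
have pE : \sum_t th t *: B t = mpolyX K s * uni i p.
  rewrite uniE mulr_sumr.
  rewrite (big_ord_widen_cond D.+1 xpredT (fun t =>
      mpolyX K s * (p`_t *: mpolyX K (mnm1 i *+ t)%M))); last exact: size_poly.
  rewrite [RHS]big_mkcond; apply: eq_bigr => j _ /=; case: ltnP => [jp|jp].
    by rewrite -scalerAr -mpolyXD coef_poly ltn_ord inord_val.
  have := nth_default 0 jp; rewrite coef_poly ltn_ord inord_val => ->.
  by rewrite scale0r.
have p0 : p != 0.
  apply: contraNneq thn => p0; have := congr1 (fun p : {poly K} => p`_t) p0.
  by rewrite coef_poly ltn_ord inord_val coef0 => ->.
have [m [v]] := multiplicity_XsubC p 0; rewrite p0 /= subr0 => rv pv.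
exists v; first by rewrite -rootE.
exists (mpolyX K (s + mnm1 i *+ m)%M); split; first by exists (s + mnm1 i *+ m)%M.
move: Wth => /box_relationsP[h [_ hE]]; exists h; rewrite -hE pE pv uniM uniXn mpolyXD;
    ring.
Qed.

End TorusFinite.

(** * Nilpotency of the coordinates in the local ring at the origin *)

Section NilpotentIdeal.
Variables (A : comNzRingType) (n : nat) (X : 'I_n -> A) (I : {set 'I_n} -> A -> Prop).
Hypothesis I0 : forall Z, I Z 0.
Hypothesis ID : forall Z a b, I Z a -> I Z b -> I Z (a + b).
Hypothesis IM : forall Z a b, I Z b -> I Z (a * b).
Hypothesis Igen : forall (Z : {set 'I_n}) i, i \in Z -> I Z (X i).
Variable U : A -> Prop.
Hypothesis U1 : U 1.
Hypothesis UM : forall a b, U a -> U b -> U (a * b).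
Hypothesis Ureg : forall Z s a, U s -> I Z (s * a) -> I Z a.
Hypothesis Istep : forall Z i a, I (i |: Z)%SET a ->
    exists s g, U s /\ I Z (s * a - X i * g).
Hypothesis Itop : forall Z : {set 'I_n}, Z != [set: 'I_n]%SET ->
  exists N, I Z (\prod_(i | i \notin Z) X i ^+ N).

Let IN Z a : I Z a -> I Z (- a).
Proof. by rewrite -mulN1r; exact: IM. Qed.

Let congM Z a b a' b' : I Z (a - b) -> I Z (a' - b') -> I Z (a * a' - b * b').
Proof.
move=> h h'; have -> : a * a' - b * b' = a' * (a - b) + b * (a' - b') by ring.
by apply: ID; exact: IM.
Qed.

Let congX Z a b N : I Z (a - b) -> I Z (a ^+ N - b ^+ N).
Proof.
move=> h; elim: N => [|N IH]; first by rewrite !expr0 subrr.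
by rewrite !exprS; exact: congM.
Qed.

Let cong_prod Z (Q : pred 'I_n) (a b : 'I_n -> A) : (forall i, Q i -> I Z (a i - b i)) ->
  I Z (\prod_(i | Q i) a i - \prod_(i | Q i) b i).
Proof.
move=> h; elim/big_rec2: _ => [|i y x Qi IH]; first by rewrite subrr.
by apply: congM => //; exact: h.
Qed.

(** Here I_Z stands for the local ideal of f plus the coordinates in Z, and the induction descends
    on Z. For j outside Z a power of X_i lies in I_(j, Z), so up to a unit it is a multiple of X_j
    modulo I_Z. Multiplying over j and raising to the power M produces the product of all X_j^M,
    which is in I_Z because the open stratum has no zeros near 0. *)
Lemma nilpotent_strata i : exists r, I finset.set0 (X i ^+ r).
Proof.
have [N] := ubnP #|~: (finset.set0 : {set 'I_n})|%SET.
elim: N (finset.set0 : {set 'I_n}) => // N IH Z ZN.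
have [->|ZT] := eqVneq Z [set: 'I_n]%SET; first by exists 1%N; rewrite expr1; exact: Igen.
have [M IZ] := Itop ZT.
have /choice[r rP] (j : 'I_n) : exists r, j \notin Z -> I (j |: Z)%SET (X i ^+ r).
  have [jZ|jZ] := boolP (j \in Z); first by exists 0%N.
  have [|r rP] := IH (j |: Z)%SET; last by exists r.
  rewrite -ltnS; apply: leq_trans ZN; rewrite ltnS finset.setCU.
  apply: proper_card; apply/properP; split; first exact: finset.subsetIr.
  by exists j; rewrite !inE ?jZ// eqxx.
have /choice[sg sgP] j : exists sg : A * A, U sg.1 /\ (j \notin Z ->
    I Z (sg.1 * X i ^+ r j - X j * sg.2)).
  have [jZ|jZ] := boolP (j \in Z); first by exists (1, 0).
  by have [s [g [us gZ]]] := Istep (rP j jZ); exists (s, g).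
exists (\sum_(j | j \notin Z) r j * M)%N.
apply: (@Ureg Z (\prod_(j | j \notin Z) (sg j).1 ^+ M)).
  apply: (big_ind U) => // j _; elim: M {IZ} => [|M IHM]; first by rewrite expr0.
  by rewrite exprS; apply: UM => //; exact: (sgP j).1.
rewrite expr_sum; under [X in _ * X]eq_bigr do rewrite exprM.
rewrite -big_split /=; under eq_bigr do rewrite -exprMn.
have h := cong_prod (fun j jZ => congX M ((sgP j).2 jZ)).
rewrite -[X in I Z X](subrK (\prod_(j | j \notin Z) (X j * (sg j).2) ^+ M));
    apply: ID => //.
under eq_bigr do rewrite exprMn.
by rewrite big_split /= mulrC; exact: IM.
Qed.

End NilpotentIdeal.

Section Strata.
Variables (K : fieldType) (n q : nat) (blk : 'I_q -> 'I_n) (ex : 'I_q -> multinom n).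
Local Notation P := (mpoly n K).
Local Notation Q := (q + (n + n))%N.

(* An index of ['I_Q] is either a monomial of the system or, for [i : 'I_n], one
   of the two monomials 1 and x_i; the latter replace the equations of the
   coordinates in [Z]. *)
Section Aux.
Variables (Z : {set 'I_n}) (phi : 'I_n -> 'I_n).
Hypothesis phi_inj : {in [predC Z] &, injective phi}.

(** A left inverse of [phi] outside Z: the equation [phi i] becomes the i-th equation of the
    auxiliary system. *)
Definition psi (j : 'I_n) : 'I_n := odflt j [pick i | (i \notin Z) && (phi i == j)].

Lemma psiK i : i \notin Z -> psi (phi i) = i.
Proof.
move=> iZ; rewrite /psi; case: pickP => [i' /andP[iZ' /eqP/phi_inj ->//]|/(_ i)].
by rewrite iZ eqxx.
Qed.

Definition aux_blk (t : 'I_Q) : 'I_n := match fintype.split t with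
  | inl a => psi (blk a)
  | inr e => match fintype.split e with inl i => i | inr i => i end end.

Definition aux_ex (t : 'I_Q) : multinom n := match fintype.split t with
  | inl a => ex a
  | inr e => match fintype.split e with inl i => 0%M | inr i => mnm1 i end end.

Definition on_stratum (a : 'I_q) := [forall i in Z, ex a i == 0%N].

Definition aux_set : {set 'I_Q} := [set t | match fintype.split t with
  | inl a => [exists i, (i \notin Z) && (phi i == blk a)] && on_stratum a
  | inr e => match fintype.split e with inl i => i \in Z | inr i => i \in Z end end]%SET.

Definition aux_at (s : 'I_#|aux_set|) : 'I_Q := enum_val s.

Definition stratum_sys (c : 'I_q -> K) j : P :=
  \sum_(a | (blk a == j) && on_stratum a) c a *: mpolyX K (ex a).

Lemma aux_sysE (c : 'I_Q -> K) j :
  sparse_sys (aux_blk \o aux_at) (aux_ex \o aux_at) (c \o aux_at) j =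
  if j \in Z then mpolyC n (c (rshift q (lshift n j))) +
      c (rshift q (rshift n j)) *: mpolyX K (mnm1 j)
  else stratum_sys (fun a => c (lshift (n + n) a)) (phi j).
Proof.
rewrite /sparse_sys /=.
rewrite -(big_enum_val_cond (fun t => aux_blk t == j) (fun t =>
    c t *: mpolyX K (aux_ex t))).
rewrite big_mkcond big_split_ord /= big_split_ord /=.
have spl (a : 'I_q) : fintype.split (lshift (n + n) a) = inl a :> 'I_q + 'I_(n + n).
  by rewrite -[lshift _ a]/(unsplit (inl a)) unsplitK.
have spr (a : 'I_(n + n)) : fintype.split (rshift q a) = inr a :> 'I_q + 'I_(n + n).
  by rewrite -[rshift _ a]/(unsplit (inr a)) unsplitK.
have spl' (a : 'I_n) : fintype.split (lshift n a) = inl a :> 'I_n + 'I_n.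
  by rewrite -[lshift _ a]/(unsplit (inl a)) unsplitK.
have spr' (a : 'I_n) : fintype.split (rshift n a) = inr a :> 'I_n + 'I_n.
  by rewrite -[rshift _ a]/(unsplit (inr a)) unsplitK.
under eq_bigr => a _ do rewrite inE /aux_blk /aux_ex spl.
under [X in _ + (X + _)]eq_bigr => a _ do rewrite inE /aux_blk /aux_ex spr spl'.
under [X in _ + (_ + X)]eq_bigr => a _ do rewrite inE /aux_blk /aux_ex spr spr'.
have two (F : 'I_n -> P) : \sum_i (if (i \in Z) && (i == j) then F i else 0) = if j \in Z
    then F j else 0.
  rewrite (bigD1 j)//= eqxx andbT big1 ?addr0// => i /negPf ->.
  by rewrite andbF.
rewrite !two; case: ifP => jZ.
  rewrite big1 ?add0r ?mpolyX0 -?mul_mpolyC ?mulr1// => a _.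
  case: ifP => // /andP[/andP[/fintype.existsP[i /andP[iZ /eqP <-]] _]].
  by rewrite psiK// => /eqP ij; rewrite ij jZ in iZ.
rewrite !addr0 /stratum_sys [RHS]big_mkcond; apply: eq_bigr => a _.
congr (if _ then _ else _); rewrite -andbA andbC; case: (on_stratum a);
    rewrite ?andbF//= andbT.
apply/idP/idP => [/andP[/eqP pj /fintype.existsP[i /andP[iZ /eqP ib]]]|/eqP ->].
  by rewrite -pj -ib psiK.
rewrite psiK ?jZ// eqxx; apply/fintype.existsP; exists j; by rewrite jZ eqxx.
Qed.

Lemma stratum_sys_mod c j : exists g : 'I_n -> P,
  sparse_sys blk ex c j = stratum_sys c j + \sum_(i in Z) mpolyX K (mnm1 i) * g i.
Proof.
rewrite /sparse_sys (bigID on_stratum) /= -/(stratum_sys c j).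
suff [g ->] : exists g : 'I_n ->
    P, \sum_(a | (blk a == j) && ~~ on_stratum a) c a *: mpolyX K (ex a) =
  \sum_(i in Z) mpolyX K (mnm1 i) * g i by exists g.
apply: (big_ind (fun v : P => exists g : 'I_n ->
    P, v = \sum_(i in Z) mpolyX K (mnm1 i) * g i)).
- by exists (fun=> 0); rewrite big1// => i _; rewrite mulr0.
- move=> _ _ [g ->] [g' ->]; exists (fun i => g i + g' i); rewrite -big_split.
  by apply: eq_bigr => i _; rewrite mulrDr.
- move=> a /andP[_ nZ].
  have [i hi] : exists i, ~~ ((i \in Z) ==> (ex a i == 0%N)) by exact/fintype.forallPn.
  move: hi; rewrite negb_imply => /andP[iZ ai].
  exists (fun i' => if i' == i then c a *: mpolyX K (ex a - mnm1 i)%M else 0).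
  rewrite (bigD1 i)//= eqxx big1 => [|i' /andP[_ /negPf ->]]; last by rewrite mulr0.
  by rewrite addr0 -scalerAr -mpolyXD addmC subm_add// lt0n.
Qed.

End Aux.

Definition strat_ideal (c : 'I_q -> K) (Z : {set 'I_n}) (v : P) := exists s, unit_at0 s /\
  exists g : 'I_n -> P,
      ideal_mem (sparse_sys blk ex c) (s * v - \sum_(i in Z) mpolyX K (mnm1 i) * g i).

(** The restricted equations [phi i] and the equations c + c' x_i for i in Z form a square system,
    finite in the full torus. Substituting the roots of the latter leaves a relation on the stratum,
    where a polynomial in one coordinate with nonzero constant term multiplies a monomial into the
    ideal. *)
Lemma strat_top (Z : {set 'I_n}) (phi : 'I_n -> 'I_n) (c : 'I_Q -> K) :
  {in [predC Z] &, injective phi} ->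
  (forall i, c (rshift q (lshift n i)) != 0) ->
      (forall i, c (rshift q (rshift n i)) != 0) ->
  (forall i, exists2 u : {poly K}, u.[0] != 0 & loc (@monomial K n)
    (sparse_sys (aux_blk Z phi \o @aux_at Z phi) (aux_ex \o @aux_at Z phi) (c \o @aux_at Z
        phi)) (uni i u)) ->
  Z != [set: 'I_n]%SET ->
  exists N, strat_ideal (fun a =>
      c (lshift (n + n) a)) Z (\prod_(i | i \notin Z) mpolyX K (mnm1 i) ^+ N).
Proof.
move=> phi_inj z0 o0 ft ZT.
have [i1 i1Z] : exists i, i \notin Z.
  by apply/fintype.existsP; rewrite -negb_forall; apply: contra ZT => /forallP h;
      apply/eqP/setP => i; rewrite h inE.
have [u u0 [_ [[p ->] [h hE]]]] := ft i1.
(* The root of the auxiliary equation of index i; it is nonzero, so that the monomial denominator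
   keeps a nonzero constant C after the substitution. *)
pose xi i := - c (rshift q (lshift n i)) / c (rshift q (rshift n i)).
pose sg (i : 'I_n) : P := if i \in Z then mpolyC n (xi i) else mpolyX K (mnm1 i).
have sgX m : psubst sg (mpolyX K m) = (\prod_(i in Z) xi i ^+ m i) *:
    \prod_(i | i \notin Z) mpolyX K (mnm1 i) ^+ m i.
  rewrite psubstX (bigID (mem Z)) /= -mul_mpolyC rmorph_prod /=; congr (_ * _).
    by apply: eq_bigr => i iZ; rewrite /sg iZ rmorphXn.
  by apply: eq_bigr => i /negPf iZ; rewrite /sg iZ.
have sgC a : psubst sg (mpolyC n a) = mpolyC n a by exact: comp_mpolyC.
have sgZ a v : psubst sg (a *: v) = a *: psubst sg v by exact: comp_mpolyZ.
have sgM v w : psubst sg (v * w) = psubst sg v * psubst sg w by exact: rmorphM.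
have sgD v w : psubst sg (v + w) = psubst sg v + psubst sg w by exact: raddfD.
have sgS (I : finType) (Pr : pred I) (F : I ->
    P) : psubst sg (\sum_(i | Pr i) F i) = \sum_(i | Pr i) psubst sg (F i).
  exact: raddf_sum.
have xi0 i : xi i != 0 by rewrite mulf_neq0 ?oppr_eq0 ?invr_neq0.
pose C := \prod_(i in Z) xi i ^+ p i.
have C0 : C != 0 by apply/prodf_neq0 => i _; rewrite expf_neq0.
have sgu : psubst sg (uni i1 u) = uni i1 u.
  rewrite uniE sgS; apply: eq_bigr => d _; rewrite sgZ sgX.
  rewrite big1 => [|i iZ]; last first.
    by mnm; case: eqP => [e|_]; [rewrite e iZ in i1Z|rewrite mul0n expr0].
  rewrite scale1r (bigD1 i1)//= big1 => [|i /andP[iZ ii]]; last first.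
    by mnm; rewrite eq_sym (negPf ii) mul0n expr0.
  by mnm; rewrite eqxx mul1n mulr1 -mpolyXn.
have sgf j : psubst sg (sparse_sys (aux_blk Z phi \o @aux_at Z phi) (aux_ex \o @aux_at Z
    phi) (c \o @aux_at Z phi) j) =
    if j \in Z then 0 else stratum_sys Z (fun a => c (lshift (n + n) a)) (phi j).
  rewrite aux_sysE//; case: ifP => jZ.
    rewrite sgD sgC sgZ psubst1 /sg jZ -mul_mpolyC -mpolyCM -mpolyCD.
    by rewrite /xi mulrC divfK// addrN mpolyC0.
  rewrite /stratum_sys sgS; apply: eq_bigr => a /andP[_ /forallP aZ].
  rewrite sgZ sgX [X in _ = _ *: X]mpolyXE_id [in RHS](bigID (mem Z)) /=.
  have az i : i \in Z -> ex a i = 0%N by move=> iZ; have /implyP/(_ iZ)/eqP := aZ i.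
  rewrite big1 => [|i /az ->]; last by rewrite expr0.
  have e1 : \prod_(i in Z) mpolyX K (mnm1 i) ^+ ex a i = 1 :> P.
    by rewrite big1// => i /az ->; rewrite expr0.
  by rewrite e1 mul1r scale1r.
have /choice[G GP] j := stratum_sys_mod Z (fun a => c (lshift (n + n) a)) (phi j).
pose N := mdeg p; exists N.
(* A unit at the origin because u(0) is nonzero; the remaining factor is the monomial whose
   exponents are raised to N by the cofactor R. *)
exists (uni i1 u); split.
  rewrite /unit_at0 uniE raddf_sum /=;
      case: (size u) (size_poly_eq0 u) (horner_coef0 u) => [|d] su0 uc0.
    by move: u0; rewrite -[u](_ : 0 = _) ?horner0 ?eqxx//; apply/esym/eqP; rewrite -su0.
  rewrite big_ord_recl big1 => [|i _]; rewrite mcoeffZ mcoeffX.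
    by rewrite mulm0n eqxx mulr1 addr0 -uc0.
  case: eqP => [/(congr1 (fun m : multinom n => m i1))|]; last by rewrite mulr0.
  by mnm; rewrite eqxx mul1n.
pose R := \prod_(i | i \notin Z) mpolyX K (mnm1 i) ^+ (N - p i) : P.
exists (fun i => - (C^-1 *: (R * \sum_(j | j \notin Z) G j i * psubst sg (h j)))).
exists (fun j' => C^-1 *: (R * \sum_(j | (j \notin Z) && (phi j == j')) psubst sg (h j))).
have key : C *: ((\prod_(i | i \notin Z) mpolyX K (mnm1 i) ^+ p i) * uni i1 u) =
   \sum_(j | j \notin Z) stratum_sys Z (fun a =>
       c (lshift (n + n) a)) (phi j) * psubst sg (h j).
  have := congr1 (psubst sg) hE; rewrite sgM sgX sgu scalerAl => ->.
  rewrite sgS [LHS](bigID (mem Z)) /= big1 ?add0r => [|j jZ].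
    by apply: eq_bigr => j /negPf jZ; rewrite sgM sgf jZ.
  by rewrite sgM sgf jZ mul0r.
have RE : \prod_(i | i \notin Z) mpolyX K (mnm1 i) ^+ N = R * \prod_(i | i \notin Z) mpolyX
    K (mnm1 i) ^+ p i :> P.
  rewrite -big_split /=; apply: eq_bigr => i _; rewrite -exprD subnK//.
  exact: mdeg_ge.
have fE : \sum_j' sparse_sys blk ex (fun a => c (lshift (n + n) a)) j' *
      (C^-1 *: (R * \sum_(j | (j \notin Z) && (phi j == j')) psubst sg (h j))) =
   C^-1 *: (R * \sum_(j | j \notin Z) sparse_sys blk ex (fun a =>
       c (lshift (n + n) a)) (phi j) * psubst sg (h j)).
  rewrite [in RHS](partition_big phi xpredT)//= mulr_sumr scaler_sumr;
      apply: eq_bigr => j' _.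
  rewrite -scalerAr mulrCA; congr (_ *: (_ * _)); rewrite mulr_sumr.
  by apply: eq_bigr => j /andP[_ /eqP ->].
rewrite fE; under [in RHS]eq_bigr => j _ do rewrite GP mulrDl.
rewrite big_split /= -key mulrDr scalerDr; congr (_ + _).
  by rewrite -scalerAr scalerA mulVf// scale1r RE; ring.
under eq_bigr do rewrite mulrN.
rewrite sumrN opprK.
under [in RHS]eq_bigr do rewrite mulr_suml.
rewrite exchange_big mulr_sumr scaler_sumr; apply: eq_bigr => i _ /=.
rewrite -scalerAr mulrCA; congr (_ *: (_ * _)); rewrite mulr_sumr.
by apply: eq_bigr => j _; rewrite mulrA.
Qed.

End Strata.

(** * Volumes as limits of lattice point counts *)

Section Cubes.
Variables (R : realType).

Definition cube n (h : R) (z : multinom n) : set (n.-tuple (measurableTypeR R)) :=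
  [set t | forall i, h * (z i)%:R <= tnth t i < h * (z i).+1%:R].

Lemma cube_measure n h z : 0 < h -> measurable (@cube n h z) /\
  lebesgue_tuple n (cube h z) = (h ^+ n)%:E.
Proof.
move=> h0; have mc n' (z' : multinom n') : measurable (cube h z').
  have -> : cube h z' = \bigcap_(i in [set: 'I_n']) ((fun t =>
      tnth t i) @^-1` `[h * (z' i)%:R, h * (z' i).+1%:R[%classic).
    apply/seteqP; split => [t ht i _|t ht i]; first by rewrite /= in_itv /=; exact: ht.
    by have := ht i I; rewrite /= in_itv.
  apply: fin_bigcap_measurable => [|i _]; first exact: finite_finset.
  by rewrite -[X in measurable X]setTI; apply: measurable_tnth.
split; first exact: mc.
elim: n z => [|n IH] z.
  rewrite /= /dirac expr0 indicE; have -> // : ([tuple] : 0.-tuple R) \in cube h z.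
  by rewrite inE => -[].
pose z' : multinom n := mnm_of (fun i => z (lift ord0 i)).
rewrite /= /lebesgue_prod /pushforward.
have -> : @tuple_cons R n @^-1` cube h z = `[h * (z ord0)%:R,
    h * (z ord0).+1%:R[%classic `*` cube h z'.
  apply/seteqP; split => [[x t] /= ht|[x t] /= [xh ht] i].
    split => /=; first by rewrite in_itv /=; have := ht ord0; rewrite tnth0.
    by move=> i; have := ht (lift ord0 i); rewrite tnthS mnm_ofE.
  case: (unliftP ord0 i) => [j ->|->]; last by rewrite tnth0; move: xh; rewrite in_itv.
  by rewrite tnthS; have := ht j; rewrite mnm_ofE.
rewrite product_measure1E//; last exact: mc.
have L : lebesgue_measure (`[h * (z ord0)%:R, h * (z ord0).+1%:R[%classic : set R) = h%:E.
  rewrite lebesgue_measure_itv /= lte_fin ltr_pM2l// ltr_nat ltnSn.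
  by rewrite -EFinB -mulrBr -natrB// subSnn mulr1.
by rewrite [X in (_ * X)%E]IH [X in (X * _)%E]L -EFinM exprS.
Qed.

Lemma cube_disjoint n (h : R) (z z' : multinom n) t : 0 < h -> cube h z t ->
    cube h z' t -> z = z'.
Proof.
move=> h0 tz tz'; apply/mnmP => i.
have /andP[a1 a2] := tz i; have /andP[b1 b2] := tz' i.
have := le_lt_trans a1 b2; have := le_lt_trans b1 a2.
by rewrite !ltr_pM2l// !ltr_nat => ? ?; lia.
Qed.

Definition cubes n (h : R) (s : seq (multinom n)) : set (n.-tuple (measurableTypeR R)) :=
  [set t | exists2 z, z \in s & cube h z t].

Lemma cubes_measure n h (s : seq (multinom n)) : 0 < h -> uniq s ->
    measurable (cubes h s) /\
  lebesgue_tuple n (cubes h s) = ((size s)%:R * h ^+ n)%:E.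
Proof.
move=> h0; elim: s => [|z s IH] /=.
  have -> : cubes h ([::] : seq (multinom n)) = set0 by apply/seteqP; split => // t [].
  by rewrite measure0 mul0r.
move=> /andP[zs /IH[mS mE]].
have -> : cubes h (z :: s) = cube h z `|` cubes h s.
  apply/seteqP; split => [t [z']|t [tz|[z' zs' tz']]].
  - by rewrite inE => /orP[/eqP -> tz|zs' tz']; [left|right; exists z'].
  - by exists z; rewrite ?mem_head.
  - by exists z' => //; rewrite inE zs' orbT.
have [mz Ez] := cube_measure z h0.
split; first exact: measurableU.
rewrite measureU//; last first.
  apply/seteqP; split => // t [tz [z' z's tz']]; move: zs.
  by rewrite (cube_disjoint h0 tz tz') z's.
rewrite [X in (X + _)%E]Ez [X in (_ + X)%E]mE -EFinD; congr EFin.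
by rewrite -[in RHS]addn1 natrD mulrDl mul1r addrC.
Qed.

Lemma finite_bounded n (P : multinom n -> Prop) (B : nat) :
  (forall z, P z -> forall i, (z i <= B)%N) -> exists N, finite_of_size P N.
Proof.
move=> PB.
pose s := [seq mnm_of (fun i => val (f i)) | f : {ffun 'I_n ->
    'I_B.+1} <- enum {: {ffun 'I_n -> 'I_B.+1}}].
pose s' := undup [seq z <- s | `[< P z >]].
exists (size s'), s'; split; rewrite ?undup_uniq// => z.
rewrite mem_undup mem_filter; split => [Pz|/andP[/asboolP]//].
apply/andP; split; first exact/asboolP.
apply/mapP; exists [ffun i => inord (z i)]; rewrite ?mem_enum//.
by apply/mnmP => i; rewrite mnm_ofE ffunE /= inordK// ltnS; exact: PB.
Qed.

Lemma cube_floor n (h : R) (t : n.-tuple (measurableTypeR R)) : 0 < h ->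
  (forall i, 0 <= tnth t i) -> exists z : multinom n, cube h z t.
Proof.
move=> h0 t0; exists (mnm_of (fun i => Num.truncn (tnth t i / h))) => i.
have ti : 0 <= tnth t i / h by rewrite divr_ge0// ltW.
have /andP[a b] := truncn_itv ti.
rewrite mnm_ofE mulrC -ler_pdivlMr// a /= mulrC -ltr_pdivrMr//.
Qed.

Section CountVolume.
Variables (n : nat) (Q : set 'rV[R]_n) (B : nat).
Hypothesis clQ : closed Q.
Hypothesis Q0 : forall p, Q p -> forall i, 0 <= p 0 i <= B%:R.

Local Notation mu := (@lebesgue_tuple R n).
Let QT : set (n.-tuple (measurableTypeR R)) := @row_of_tuple R n @^-1` Q.

Definition near_set (h : R) : set (n.-tuple (measurableTypeR R)) :=
  [set t | (forall i, 0 <= tnth t i) /\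
      exists2 p, Q p & forall i, `|tnth t i - p 0 i| <= h].

Let hm (m : nat) : R := 2^-1 ^+ m.

Let hm0 m : 0 < hm m. Proof. by rewrite exprn_gt0// invr_gt0. Qed.

Let hmS m : hm m = hm m.+1 + hm m.+1.
Proof. by rewrite /hm exprS; field. Qed.

(** Finite unions of dyadic cubes, nested for growing m because cubes of step m + 1 reach no further
    than the neighbourhood covered at step m; their intersection is the closed set itself. *)
Lemma near_set_cover m : exists s : seq (multinom n), [/\ uniq s,
  near_set (hm m) `<=` cubes (hm m) s & cubes (hm m) s `<=` near_set (hm m + hm m)].
Proof.
pose P (z : multinom n) := exists2 t, near_set (hm m) t & cube (hm m) z t.
have [|N [s [us _ sP]]] := @finite_bounded n P ((B + 1) * 2 ^ m).
  move=> z [t [_ [p Qp tp]] zt] i; have /andP[a _] := zt i; have /andP[_ c] := Q0 Qp i.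
  have := tp i; rewrite ler_norml => /andP[_ d].
  have hm1 : hm m <= 1 by rewrite exprn_ile1// ?invr_ge0// invf_le1// ler1n.
  rewrite -(ler_nat R) natrM natrX -ler_pdivrMr ?exprn_gt0// -exprVn mulrC natrD.
  by rewrite -/(hm m); lra.
exists s; split => //.
  move=> t nt; have [z zt] := cube_floor (hm0 m) nt.1.
  by exists z => //; apply/sP; exists t.
move=> t [z /sP[t' [t'0 [p Qp tp]] zt'] zt]; split => [i|].
  by have /andP[a _] := zt i; apply: le_trans a; rewrite mulr_ge0// ltW.
exists p => // i; have /andP[a b] := zt i; have /andP[a' b'] := zt' i.
have := tp i; rewrite !ler_norml -addn1 natrD mulrDr mulr1 in b b' * => /andP[c d].
by apply/andP; split; lra.
Qed.

Lemma closed_near t : (forall m, near_set (hm m) t) -> Q (row_of_tuple t).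
Proof.
move=> h; apply: clQ => U /nbhs_ballP[e /= e0 eU].
have [m me] : exists m, hm m < e.
  have /cvgrPdist_lt/(_ e e0)[m _ /(_ m (leqnn m))] : (fun m => hm m) @ \oo --> (0 : R).
    by apply: cvg_expr; rewrite ger0_norm ?invr_ge0// invf_lt1// ltr1n.
  by rewrite /= sub0r normrN gtr0_norm// => me; exists m.
have [_ [p Qp tp]] := h m; exists p; split => //; apply: eU; split => // i j.
rewrite (ord1 i) mxE -ball_normE /=; apply: le_lt_trans me; exact: tp.
Qed.

Lemma near_in h : 0 <= h -> QT `<=` near_set h.
Proof.
move=> h0 t Qt; split => [i|]; first by have /andP[] := Q0 Qt i; rewrite mxE.
by exists (row_of_tuple t) => // i; rewrite mxE subrr normr0.
Qed.

Lemma near_le h h' : h <= h' -> near_set h `<=` near_set h'.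
Proof. by move=> hh t [t0 [p Qp tp]]; split => //; exists p => // i;
    exact: le_trans (tp i) hh. Qed.

Variables (P : nat -> multinom n -> Prop) (cnt : nat -> nat) (C : R) (s0 : multinom n).
Hypothesis cntP : forall N, finite_of_size (P N) (cnt N).
Hypothesis PQ : forall N z, P N z ->
    exists2 p, Q p & forall i, `|(z i)%:R - N%:R * p 0 i| <= C.
Hypothesis QP : forall N p (z : multinom n), Q p ->
  (forall i, (z i)%:R <= N%:R * p 0 i < (z i).+1%:R) -> P N (z + s0)%M.

(** From above, the scaled lattice points together with their unit cubes lie in a small
    neighbourhood of Q, whose measure tends to that of Q. From below, the floors of the points of N
    Q count after a fixed shift [s0], and their cubes cover Q. *)
Theorem count_volume : [/\ measurable QT, mu QT = (volume Q)%:E &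
  (fun N => (cnt N)%:R / N%:R ^+ n) @ \oo --> (volume Q : R)].
Proof.
have [s sP] := choice near_set_cover.
pose G m := cubes (hm m) (s m).
have GE m := cubes_measure (hm0 m) (let: And3 u _ _ := sP m in u).
have mG m : measurable (G m) by have [] := GE m.
have QE : QT = \bigcap_m G m.
  apply/seteqP; split => [t Qt m _|t Gt].
    by have [_ + _] := sP m; apply; apply: near_in Qt; exact: ltW.
  apply: closed_near => m; rewrite hmS; have [_ _ +] := sP m.+1; apply; exact: Gt.
have mQ : measurable QT by rewrite QE; exact: bigcapT_measurable.
have muG m : (mu (G m) < +oo)%E by rewrite (GE m).2 ltry.
have muQ : (mu QT < +oo)%E.
  apply: le_lt_trans (muG 0%N); apply: le_measure; rewrite ?inE// QE; exact: bigcap_inf.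
have vQ : mu QT = (volume Q)%:E.
  by rewrite /volume fineK// ge0_fin_numE.
have Gdec : nonincreasing_seq G.
  apply/nonincreasing_seqP => m; apply/subsetPset => t.
  have [_ h1 _] := sP m; have [_ _ h2] := sP m.+1.
  by move=> /h2; rewrite -hmS; exact: h1.
have Gcvg : mu \o G @ \oo --> mu QT.
  rewrite QE; apply: nonincreasing_cvg_mu => //; first exact: muG.
  by move: mQ; rewrite [X in measurable X]QE.
have upper e : 0 < e -> \forall N \near \oo, (cnt N)%:R / N%:R ^+ n <= volume Q + e.
  move=> e0.
  have [m Gm] : exists m, fine (mu (G m)) <= volume Q + e.
    have /cvgrPdist_lt/(_ e e0)[m _ /(_ m (leqnn m))] : fine \o (mu \o G) @ \oo --> volume
        Q.
      by apply: fine_cvg; rewrite -vQ.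
    rewrite /= ltr_norml => /andP[+ _]; rewrite ltrBrDr addrC => ?; exists m; lra.
  near=> N.
  have N0 : 0 < N%:R :> R by rewrite ltr0n; near: N; exact: nbhs_infty_gt.
  (* Distance C from N Q to the lattice point, plus 1 for the side of its cube. *)
  have CN : (C + 1) / N%:R <= hm m.
    rewrite ler_pdivrMr// mulrC -ler_pdivrMr//; near: N; exact: nbhs_infty_ger.
  apply: le_trans Gm.
  have [t [ut st tP]] := cntP N.
  have NV : 0 < N%:R^-1 :> R by rewrite invr_gt0.
  have [mt tE] := cubes_measure NV ut.
  rewrite -lee_fin fineK ?ge0_fin_numE// -exprVn -st -tE.
  apply: le_measure; rewrite ?inE//.
  move=> x [z /tP/PQ[p Qp zp] zx]; have [_ + _] := sP m; apply; apply: (near_le CN);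
      split => [i|].
    by have /andP[a _] := zx i; apply: le_trans a; rewrite mulr_ge0// ltW.
  exists p => // i; have /andP[a b] := zx i.
  have Nn : N%:R != 0 :> R by rewrite lt0r_neq0.
  rewrite -[tnth x i](mulKf Nn) -[p 0 i](mulKf Nn) -mulrBr normrM gtr0_norm// mulrC.
  rewrite ler_pM2r//; move: a b;
      rewrite ![N%:R^-1 * _]mulrC ler_pdivrMr// ltr_pdivlMr// => a b.
  have := zp i; rewrite !ler_norml => /andP[c d]; rewrite -addn1 natrD in b.
  by apply/andP; split; lra.
have lower : \forall N \near \oo, volume Q <= (cnt N)%:R / N%:R ^+ n.
  near=> N.
  have N0 : 0 < N%:R :> R by rewrite ltr0n; near: N; exact: nbhs_infty_gt.
  have NV : 0 < N%:R^-1 :> R by rewrite invr_gt0.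
  pose F (z : multinom n) := exists2 p, Q p & forall i,
      (z i)%:R <= N%:R * p 0 i < (z i).+1%:R.
  have [|M MF] := @finite_bounded n F (N * B).
    move=> z [p Qp zp] i; have /andP[a _] := zp i; have /andP[_ c] := Q0 Qp i.
    by rewrite -(ler_nat R) natrM; apply: le_trans a _; rewrite ler_pM2l.
  have Mc : (M <= cnt N)%N.
    apply: (finite_of_size_inj (f := fun z => (z + s0)%M)) MF (cntP N).
      by move=> x y _ _ /eqP; rewrite eqm_add2r => /eqP.
    by move=> z [p Qp zp]; exact: QP zp.
  have [t [ut st tP]] := MF; have [mt tE] := cubes_measure NV ut.
  apply: (@le_trans _ _ (M%:R / N%:R ^+ n));
      last by rewrite ler_pM2r ?ler_nat// invr_gt0 exprn_gt0.
  rewrite -lee_fin -vQ -exprVn -st -tE.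
  apply: le_measure; rewrite ?inE// => x Qx.
  have [|z zx] := @cube_floor n N%:R^-1 x NV.
    by move=> i; have /andP[] := Q0 Qx i; rewrite mxE.
  exists z => //; apply/tP; exists (row_of_tuple x) => // i.
  have := zx i; rewrite mxE ![N%:R^-1 * _]mulrC ler_pdivrMr// ltr_pdivlMr//.
  by rewrite mulrC.
split => //; apply/cvgrPdist_le => e e0; near=> N.
have h1 : (cnt N)%:R / N%:R ^+ n <= volume Q + e by near: N; exact: upper.
have h2 : volume Q <= (cnt N)%:R / N%:R ^+ n by near: N.
rewrite ler_norml; apply/andP; split; lra.
Unshelve. all: by end_near.
Qed.

End CountVolume.
End Cubes.

(** * Polytopes as images of bounded linear programs *)

Section LP.
Variable (R : realType).

Lemma rV_nbhs_filter q (x : 'rV[R]_q) : Filter (nbhs x).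
Proof. exact: nbhs_filter. Qed.

Lemma continuous_dot q (w : 'I_q ->
    R) : continuous (fun l : 'rV[R]_q => \sum_a l 0 a * w a).
Proof.
move=> x; have FF := rV_nbhs_filter x; rewrite /continuous_at.
elim: (index_enum _) => [|a r IH].
  by rewrite big_nil; under eq_cvg do rewrite big_nil; exact: cvg_cst.
rewrite big_cons; under eq_cvg do rewrite big_cons.
apply: cvgD => //; apply: cvgM; last exact: cvg_cst.
exact: coord_continuous.
Qed.

Lemma continuous_mulmx q n (V : 'M[R]_(q, n)) : continuous (fun l : 'rV[R]_q => l *m V).
Proof.
move=> x; have FF := rV_nbhs_filter x; move=> U /nbhs_ballP[e /= e0 eU].
have h0 j : \forall y \near x, ball ((x *m V) 0 j) e ((y *m V) 0 j).
  have hb : nbhs (\sum_a x 0 a * V a j) (ball (\sum_a x 0 a * V a j) e) by exact: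
      nbhsx_ballx.
  have := @continuous_dot q (fun a => V a j) x _ hb.
  by apply: (@filterS _ _ FF) => y; rewrite /= !mxE.
have h1 : \forall y \near x, forall j, ball ((x *m V) 0 j) e ((y *m V) 0 j).
  exact: (@filter_forall _ 'I_n (fun j y => ball ((x *m V) 0 j) e ((y *m V) 0 j)) _ FF h0).
apply: (@filterS _ _ FF _ _ _ h1) => y h; apply: eU; split => // i j.
by rewrite (ord1 i); exact: h.
Qed.

Section Program.
Variables (q r : nat) (E : 'M[R]_(q, r)) (w : 'rV[R]_r) (B : R).

Definition feasible : set 'rV[R]_q :=
  [set l : 'rV[R]_q | (forall a : 'I_q, 0 <= l 0 a <= B) /\ l *m E = w].

Lemma feasible_compact : compact feasible.
Proof.
apply: (@subclosed_compact _ _ [set l : 'rV[R]_q | forall a, `[0, B]%classic (l 0 a)]).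
- have -> : feasible = (\bigcap_(a in [set: 'I_q]) [set l : 'rV[R]_q | l 0 a \in `[0,
    B]%classic]) `&`
      (\bigcap_(j in [set: 'I_r]) [set l : 'rV[R]_q | \sum_a l 0 a * E a j = w 0 j]).
    apply/seteqP; split => [l [l0 le]|l [l0 le]]; split.
    + by move=> a _ /=; rewrite inE /= in_itv /=; exact: l0.
    + by move=> j _ /=; rewrite -le mxE.
    + by move=> a; have := l0 a I; rewrite /= inE /= in_itv.
    + by apply/rowP => j; rewrite mxE; exact: (le j I).
  apply: closedI; apply: closed_bigI => i _.
    have -> : [set l : 'rV[R]_q | l 0 i \in `[0,
        B]%classic] = (fun l : 'rV[R]_q => l 0 i) @^-1` `[0, B]%classic.
      by apply/seteqP; split => l; rewrite /= inE.
    apply: (proj1 (continuous_closedP _) _); last exact: itv_closed.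
    exact: coord_continuous.
  have -> : [set l : 'rV[R]_q | \sum_a l 0 a * E a i = w 0 i] =
     (fun l : 'rV[R]_q => \sum_a l 0 a * E a i) @^-1` [set x | x = w 0 i] by [].
  by apply: (proj1 (continuous_closedP _) (@continuous_dot _ _)); exact: closed_eq.
- by apply: (@rV_compact R q (fun=> `[0, B]%classic)) => i; exact: segment_compact.
- by move=> l [l0 _] a; rewrite /= in_itv /=; exact: l0.
Qed.

Lemma feasible_image_closed n (V : 'M[R]_(q, n)) : closed [set l *m V | l in feasible].
Proof.
apply: compact_closed; first exact: norm_hausdorff.
apply: continuous_compact; last exact: feasible_compact.
exact/continuous_subspaceT/continuous_mulmx.
Qed.

Lemma feasible_min (v : 'I_q -> R) : feasible !=set0 ->
  exists2 l, feasible l & forall l', feasible l' ->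
      \sum_a l 0 a * v a <= \sum_a l' 0 a * v a.
Proof.
move=> F0; have [||l] := @EVT_min_rV R q (fun l => \sum_a l 0 a * v a) feasible F0.
- exact: feasible_compact.
- exact/continuous_subspaceT/continuous_dot.
rewrite inE => Fl h; exists l => // l' Fl'; apply: h; exact/mem_set.
Qed.

End Program.
End LP.

Section Hulls.
Variable (R : realType).

Lemma convE n (x y : 'rV[R]_n) (t : {i01 R}) :
  @conv R (convex_lmodType 'rV[R]_n) t x y = t%:num *: x + (1 - t%:num) *: y.
Proof. by []. Qed.

Lemma convex_comb n (C : set 'rV[R]_n) (I : finType) (v : I -> 'rV[R]_n) (l : I ->
    R) (Pr : pred I) :
  @convex_set R 'rV[R]_n C -> (forall a, Pr a -> C (v a)) -> (forall a, 0 <= l a) ->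
  \sum_(a | Pr a) l a = 1 -> C (\sum_(a | Pr a) l a *: v a).
Proof.
move=> cC; have [N] := ubnP #|Pr|; elim: N Pr l => // N IH Pr l PN Cv l0 l1.
have [a Pa] : exists a, Pr a.
  apply: contrapT => h; move: l1; rewrite big1 => [/esym/eqP|a Pa];
      first by rewrite oner_eq0.
  by exfalso; apply: h; exists a.
pose s := \sum_(b | Pr b && (b != a)) l b.
have ls : l a + s = 1 by rewrite -l1 (bigD1 a).
have s0 : 0 <= s by apply: sumr_ge0.
rewrite (bigD1 a)//=; have [se|sn] := eqVneq s 0.
  rewrite big1 => [|b Pb]; last first.
    have /eqP := se; rewrite psumr_eq0// => /allP/(_ b (mem_index_enum b)).
    by rewrite Pb => /eqP ->; rewrite scale0r.
  have -> : l a = 1 by move: ls; rewrite se addr0.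
  by rewrite scale1r addr0; exact: Cv.
have sp : 0 < s by rewrite lt_neqAle eq_sym sn.
have Cx : C (\sum_(b | Pr b && (b != a)) (l b / s) *: v b).
  apply: (IH (fun b => Pr b && (b != a)) (fun b => l b / s)).
  - rewrite -ltnS; apply: leq_trans PN; rewrite ltnS; apply: proper_card; apply/properP;
      split.
      by apply/fintype.subsetP => b /andP[].
    by exists a => //; rewrite unfold_in eqxx andbF.
  - by move=> b /andP[/Cv].
  - by move=> b; rewrite divr_ge0.
  - by rewrite -mulr_suml divff.
have la : 0 <= l a <= 1 by rewrite l0 /=; lra.
have /andP[la0 la1] := la.
have := cC (v a) _ (Itv01 la0 la1) (mem_set (Cv a Pa)) (mem_set Cx).
rewrite inE convE /=; congr C; congr (_ + _).
rewrite scaler_sumr; apply: eq_bigr => b _; rewrite scalerA; congr (_ *: _).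
by rewrite -ls addrC addKr mulrC divfK.
Qed.

Lemma conv_hullE n (I : finType) (v : I -> 'rV[R]_n) (Pr : pred I) :
  conv_hull [set v a | a in [set a | Pr a]] =
  [set \sum_(a | Pr a) l a *: v a | l in [set l : I ->
      R | (forall a, 0 <= l a) /\ \sum_(a | Pr a) l a = 1]].
Proof.
apply/seteqP; split; last first.
  move=> _ [l [l0 l1] <-] C [cC vC]; apply: convex_comb => // a Pa; apply: vC.
  by exists a.
apply: smallest_sub => [x y t|_ [a Pa <-]]; rewrite ?inE.
  move=> [l [l0 l1] <-] [l' [l0' l1'] <-].
  exists (fun a => t%:num * l a + (1 - t%:num) * l' a).
    split=> [a|]; last by rewrite big_split /= -!mulr_sumr l1 l1'; lra.
    by rewrite addr_ge0// mulr_ge0// subr_ge0.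
  rewrite convE !scaler_sumr -big_split; apply: eq_bigr => a _ /=.
  by rewrite [in LHS]scalerDl !scalerA.
exists (fun b => (b == a)%:R); first split => [b|]; first exact: ler0n.
  by rewrite (bigD1 a)//= eqxx big1 ?addr0// => b /andP[_ /negPf ->].
rewrite (bigD1 a)//= eqxx big1 ?addr0 ?scale1r// => b /andP[_ /negPf ->].
by rewrite scale0r.
Qed.

Lemma minkowski_hullE n (I J : finType) (blk : I -> J) (v : I -> 'rV[R]_n) (S : {set J}) :
  minkowski_sum S (fun j => conv_hull [set v a | a in [set a | blk a == j]]) =
  [set \sum_a l a *: v a | l in [set l : I -> R | (forall a, 0 <= l a) /\
     forall j, \sum_(a | blk a == j) l a = (j \in S)%:R]].
Proof.
apply/seteqP; split => [_ [y yP <-]|_ [l [l0 l1] <-]].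
  have /choice[L LP] j : exists l : I -> R, j \in S ->
      [/\ forall a, 0 <= l a, \sum_(a | blk a == j) l a = 1 &
      \sum_(a | blk a == j) l a *: v a = y j].
    have [jS|_] := boolP (j \in S); last by exists (fun=> 0).
    by have := yP j jS; rewrite conv_hullE => -[l [l0 l1] <-]; exists l.
  exists (fun a => if blk a \in S then L (blk a) a else 0).
    split=> [a|j]; first by case: ifP => // /LP[+ _ _]; apply.
    have [jS|jS] := boolP (j \in S).
      by have [_ <- _] := LP j jS; apply: eq_bigr => a /eqP ->; rewrite jS.
    by rewrite big1// => a /eqP ->; rewrite (negPf jS).
  rewrite (partition_big blk xpredT)//= [RHS]big_mkcond; apply: eq_bigr => j _.
  case: ifP => jS; last by rewrite big1// => a /eqP ->; rewrite jS scale0r.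
  by have [_ _ <-] := LP j jS; apply: eq_bigr => a /eqP ->; rewrite jS.
exists (fun j => \sum_(a | blk a == j) l a *: v a).
  by move=> j jS; rewrite conv_hullE; exists l => //; split => //; rewrite l1 jS.
rewrite [RHS](partition_big blk xpredT)//= [LHS]big_mkcond; apply: eq_bigr => j _.
case: ifP => // jS; have := l1 j; rewrite jS => /eqP; rewrite psumr_eq0// => /allP h.
rewrite big1// => a aj; have := h a (mem_index_enum a).
by rewrite aj => /eqP ->; rewrite scale0r.
Qed.

End Hulls.

Section BoxVolume.
Variables (R : realType) (n q : nat) (blk : 'I_q -> 'I_n) (ex : 'I_q -> multinom n).
Hypothesis blk_onto : forall j, exists a, blk a = j.

Definition pt_of (m : multinom n) : 'rV[R]_n := \row_i (m i)%:R.

Definition block_pts (j : 'I_n) : set 'rV[R]_n :=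
  [set pt_of (ex a) | a in [set a | blk a == j]].

Definition sum_hull (S : {set 'I_n}) := minkowski_sum S (fun j => conv_hull (block_pts j)).

Lemma sum_hullE S : sum_hull S = [set \sum_a l a *: pt_of (ex a) | l in
  [set l : 'I_q -> R | (forall a, 0 <= l a) /\
      forall j, \sum_(a | blk a == j) l a = (j \in S)%:R]].
Proof. exact: minkowski_hullE. Qed.

Lemma block_le (l : 'I_q -> R) (S : {set 'I_n}) a : (forall a, 0 <= l a) ->
  (forall j, \sum_(a | blk a == j) l a = (j \in S)%:R) -> l a <= (blk a \in S)%:R.
Proof.
by move=> l0 l1; rewrite -l1 (bigD1 a)//= lerDl sumr_ge0.
Qed.

Lemma sum_hull_closed S : closed (sum_hull S).
Proof.
pose E : 'M[R]_(q, n) := \matrix_(a, j) (blk a == j)%:R.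
pose V : 'M[R]_(q, n) := \matrix_(a, i) (ex a i)%:R.
have -> : sum_hull S = [set l *m V | l in feasible E (\row_j (j \in S)%:R) 1].
  rewrite sum_hullE; apply/seteqP; split => [_ [l [l0 l1] <-]|_ [l [l0 l1] <-]].
    exists (\row_a l a); last first.
      apply/rowP => i; rewrite !mxE summxE; apply: eq_bigr => a _; by rewrite !mxE.
    split=> [a|]; first by rewrite mxE l0 (le_trans (block_le a l0 l1))//; case: (_ \in _).
    apply/rowP => j; rewrite !mxE -l1 [RHS]big_mkcond; apply: eq_bigr => a _.
    by rewrite !mxE; case: eqP; rewrite ?mulr1 ?mulr0.
  exists (fun a => l 0 a).
    split=> [a|j]; first by have /andP[] := l0 a.
    move/rowP: l1 => /(_ j); rewrite !mxE => <-; rewrite [LHS]big_mkcond;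
        apply: eq_bigr => a _.
    by rewrite !mxE; case: eqP; rewrite ?mulr1 ?mulr0.
  by apply/rowP => i; rewrite !mxE summxE; apply: eq_bigr => a _; rewrite !mxE.
exact: feasible_image_closed.
Qed.

Let T := (\sum_a mdeg (ex a))%N.

Let exT a i : (ex a i <= T)%N.
Proof. by apply: leq_trans (mdeg_ge _ _) _; rewrite /T (bigD1 a)//= leq_addr. Qed.

(** A cube of this side absorbs rounding: T bounds the error from rounding down all weights, and in
    each of the n blocks at most q units of degree are lost and restored at a point with coordinates
    at most T. *)
Definition box_bound := (T + n * (q * T))%N.

Variables (b : nat) (k1 : multinom n) (S : {set 'I_n}) (cnt : multinom n -> nat).
Hypothesis bb : (box_bound <= b)%N.
Hypothesis cntP : forall k, finite_of_size (box_module blk ex b k) (cnt k).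

(** Up to a bounded error the points of X in degree k1 + N 1_S are the lattice points of N times the
    Minkowski sum over S. *)
Lemma box_volume : [/\ measurable (@row_of_tuple R n @^-1` sum_hull S),
  lebesgue_tuple n (@row_of_tuple R n @^-1` sum_hull S) = (volume (sum_hull S))%:E &
  (fun N => (cnt (box_shift N k1 S))%:R / N%:R ^+ n) @ \oo --> (volume (sum_hull S) : R)].
Proof.
have [al alP] := choice blk_onto.
pose kk N j := (k1 j + (if j \in S then N else 0))%N.
have kkE N j : box_shift N k1 S j = kk N j by rewrite /box_shift; mnm; rewrite mnm_ofE.
have sp (p : 'rV[R]_n) l : p = \sum_a l a *: pt_of (ex a) ->
    forall i, p 0 i = \sum_a l a * (ex a i)%:R.
  by move=> -> i; rewrite summxE; apply: eq_bigr => a _; rewrite !mxE.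
pose C : R := b%:R + \sum_a (k1 (blk a))%:R * T%:R.
(* The shift exceeds what is needed to fill up the degrees at the chosen points [al j], so that the
   cube coordinate y below is nonnegative. *)
pose s0 : multinom n := mnm_of (fun i => \sum_j (k1 j + q) * ex (al j) i)%N.
apply: (@count_volume R n (sum_hull S) T (@sum_hull_closed S) _
   (fun N => box_module blk ex b (box_shift N k1 S)) (fun N =>
       cnt (box_shift N k1 S)) C s0).
- move=> p; rewrite sum_hullE => -[l [l0 l1] /esym/sp pE] i; rewrite pE; apply/andP; split.
    by apply: sumr_ge0 => a _; rewrite mulr_ge0.
  rewrite /T natr_sum; apply: ler_sum => a _.
  apply: (@le_trans _ _ (ex a i)%:R); last by rewrite ler_nat mdeg_ge.
  rewrite ler_piMl//; apply: le_trans (block_le a l0 l1) _; by case: (_ \in _).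
- by move=> N; exact: cntP.
- move=> N z /box_moduleP[u [y [uk yb zE]]].
  have uj j : (\sum_(a | blk a == j) u a = kk N j)%N by rewrite -wdgE uk kkE.
  (* Multiplicities are normalized by the degree of the block. When this degree is 0, which forces N
     = 0, the weight is put on the point [al]; indices outside S have bounded multiplicity and are
     dropped. *)
  pose l a : R := if blk a \in S then
    (if kk N (blk a) == 0%N then (a == al (blk a))%:R else (u a)%:R / (kk N (blk a))%:R)
        else 0.
  have l0 a : 0 <= l a by rewrite /l; case: ifP => // _; case: ifP => // _;
      rewrite divr_ge0.
  have l1 j : \sum_(a | blk a == j) l a = (j \in S)%:R.
    have [jS|jS] := boolP (j \in S); last first.
      by rewrite big1// => a /eqP aj; rewrite /l aj (negPf jS).
    have [k0|k0] := eqVneq (kk N j) 0%N.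
      rewrite (bigD1 (al j)) ?alP//= big1 => [|a /andP[/eqP aj /negPf anj]].
        by rewrite /l alP jS k0 eqxx eqxx addr0.
      by rewrite /l aj jS k0 eqxx anj.
    transitivity (\sum_(a | blk a == j) (u a)%:R / (kk N j)%:R : R).
      by apply: eq_bigr => a /eqP aj; rewrite /l aj jS (negPf k0).
    by rewrite -mulr_suml -natr_sum uj divff// pnatr_eq0.
  exists (\sum_a l a *: pt_of (ex a)); first by rewrite sum_hullE; exists l.
  move=> i; rewrite (sp _ l erefl) zE; mnm; rewrite wptE natrD natr_sum.
  rewrite mulr_sumr -addrA -sumrB.
  have d0 a : (0 : R) <= (u a)%:R - N%:R * l a <= (k1 (blk a))%:R.
    have ule : (u a <= kk N (blk a))%N by rewrite -uj (bigD1 a)//= leq_addr.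
    rewrite /l; case: ifP => [jS|jS]; last first.
      by rewrite mulr0 subr0 ler0n ler_nat; move: ule; rewrite /kk jS addn0.
    case: eqP => [k0|/eqP k0].
      have N0 : N = 0%N by move: k0; rewrite /kk jS; lia.
      have -> : u a = 0%N by move: ule; rewrite k0; lia.
      by rewrite N0 mul0r subr0 lexx ler0n.
    have kE : (kk N (blk a))%:R = (k1 (blk a))%:R + N%:R :> R by rewrite /kk jS natrD.
    have kp : 0 < (kk N (blk a))%:R :> R by rewrite ltr0n lt0n.
    have uq : (u a)%:R / (kk N (blk a))%:R <= 1 :> R by rewrite ler_pdivrMr// mul1r ler_nat.
    have up : 0 <= (u a)%:R / (kk N (blk a))%:R :> R by rewrite divr_ge0.
    have ut : (u a)%:R / (kk N (blk a))%:R * (kk N (blk a))%:R = (u a)%:R :> R by rewrite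
        divfK// lt0r_neq0.
    move: ut uq up; set t := _ / _ => ut uq up; rewrite -ut kE.
    have k1p : 0 <= (k1 (blk a))%:R :> R by [].
    have -> : t * ((k1 (blk a))%:R + N%:R) - N%:R * t = t * (k1 (blk a))%:R by ring.
    by rewrite mulr_ge0//= ler_piMl.
  have -> : \sum_a ((ex a i * u a)%:R - N%:R * (l a * (ex a i)%:R)) =
      \sum_a ((u a)%:R - N%:R * l a) * (ex a i)%:R :> R.
    by apply: eq_bigr => a _; rewrite natrM; ring.
  have s0' : 0 <= \sum_a ((u a)%:R - N%:R * l a) * (ex a i)%:R :> R.
    by apply: sumr_ge0 => a _; rewrite mulr_ge0//; have /andP[] := d0 a.
  rewrite ger0_norm ?addr_ge0// lerD ?ler_nat//; apply: ler_sum => a _.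
  have /andP[? ?] := d0 a; by rewrite ler_pM// ler_nat.
- move=> N p z; rewrite sum_hullE => -[l [l0 l1] /esym/sp pE] zp.
  pose f a := Num.truncn (N%:R * l a).
  have fP a : (f a)%:R <= N%:R * l a < (f a)%:R + 1.
    by have := truncn_itv (mulr_ge0 (ler0n R N) (l0 a)); rewrite -[X in _ < X]natr1.
  have fj j : (\sum_(a | blk a == j) f a <= (if j \in S then N else 0))%N.
    rewrite -(ler_nat R) natr_sum;
        apply: (@le_trans _ _ (\sum_(a | blk a == j) N%:R * l a)).
      by apply: ler_sum => a _; have /andP[] := fP a.
    by rewrite -mulr_sumr l1; case: ifP => _; rewrite ?mulr1 ?mulr0.
  (* The degree lost in the block j by rounding down, less than one unit per index. *)
  pose r j := ((if j \in S then N else 0) - \sum_(a | blk a == j) f a)%N.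
  have rq j : (r j <= q)%N.
    rewrite -(ler_nat R) /r natrB//.
    have -> : (if j \in S then N else 0)%:R = \sum_(a | blk a == j) N%:R * l a :> R.
      by rewrite -mulr_sumr l1; case: ifP => _; rewrite ?mulr1 ?mulr0.
    rewrite natr_sum -sumrB; apply: (@le_trans _ _ (\sum_(a | blk a == j) 1)).
      by apply: ler_sum => a _; have /andP[_ ?] := fP a; rewrite lerBlDl ltW.
    by rewrite sumr_const ler_nat -[X in (_ <= X)%N]card_ord max_card.
  pose u : multinom q := mnm_of (fun a =>
      f a + (if a == al (blk a) then k1 (blk a) + r (blk a) else 0))%N.
  have uE a : u a = (f a + (if a == al (blk a) then k1 (blk a) +
      r (blk a) else 0))%N by rewrite mnm_ofE.
  have alsum (F : 'I_n -> 'I_q -> nat) (Pr : pred 'I_n) :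
      (\sum_(a | Pr (blk a)) (if a == al (blk a) then F (blk a) a else 0) = \sum_(j | Pr j)
          F j (al j))%N.
    rewrite (partition_big blk Pr)//=; apply: eq_bigr => j Pj.
    rewrite (bigD1 (al j)) ?alP ?Pj ?eqxx//= big1 ?addn0// =>
        a /andP[/andP[_ /eqP ->] /negPf anj].
    by rewrite anj.
  have wE i : wpt ex u i = (\sum_a ex a i * f a + \sum_j (k1 j + r j) * ex (al j) i)%N.
    rewrite wptE; under eq_bigr do rewrite uE mulnDr.
    rewrite big_split /=; congr addn.
    rewrite -(alsum (fun j a => (k1 j + r j) * ex a i)%N xpredT); apply: eq_bigr => a _.
    by case: ifP; rewrite ?muln0// mulnC.
  have zi i : (\sum_a ex a i * f a <= z i)%N /\ (z i <= \sum_a ex a i * f a + T)%N.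
    have /andP[z1 z2] := zp i; rewrite pE in z1 z2; rewrite mulr_sumr in z1 z2.
    have e1 : (\sum_a ex a i * f a)%:R <= \sum_a N%:R * (l a * (ex a i)%:R) :> R.
      rewrite natr_sum; apply: ler_sum => a _; rewrite natrM mulrA mulrC ler_wpM2r//.
      by have /andP[] := fP a.
    have e2 : \sum_a N%:R * (l a * (ex a i)%:R) <= (\sum_a ex a i * f a)%:R + T%:R :> R.
      rewrite /T !natr_sum -big_split; apply: ler_sum => a _ /=.
      apply: (@le_trans _ _ (((f a)%:R + 1) * (ex a i)%:R)).
        by rewrite mulrA ler_wpM2r//; have /andP[_ /ltW] := fP a.
      by rewrite mulrDl mul1r natrM mulrC lerD2l ler_nat mdeg_ge.
    split; first by rewrite -ltnS -(ltr_nat R); exact: le_lt_trans e1 z2.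
    by rewrite -(ler_nat R) natrD; exact: le_trans z1 e2.
  apply/box_moduleP; exists u, (mnm_of (fun i => z i + s0 i - wpt ex u i)%N); split.
  + apply/mnmP => j; rewrite kkE wdgE; under eq_bigr do rewrite uE.
    rewrite big_split /= (alsum (fun j a => k1 j + r j)%N (fun j' => j' == j)) big_pred1_eq.
    by rewrite /kk /r; move: (fj j); set s := (\sum_(a | _) f a)%N; case: (j \in S) => h;
        lia.
  + move=> i; rewrite mnm_ofE wE [s0 i]mnm_ofE; apply: leq_trans bb; rewrite /box_bound.
    have [_ z2] := zi i.
    have : (\sum_j (k1 j + q) * ex (al j) i <= \sum_j (k1 j + r j) * ex (al j) i +
        n * (q * T))%N.
      have -> : (n * (q * T) = \sum_(j < n) q * T)%N by rewrite sum_nat_const card_ord.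
      rewrite -big_split; apply: leq_sum => j _ /=.
      by rewrite !mulnDl -addnA leq_add2l (leq_trans _ (leq_addl _ _))// leq_mul2l exT orbT.
    lia.
  + apply/mnmP => i; mnm; rewrite mnm_ofE subnK// wE [s0 i]mnm_ofE leq_add//;
      first by have [] := zi i.
    by apply: leq_sum => j _; rewrite leq_mul2r leq_add2l rq orbT.
Qed.

End BoxVolume.

Lemma cvg_sumR (R : realType) (I : Type) (r : seq I) (f : I -> nat -> R) (l : I -> R) :
  (forall i, f i @ \oo --> l i) ->
      (fun N => \sum_(i <- r) f i N) @ \oo --> \sum_(i <- r) l i.
Proof.
move=> fl; elim: r => [|i r IH].
  by rewrite big_nil; under eq_cvg do rewrite big_nil; exact: cvg_cst.
by rewrite big_cons; under eq_cvg do rewrite big_cons; exact: cvgD.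
Qed.

Lemma telescoped_limit (R : realType) n D (cnt : {set 'I_n} -> nat ->
    nat) (V : {set 'I_n} -> R) :
  (forall S, (fun N => (cnt S N)%:R / N%:R ^+ n) @ \oo --> V S) ->
  (forall N, \sum_(S : {set 'I_n}) (-1) ^+ (n - #|S|) * (cnt S N)%:Z = (D * N ^ n)%N%:Z) ->
  D%:R = \sum_(S : {set 'I_n}) (-1) ^+ (n - #|S|) * V S.
Proof.
move=> cv e.
have : (fun N => \sum_(S : {set 'I_n}) (-1) ^+ (n - #|S|) * ((cnt S N)%:R / N%:R ^+ n)) @
    \oo -->
    \sum_(S : {set 'I_n}) (-1) ^+ (n - #|S|) * V S.
  by apply: cvg_sumR => S; apply: cvgM (cv S); exact: cvg_cst.
move=> h; apply: (cvg_unique _ _ h) => //.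
apply: (@cvg_near_cst _ _ _ _ \oo); near=> N.
have N0 : N%:R ^+ n != 0 :> R.
  by rewrite expf_neq0// pnatr_eq0 -lt0n; near: N; exact: nbhs_infty_gt.
have := congr1 (fun z : int => z%:~R : R) (e N); rewrite rmorph_sum /= => eN.
have eN' : \sum_(S : {set 'I_n}) (-1) ^+ (n - #|S|) * (cnt S N)%:R = D%:R * N%:R ^+ n :> R.
  rewrite -natrX -natrM -[RHS]eN; apply: eq_bigr => S _.
  by rewrite rmorphM rmorphXn /= rmorphN1.
rewrite -[RHS](mulfK N0) -eN' mulr_suml; apply: eq_bigr => S _.
by rewrite mulrA.
Unshelve. all: by end_near.
Qed.

Section Uniform.
Variables (R : realType) (n q : nat) (blk : 'I_q -> 'I_n) (ex : 'I_q -> multinom n).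
Hypothesis blk_onto : forall j, exists a, blk a = j.

(** Being the mixed volume, D does not depend on the cube, so b may be chosen afterwards in terms of
    D and of the determinants of edges. *)
Lemma box_uniform : exists D : nat, D%:R = mixed_volume (@block_pts R n q blk ex) /\
  forall b, (box_bound ex <= b)%N -> exists (k0 : nat) (cnt : multinom n -> nat),
  [/\ forall k, finite_of_size (box_module blk ex b k) (cnt k),
      forall (K : fieldType) k, large k0 k -> polycond (fun c : 'I_q -> K =>
        codim_le (supported (box_module blk ex b k))
          (relations blk ex (@box_gens n b) (fun=> 0%M) (fun _ _ => False) c n k) D /\
        codim_ge (supported (box_module blk ex b k))
          (relations blk ex (@box_gens n b) (fun=> 0%M) (fun _ _ => False) c n k) D),
      forall (K : fieldType) k a, large k0 k -> polycond (fun c : 'I_q -> K =>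
        codim_le (supported (box_module blk ex b k))
          (relations blk ex (@box_gens n b) (fun=> 0%M) (divisible_by blk ex b a) c n k) 0),
     (0 < D)%N -> exists al be : 'I_n -> 'I_q,
       (forall j, blk (al j) = j /\ blk (be j) = j) /\
       forall z : 'I_n -> int,
         (forall i, \sum_j z j * ((ex (al j) i)%:Z - (ex (be j) i)%:Z) = 0) ->
         forall j, z j = 0 &
     forall k, large k0 k -> exists M (J : 'I_M -> 'I_n) (src tgt : 'I_M -> multinom n),
       [/\ (M + D)%N = cnt k, forall l,
           below blk ex (@box_gens n b) (fun=> 0%M) (J l) k (src l),
       forall l, box_module blk ex b k (tgt l) &
       forall K : fieldType,
           \det (coef_mx blk ex J src tgt (fun a => mpolyX K (mnm1 a))) != 0]].
Proof.
have D0 b k0 D (cnt : multinom n -> nat) : (box_bound ex <= b)%N ->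
    (forall k, finite_of_size (box_module blk ex b k) (cnt k)) ->
    (forall N k, large k0 k -> \sum_(S : {set 'I_n}) (-1) ^+ (n - #|S|) *
         (cnt (box_shift N k S))%:Z = (D * N ^ n)%N%:Z) ->
    D%:R = mixed_volume (@block_pts R n q blk ex).
  move=> bb c1 c2; pose k := mnm_of (fun _ : 'I_n => k0).
  apply: (@telescoped_limit R n D (fun S N => cnt (box_shift N k S)) (fun S =>
      volume (@sum_hull R n q blk ex S))).
    by move=> S; have [] := @box_volume R n q blk ex blk_onto b k S cnt bb c1.
  by move=> N; apply: c2 => j; rewrite mnm_ofE.
have [k0 [D [cnt [[c1 c2 c3 c4 c5] c6]]]] := box_generic blk ex (box_bound ex).
have DE := D0 _ _ _ _ (leqnn _) c1 c2.
exists D; split => // b bb.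
have [k0' [D' [cnt' [[c1' c2' c3' c4' c5'] c6']]]] := box_generic blk ex b.
have /eqP := D0 _ _ _ _ bb c1' c2'; rewrite -DE eqr_nat => /eqP DD.
by exists k0', cnt'; rewrite -DD; split.
Qed.

Lemma torus_finite_generic (K : fieldType) : polycond (fun c : 'I_q -> K =>
  forall i, exists2 u : {poly K},
      u.[0] != 0 & loc (@monomial K n) (sparse_sys blk ex c) (uni i u)).
Proof.
(* The additional D in the side of the cube gives room for the D + 1 powers of a coordinate used in
   [torus_finite]. *)
have [D [_ /(_ (box_bound ex + D)%N (leq_addr _ _))[k0 [cnt [_ h _ _ _]]]]] := box_uniform.
pose k := mnm_of (fun _ : 'I_n => k0).
have kk : large k0 k by move=> j; rewrite mnm_ofE.
apply: polycondW (h K k kk) => c [le _] i.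
by apply: torus_finite le _ blk_onto i; exact: leq_addl.
Qed.

End Uniform.

Lemma polycond_imp (K : fieldType) q (A : Prop) (P : ('I_q -> K) -> Prop) :
  (A -> polycond P) -> polycond (fun c => A -> P c).
Proof.
move=> h; have [a|na] := pselect A; first by apply: polycondW (h a) => c Pc _.
exact: polycondT.
Qed.

Lemma polycond_neq0 (K : fieldType) q (a : 'I_q) : polycond (fun c : 'I_q -> K => c a != 0).
Proof.
exists (mpolyX K (mnm1 a)); first by rewrite -msupp_eq0 msuppX.
by move=> c; rewrite mevalXU.
Qed.

Section Nilpotent.
Variables (R : realType) (K : fieldType) (n q : nat) (blk : 'I_q -> 'I_n) (ex : 'I_q ->
    multinom n).
Local Notation P := (mpoly n K).
Local Notation Q := (q + (n + n))%N.
Hypothesis uncountableK : forall B : set K, countable B -> exists t, ~ B t.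
Hypothesis strata : forall Z : {set 'I_n}, (n <= #|Z| + #|[set j | [exists a,
    (blk a == j) && on_stratum ex Z a]]%SET|)%N.

(** Auxiliary coefficients that do not occur in the condition are specialized to those of one point
    where the witness polynomial does not vanish. *)
Lemma polycond_forget r (A : ('I_q -> K) -> Prop) :
  polycond (fun c : 'I_(q + r) -> K => A (fun a => c (lshift r a))) -> polycond A.
Proof.
move=> [G G0 GA].
have [c /(_ 0%N) cG] : exists c, forall k : nat, meval c G != 0.
  by apply: (countable_generic uncountableK) => _; exists G.
pose h (a : 'I_(q + r)) : mpoly q K := match fintype.split a with
  inl a => mpolyX K (mnm1 a) | inr e => mpolyC q (c (rshift q e)) end.
pose ext (d : 'I_q -> K) (a : 'I_(q + r)) := match fintype.split a with
  inl a => d a | inr e => c (rshift q e) end.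
have hE d : meval d (psubst h G) = meval (ext d) G.
  rewrite meval_psubst; apply: meval_eq => a; rewrite /h /ext.
  by case: (fintype.split a) => e; rewrite ?mevalXU ?mevalC.
exists (psubst h G) => [|d]; last first.
  rewrite hE => /GA; congr A; apply/funext => a.
  by rewrite /ext -[lshift r a]/(unsplit (inl a)) unsplitK.
apply: contraNneq cG => h0; have := hE (fun a => c (lshift r a)).
rewrite h0 meval0 => ->; apply/eqP/meval_eq => a; rewrite /ext.
by case: (split_ordP a) => e ->.
Qed.

(** By (H2) at least n - #Z equations do not vanish identically on the stratum, so the coordinates
    outside Z can be injected into them. *)
Lemma stratum_matching (Z : {set 'I_n}) : exists phi : 'I_n ->
    'I_n, {in [predC Z] &, injective phi} /\
  forall i, i \notin Z -> exists a, blk a = phi i /\ on_stratum ex Z a.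
Proof.
set J := [set j | [exists a, (blk a == j) && on_stratum ex Z a]]%SET.
have le : (#|~: Z|%SET <= #|J|)%N.
  by have := strata Z; rewrite -/J; have := cardsC Z; rewrite card_ord; lia.
have idx i : i \notin Z -> (index i (enum (~: Z)%SET) < #|J|)%N.
  by move=> iZ; apply: leq_trans le; rewrite cardE index_mem mem_enum inE.
exists (fun i => nth i (enum J) (index i (enum (~: Z)%SET))); split.
  move=> i i'; rewrite !inE => iZ iZ'.
  have -> : nth i' (enum J) (index i' (enum (~: Z)%SET)) = nth i (enum J) (index i' (enum
      (~: Z)%SET)).
    by apply: set_nth_default; rewrite -cardE idx.
  move=> /eqP; rewrite nth_uniq ?enum_uniq -?cardE ?idx// => /eqP.
  by apply: index_inj; rewrite ?mem_enum ?inE.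
move=> i iZ; have : nth i (enum J) (index i (enum (~: Z)%SET)) \in J.
  by rewrite -mem_enum mem_nth// -cardE idx.
by rewrite inE => /fintype.existsP[a /andP[/eqP e st]]; exists a.
Qed.

(** Generic finiteness in the torus, applied to the auxiliary system of every stratum, supplies the
    hypothesis [Itop] of [nilpotent_strata]. *)
Lemma nilpotent_generic : polycond (fun c : 'I_q -> K =>
  exists r, forall i, loc (@unit_at0 K n) (sparse_sys blk ex c) (uni i 'X^r)).
Proof.
apply: (@polycond_forget (n + n)).
have [phi phiP] := choice stratum_matching.
have ft (Z : {set 'I_n}) : polycond (fun c : 'I_Q ->
    K => forall i, exists2 u : {poly K}, u.[0] != 0 &
    loc (@monomial K n) (sparse_sys (aux_blk blk Z (phi Z) \o @aux_at n q blk ex Z (phi Z))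
      (aux_ex ex \o @aux_at n q blk ex Z (phi Z)) (c \o @aux_at n q blk ex Z (phi Z))) (uni
          i u)).
  have onto j : exists s, (aux_blk blk Z (phi Z) \o @aux_at n q blk ex Z (phi Z)) s = j.
    have [t tS tj] : exists2 t,
        t \in aux_set blk ex Z (phi Z) & aux_blk blk Z (phi Z) t = j.
      have [jZ|jZ] := boolP (j \in Z).
        exists (rshift q (lshift n j)).
          rewrite inE -[rshift q _]/(unsplit (inr _)) unsplitK.
          by rewrite -[lshift n _]/(unsplit (inl _)) unsplitK.
        rewrite /aux_blk -[rshift q _]/(unsplit (inr _)) unsplitK.
        by rewrite -[lshift n _]/(unsplit (inl _)) unsplitK.
      have [a [ab st]] := (phiP Z).2 j jZ; exists (lshift (n + n) a).
        rewrite inE -[lshift (n + n) a]/(unsplit (inl a)) unsplitK st andbT.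
        by apply/fintype.existsP; exists j; rewrite jZ ab eqxx.
      by rewrite /aux_blk -[lshift (n +
          n) a]/(unsplit (inl a)) unsplitK ab (psiK (phiP Z).1 jZ).
    by exists (enum_rank_in tS t); rewrite /= /aux_at enum_rankK_in.
  have := @polycond_pull K _ _ (@aux_at n q blk ex Z (phi Z)) _ _ (torus_finite_generic R _
      onto K).
  by apply; exact: enum_val_inj.
have z0 := polycond_fin (fun i : 'I_n => @polycond_neq0 K Q (rshift q (lshift n i))).
have o0 := polycond_fin (fun i : 'I_n => @polycond_neq0 K Q (rshift q (rshift n i))).
apply: polycondW (polycondI (polycond_fin ft) (polycondI z0 o0)) => c [cft [cz co]].
set f := sparse_sys blk ex _.
have unM := (@unit_at0_mult K n).
suff h i : exists r, loc (@unit_at0 K n) f (mpolyX K (mnm1 i) ^+ r).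
  have [r rP] := choice h; exists (\sum_i r i)%N => i.
  rewrite (bigD1 i)//= exprD uniM mulrC; apply: locM.
  by rewrite uniXn -mpolyXn; exact: rP.
pose I := strat_ideal blk ex (fun a => c (lshift (n + n) a)).
have [|||||||||r] := @nilpotent_strata P n (fun i =>
    mpolyX K (mnm1 i)) I _ _ _ _ (@unit_at0 K n) _ _ _ _ _ i.
- move=> Z; exists 1; split; first exact: unM.1.
  exists (fun=> 0); rewrite mulr0 big1 ?subrr; first exact: ideal_mem0.
  by move=> j _; rewrite mulr0.
- move=> Z a a' [s [us [g sg]]] [s' [us' [g' sg']]]; exists (s * s'); split;
    first exact: unM.2.
  exists (fun j => s' * g j + s * g' j).
  have -> : s * s' * (a + a') - \sum_(j in Z) mpolyX K (mnm1 j) * (s' * g j + s * g' j) =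
     s' * (s * a - \sum_(j in Z) mpolyX K (mnm1 j) * g j) +
         s * (s' * a' - \sum_(j in Z) mpolyX K (mnm1 j) * g' j).
    have -> : \sum_(j in Z) mpolyX K (mnm1 j) * (s' * g j + s * g' j) =
      s' * (\sum_(j in Z) mpolyX K (mnm1 j) * g j) +
          s * (\sum_(j in Z) mpolyX K (mnm1 j) * g' j).
      by rewrite !mulr_sumr -big_split; apply: eq_bigr => j _ /=; ring.
    by ring.
  by apply: ideal_memD; exact: ideal_memM.
- move=> Z a a' [s [us [g sg]]]; exists s; split => //; exists (fun j => a * g j).
  have -> : s * (a * a') - \sum_(j in Z) mpolyX K (mnm1 j) * (a * g j) =
     a * (s * a' - \sum_(j in Z) mpolyX K (mnm1 j) * g j).
    rewrite mulrBr mulr_sumr; congr (_ - _); first by ring.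
    by apply: eq_bigr => j _; ring.
  exact: ideal_memM.
- move=> Z j jZ; exists 1; split; first exact: unM.1.
  exists (fun j' => (j' == j)%:R);
      rewrite (bigD1 j)//= eqxx big1 => [|j' /andP[_ /negPf ->]].
    by rewrite mul1r mulr1 addr0 subrr; exact: ideal_mem0.
  by rewrite mulr0.
- exact: unM.1.
- by move=> a a'; exact: unM.2.
- move=> Z s a us [s' [us' [g sg]]]; exists (s' * s); split; first exact: unM.2.
  by exists g; rewrite -mulrA.
- move=> Z j a [s [us [g sg]]].
  have [jZ|jZ] := boolP (j \in Z).
    exists s, 0; split => //; rewrite mulr0 subr0; exists 1; split; first exact: unM.1.
    by exists g; rewrite mul1r; move: sg; rewrite (finset.setUidPr _)// finset.sub1set.
  exists s, (g j); split => //; exists 1; split; first exact: unM.1.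
  exists g; move: sg; rewrite (bigD1 j) ?finset.setU11//= mul1r.
  rewrite (eq_bigl (fun j' => j' \in Z)) => [|j']; first by rewrite opprD addrA.
  by rewrite !inE; case: eqP => [->|_]; rewrite ?(negPf jZ)//= andbT.
- by move=> Z ZT; exact: (@strat_top K n q blk ex Z (phi Z) c (phiP Z).1 cz co (cft Z) ZT).
- move=> [s [us [g]]]; rewrite big_pred0 => [|j]; last by rewrite finset.in_set0.
  by rewrite subr0 => sg; exists r, s.
Qed.

End Nilpotent.

Section MixedVolumeBound.
Variables (R : realType) (K : fieldType) (n q : nat) (blk : 'I_q -> 'I_n) (ex : 'I_q ->
    multinom n).
Local Notation P := (mpoly n K).
Hypothesis uncountableK : forall B : set K, countable B -> exists t, ~ B t.
Hypothesis strata : forall Z : {set 'I_n}, (n <= #|Z| + #|[set j | [exists a,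
    (blk a == j) && on_stratum ex Z a]]%SET|)%N.
Hypothesis ex_neq0 : forall a, ex a != 0%M.
Variable i0 : 'I_n.

Lemma strata_onto j : exists a, blk a = j.
Proof.
have := strata finset.set0; rewrite cards0 add0n => h.
have : j \in [set j | [exists a, (blk a == j) && on_stratum ex finset.set0 a]]%SET.
  apply: contraT => nj; suff : (n < n)%N by rewrite ltnn.
  apply: leq_ltn_trans h _; rewrite -[X in (_ < X)%N]card_ord -cardsT; apply: proper_card.
  by rewrite properT; apply: contra nj => /eqP ->.
by rewrite inE => /fintype.existsP[a /andP[/eqP <- _]]; exists a.
Qed.

(** The stratum where all coordinates but x_i vanish leaves at least one equation, and its term
    there is not constant by (H1). *)
Lemma strata_axis i : exists a, (0 < ex a i)%N /\ forall i', i' != i -> ex a i' = 0%N.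
Proof.
have [a st] : exists a, on_stratum ex (~: [set i])%SET a.
  have : (0 < #|[set j | [exists a, (blk a == j) && on_stratum ex (~: [set i]) a]]%SET|)%N.
    have := strata (~: [set i])%SET; rewrite cardsC1 card_ord.
    have := ltn_ord i; case: #|[set j | _]%SET| => [|m]; lia.
  by move=> /card_gt0P[j]; rewrite inE => /fintype.existsP[a /andP[_ st]]; exists a.
have az i' : i' != i -> ex a i' = 0%N.
  by move=> ii; have /fintype.forallP/(_ i')/implyP := st; rewrite !inE ii => /(_ isT)/eqP.
exists a; split => //; rewrite lt0n; apply: contra (ex_neq0 a) => /eqP ai.
apply/eqP/mnmP => i'; rewrite mnm0E; have [->//|] := eqVneq i' i; exact: az.
Qed.

(** The bound needs the codimensions in all large degrees at once, for A and for A^0, so it is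
    obtained at one common point of countably many conditions on the coefficients of A^0. *)
Theorem mult_mixed_volume (C : ('I_q -> K) -> Prop) (DL DV : nat) : polycond C ->
  DL%:R = mixed_volume (@block_pts R n q blk ex) ->
  DV%:R = mixed_volume (@block_pts R n (q + n) (@blk0 n q blk) (@ex0 n q ex)) ->
  exists2 c, C c & forall mu,
    codim_ge (fun _ : P => True) (loc (@unit_at0 K n) (sparse_sys blk ex c)) mu ->
        (mu + DL <= DV)%N.
Proof.
move=> pC DLE DVE.
have onto0 j : exists a, @blk0 n q blk a = j.
  by exists (rshift q j); exact: blk0_r.
have [DL' [/eqP + facL]] := @box_uniform R n q blk ex strata_onto.
rewrite -DLE eqr_nat => /eqP DD; subst DL'.
have [DV' [/eqP + facV]] := @box_uniform R n (q + n) _ (@ex0 n q ex) onto0.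
rewrite -DVE eqr_nat => /eqP DD; subst DV'.
pose dl (al be : 'I_n ->
    'I_q) : 'M[int]_n := \matrix_(j, i) ((ex (al j) i)%:Z - (ex (be j) i)%:Z).
(* The edges are only known once b is chosen; hence the sum of the determinants of all possible
   choices. *)
pose bL := (box_bound ex + \sum_(ab : {ffun 'I_n -> 'I_q} * {ffun 'I_n ->
    'I_q}) `|\det (dl ab.1 ab.2)|)%N.
(* Makes room for the remainders of exponents modulo the support points on the axes, used below to
   reach every monomial. *)
pose bV := (box_bound (@ex0 n q ex) + \sum_a mdeg (ex a))%N.
have [kL [cntL [_ l3 l4 l5 _]]] := facL bL (leq_addr _ _).
have [kV [cntV [v1 _ _ _ v6]]] := facV bV (leq_addr _ _).
pose at_k (k : multinom n) (c : 'I_(q + n) -> K) := (large kL k ->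
   (codim_le (supported (box_module blk ex bL k))
      (relations blk ex (@box_gens n bL) (fun=> 0%M) (fun _ _ => False) (fun a =>
          c (lshift n a)) n k) DL /\
    codim_ge (supported (box_module blk ex bL k))
      (relations blk ex (@box_gens n bL) (fun=> 0%M) (fun _ _ => False) (fun a =>
          c (lshift n a)) n k) DL) /\
   forall a, codim_le (supported (box_module blk ex bL k))
      (relations blk ex (@box_gens n bL) (fun=> 0%M) (divisible_by blk ex bL a) (fun a => c
          (lshift n a)) n k) 0) /\
  (large kV k -> exists M (J : 'I_M -> 'I_n) (src tgt : 'I_M -> multinom n),
       [/\ (M + DV)%N = cntV k, forall l,
           below (@blk0 n q blk) (@ex0 n q ex) (@box_gens n bV) (fun=> 0%M) (J l) k (src l),
       forall l, box_module (@blk0 n q blk) (@ex0 n q ex) bV k (tgt l) &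
       \det (coef_mx (@blk0 n q blk) (@ex0 n q ex) J src tgt c) != 0]).
have linj : injective (lshift n : 'I_q -> 'I_(q + n)) by exact: lshift_inj.
have pk k : polycond (at_k k).
  apply: polycondI; apply: polycond_imp => kk.
    apply: polycondI; first exact: (polycond_pull linj (l3 K k kk)).
    by apply: polycond_fin => a; exact: (polycond_pull linj (l4 K k a kk)).
  have [M [J [src [tgt [MD Js Xt dM]]]]] := v6 k kk.
  by apply: polycondW (coef_mx_polycond (dM K)) => c dc; exists M, J, src, tgt.
(* The natural number t codes a multidegree; the conditions that do not depend on it are repeated in
   each member. *)
pose fam (t : nat) (c : 'I_(q + n) -> K) :=
  (C (fun a => c (lshift n a)) /\
   ((exists r, forall i,
       loc (@unit_at0 K n) (sparse_sys blk ex (fun a => c (lshift n a))) (uni i 'X^r)) /\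
    forall i, exists2 u : {poly K}, u.[0] != 0 &
      loc (@monomial K n) (sparse_sys blk ex (fun a => c (lshift n a))) (uni i u))) /\
  forall k, choice.unpickle t = Some k -> at_k k c.
have pf t : polycond (fam t).
  apply: polycondI.
    apply: polycondI; first exact: (polycond_pull linj pC).
    apply: polycondI; first exact: (polycond_pull linj (@nilpotent_generic R K n q blk ex
        uncountableK strata)).
    exact: (polycond_pull linj (@torus_finite_generic R n q blk ex strata_onto K)).
  case: (choice.unpickle t : option (multinom n)) => [k|]; last exact: polycondT.
  by apply: polycondW (pk k) => c ck k' [<-].
have [c cP] := countable_generic uncountableK pf.
have ck k : at_k k c by have [_] := cP (choice.pickle k); apply; exact: choice.pickleK.
have [[cC [[r nil] ft]] _] := cP 0%N.
have /choice[u' u'P] i : exists u : {poly K}, u.[0] != 0 /\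
    loc (@monomial K n) (sparse_sys blk ex (fun a => c (lshift n a))) (uni i u).
  by have [w] := ft i; exists w.
exists (fun a => c (lshift n a)) => // mu hmu.
have hT : codim_ge (fun _ : P => True) (loc (@monomial K n) (sparse_sys blk ex (fun a =>
    c (lshift n a)))) DL.
  apply: (@torus_lower K n q blk ex bL _ kL).
  - by move=> k kk; have [/(_ kk)[[]]] := ck k.
  - by move=> k kk; have [/(_ kk)[[]]] := ck k.
  - by move=> k a kk; have [/(_ kk)[_ +] _] := ck k; apply.
  - move=> D0; have [al [be [ab ind]]] := l5 D0; exists al, be; split.
    + by move=> j; have [] := ab j.
    + by move=> j; have [] := ab j.
    + move=> Dl; split.
        apply/negP => /det0P[v v0 vD]; move/negP: v0; apply; apply/eqP/rowP => j;
            rewrite [RHS]mxE.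
        apply: (ind (fun j => v 0 j)) => i; move/rowP: vD => /(_ i); rewrite !mxE => e;
            rewrite -[RHS]e.
        by apply: eq_bigr => j' _; rewrite mxE.
      have -> : Dl = dl [ffun j => al j] [ffun j => be j].
        by apply/matrixP => j i; rewrite !mxE !ffunE.
      apply: leq_trans (leq_addl _ _).
      by rewrite (bigD1 ([ffun j => al j], [ffun j => be j]))//= leq_addr.
have [ax axP] := choice strata_axis.
apply: (@mult_bound K n q blk ex i0 c bV kV DV cntV v1 _ _ mu DL r u') => //.
- by move=> k kk; have [_ /(_ kk)] := ck k.
- move=> x.
  (* A monomial x is divided coordinatewise by the axis points; [W] then raises the degree to k by
     means of the points 0 of A^0, which do not change x. *)
  pose U : multinom (q + n) :=
      \big[@mnm_add _/@mnm0 _]_i (mnm1 (lshift n (ax i)) *+ (x i %/ ex (ax i) i)%N)%M.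
  exists (mdeg (wdg (@blk0 n q blk) U)) => k kk.
  pose W : multinom (q + n) :=
      (U + \big[@mnm_add _/@mnm0 _]_j (mnm1 (rshift q j) *+ (k j - wdg (@blk0 n q blk) U
          j)%N)%M)%M.
  have wdgX m (a : 'I_(q +
      n)) : wdg (@blk0 n q blk) (mnm1 a *+ m)%M = (mnm1 (@blk0 n q blk a) *+ m)%M.
    by elim: m => [|m IH]; rewrite ?mulm0n ?wdg0// !mulmS wdgD wdg1 IH.
  have wptX m (a : 'I_(q + n)) : wpt (@ex0 n q ex) (mnm1 a *+ m)%M = (@ex0 n q ex a *+ m)%M.
    by elim: m => [|m IH]; rewrite ?mulm0n ?wpt0// !mulmS wptD wpt1 IH.
  apply/box_moduleP; exists W, (mnm_of (fun i => x i %% ex (ax i) i)%N); split.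
  + rewrite wdgD (big_morph (wdg _) (@wdgD _ _ _) (@wdg0 _ _ _)); apply/mnmP => j; mnm;
      rewrite mnm_sumE.
    rewrite (bigD1 j)//= big1 => [|j' /negPf jj]; rewrite wdgX blk0_r; mnm.
      by rewrite eqxx mul1n addn0 subnKC//; apply: leq_trans (kk j); exact: mdeg_ge.
    by rewrite jj mul0n.
  + move=> i; rewrite mnm_ofE; apply: leq_trans (ltnW (ltn_pmod _ _)) _;
      first by have [] := axP i.
    apply: leq_trans (leq_addl _ _); rewrite (bigD1 (ax i))//=.
    exact: leq_trans (mdeg_ge _ _) (leq_addr _ _).
  + rewrite wptD !(big_morph (wpt _) (@wptD _ _ _) (@wpt0 _ _ _)); apply/mnmP => i; mnm;
      rewrite !mnm_sumE mnm_ofE.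
    rewrite [X in (_ + (_ + X))%N]big1 => [|j _]; last first.
      by rewrite wptX ex0_r; mnm; rewrite mul0n.
    rewrite (bigD1 i)//= big1 => [|i' ii]; rewrite wptX ex0_l; mnm.
      by rewrite !addn0 addnC mulnC -divn_eq.
    by rewrite (axP i').2 ?mul0n// eq_sym.
- by move=> i; have [] := u'P i.
- by move=> i; have [] := u'P i.
Qed.

End MixedVolumeBound.

(** * The exchange argument *)

Section Exchange.
Variables (R : realType) (m : nat) (I : finType).
Local Notation V := 'rV[R]_m.+1.
Local Notation wi := (widen_ord (leqnSn m)).
Variables (Q : I -> set V) (lam : I -> 'I_m.+1 -> R).
Hypothesis lam0 : forall j i, 0 < lam j i.
Hypothesis Qlam : forall j i, Q j (lam j i *: delta_mx 0 i).
Hypothesis Q0 : forall j p, Q j p -> forall i, 0 <= p 0 i.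
Hypothesis Qconv : forall j, @convex_set R V (Q j).
Implicit Types (J : {set I}) (j : I) (z p : V).

(* Over pi(Delta_j), Q_j and this set Q_j + R_{>=0}^n have the same lower envelope. *)
Definition upper j z := exists2 p, Q j p & forall i, p 0 i <= z 0 i.

(** On nonnegative vectors this is the gauge of pi(Delta_j): the projection of z lies in that
    simplex exactly when the value is at most 1. *)
Definition axis_gauge j z := \sum_(i < m) z 0 (wi i) / lam j (wi i).

Definition excess J (z : I -> V) : R := \sum_(j in J) Num.max (axis_gauge j (z j) - 1) 0.

Definition split_in J x (z : I -> V) := (forall j, j \in J ->
    upper j (z j)) /\ \sum_(j in J) z j = x.

Hypothesis min_exists : forall J x (z : I -> V), split_in J x z -> exists2 z' : I ->
    V, split_in J x z' &
  forall z'' : I -> V, split_in J x z'' -> excess J z' <= excess J z''.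

Lemma axis_gaugeD j z z' : axis_gauge j (z + z') = axis_gauge j z + axis_gauge j z'.
Proof. by rewrite -big_split; apply: eq_bigr => i _; rewrite mxE mulrDl. Qed.

Lemma axis_gaugeZ j s z : axis_gauge j (s *: z) = s * axis_gauge j z.
Proof. by rewrite mulr_sumr; apply: eq_bigr => i _; rewrite mxE mulrA. Qed.

Lemma axis_gaugeB j z z' : axis_gauge j (z - z') = axis_gauge j z - axis_gauge j z'.
Proof. by rewrite -scaleN1r axis_gaugeD axis_gaugeZ mulN1r. Qed.

Lemma axis_gauge_delta j i : axis_gauge j (delta_mx 0 (wi i)) = (lam j (wi i))^-1.
Proof.
rewrite /axis_gauge (bigD1 i)//= big1 => [|i' ii]; rewrite mxE eqxx /=.
  by rewrite eqxx mul1r addr0.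
have -> : (wi i' == wi i) = false by apply/negbTE; apply: contra ii => /eqP [e];
    apply/eqP/val_inj.
by rewrite mul0r.
Qed.

Lemma axis_gauge_ge0 j z : (forall i, 0 <= z 0 i) -> 0 <= axis_gauge j z.
Proof. by move=> z0; apply: sumr_ge0 => i _; rewrite divr_ge0// ltW. Qed.

Lemma upper_ge0 j z : upper j z -> forall i, 0 <= z 0 i.
Proof. by move=> [p Qp pz] i; apply: le_trans (pz i); exact: (Q0 Qp). Qed.

Lemma face_mem j z : (forall i, 0 <= z 0 i) -> axis_gauge j z = 1 -> z 0 ord_max = 0 ->
    Q j z.
Proof.
move=> z0 h1 zm; have :=
    @convex_comb R m.+1 (Q j) 'I_m (fun i => lam j (wi i) *: delta_mx 0 (wi i))
  (fun i => z 0 (wi i) / lam j (wi i)) xpredT (@Qconv j).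
have -> : \sum_(i < m) (z 0 (wi i) / lam j (wi i)) *: (lam j (wi i) *:
    delta_mx 0 (wi i)) = z.
  apply/rowP => i; rewrite summxE; case: (unliftP ord_max i) => [i' ->|->].
    rewrite (bigD1 i')//= big1 => [|k ki]; rewrite !mxE eqxx /=.
      have -> : (lift ord_max i' == wi i') by apply/eqP/val_inj;
          rewrite /= /bump leqNgt ltn_ord.
      rewrite mulr1 divfK ?addr0 ?lt0r_neq0//; congr (z _ _); apply/val_inj.
      by rewrite /= /bump leqNgt ltn_ord.
    have -> : (lift ord_max i' == wi k) = false.
      apply/negbTE; apply: contra ki => /eqP/(congr1 val) /=;
          rewrite /bump leqNgt ltn_ord add0n => e.
      by apply/eqP/val_inj.
    by rewrite !mulr0.
  rewrite big1 ?zm// => k _; rewrite !mxE eqxx /=.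
  have -> : (ord_max == wi k) = false by apply/negbTE/eqP => /(congr1 val) /= e;
      have := ltn_ord k; rewrite -e ltnn.
  by rewrite !mulr0.
by apply => // i; rewrite divr_ge0// ltW.
Qed.

Definition flat z : V := \row_i (if i == ord_max then 0 else z 0 i).

Lemma wi_neq_max i : (wi i == ord_max) = false.
Proof. by apply/negbTE/eqP => /(congr1 val) /= e; have := ltn_ord i; rewrite e ltnn. Qed.

Lemma axis_gauge_flat j z : axis_gauge j (flat z) = axis_gauge j z.
Proof. by apply: eq_bigr => i _; rewrite mxE wi_neq_max. Qed.

(** Dropping the height and shrinking to gauge 1 leads to the face spanned by the axis points at
    height 0, which belongs to Q_j. *)
Lemma upper_hgt j z : (forall i, 0 <= z 0 i) -> 1 <= axis_gauge j z -> upper j z.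
Proof.
move=> z0 h1; have h0 : 0 < axis_gauge j z by exact: lt_le_trans h1.
exists ((axis_gauge j z)^-1 *: flat z).
  apply: face_mem => [i||]; last by rewrite !mxE eqxx mulr0.
    by rewrite !mxE mulr_ge0 ?invr_ge0 ?(ltW h0)//; case: ifP.
  by rewrite axis_gaugeZ axis_gauge_flat mulVf// lt0r_neq0.
move=> i; rewrite !mxE; case: ifP => _; first by rewrite mulr0.
by rewrite ler_piMl// invf_le1.
Qed.

Lemma upper_up j z z' : upper j z -> (forall i, z 0 i <= z' 0 i) -> upper j z'.
Proof. by move=> [p Qp pz] zz; exists p => // i; exact: le_trans (pz i) (zz i). Qed.

(** The ray from p through z is prolonged until its gauge is 1 and flattened there to a point of the
    face. On the segment from this point to p, the point over the projection of z is not higher than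
    z. *)
Lemma below_face j z : upper j z -> axis_gauge j z <= 1 ->
  exists2 p, Q j p & (forall i, p 0 (wi i) = z 0 (wi i)) /\ p 0 ord_max <= z 0 ord_max.
Proof.
move=> [p Qp pz] h1; have z0 := upper_ge0 (ex_intro2 _ _ p Qp pz).
have d0 i : 0 <= (z - p) 0 i by rewrite !mxE subr_ge0.
have [hd|hd] := eqVneq (axis_gauge j (z - p)) 0.
  exists p => //; split => // i; move/eqP: hd; rewrite psumr_eq0 => [|k _];
      last by rewrite divr_ge0// ltW.
  move=> /allP/(_ i (mem_index_enum i)) /=;
      rewrite mulf_eq0 invr_eq0 (gt_eqF (lam0 _ _)) orbF !mxE subr_eq0.
  by move=> /eqP.
have hdp : 0 < axis_gauge j (z - p) by rewrite lt_neqAle eq_sym hd axis_gauge_ge0.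
pose tau := (1 - axis_gauge j z) / axis_gauge j (z - p).
have tau0 : 0 <= tau by rewrite divr_ge0 ?subr_ge0// ltW.
pose u := flat (z + tau *: (z - p)).
have Qu : Q j u.
  apply: face_mem => [i||]; last by rewrite mxE eqxx.
    by rewrite mxE; case: ifP => // _; rewrite mxE addr_ge0// mxE mulr_ge0.
  by rewrite axis_gauge_flat axis_gaugeD axis_gaugeZ /tau divfK ?lt0r_neq0//; lra.
have T0 : 0 < 1 + tau by rewrite ltr_wpDr.
pose w : V := (1 + tau)^-1 *: u + (tau / (1 + tau)) *: p.
have t01 : 0 <= (1 + tau)^-1 by rewrite invr_ge0 ltW.
have t11 : (1 + tau)^-1 <= 1 by rewrite invf_le1// lerDl.
have Qw : Q j w.
  have := Qconv (Itv01 t01 t11) (mem_set Qu) (mem_set Qp).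
  rewrite inE convE /=; congr (Q j (_ + _ *: _)).
  by field; rewrite lt0r_neq0.
exists w => //; split => [i|].
  by rewrite /w !mxE wi_neq_max; field; rewrite lt0r_neq0.
rewrite /w !mxE eqxx mulr0 add0r; apply: le_trans (pz _).
by rewrite ler_piMl ?(Q0 Qp)// ler_pdivrMr// mul1r lerDr.
Qed.

(** Otherwise part of a coordinate could be moved from a summand of gauge above 1 to one of gauge
    below 1, which would decrease the excess. *)
Lemma exchange_poor J x (z : I -> V) : split_in J x z ->
  (forall z' : I -> V, split_in J x z' -> excess J z <= excess J z') -> 0 < excess J z ->
  forall j, j \in J -> 1 <= axis_gauge j (z j).
Proof.
move=> [zU zx] zmin e0 j1 j1J; rewrite leNgt; apply/negP => h1.
have [j0 j0J h0] : exists2 j0, j0 \in J & 1 < axis_gauge j0 (z j0).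
  apply: contrapT => h; move: e0; rewrite /excess big1 ?ltxx// => j jJ.
  apply/max_idPr; rewrite subr_le0 leNgt; apply/negP => hj; apply: h; by exists j.
have [i zi] : exists i, 0 < z j0 0 (wi i).
  apply: contrapT => h; move: h0; rewrite /axis_gauge big1 ?ltr10// => i _.
  have -> : z j0 0 (wi i) = 0.
    apply/eqP; rewrite eq_le (upper_ge0 (zU _ j0J)) andbT leNgt; apply/negP => zi;
        apply: h; by exists i.
  by rewrite mul0r.
have j01 : j0 != j1 by apply/eqP => e; move: h1; rewrite -e => /(lt_trans h0); rewrite ltxx.
(* The largest amount that keeps the donor nonnegative and of gauge at least 1, and the receiver of
   gauge at most 1. *)
pose d := Num.min (z j0 0 (wi i)) (Num.min ((axis_gauge j0 (z j0) - 1) * lam j0 (wi i)) ((1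
    - axis_gauge j1 (z j1)) * lam j1 (wi i))).
have d0 : 0 < d by rewrite !lt_min zi !mulr_gt0 ?subr_gt0.
have d1 : d <= z j0 0 (wi i) by rewrite ge_min lexx.
have d2 : d / lam j0 (wi i) <= axis_gauge j0 (z j0) - 1 by rewrite ler_pdivrMr// !ge_min
    lexx orbT.
have d3 : d / lam j1 (wi i) <= 1 - axis_gauge j1 (z j1) by rewrite ler_pdivrMr// !ge_min
    lexx !orbT.
pose z' j := if j == j0 then z j0 - d *: delta_mx 0 (wi i) else
             if j == j1 then z j1 + d *: delta_mx 0 (wi i) else z j.
have z'0 : z' j0 = z j0 - d *: delta_mx 0 (wi i) by rewrite /z' eqxx.
have z'1 : z' j1 = z j1 + d *: delta_mx 0 (wi i) by rewrite /z' eq_sym (negPf j01) eqxx.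
have z'E j : j != j0 -> j != j1 -> z' j = z j by rewrite /z' => /negPf -> /negPf ->.
have H0 : axis_gauge j0 (z' j0) = axis_gauge j0 (z j0) - d / lam j0 (wi i) by rewrite z'0
    axis_gaugeB axis_gaugeZ axis_gauge_delta.
have H1 : axis_gauge j1 (z' j1) = axis_gauge j1 (z j1) +
    d / lam j1 (wi i) by rewrite z'1 axis_gaugeD axis_gaugeZ axis_gauge_delta.
have del i' : 0 <= (delta_mx 0 (wi i) : V) 0 i' by rewrite mxE ler0n.
have spl (F : I -> V) : \sum_(j in J) F j = F j0 + (F j1 +
    \sum_(j in J | (j != j0) && (j != j1)) F j).
  rewrite (bigD1 j0)//= (bigD1 j1) /=; last by rewrite j1J eq_sym.
  by congr (_ + (_ + _)); apply: eq_bigl => j; rewrite andbA.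
have splR (F : I -> R) : \sum_(j in J) F j = F j0 + (F j1 +
    \sum_(j in J | (j != j0) && (j != j1)) F j).
  rewrite (bigD1 j0)//= (bigD1 j1) /=; last by rewrite j1J eq_sym.
  by congr (_ + (_ + _)); apply: eq_bigl => j; rewrite andbA.
have : excess J z <= excess J z'.
  apply: zmin; split.
    move=> j jJ; have [->|jj0] := eqVneq j j0.
      apply: upper_hgt; last by rewrite H0; lra.
      move=> i'; rewrite z'0 !mxE eqxx /=; case: eqP => [->|_];
          last by rewrite mulr0 subr0; exact: (upper_ge0 (zU _ j0J)).
      by rewrite mulr1 subr_ge0.
    have [->|jj1] := eqVneq j j1; last by rewrite z'E//; exact: zU.
    apply: (upper_up (zU _ j1J)) => i';
        rewrite z'1 [X in _ <= X]mxE lerDl mxE mulr_ge0// ltW//.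
  rewrite -zx !spl z'0 z'1.
  rewrite (eq_bigr z) => [|j /and3P[_ jj0 jj1]]; last exact: z'E.
  by rewrite -!addrA; congr (_ + _); rewrite addrCA addKr.
rewrite /excess !splR H0 H1.
have -> : \sum_(j in J | (j != j0) && (j != j1)) Num.max (axis_gauge j (z' j) - 1) 0 =
  \sum_(j in J | (j != j0) && (j != j1)) Num.max (axis_gauge j (z j) - 1) 0.
  by apply: eq_bigr => j /and3P[_ jj0 jj1]; rewrite z'E.
rewrite (max_idPl _); last by rewrite subr_ge0 ltW.
rewrite (max_idPr _); last by rewrite subr_le0 ltW.
rewrite (max_idPl _); last by lra.
rewrite (max_idPr _); last by lra.
have : 0 < d / lam j0 (wi i) by rewrite divr_gt0.
lra.
Qed.

(** If the excess were positive, all gauges would be at least 1. A small move toward the splitting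
    y, whose gauges are at most 1, lowers them; summands falling below 1 are refilled in one
    coordinate at the expense of a summand j0 of gauge above 1, and the total excess drops. *)
Lemma exchange_rich J x (z y : I -> V) : split_in J x z ->
  (forall z' : I -> V, split_in J x z' -> excess J z <= excess J z') ->
  (forall j, j \in J -> (forall i, 0 <= y j 0 i) /\ axis_gauge j (y j) <= 1) ->
  (forall i, (\sum_(j in J) y j) 0 (wi i) = x 0 (wi i)) -> excess J z = 0.
Proof.
move=> sz zmin yP yx; have [zU zx] := sz.
have e0 : 0 <= excess J z by apply: sumr_ge0 => j _; rewrite le_max lexx orbT.
apply/eqP; rewrite eq_le e0 andbT leNgt; apply/negP => ep.
have h1 := exchange_poor sz zmin ep.
have [j0 j0J h0] : exists2 j0, j0 \in J & 1 < axis_gauge j0 (z j0).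
  apply: contrapT => h; move: ep; rewrite /excess big1 ?ltxx// => j jJ.
  apply/max_idPr; rewrite subr_le0 leNgt; apply/negP => hj; apply: h; by exists j.
have [i zi] : exists i, 0 < z j0 0 (wi i).
  apply: contrapT => h; move: h0; rewrite /axis_gauge big1 ?ltr10// => i _.
  have -> : z j0 0 (wi i) = 0.
    apply/eqP; rewrite eq_le (upper_ge0 (zU _ j0J)) andbT leNgt; apply/negP => zi;
        apply: h; by exists i.
  by rewrite mul0r.
set e : V := delta_mx 0 (wi i).
(* The heights are taken from z so that y' also sums to x; the gauge does not see them. *)
pose y' j : V := \row_i (if i == ord_max then z j 0 i else y j 0 i).
have hy' j : axis_gauge j (y' j) = axis_gauge j (y j) by apply: eq_bigr => k _;
    rewrite mxE wi_neq_max.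
have y'0 j : j \in J -> forall i, 0 <= y' j 0 i.
  by move=> jJ k; rewrite mxE; case: ifP => _;
      [exact: (upper_ge0 (zU _ jJ))|exact: (yP j jJ).1].
have y'x : \sum_(j in J) y' j = x.
  apply/rowP => k; rewrite summxE; case: (eqVneq k ord_max) => [->|km].
    by rewrite -zx summxE; apply: eq_bigr => j _; rewrite mxE eqxx.
  have [k' ->] : exists k', k = wi k'.
    have kk : (k < m)%N.
      have := ltn_ord k; rewrite ltnS leq_eqVlt => /orP[/eqP ke|//].
      by case/eqP: km; apply/val_inj.
    by exists (Ordinal kk); apply/val_inj.
  by rewrite -yx summxE; apply: eq_bigr => j _; rewrite mxE wi_neq_max.
pose C := \sum_(j in J) axis_gauge j (z j) * lam j (wi i).
have hz0 j : j \in J -> 0 <= axis_gauge j (z j) by move=> jJ; apply: le_trans (h1 j jJ).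
have C0 : 0 <= C by apply: sumr_ge0 => j jJ; rewrite mulr_ge0 ?hz0// ltW.
pose C' := C / lam j0 (wi i).
have C'0 : 0 <= C' by rewrite divr_ge0// ltW.
(* The first bound keeps the coordinate i of the summand j0 nonnegative after paying for the
   refills, at most s C in total; the second keeps its gauge at least 1. *)
pose s := Num.min (z j0 0 (wi i) / (z j0 0 (wi i) + C +
    1)) ((axis_gauge j0 (z j0) - 1) / (axis_gauge j0 (z j0) + C')).
have dn1 : 0 < z j0 0 (wi i) + C + 1 by lra.
have dn2 : 0 < axis_gauge j0 (z j0) + C' by lra.
have s0 : 0 < s by rewrite lt_min !divr_gt0// subr_gt0.
have s1 : s * (z j0 0 (wi i) + C +
    1) <= z j0 0 (wi i) by rewrite -ler_pdivlMr// ge_min lexx.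
have s2 : s * (axis_gauge j0 (z j0) +
    C') <= axis_gauge j0 (z j0) - 1 by rewrite -ler_pdivlMr// ge_min lexx orbT.
have sle1 : s <= 1.
  apply: (@le_trans _ _ (z j0 0 (wi i) / (z j0 0 (wi i) + C + 1)));
      first by rewrite ge_min lexx.
  by rewrite ler_pdivrMr// mul1r; lra.
pose b j := z j + s *: (y' j - z j).
have hb j : axis_gauge j (b j) = (1 - s) * axis_gauge j (z j) + s * axis_gauge j (y j).
  by rewrite /b axis_gaugeD axis_gaugeZ axis_gaugeB hy'; ring.
have b0 j : j \in J -> forall k, 0 <= b j 0 k.
  move=> jJ k; have := y'0 j jJ k; have := upper_ge0 (zU _ jJ) k; rewrite /b !mxE.
  set u := z j 0 k; set w := (if _ then _ else _) => u0 w0.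
  have -> : u + s * (w - u) = (1 - s) * u + s * w by ring.
  by rewrite addr_ge0// mulr_ge0// ?subr_ge0// ltW.
pose df j := Num.max (1 - axis_gauge j (b j)) 0.
have df0 j : 0 <= df j by rewrite le_max lexx orbT.
have dfs j : j \in J -> df j <= s * axis_gauge j (z j).
  move=> jJ; rewrite ge_max mulr_ge0 ?hz0 ?(ltW s0)// andbT hb.
  have := h1 j jJ; have := mulr_ge0 (ltW s0) (axis_gauge_ge0 j (yP j jJ).1); lra.
pose g := \sum_(j in J | j != j0) df j * lam j (wi i).
have gC : g <= s * C.
  rewrite /C (bigD1 j0)//= mulrDr -[g]add0r lerD//.
    by rewrite mulr_ge0 ?(ltW s0)// mulr_ge0 ?hz0// ltW.
  rewrite mulr_sumr; apply: ler_sum => j /andP[jJ _];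
      rewrite mulrA ler_wpM2r ?(ltW (lam0 _ _))//.
  exact: dfs.
have g0 : 0 <= g by apply: sumr_ge0 => j _; rewrite mulr_ge0// ltW.
pose z' j := if j == j0 then b j0 - g *: e else b j + (df j * lam j (wi i)) *: e.
have H0 : axis_gauge j0 (z' j0) = axis_gauge j0 (b j0) - g / lam j0 (wi i).
  by rewrite /z' eqxx axis_gaugeB axis_gaugeZ axis_gauge_delta.
have gl : g / lam j0 (wi i) <= s * C' by rewrite /C' mulrA ler_pM2r ?invr_gt0.
have gl0 : 0 <= g / lam j0 (wi i) by rewrite divr_ge0// ltW.
have yj0 : 0 <= s * axis_gauge j0 (y j0) <= s.
  rewrite mulr_ge0 ?(ltW s0) ?(axis_gauge_ge0 _ (yP _ j0J).1)//= ler_piMr ?(ltW s0)//.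
  exact: (yP _ j0J).2.
have H0ge : 1 <= axis_gauge j0 (z' j0) by rewrite H0 hb; have /andP[? ?] := yj0; lra.
have H0lt : axis_gauge j0 (z' j0) < axis_gauge j0 (z j0).
  rewrite H0 hb; have /andP[? ?] := yj0.
  have : s < s * axis_gauge j0 (z j0) by rewrite -{1}[s]mulr1 ltr_pM2l.
  lra.
have H1 j : j != j0 -> axis_gauge j (z' j) = Num.max 1 (axis_gauge j (b j)).
  move=> jj; rewrite /z' (negPf jj) axis_gaugeD axis_gaugeZ axis_gauge_delta mulfK
      ?lt0r_neq0// /df.
  case: (leP (axis_gauge j (b j)) 1) => hj.
    by rewrite (max_idPl _) ?subr_ge0//; lra.
  by rewrite (max_idPr _) ?addr0// subr_le0 ltW.
have : excess J z <= excess J z'.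
  apply: zmin; split.
    move=> j jJ; apply: upper_hgt.
      move=> k; rewrite /z'; case: eqP => [_|_]; last first.
        rewrite [X in _ <= X]mxE addr_ge0 ?b0// mxE mulr_ge0 ?mulr_ge0 ?(ltW (lam0 _ _))//
            mxE ler0n //.
      rewrite [X in _ <= X]mxE [X in _ + X]mxE; have := b0 j0 j0J k.
      rewrite [X in _ - X]mxE [e 0 k]mxE eqxx /=; case: eqP => [->|_];
          last by rewrite mulr0 subr0.
      move=> _; rewrite mulr1 subr_ge0; apply: le_trans gC _.
      have := y'0 j0 j0J (wi i); rewrite /b !mxE wi_neq_max => yw.
      have := mulr_ge0 (ltW s0) yw; nra.
    have [->//|jj] := eqVneq j j0.
    by rewrite H1// le_max lexx.
  have bx : \sum_(j in J) b j = x.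
    by rewrite /b big_split /= -scaler_sumr sumrB y'x zx subrr scaler0 addr0.
  rewrite -bx (bigD1 j0)//= [in RHS](bigD1 j0)//= /z' eqxx -addrA; congr (_ + _).
  under eq_bigr => j /andP[_ /negPf jj] do rewrite jj.
  by rewrite big_split /= -scaler_suml -/g addrC addrK.
apply/negP; rewrite -ltNge /excess (bigD1 j0)//= [in ltRHS](bigD1 j0)//= ltr_leD//.
  by rewrite !(max_idPl _) ?subr_ge0 ?ltrD2r// ltW.
apply: ler_sum => j /andP[jJ jj]; rewrite H1//.
have hbz : axis_gauge j (b j) <= axis_gauge j (z j).
  rewrite hb; have := h1 j jJ; have := (yP j jJ).2 => a1 a2; nra.
have hz := h1 j jJ.
have m1 : Num.max 1 (axis_gauge j (b j)) <= axis_gauge j (z j) by rewrite ge_max hz hbz.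
have m2 : 1 <= Num.max 1 (axis_gauge j (b j)) by rewrite le_max lexx.
by rewrite [X in X <= _](max_idPl _) ?subr_ge0// [X in _ <= X](max_idPl _) ?subr_ge0//
    lerD2r.
Qed.

Definition in_dom J (x : V) := exists2 y : I -> V,
  forall j, j \in J -> (forall i, 0 <= y j 0 i) /\ axis_gauge j (y j) <= 1 &
  forall i, (\sum_(j in J) y j) 0 (wi i) = x 0 (wi i).

(** A splitting of minimal excess has excess 0 over the sum of the simplices, so each summand lies
    over its own simplex and can be lowered into Q_j. *)
Lemma split_in_dom J x (z : I -> V) : split_in J x z -> in_dom J x ->
  exists p : I -> V, [/\ forall j, j \in J -> Q j (p j) /\ axis_gauge j (p j) <= 1,
    forall i, (\sum_(j in J) p j) 0 (wi i) = x 0 (wi i) &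
    (\sum_(j in J) p j) 0 ord_max <= x 0 ord_max].
Proof.
move=> /min_exists[z' sz' zmin] [y yP yx].
have e0 := exchange_rich sz' zmin yP yx.
have h1 j : j \in J -> axis_gauge j (z' j) <= 1.
  move=> jJ; rewrite -subr_le0; apply/max_idPr.
  have /eqP := e0; rewrite /excess psumr_eq0 => [|k _]; last by rewrite le_max lexx orbT.
  by move=> /allP/(_ j (mem_index_enum j)) /implyP/(_ jJ)/eqP.
have /choice[p pP] j : exists p, j \in J ->
    Q j p /\ ((forall i, p 0 (wi i) = z' j 0 (wi i)) /\ p 0 ord_max <= z' j 0 ord_max).
  have [jJ|_] := boolP (j \in J); last by exists 0.
  by have [p Qp pz] := below_face (sz'.1 j jJ) (h1 j jJ); exists p.
exists p; split.
- move=> j jJ; have [Qp [pw _]] := pP j jJ; split => //.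
  by rewrite (_ : axis_gauge j (p j) = axis_gauge j (z' j)) ?h1//; apply: eq_bigr => i _;
      rewrite pw.
- move=> i; rewrite -sz'.2 !summxE; apply: eq_bigr => j jJ; by have [_ [-> _]] := pP j jJ.
- rewrite -sz'.2 !summxE; apply: ler_sum => j jJ; by have [_ []] := pP j jJ.
Qed.

(** Outside the sum of the simplices the minimal excess is positive, so all gauges are at least 1
    and every summand may be flattened. The minimization starts from a splitting made admissible by
    the points on the last axis. *)
Lemma split_off_dom J (x : V) : J != finset.set0 -> (forall i, 0 <= x 0 i) ->
    ~ in_dom J x ->
  exists z : I -> V, split_in J (flat x) z.
Proof.
move=> /finset.set0Pn[j1 j1J] x0 nD.
pose z (j : I) : V := (if j == j1 then flat x else 0) + lam j ord_max *: delta_mx 0 ord_max.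
have zU j : j \in J -> upper j (z j).
  move=> _; exists (lam j ord_max *: delta_mx 0 ord_max); first exact: Qlam.
  by move=> i; rewrite [X in _ <= X]mxE lerDr; case: eqP => _; rewrite mxE//; case: ifP.
have [z' sz' zmin] := min_exists (conj zU erefl).
have zw i : (\sum_(j in J) z' j) 0 (wi i) = x 0 (wi i).
  rewrite sz'.2 summxE (bigD1 j1)//= big1 => [|j /andP[_ /negPf jj]].
    by rewrite /z eqxx !mxE wi_neq_max andbF mulr0 !addr0.
  by rewrite /z jj !mxE wi_neq_max andbF mulr0 addr0.
exists (fun j => flat (z' j)); split; last first.
  apply/rowP => i; rewrite summxE mxE; case: (eqVneq i ord_max) => [->|im].
    by rewrite big1// => j _; rewrite mxE eqxx.
  have [i' ->] : exists i', i = wi i'.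
    have ii : (i < m)%N.
      have := ltn_ord i; rewrite ltnS leq_eqVlt => /orP[/eqP ie|//].
      by case/eqP: im; apply/val_inj.
    by exists (Ordinal ii); apply/val_inj.
  by rewrite -zw summxE; apply: eq_bigr => j _; rewrite mxE wi_neq_max.
have ep : 0 < excess J z'.
  rewrite lt_neqAle sumr_ge0 ?andbT => [|j _]; last by rewrite le_max lexx orbT.
  apply/negP => /eqP/esym e0; apply: nD; exists z' => // j jJ; split;
      first exact: upper_ge0 (sz'.1 j jJ).
  rewrite -subr_le0; apply/max_idPr.
  have /eqP := e0; rewrite /excess psumr_eq0 => [|k _]; last by rewrite le_max lexx orbT.
  by move=> /allP/(_ j (mem_index_enum j)) /implyP/(_ jJ)/eqP.
move=> j jJ; apply: upper_hgt; last by rewrite axis_gauge_flat;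
    exact: exchange_poor sz' zmin ep j jJ.
by move=> i; rewrite mxE; case: ifP => // _; exact: upper_ge0 (sz'.1 j jJ) i.
Qed.

End Exchange.

Lemma continuous_sum_rV (R : realType) q (I : Type) (r : seq I) (P : pred I) (f : I ->
    'rV[R]_q -> R) :
  (forall i, continuous (f i)) -> continuous (fun l => \sum_(i <- r | P i) f i l).
Proof.
move=> fc x; have FF := rV_nbhs_filter x; rewrite /continuous_at; elim: r => [|i r IH].
  by rewrite big_nil; under eq_cvg do rewrite big_nil; exact: cvg_cst.
rewrite big_cons; under eq_cvg do rewrite big_cons.
by case: (P i) => //; apply: cvgD => //; exact: fc.
Qed.

(** * Existence of splittings of minimal excess *)

Section MinExists.
Variables (R : realType) (n q m : nat) (blk : 'I_q -> 'I_n) (v : 'I_q -> 'rV[R]_m.+1).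
Variable lam : 'I_n -> 'I_m.+1 -> R.
Hypothesis v0 : forall a i, 0 <= v a 0 i.
Let Q j := conv_hull [set v a | a in [set a | blk a == j]].

Lemma hull_ge0 j (p : 'rV[R]_m.+1) : Q j p -> forall i, 0 <= p 0 i.
Proof.
rewrite /Q conv_hullE => -[l [l0 _] <-] i; rewrite summxE; apply: sumr_ge0 => a _.
by rewrite mxE mulr_ge0.
Qed.

(** The variables of the program are the convex weights and a nonnegative slack vector; with
    coordinates of z bounded by B, weights are at most 1 and slacks at most B. *)
Let upperB (B : R) j : set 'rV[R]_m.+1 :=
  [set l *m (col_mx (\matrix_(a, i) v a 0 i) 1%:M) | l in
    feasible (col_mx (\matrix_(a < q, c < n) (blk a == c)%:R) (0 : 'M[R]_(m.+1,
        n))) (\row_c (c == j)%:R) (1 + B)].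

Let upperBP (B : R) j (z : 'rV[R]_m.+1) : upperB B j z -> upper Q j z.
Proof.
move=> [l [l0 l1] <-].
have lE : l = row_mx (lsubmx l) (rsubmx l) by rewrite hsubmxK.
move: l1; rewrite {1}lE mul_row_col mulmx0 addr0 => l1.
have la a : 0 <= (lsubmx l) 0 a by rewrite mxE; have /andP[] := l0 (lshift m.+1 a).
exists (\sum_(a | blk a == j) (lsubmx l) 0 a *: v a).
  rewrite /Q conv_hullE; exists (fun a => (lsubmx l) 0 a) => //; split => //.
  move/rowP: l1 => /(_ j); rewrite !mxE eqxx /= mulr1n => e;
      rewrite -[RHS]e [LHS]big_mkcond; apply: eq_bigr => a _.
  by rewrite [in RHS]mxE; case: eqP; rewrite ?mulr1 ?mulr0.
have lz a : blk a != j -> (lsubmx l) 0 a = 0.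
  move=> aj; move/rowP: l1 => /(_ (blk a)); rewrite !mxE (negPf aj) => /eqP.
  rewrite psumr_eq0 => [|b _]; last by rewrite mulr_ge0// mxE ler0n.
  move=> /allP/(_ a (mem_index_enum a)) /=; rewrite [X in _ * X]mxE eqxx mulr1 => /eqP e.
  by rewrite -[RHS]e mxE.
move=> i; rewrite lE mul_row_col mulmx1 -lE mxE.
have -> : (\sum_(a | blk a == j) lsubmx l 0 a *: v a) 0 i = (lsubmx l *m \matrix_(a,
    i) v a 0 i) 0 i.
  rewrite summxE !mxE big_mkcond; apply: eq_bigr => a _; rewrite !mxE.
  case: eqP => [//|/eqP/lz]; rewrite mxE => ->; by rewrite mul0r.
by rewrite lerDl mxE; have /andP[] := l0 (rshift q i).
Qed.

Let upperPB (B : R) j (z : 'rV[R]_m.+1) : (forall i, z 0 i <= B) -> upper Q j z ->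
    upperB B j z.
Proof.
move=> zB [p Qp pz]; have p0 := hull_ge0 Qp; move: (Qp);
    rewrite {1}/Q conv_hullE => -[l [l0 l1] lp].
pose l' a := if blk a == j then l a else 0.
have B0 : m.+1 = m.+1 -> 0 <= B by move=> _; apply: le_trans (zB ord0);
    exact: le_trans (p0 ord0) (pz ord0).
exists (row_mx (\row_a l' a) (z - p)); last first.
  rewrite mul_row_col mulmx1; apply/rowP => i; rewrite !mxE.
  have -> : \sum_a (\row_a0 l' a0) 0 a * (\matrix_(a0, i0) v a0 0 i0) a i = p 0 i.
    rewrite -lp summxE [RHS]big_mkcond; apply: eq_bigr => a _; rewrite !mxE /l'.
    by case: ifP; rewrite ?mul0r.
  by rewrite addrC subrK.
split=> [k|].
  case: (split_ordP k) => a ->; rewrite ?row_mxEl ?row_mxEr !mxE.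
    rewrite /l'; case: eqP => [aj|_]; last by rewrite lexx addr_ge0// B0.
    rewrite l0 (@le_trans _ _ 1)// ?lerDl ?B0// -l1 (bigD1 a) ?aj//= lerDl.
    exact: sumr_ge0.
  rewrite subr_ge0 pz /= lerBlDr -lerBlDl; apply: le_trans (_ : z 0 a - B <= _).
    by rewrite lerB//; lra.
  by rewrite (@le_trans _ _ 0)// ?subr_le0.
rewrite mul_row_col mulmx0 addr0; apply/rowP => c; rewrite !mxE.
have [->|cj] := eqVneq c j.
  rewrite -[RHS]l1 [RHS]big_mkcond; apply: eq_bigr => a _; rewrite !mxE /l'.
  by case: eqP; rewrite ?mulr1 ?mulr0.
apply: big1 => a _; rewrite !mxE /l'; case: eqP => [->|_]; last by rewrite mul0r.
by rewrite eq_sym (negPf cj) mulr0.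
Qed.

(** Summands are nonnegative, so all their coordinates are bounded by the sum B of those of x. The
    splittings form a compact set, on which the excess is continuous. *)
Lemma hull_min_exists (J : {set 'I_n}) (x : 'rV[R]_m.+1) (z : 'I_n ->
    'rV[R]_m.+1) : split_in Q J x z ->
  exists2 z' : 'I_n -> 'rV[R]_m.+1, split_in Q J x z' &
  forall z'' : 'I_n -> 'rV[R]_m.+1, split_in Q J x z'' ->
      excess lam J z' <= excess lam J z''.
Proof.
move=> sz; pose B := \sum_i x 0 i.
have up0 j (p : 'rV[R]_m.+1) : upper Q j p -> forall i, 0 <= p 0 i.
  by move=> [p' Qp pp] i; exact: le_trans (hull_ge0 Qp i) (pp i).
have x0 i : 0 <= x 0 i.
  by rewrite -sz.2 summxE; apply: sumr_ge0 => j jJ; exact: up0 (sz.1 j jJ) i.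
have xB i : x 0 i <= B by rewrite /B (bigD1 i)//= lerDl; apply: sumr_ge0.
have bnd (z0 : 'I_n -> 'rV[R]_m.+1) : split_in Q J x z0 -> forall j i, j \in J ->
    z0 j 0 i <= B.
  move=> [zU zx] j i jJ; apply: le_trans (xB i); rewrite -zx summxE (bigD1 j)//= lerDl.
  by apply: sumr_ge0 => k /andP[kJ _]; exact: up0 (zU k kJ) i.
pose N := #|{: 'I_n * 'I_m.+1}|.
pose sel (j : 'I_n) : 'M[R]_(N, m.+1) := \matrix_(k, i) (k == enum_rank (j, i))%:R.
have selE (Z : 'rV[R]_N) j i : (Z *m sel j) 0 i = Z 0 (enum_rank (j, i)).
  rewrite mxE (bigD1 (enum_rank (j, i)))//= mxE eqxx mulr1 big1 ?addr0// => k /negPf ki.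
  by rewrite mxE ki mulr0.
pose D : set 'rV[R]_N := [set Z : 'rV[R]_N | [/\ forall k, `[0, B]%classic (Z 0 k),
    forall j, j \in J -> upperB B j (Z *m sel j) &
   Z *m (\sum_(j in J) sel j) = x]].
pose pack (z0 : 'I_n ->
    'rV[R]_m.+1) : 'rV[R]_N :=
        \row_k (if (enum_val k).1 \in J then z0 (enum_val k).1 0 (enum_val k).2 else 0).
have packE z0 j : j \in J -> pack z0 *m sel j = z0 j.
  by move=> jJ; apply/rowP => i; rewrite selE mxE enum_rankK /= jJ.
have B0 : 0 <= B by apply: sumr_ge0.
have packD z0 : split_in Q J x z0 -> D (pack z0).
  move=> s0; split.
  - move=> k; rewrite /= in_itv /= mxE; case: ifP => [kJ|_]; last by rewrite lexx B0.
    by rewrite (up0 _ _ (s0.1 _ kJ)) (bnd _ s0).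
  - move=> j jJ; rewrite packE//; apply: upperPB (s0.1 j jJ) => i; exact: bnd.
  - by rewrite mulmx_sumr -s0.2; apply: eq_bigr => j jJ; rewrite packE.
have cD : compact D.
  apply: (@subclosed_compact _ _ [set Z : 'rV[R]_N | forall k, `[0, B]%classic (Z 0 k)]).
  - have -> : D = (\bigcap_(k in [set: 'I_N]) ((fun Z : 'rV[R]_N => Z 0 k) @^-1` `[0,
      B]%classic)) `&`
        ((\bigcap_(j in [set j | j \in J]) ((fun Z : 'rV[R]_N =>
            Z *m sel j) @^-1` upperB B j)) `&`
         (\bigcap_(i in [set: 'I_m.+1]) ((fun Z : 'rV[R]_N =>
             \sum_k Z 0 k * (\sum_(j in J) sel j) k i) @^-1` [set y | y = x 0 i]))).
      apply/seteqP; split => [Z [Z1 Z2 Z3]|Z [Z1 [Z2 Z3]]]; split => //.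
      + by move=> k _; exact: Z1.
      + by split => // i _; rewrite /= -Z3 mxE.
      + by move=> k; exact: (Z1 k I).
      + by apply/rowP => i; rewrite mxE; exact: (Z3 i I).
    apply: closedI; [|apply: closedI]; apply: closed_bigI => i _.
    + apply: (proj1 (continuous_closedP _) _); last exact: itv_closed.
      exact: coord_continuous.
    + apply: (proj1 (continuous_closedP _) (@continuous_mulmx R _ _ _)).
      exact: feasible_image_closed.
    + by apply: (proj1 (continuous_closedP _) (@continuous_dot R _ _)); exact: closed_eq.
  - by apply: (@rV_compact R N (fun=> `[0, B]%classic)) => i; exact: segment_compact.
  - by move=> Z [].
pose ex (Z : 'rV[R]_N) := \sum_(j in J) Num.max (\sum_(i < m) Z 0 (enum_rank (j,
    widen_ord (leqnSn m) i)) / lam j (widen_ord (leqnSn m) i) - 1) 0.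
have exE Z : excess lam J (fun j => Z *m sel j) = ex Z.
  by apply: eq_bigr => j _; congr (Num.max (_ - _) _); apply: eq_bigr => i _; rewrite selE.
have cex : continuous ex.
  apply: continuous_sum_rV => j Z; have FF := rV_nbhs_filter Z.
  pose h (Z : 'rV[R]_N) := \sum_(i < m) Z 0 (enum_rank (j,
      widen_ord (leqnSn m) i)) / lam j (widen_ord (leqnSn m) i).
  have hc : continuous h.
    apply: continuous_sum_rV => i Y; have FY := rV_nbhs_filter Y.
    by apply: cvgM; [exact: coord_continuous|exact: cvg_cst].
  have -> : (fun Y : 'rV[R]_N => Num.max (h Y - 1) 0) = (fun Y =>
      ((h Y - 1) + `|h Y - 1|) / 2).
    apply/funext => Y; case: (leP (h Y - 1) 0) => hY.
      by rewrite ler0_norm// addrN mul0r.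
    by rewrite gtr0_norm//; field.
  apply: cvgM; last exact: cvg_cst.
  have h1 : h Y - 1 @[Y --> Z] --> h Z - 1 by apply: cvgB; [exact: hc|exact: cvg_cst].
  by apply: cvgD => //; exact: cvg_norm.
have [|||Z ZD Zmin] := @EVT_min_rV R N ex D.
- by exists (pack z); exact: packD.
- exact: cD.
- exact: continuous_subspaceT.
move: ZD; rewrite inE => -[Z1 Z2 Z3].
exists (fun j => Z *m sel j).
  by split => [j jJ|]; [exact: upperBP (Z2 j jJ)|rewrite -mulmx_sumr].
move=> z'' sz''; rewrite exE; apply: le_trans (Zmin (pack z'') (mem_set (packD _ sz''))) _.
rewrite -exE /excess; apply: ler_sum => j jJ; by rewrite packE.
Qed.

End MinExists.

(** * Regions under lower envelopes *)

Lemma set_minP (R : realType) (E : set R) x : E x -> lbound E x -> set_min E = x.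
Proof.
move=> Ex lx; have : (E `&` lbound E) (set_min E) by apply: xgetI; split;
    [exact: Ex|exact: lx].
by move=> [Em lm]; apply/eqP; rewrite eq_le lm// lx.
Qed.

Section Envelope.
Variables (R : realType) (m q : nat).
Local Notation n := m.+1.
Local Notation V := 'rV[R]_m.+1.
Local Notation wi := (widen_ord (leqnSn m)).
Variables (blk : 'I_q -> 'I_n) (ex : 'I_q -> multinom n) (M : nat).
Hypothesis M0 : (0 < M)%N.
Hypothesis Me : forall (j i : 'I_n), exists a, blk a = j /\ ex a = (mnm1 i *+ M)%M.

Let v a : V := @pt_of R n (ex a).
Definition hullQ (j : 'I_n) : set V := conv_hull (@block_pts R n q blk ex j).
Local Notation Q := hullQ.

(* Monomials of degree > M are replaced by M e_0, which is in the support anyway. *)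
Definition clamp a : multinom n :=
    if (mdeg (ex a) <= M)%N then ex a else (mnm1 ord0 *+ M)%M.
Definition hullC (j : 'I_n) : set V := conv_hull (@block_pts R n q blk clamp j).

Definition axis_len (j i : 'I_n) : R := axis_min (Q j) i.

Lemma hullQ_pt a : Q (blk a) (v a).
Proof. by move=> C [_ sC]; apply: sC; exists a => //=; rewrite eqxx. Qed.

Lemma pt_Me i : @pt_of R n (mnm1 i *+ M)%M = M%:R *: delta_mx 0 i.
Proof.
apply/rowP => k; rewrite !mxE eqxx /=; mnm; rewrite [in LHS]eq_sym natrM mulrC.
by [].
Qed.

Lemma hullQ_Me j i : Q j (M%:R *: delta_mx 0 i).
Proof. by have [a [<- ea]] := Me j i; rewrite -pt_Me -ea; exact: hullQ_pt. Qed.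

Lemma hullQ_ge0 j (p : V) : Q j p -> forall i, 0 <= p 0 i.
Proof.
by apply: (hull_ge0 (v := v) (blk := blk)) => a i; rewrite mxE.
Qed.

Lemma hull_convex (E : set V) : @convex_set R V (conv_hull E).
Proof.
move=> x y l; rewrite !inE => hx hy C [cC sC].
have := cC x y l (mem_set (hx C (conj cC sC))) (mem_set (hy C (conj cC sC))).
by rewrite inE.
Qed.

Lemma axis_lenP j i : exists k : nat, [/\ (0 < k)%N, (k <= M)%N,
    axis_len j i = k%:R & Q j (k%:R *: delta_mx 0 i)].
Proof.
pose P k := `[< (0 < k)%N /\ Q j (k%:R *: delta_mx 0 i) >].
have exP : exists k, P k by exists M; apply/asboolP; split => //; exact: hullQ_Me.
case: (ex_minnP exP) => k /asboolP[k0 Qk] kmin.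
have kM : (k <= M)%N by apply: kmin; apply/asboolP; split => //; exact: hullQ_Me.
exists k; split => //; apply: set_minP; first by exists k.
by move=> _ [k' k'0 [-> Qk']]; rewrite ler_nat; apply: kmin; exact/asboolP.
Qed.

Lemma axis_len_gt0 j i : 0 < axis_len j i.
Proof. by have [k [k0 _ -> _]] := axis_lenP j i; rewrite ltr0n. Qed.

Lemma axis_len_le j i : axis_len j i <= M%:R.
Proof. by have [k [_ kM -> _]] := axis_lenP j i; rewrite ler_nat. Qed.

Lemma axis_len_mem j i : Q j (axis_len j i *: delta_mx 0 i).
Proof. by have [k [_ _ -> Qk]] := axis_lenP j i. Qed.

Lemma simplex_comb (E : set V) (l c : 'I_n -> R) : @convex_set R V E ->
  (forall i, E (c i *: delta_mx 0 i)) -> (forall i, 0 <= l i) -> \sum_i l i = 1 ->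
  E (\row_i (l i * c i)).
Proof.
move=> cE Ec l0 l1; have :=
    @convex_comb R n E _ (fun i => c i *: delta_mx 0 i) l xpredT cE (fun i _ => Ec i) l0 l1.
congr E; apply/rowP => i; rewrite summxE (bigD1 i)//= big1 => [|k /negPf ki];
    rewrite !mxE ?eqxx.
  by rewrite mulr1 addr0.
by rewrite eq_sym ki !mulr0.
Qed.

Lemma axis_simplexE j (z : V) : axis_simplex (Q j) z <-> (forall i, 0 <= z 0 i) /\
    \sum_i z 0 i / axis_len j i <= 1.
Proof.
split.
  apply: (@smallest_sub _ _ _ [set z : V | (forall i, 0 <= z 0 i) /\
      \sum_i z 0 i / axis_len j i <= 1]).
    move=> x y t; rewrite !inE => -[x0 x1] [y0 y1]; rewrite convE; split => [i|].
      by rewrite !mxE addr_ge0// mulr_ge0// subr_ge0.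
    have -> : \sum_i (t%:num *: x + (1 - t%:num) *: y) 0 i / axis_len j i =
      t%:num * (\sum_i x 0 i / axis_len j i) + (1 - t%:num) * (\sum_i y 0 i / axis_len j i).
      by rewrite !mulr_sumr -big_split; apply: eq_bigr => i _;
          rewrite !mxE /= mulrDl !mulrA.
    have t0 : 0 <= t%:num by []. have t1 : t%:num <= 1 by [].
    have t1' : 0 <= 1 - t%:num by rewrite subr_ge0.
    have := ler_wpM2l t0 x1; have := ler_wpM2l t1' y1; lra.
  move=> _ [->|[i _ <-]]; split => [k|].
  - by rewrite mxE.
  - by rewrite big1// => k _; rewrite mxE mul0r.
  - by rewrite !mxE mulr_ge0// ltW// axis_len_gt0.
  rewrite (bigD1 i)//= big1 => [|k /negPf ki]; rewrite !mxE ?eqxx ?ki ?mulr0 ?mul0r//.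
  by rewrite mulr1 divff ?addr0// lt0r_neq0// axis_len_gt0.
move=> [z0 z1] C [cC sC].
have C0 : C 0 by apply: sC; left.
have [s0|sn] := eqVneq (\sum_i z 0 i / axis_len j i) 0.
  have -> : z = 0; last by [].
  apply/rowP => i; rewrite mxE; move/eqP: s0; rewrite psumr_eq0 => [|k _];
      last by rewrite divr_ge0// ltW// axis_len_gt0.
  move=> /allP/(_ i (mem_index_enum i)) /=;
      rewrite mulf_eq0 invr_eq0 (gt_eqF (axis_len_gt0 _ _)) orbF.
  by move=> /eqP.
set s := \sum_i _ in z1 sn.
have s0 : 0 < s.
  by rewrite lt_neqAle eq_sym sn; apply: sumr_ge0 => i _;
      rewrite divr_ge0// ltW// axis_len_gt0.
have Cz : C (\row_i ((z 0 i / axis_len j i / s) * axis_len j i)).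
  apply: simplex_comb => // [i|i|].
  - by apply: sC; right; exists i.
  - by rewrite !divr_ge0// ltW// axis_len_gt0.
  - by rewrite -mulr_suml divff.
have := cC _ _ (Itv01 (ltW s0) z1) (mem_set Cz) (mem_set C0).
rewrite inE convE /= scaler0 addr0; congr C; apply/rowP => i; rewrite !mxE.
by rewrite [_ / s * _]mulrAC divfK ?lt0r_neq0 ?axis_len_gt0// mulrC divfK.
Qed.

Definition ext (x : 'rV[R]_m) (t : R) : V :=
    \row_i (if insub (val i) is Some k then x 0 (k : 'I_m) else t).

Lemma ext_wi x t i : ext x t 0 (wi i) = x 0 i.
Proof. by rewrite mxE /= (insubT (fun k => k < m)%N (ltn_ord i)); congr (x _ _);
    exact: val_inj. Qed.

Lemma ext_max x t : ext x t 0 ord_max = t.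
Proof. by rewrite mxE insubF //= ltnn. Qed.

Lemma wi_or_max (k : 'I_n) : k = ord_max \/ exists i, k = wi i.
Proof.
have := ltn_ord k; rewrite ltnS leq_eqVlt => /orP[/eqP ke|km]; first by left;
    exact: val_inj.
by right; exists (Ordinal km); exact: val_inj.
Qed.

Lemma ext_eq (z : V) (x : 'rV[R]_m) t : (forall i, z 0 (wi i) = x 0 i) ->
    z 0 ord_max = t -> z = ext x t.
Proof.
move=> zx zt; apply/rowP => k; case: (wi_or_max k) => [->|[i ->]]; first by rewrite ext_max.
by rewrite ext_wi.
Qed.

Lemma proj_ext x t : proj_init (ext x t) = x.
Proof. by apply/rowP => i; rewrite mxE ext_wi. Qed.

Lemma ext_proj (z : V) : z = ext (proj_init z) (z 0 ord_max).
Proof. by apply: ext_eq => // i; rewrite mxE. Qed.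

Local Notation hgt := (@axis_gauge R m 'I_n axis_len).

Definition dom j : set 'rV[R]_m := @proj_init R m @` axis_simplex (Q j).

Lemma hgt_ext j (x : 'rV[R]_m) t t' : hgt j (ext x t) = hgt j (ext x t').
Proof. by apply: eq_bigr => i _; rewrite !ext_wi. Qed.

Lemma domE j (y : 'rV[R]_m) : dom j y <-> (forall i, 0 <= y 0 i) /\ hgt j (ext y 0) <= 1.
Proof.
have big (z : V) : \sum_i z 0 i / axis_len j i = hgt j z + z 0 ord_max / axis_len j ord_max.
  by rewrite big_ord_recr.
split=> [[z /axis_simplexE[z0 z1] <-]|[y0 y1]].
  split => [i|]; first by rewrite mxE.
  have -> : hgt j (ext (proj_init z) 0) = hgt j z by apply: eq_bigr => i _;
      rewrite ext_wi mxE.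
  by move: z1; rewrite big; have := divr_ge0 (z0 ord_max) (ltW (axis_len_gt0 j ord_max));
      lra.
exists (ext y 0); last exact: proj_ext.
apply/axis_simplexE; split => [k|]; last by rewrite big ext_max mul0r addr0.
by case: (wi_or_max k) => [->|[i ->]]; rewrite ?ext_max// ext_wi.
Qed.

(** The point over y on the slanted facet of Delta_j, a convex combination of axis points; it bounds
    the lower envelope from above. *)
Lemma roof_mem j (y : 'rV[R]_m) : dom j y ->
    Q j (ext y ((1 - hgt j (ext y 0)) * axis_len j ord_max)).
Proof.
move=> /domE[y0 y1].
have := @simplex_comb (Q j) (fun i =>
    ext y ((1 - hgt j (ext y 0)) * axis_len j ord_max) 0 i / axis_len j i)
  (axis_len j) (@hull_convex _) (@axis_len_mem j).
have -> : \row_i (ext y ((1 - hgt j (ext y 0)) * axis_len j ord_max) 0 i / axis_len j i *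
    axis_len j i) =
  ext y ((1 - hgt j (ext y 0)) * axis_len j ord_max).
  by apply/rowP => i; rewrite mxE divfK// lt0r_neq0// axis_len_gt0.
apply => [k|].
  rewrite divr_ge0 ?(ltW (axis_len_gt0 _ _))//.
  case: (wi_or_max k) => [->|[i ->]]; rewrite ?ext_max ?ext_wi//.
  by rewrite mulr_ge0 ?subr_ge0// ltW// axis_len_gt0.
rewrite big_ord_recr /= ext_max mulfK ?lt0r_neq0 ?axis_len_gt0//.
rewrite -/(hgt j (ext y _)) (hgt_ext _ _ _ 0); lra.
Qed.

Section Family.
Variable J : {set 'I_n}.

Definition fam (x : 'rV[R]_m) (p : 'I_n -> V) := (forall j, j \in J ->
    Q j (p j) /\ hgt j (p j) <= 1) /\
  forall i, (\sum_(j in J) p j) 0 (wi i) = x 0 i.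

Definition cost (p : 'I_n -> V) : R := (\sum_(j in J) p j) 0 ord_max.

(** The choice of points of the Q_j over the simplices with given projected sum is one bounded
    linear program, the total height being its objective. *)
Lemma fam_min (x : 'rV[R]_m) (p0 : 'I_n -> V) : fam x p0 -> exists2 p : 'I_n ->
    V, fam x p & forall p' : 'I_n -> V, fam x p' -> cost p <= cost p'.
Proof.
move=> fp0.
pose E1 : 'M[R]_(q, n) := \matrix_(a, c) (blk a == c)%:R.
pose E2 : 'M[R]_(q, n) := \matrix_(a, c) (if blk a == c then hgt c (v a) else 0).
pose E3 : 'M[R]_(q, m) := \matrix_(a, i) v a 0 (wi i).
(* The q weights and one slack per block are subject to three kinds of equations: total weight of a
   block, gauge plus slack, and the projected sum. *)
pose E : 'M[R]_(q + n,
    n + n + m) := col_mx (row_mx (row_mx E1 E2) E3) (row_mx (row_mx 0 1%:M) 0).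
pose ind : 'rV[R]_n := \row_j (j \in J)%:R.
pose w : 'rV[R]_(n + n + m) := row_mx (row_mx ind ind) x.
pose cst (k : 'I_(q + n)) : R :=
    match fintype.split k with inl a => v a 0 ord_max | inr _ => 0 end.
pose F := feasible E w 1.
pose of_l (l : 'rV[R]_(q + n)) j : V := \sum_(a | blk a == j) l 0 (lshift n a) *: v a.
have FE (l : 'rV[R]_(q + n)) : l *m E = w <-> [/\ forall j,
    \sum_(a | blk a == j) l 0 (lshift n a) = (j \in J)%:R,
    forall j, hgt j (of_l l j) + l 0 (rshift q j) = (j \in J)%:R & forall i,
        \sum_a l 0 (lshift n a) * v a 0 (wi i) = x 0 i].
  have lE : l = row_mx (lsubmx l) (rsubmx l) by rewrite hsubmxK.
  have e1 j : (lsubmx l *m E1) 0 j = \sum_(a | blk a == j) l 0 (lshift n a).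
    rewrite mxE [RHS]big_mkcond; apply: eq_bigr => a _; rewrite !mxE.
    by case: eqP; rewrite ?mulr1 ?mulr0.
  have e2 j : (lsubmx l *m E2) 0 j = hgt j (of_l l j).
    rewrite mxE /of_l (big_morph (hgt j) (@axis_gaugeD R m _ axis_len j) (_ : hgt j 0 =
        0)); last first.
      by rewrite /axis_gauge big1// => i _; rewrite mxE mul0r.
    rewrite [RHS]big_mkcond; apply: eq_bigr => a _; rewrite !mxE axis_gaugeZ.
    by case: eqP; rewrite ?mulr0.
  have e3 i : (lsubmx l *m E3) 0 i = \sum_a l 0 (lshift n a) * v a 0 (wi i).
    by rewrite mxE; apply: eq_bigr => a _; rewrite !mxE.
  have -> : l *m E = row_mx (row_mx (lsubmx l *m E1) (lsubmx l *m E2 +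
      rsubmx l)) (lsubmx l *m E3).
    rewrite {1}lE mul_row_col !mul_mx_row !mulmx0 mulmx1 !add_row_mx !addr0 //.
  split=> [/eq_row_mx[/eq_row_mx[h1 h2] h3]|[h1 h2 h3]].
    split => [j|j|i].
    - by rewrite -e1 h1 mxE.
    - by rewrite -e2; move/rowP: h2 => /(_ j); rewrite !mxE.
    - by rewrite -e3 h3.
  congr row_mx; last by apply/rowP => i; rewrite e3.
  congr row_mx; apply/rowP => j; first by rewrite e1 mxE.
  by rewrite mxE e2 [rsubmx l 0 j]mxE h2 mxE.
have of_l_fam l : F l -> fam x (of_l l) /\ cost (of_l l) = \sum_k l 0 k * cst k.
  move=> [l0 /FE[h1 h2 h3]].
  have lz j a : j \notin J -> blk a == j -> l 0 (lshift n a) = 0.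
    move=> jJ aj; have /eqP := h1 j; rewrite (negPf jJ) psumr_eq0 => [|b _];
        last by have /andP[] := l0 (lshift n b).
    by move=> /allP/(_ a (mem_index_enum a)) /implyP/(_ aj)/eqP.
  have tot : \sum_(j in J) of_l l j = \sum_a l 0 (lshift n a) *: v a.
    rewrite [RHS](partition_big blk xpredT)//= [LHS]big_mkcond; apply: eq_bigr => j _.
    case: ifP => // jJ; rewrite big1// => a aj; by rewrite (lz j)// ?jJ// scale0r.
  split; last first.
    rewrite /cost tot summxE big_split_ord /= [X in _ + X]big1 => [|j _]; last first.
      by rewrite /cst -[rshift q j]/(unsplit (inr j)) unsplitK mulr0.
    rewrite addr0; apply: eq_bigr => a _; rewrite mxE /cst.
    by rewrite -[lshift n a]/(unsplit (inl a)) unsplitK.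
  split=> [j jJ|i]; last first.
    by rewrite tot summxE -h3; apply: eq_bigr => a _; rewrite mxE.
  split; last first.
    by have := h2 j; rewrite jJ /= mulr1n; have /andP[? _] := l0 (rshift q j); lra.
  rewrite /hullQ /block_pts conv_hullE; exists (fun a => l 0 (lshift n a)) => //; split.
    by move=> a; have /andP[] := l0 (lshift n a).
  by rewrite h1 jJ.
have fam_of p : fam x p -> exists2 l, F l & cost p = \sum_k l 0 k * cst k.
  move=> [pQ px].
  have /choice[L LP] j : exists L : 'I_q -> R, j \in J ->
      [/\ forall a, 0 <= L a, \sum_(a | blk a == j) L a = 1 &
     \sum_(a | blk a == j) L a *: v a = p j].
    have [jJ|_] := boolP (j \in J); last by exists (fun=> 0).
    by have [+ _] := pQ j jJ; rewrite /hullQ /block_pts conv_hullE => -[L [L0 L1] <-];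
        exists L.
  pose l : 'rV[R]_(q + n) := row_mx (\row_a (if blk a \in J then L (blk a) a else 0))
    (\row_j (if j \in J then 1 - hgt j (p j) else 0)).
  have ll a : l 0 (lshift n a) = if blk a \in J then L (blk a) a else 0 by rewrite row_mxEl
      mxE.
  have lr j : l 0 (rshift q j) = if j \in J then 1 - hgt j (p j) else 0 by rewrite row_mxEr
      mxE.
  have ofl j : j \in J -> of_l l j = p j.
    move=> jJ; have [_ _ <-] := LP j jJ; apply: eq_bigr => a /eqP aj.
    by rewrite ll aj jJ.
  have ofl0 j : j \notin J -> of_l l j = 0.
    move=> jJ; rewrite /of_l big1// => a /eqP aj; by rewrite ll aj (negPf jJ) scale0r.
  have Fl : F l.
    split.
      move=> k; case: (split_ordP k) => a ->; rewrite ?ll ?lr; case: ifP => aJ;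
          rewrite ?lexx ?ler01//.
        have [L0 L1 _] := LP _ aJ; rewrite L0 -L1 (bigD1 a) ?eqxx//= lerDl; exact: sumr_ge0.
      have [Qp h1] := pQ a aJ; rewrite subr_ge0 h1 lerBlDr lerDl.
      by apply: axis_gauge_ge0 => [j i|]; [exact: axis_len_gt0|exact: hullQ_ge0 Qp].
    apply/FE; split => [j|j|i].
    - have [jJ|jJ] := boolP (j \in J); last by rewrite big1// => a /eqP aj;
        rewrite ll aj (negPf jJ).
      by have [_ <- _] := LP j jJ; apply: eq_bigr => a /eqP aj; rewrite ll aj jJ.
    - rewrite lr; have [jJ|jJ] := boolP (j \in J); first by rewrite ofl// addrC subrK.
      by rewrite ofl0// addr0 /axis_gauge big1// => i _; rewrite mxE mul0r.
    - rewrite -px summxE (partition_big blk xpredT)//= [RHS]big_mkcond;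
        apply: eq_bigr => j _.
      have [jJ|jJ] := boolP (j \in J); last first.
        by rewrite big1// => a /eqP aj; rewrite ll aj (negPf jJ) mul0r.
      by rewrite -(ofl j jJ) [RHS]summxE; apply: eq_bigr => a _; rewrite [RHS]mxE.
  exists l => //; have [_ <-] := of_l_fam l Fl; rewrite /cost.
  by have -> : \sum_(j in J) p j = \sum_(j in J) of_l l j by apply: eq_bigr => j /ofl ->.
have [l0 Fl0 _] := fam_of _ fp0.
have [|l Fl lmin] := @feasible_min R _ _ E w 1 cst; first by exists l0.
have [fl cl] := of_l_fam l Fl; exists (of_l l) => // p' /fam_of[l' Fl' ->].
by rewrite cl; exact: lmin.
Qed.

End Family.

Definition env j := lower_envelope (Q j).

Lemma envP j (y : 'rV[R]_m) : dom j y ->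
    Q j (ext y (env j y)) /\ forall t, Q j (ext y t) -> env j y <= t.
Proof.
move=> Py; have [y0 y1] := (domE j y).1 Py.
have fam1 t : Q j (ext y t) ->
    fam [set j]%SET y (fun=> ext y t) /\ cost [set j]%SET (fun=> ext y t) = t.
  move=> Qt; split; last by rewrite /cost big_set1 ext_max.
  split => [k|i]; last by rewrite big_set1 ext_wi.
  by rewrite inE => /eqP ->; rewrite (hgt_ext _ _ _ 0).
have [p fp pmin] := fam_min (fam1 _ (roof_mem Py)).1.
have pE : p j = ext y (cost [set j]%SET p).
  apply: ext_eq => [i|]; last by rewrite /cost big_set1.
  by rewrite -(fp.2 i) big_set1.
have Qp : Q j (ext y (cost [set j]%SET p)) by rewrite -pE; apply: (fp.1 j _).1; rewrite inE.
have le t : Q j (ext y t) -> cost [set j]%SET p <= t.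
  by move=> Qt; have [ft ct] := fam1 t Qt; rewrite -ct; exact: pmin.
suff -> : env j y = cost [set j]%SET p by [].
apply: set_minP.
  by exists (ext y (cost [set j]%SET p)); [split => //=; exact: proj_ext|exact: ext_max].
by move=> _ [z [Qz /= zy] <-]; apply: le; rewrite -zy -ext_proj.
Qed.

Definition infc J := inf_convolution J dom env.

(** Minimizing first over the height above each y_j and then over the splittings of x amounts to the
    single program of [fam_min]; in particular the minimum exists and [set_min] is not a default
    value. *)
Lemma infcP (J : {set 'I_n}) (x : 'rV[R]_m) : minkowski_sum J dom x -> exists p : 'I_n -> V,
  [/\ fam J x p, infc J x = cost J p & forall p' : 'I_n -> V, fam J x p' ->
      infc J x <= cost J p'].
Proof.
move=> [y0 y0P y0x].
have famy (y : 'I_n -> 'rV[R]_m) : (forall j, j \in J -> dom j (y j)) ->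
    \sum_(j in J) y j = x ->
    fam J x (fun j => ext (y j) (env j (y j))) /\
        cost J (fun j => ext (y j) (env j (y j))) = \sum_(j in J) env j (y j).
  move=> yP yx; split; last by rewrite /cost summxE; apply: eq_bigr => j _; rewrite ext_max.
  split => [j jJ|i]; last by rewrite -yx !summxE; apply: eq_bigr => j _; rewrite ext_wi.
  split; first by have [] := envP (yP j jJ).
  by rewrite (hgt_ext _ _ _ 0); have [_] := (domE j _).1 (yP j jJ).
have [p fp pmin] := fam_min (famy y0 y0P y0x).1.
have projP j : j \in J -> dom j (proj_init (p j)).
  move=> jJ; have [Qp h1] := fp.1 j jJ; apply/domE; split => [i|].
    by rewrite mxE; exact: hullQ_ge0 Qp _.
  by rewrite (hgt_ext _ _ _ (p j 0 ord_max)) -ext_proj.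
have projx : \sum_(j in J) proj_init (p j) = x.
  apply/rowP => i; rewrite -(fp.2 i) !summxE; apply: eq_bigr => j _; by rewrite mxE.
suff infE : infc J x = cost J p by exists p; split => // p' fp'; rewrite infE; exact: pmin.
apply: set_minP.
  exists (fun j => proj_init (p j)) => //.
  apply/eqP; rewrite eq_le; apply/andP; split.
    rewrite /cost summxE; apply: ler_sum => j jJ; apply: (envP (projP j jJ)).2.
    by rewrite -ext_proj; exact: (fp.1 j jJ).1.
  by have [fy <-] := famy _ projP projx; exact: pmin.
by move=> _ [y [yP yx] <-]; have [fy <-] := famy y yP yx; exact: pmin.
Qed.

Definition big_simplex (J : {set 'I_n}) : set V := [set z | (forall i, 0 <= z 0 i) /\
    \sum_i z 0 i <= (#|J| * M)%:R].

Definition sumC J := minkowski_sum J hullC.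

Lemma hullC_pt a : hullC (blk a) (@pt_of R n (clamp a)).
Proof. by move=> C [_ sC]; apply: sC; exists a => //=; rewrite eqxx. Qed.

Lemma hullC_Me j i : hullC j (M%:R *: delta_mx 0 i).
Proof.
have [a [<- ea]] := Me j i; have := @hullC_pt a.
by rewrite /clamp ea mdegMn mdeg1 mul1n leqnn pt_Me.
Qed.

Lemma hullC_sub j : hullC j `<=` Q j.
Proof.
apply: smallest_sub; first exact: hull_convex.
move=> _ [a /= /eqP <- <-]; rewrite /clamp; case: ifP => _; first exact: hullQ_pt.
by rewrite pt_Me; exact: hullQ_Me.
Qed.

Lemma sum_pt (k : multinom n) : \sum_i (@pt_of R n k) 0 i = (mdeg k)%:R.
Proof. by rewrite mdegE natr_sum; apply: eq_bigr => i _; rewrite mxE. Qed.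

Lemma mdeg_clamp a : (mdeg (clamp a) <= M)%N.
Proof. by rewrite /clamp; case: ifP => // _; rewrite mdegMn mdeg1 mul1n. Qed.

Lemma hullC_bound j (p : V) : hullC j p -> \sum_i p 0 i <= M%:R.
Proof.
rewrite /hullC /block_pts conv_hullE => -[l [l0 l1] <-].
under eq_bigr do rewrite summxE; rewrite exchange_big /=.
have -> : M%:R = \sum_(a | blk a == j) l a * M%:R :> R by rewrite -mulr_suml l1 mul1r.
apply: ler_sum => a _; under eq_bigr do rewrite mxE.
rewrite -mulr_sumr sum_pt; apply: ler_wpM2l => //; rewrite ler_nat; exact: mdeg_clamp.
Qed.

(** A point of degree above M is scaled down to degree M, where it lies on the face spanned by the M
    e_i. Hence clamping does not change Q_j + R_{>=0}^n. *)
Lemma hullC_below a : exists2 c, hullC (blk a) c & forall i, c 0 i <= v a 0 i.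
Proof.
have [aM|aM] := leqP (mdeg (ex a)) M.
  by exists (v a) => //; have := @hullC_pt a; rewrite /clamp aM.
have d0 : 0 < (mdeg (ex a))%:R :> R by rewrite ltr0n; exact: leq_ltn_trans aM.
exists (\row_i (v a 0 i / (mdeg (ex a))%:R * M%:R)).
  apply: simplex_comb => [|i|i|]; first exact: hull_convex.
  - exact: hullC_Me.
  - by rewrite divr_ge0 ?ler0n// mxE.
  - by rewrite -mulr_suml sum_pt divff// lt0r_neq0.
move=> i; rewrite mxE mulrAC ler_pdivrMr// ler_wpM2l ?mxE// ler_nat; exact: ltnW.
Qed.

Lemma upper_hullC j (z : V) : upper Q j z -> upper hullC j z.
Proof.
move=> [p + pz]; rewrite /hullQ /block_pts conv_hullE => -[l [l0 l1] lp].
have /choice[c cP] a : exists c, hullC (blk a) c /\ forall i, c 0 i <= v a 0 i.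
  by have [c] := hullC_below a; exists c.
exists (\sum_(a | blk a == j) l a *: c a).
  apply: convex_comb => // [|a /eqP <-]; first exact: hull_convex.
  exact: (cP a).1.
move=> i; apply: le_trans (pz i); rewrite -lp !summxE; apply: ler_sum => a _.
by rewrite !mxE ler_wpM2l//; have := (cP a).2 i; rewrite mxE.
Qed.

Section Sums.
Variable J : {set 'I_n}.
Hypothesis J0 : J != finset.set0.

Lemma sumC_convex : @convex_set R V (sumC J).
Proof.
move=> x y t; rewrite !inE => -[xx xC <-] [yy yC <-].
exists (fun j => @conv R (convex_lmodType V) t (xx j) (yy j)).
  move=> j jJ; have := @hull_convex _ _ _ t (mem_set (xC j jJ)) (mem_set (yC j jJ));
      by rewrite inE.
rewrite convE !scaler_sumr -big_split; apply: eq_bigr => j _; exact: convE.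
Qed.

Lemma sumC_face (z : V) : (forall i, 0 <= z 0 i) -> \sum_i z 0 i = (#|J| * M)%:R ->
    sumC J z.
Proof.
move=> z0 zs; have J1 : 0 < (#|J|)%:R :> R by rewrite ltr0n card_gt0.
have M1 : 0 < M%:R :> R by rewrite ltr0n.
exists (fun=> \row_i (z 0 i / (#|J| * M)%:R * M%:R)).
  move=> j _; apply: simplex_comb => [|i|i|]; first exact: hull_convex.
  - exact: hullC_Me.
  - by rewrite divr_ge0.
  - by rewrite -mulr_suml zs divff// natrM mulf_neq0// lt0r_neq0.
rewrite sumr_const; apply/rowP => i; rewrite mulmxnE mxE -mulr_natr natrM.
by field; rewrite !lt0r_neq0.
Qed.

(** Beyond z' the ray from z meets the face of total degree #J M, all of which lies in the sum, and
    z' is on the segment between. *)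
Lemma sumC_up (z z' : V) : sumC J z -> (forall i, z 0 i <= z' 0 i) ->
    big_simplex J z' -> sumC J z'.
Proof.
move=> Sz zz [z'0 z's].
have [w0|wn] := eqVneq (\sum_i (z' 0 i - z 0 i)) 0.
  have -> : z' = z; last by [].
  apply/rowP => i; move/eqP: w0; rewrite psumr_eq0 => [|k _]; last by rewrite subr_ge0.
  by move=> /allP/(_ i (mem_index_enum i)) /=; rewrite subr_eq0 => /eqP.
set w := \sum_i _ in wn.
have w0 : 0 < w by rewrite lt_neqAle eq_sym wn; apply: sumr_ge0 => i _; rewrite subr_ge0.
pose tau := ((#|J| * M)%:R - \sum_i z' 0 i) / w.
have tau0 : 0 <= tau by rewrite divr_ge0 ?subr_ge0// ltW.
have T0 : 0 < 1 + tau by rewrite ltr_wpDr.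
have Su : sumC J (z' + tau *: (z' - z)).
  apply: sumC_face => [i|]; first by rewrite !mxE addr_ge0// mulr_ge0// subr_ge0.
  have -> : \sum_i (z' + tau *: (z' - z)) 0 i = \sum_i z' 0 i + tau * w.
    by rewrite mulr_sumr -big_split; apply: eq_bigr => i _; rewrite !mxE.
  by rewrite /tau divfK// addrC subrK.
have t01 : 0 <= (1 + tau)^-1 by rewrite invr_ge0 ltW.
have t11 : (1 + tau)^-1 <= 1 by rewrite invf_le1// lerDl.
have := sumC_convex (Itv01 t01 t11) (mem_set Su) (mem_set Sz).
rewrite inE convE /=; congr (sumC J); apply/rowP => i; rewrite !mxE.
by field; rewrite lt0r_neq0.
Qed.

Lemma sumCE (z : V) : sumC J z <-> big_simplex J z /\ exists zz : 'I_n ->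
    V, split_in Q J z zz.
Proof.
split=> [[p pC <-]|[Tz [zz [zU zx]]]].
  have pQ j : j \in J -> Q j (p j) by move=> jJ; exact: hullC_sub (pC j jJ).
  split; last by exists p; split => // j jJ; exists (p j) => //; exact: pQ.
  split => [i|].
    by rewrite summxE; apply: sumr_ge0 => j jJ; exact: hullQ_ge0 (pQ j jJ) i.
  under eq_bigr do rewrite summxE;
      rewrite exchange_big /= natrM -sum1_card natr_sum mulr_suml.
  by apply: ler_sum => j jJ; rewrite mul1r; exact: hullC_bound (pC j jJ).
have /choice[p pP] j : exists p, j \in J -> hullC j p /\ forall i, p 0 i <= zz j 0 i.
  have [jJ|_] := boolP (j \in J); last by exists 0.
  by have [p] := upper_hullC (zU j jJ); exists p.
apply: (@sumC_up (\sum_(j in J) p j)) => //.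
  by exists p => // j jJ; exact: (pP j jJ).1.
by move=> i; rewrite -zx !summxE; apply: ler_sum => j jJ; exact: (pP j jJ).2.
Qed.

(** By [sumCE] a point of the big simplex is missing from the sum exactly when it has no splitting
    into the sets Q_j + R_{>=0}^n. Outside the sum of the projected simplices such a splitting
    exists at height 0 already; over it, one exists exactly from the height of the inf-convolution
    on. *)
Lemma simplex_diff (x : 'rV[R]_m) t :
  (big_simplex J (ext x t) /\ ~ sumC J (ext x t)) <->
  (minkowski_sum J dom x /\ 0 <= t < infc J x).
Proof.
have mn (J' : {set 'I_n}) (y : V) (z : 'I_n -> V) : split_in Q J' y z ->
    exists2 z' : 'I_n -> V, split_in Q J' y z' &
    forall z'' : 'I_n -> V, split_in Q J' y z'' ->
        excess axis_len J' z' <= excess axis_len J' z''.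
  by apply: hull_min_exists => a i; rewrite mxE.
have inD (y : V) : in_dom axis_len J y -> minkowski_sum J dom (proj_init y).
  move=> [yy yP yx]; exists (fun j => proj_init (yy j)).
    move=> j jJ; apply/domE; split => [i|]; first by rewrite mxE; exact: (yP j jJ).1.
    by rewrite (hgt_ext _ _ _ (yy j 0 ord_max)) -ext_proj; exact: (yP j jJ).2.
  by apply/rowP => i; rewrite [RHS]mxE -yx !summxE; apply: eq_bigr => j _; rewrite mxE.
have addmax (zz : 'I_n -> V) (s t' : R) : split_in Q J (ext x s) zz -> s <= t' ->
    exists zz' : 'I_n -> V, split_in Q J (ext x t') zz'.
  move=> [zU zx] st; have [j1 j1J] := finset.set0Pn _ J0.
  pose zz' j : V := zz j + (if j == j1 then (t' - s) *: delta_mx 0 ord_max else 0).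
  exists zz'; split.
    move=> j jJ; apply: upper_up (zU j jJ) _ => i; rewrite [X in _ <= X]mxE lerDl.
    by case: ifP => _; rewrite ?mxE// mulr_ge0 ?subr_ge0// mxE ler0n.
  rewrite big_split /= zx (bigD1 j1)//= eqxx big1 => [|j /andP[_ /negPf ->]//].
  rewrite addr0; apply: ext_eq => [i|].
    by rewrite [LHS]mxE ext_wi mxE mxE wi_neq_max andbF mulr0 addr0.
  by rewrite [LHS]mxE ext_max mxE mxE !eqxx mulr1 addrC subrK.
split.
  move=> [T nS]; have [T0 _] := T.
  have x0 i : 0 <= x 0 i by have := T0 (wi i); rewrite ext_wi.
  have t0 : 0 <= t by have := T0 ord_max; rewrite ext_max.
  have nsplit (zz : 'I_n -> V) : ~ split_in Q J (ext x t) zz by move=> h; apply: nS;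
      apply/sumCE; split => //; exists zz.
  have Dx : minkowski_sum J dom x.
    rewrite -(proj_ext x t); apply: inD; apply: contrapT => nD.
    have [z sz] := @split_off_dom R m 'I_n Q axis_len axis_len_gt0 axis_len_mem hullQ_ge0
        (fun j => @hull_convex _) mn J _ J0 T0 nD.
    have fE : flat (ext x t) = ext x 0.
      by apply: ext_eq => [i|]; rewrite mxE ?wi_neq_max ?eqxx// ext_wi.
    by rewrite fE in sz; have [zz /nsplit] := addmax _ _ _ sz t0.
  split => //; rewrite t0 /= ltNge; apply/negP => ft.
  have [p [[pQ px] infE _]] := infcP Dx.
  have sp : split_in Q J (ext x (infc J x)) p.
    split; first by move=> j jJ; exists (p j) => //; exact: (pQ j jJ).1.
    by apply: ext_eq => [i|]; [rewrite px|rewrite infE].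
  by have [zz /nsplit] := addmax _ _ _ sp ft.
move=> [Dx /andP[t0 tf]]; have [y yP yx] := Dx.
have [p [[pQ px] infE pmin]] := infcP Dx.
split; last first.
  move=> /sumCE[_ [zz szz]].
  have inx : in_dom axis_len J (ext x t).
    exists (fun j => ext (y j) 0) => [j jJ|i].
      have [y0 y1] := (domE j _).1 (yP j jJ); split => // k.
      by case: (wi_or_max k) => [->|[i ->]]; rewrite ?ext_max ?ext_wi.
    by rewrite ext_wi -yx !summxE; apply: eq_bigr => j _; rewrite ext_wi.
  have [p' [p'Q p'x p't]] :=
      @split_in_dom R m 'I_n Q axis_len axis_len_gt0 axis_len_mem hullQ_ge0 (fun j =>
          @hull_convex _) mn J _ _ szz inx.
  have fp' : fam J x p' by split => // i; rewrite p'x ext_wi.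
  have := pmin _ fp'; rewrite ext_max in p't; rewrite /cost => h.
  by have := le_lt_trans (le_trans h p't) tf; rewrite ltxx.
(* Roof points have coordinate sum at most M, since the axis lengths are at most M; as the
   inf-convolution is at most their total height, the region under its graph stays in the big
   simplex. *)
pose r j := ext (y j) ((1 - hgt j (ext (y j) 0)) * axis_len j ord_max).
have fr : fam J x r.
  split => [j jJ|i].
    split; first exact: roof_mem (yP j jJ).
    by rewrite /r (hgt_ext _ _ _ 0); have [] := (domE j _).1 (yP j jJ).
  by rewrite -yx !summxE; apply: eq_bigr => j _; rewrite ext_wi.
have rM j : j \in J -> \sum_i r j 0 i <= M%:R.
  move=> jJ; have [y0 y1] := (domE j _).1 (yP j jJ).
  rewrite big_ord_recr /= {2}/r ext_max.
  have -> : M%:R = hgt j (ext (y j) 0) * M%:R +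
      (1 - hgt j (ext (y j) 0)) * M%:R :> R by ring.
  apply: lerD; last by rewrite ler_wpM2l ?subr_ge0// axis_len_le.
  rewrite mulr_suml; apply: ler_sum => i _;
      rewrite /r !ext_wi mulrAC ler_pdivlMr ?axis_len_gt0//.
  by rewrite ler_wpM2l// axis_len_le.
split => [k|].
  case: (wi_or_max k) => [->|[i ->]]; rewrite ?ext_max// ext_wi -yx summxE.
  by apply: sumr_ge0 => j jJ; have [] := (domE j _).1 (yP j jJ).
have -> : \sum_i ext x t 0 i = \sum_(i < m) x 0 i + t.
  by rewrite big_ord_recr /= ext_max; congr (_ + _); apply: eq_bigr => i _; rewrite ext_wi.
apply: (@le_trans _ _ (\sum_(i < m) x 0 i + cost J r)).
  by rewrite lerD2l; apply: le_trans (ltW tf) _; exact: pmin.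
have -> : \sum_(i < m) x 0 i + cost J r = \sum_(j in J) \sum_i r j 0 i.
  rewrite exchange_big /= big_ord_recr /= /cost summxE; congr (_ + _).
  by apply: eq_bigr => i _; rewrite -(fr.2 i) summxE.
by rewrite natrM -sum1_card natr_sum mulr_suml; apply: ler_sum => j jJ; rewrite mul1r rM.
Qed.

End Sums.
End Envelope.

(** Cavalieri's principle in the first coordinate, along which the sections are the intervals from 0
    to f; uniqueness of the product measure allows integrating in this order. *)
Lemma cons_volume (R : realType) m (E : set (m.+1.-tuple (measurableTypeR R))) (D : set
    'rV[R]_m)
    (f : 'rV[R]_m -> R) : measurable E -> (forall x, D x -> 0 <= f x) ->
  (forall t x, E (@tuple_cons R m (t, x)) <-> D (row_of_tuple x) /\
      0 <= t < f (row_of_tuple x)) ->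
  lebesgue_tuple m.+1 E = (\int[lebesgue_tuple m]_(t in @row_of_tuple R m @^-1` D) (f
      (row_of_tuple t))%:E)%E.
Proof.
move=> mE f0 EP.
pose B : set (measurableTypeR R * m.-tuple (measurableTypeR R)) := @tuple_cons R m @^-1` E.
have mB : measurable B.
  by rewrite -[B]setTI; apply: (@measurable_tuple_cons R m) => //.
rewrite /= /lebesgue_prod /pushforward -/B.
rewrite (@product_measure_unique _ _ _ _ _ lebesgue_measure (lebesgue_tuple m)
  (product_measure2 lebesgue_measure (lebesgue_tuple m)))//; last first.
  by move=> A1 A2 mA1 mA2; exact: product_measure2E.
rewrite /product_measure2 /= [RHS]integral_mkcond; apply: eq_integral => y _ /=.
rewrite /patch; have [yD|yD] := boolP (y \in @row_of_tuple R m @^-1` D).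
  have Dy : D (row_of_tuple y) by move: yD; rewrite inE.
  have -> : ysection B y = `[0, f (row_of_tuple y)[%classic.
    apply/seteqP; split => t /=; rewrite /ysection /= inE in_itv /=; first by move=> /EP[].
    by move=> tf; apply/EP.
  rewrite lebesgue_measure_itv /= lte_fin; case: ltP => [_|fy];
      first by rewrite oppr0 adde0.
  by congr EFin; apply/eqP; rewrite eq_le fy f0.
have -> : ysection B y = set0.
  apply/seteqP; split => // t; rewrite /ysection /= inE => /EP[Dy _].
  by move: yD; rewrite notin_setE; apply.
by rewrite measure0.
Qed.

Section PermVolume.
Variables (R : realType) (n q : nat) (blk : 'I_q -> 'I_n) (ex : 'I_q ->
    multinom n) (s : 'I_n -> 'I_n).
Hypothesis blk_onto : forall j, exists a, blk a = j.
Hypothesis s_inj : injective s.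

(* The height is the last coordinate, whereas [lebesgue_tuple] splits off the
   first one. *)
Definition mperm (k : multinom n) : multinom n := mnm_of (fun i => k (s i)).
Let ex' a := mperm (ex a).

Lemma perm_sum_hull S (z : 'rV[R]_n) :
  @sum_hull R n q blk ex' S (\row_i z 0 (s i)) <-> @sum_hull R n q blk ex S z.
Proof.
have si := injF_bij s_inj.
rewrite !sum_hullE; split=> -[l lP lz]; exists l => //.
  apply/rowP => i; have [s' s'K sK] := si; rewrite -(sK i).
  have := congr1 (fun z : 'rV[R]_n => z 0 (s' i)) lz; rewrite !summxE [RHS]mxE => <-.
  by apply: eq_bigr => a _; rewrite !mxE mnm_ofE.
apply/rowP => i; rewrite mxE -lz !summxE; apply: eq_bigr => a _.
by rewrite !mxE mnm_ofE.
Qed.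

(** Permuting coordinates is a bijection between the lattice points of the two box modules in each
    degree, so the limits defining the volumes agree. *)
Lemma perm_volume S : volume (@sum_hull R n q blk ex' S) = volume (@sum_hull R n q blk ex
    S).
Proof.
have [s' s'K sK] := injF_bij s_inj.
pose b := maxn (box_bound ex) (box_bound ex').
have [_ [_ [cnt [[c1 _ _ _ _] _]]]] := box_generic blk ex b.
have [_ [_ [cnt' [[c1' _ _ _ _] _]]]] := box_generic blk ex' b.
have mpD k k' : mperm (k + k')%M = (mperm k + mperm k')%M.
  by apply/mnmP => i; mnm; rewrite !mnm_ofE; mnm.
have mpi : injective mperm.
  move=> k k' e; apply/mnmP => i; have := congr1 (fun k : multinom n => k (s' i)) e.
  by rewrite /= !mnm_ofE sK.
have mpw u : wpt ex' u = mperm (wpt ex u).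
  apply/mnmP => i; rewrite wptE mnm_ofE wptE; apply: eq_bigr => a _.
  by rewrite mnm_ofE.
have box k x : box_module blk ex b k x <-> box_module blk ex' b k (mperm x).
  split=> /box_moduleP[u [y [uk yb e]]]; apply/box_moduleP.
    by exists u, (mperm y); split => // [i|]; rewrite ?mnm_ofE// e mpD mpw.
  exists u, (mnm_of (fun i => y (s' i))); split => // [i|]; first by rewrite mnm_ofE.
  apply: mpi; rewrite e mpD mpw; congr (_ + _)%M; apply/mnmP => i; by rewrite !mnm_ofE s'K.
have cE k : cnt k = cnt' k.
  apply/eqP; rewrite eqn_leq; apply/andP; split.
    by apply: (finite_of_size_inj (f := mperm)) (c1 k) (c1' k) => [x y _ _ /mpi//|x /box].
  pose g (x : multinom n) : multinom n := mnm_of (fun i => x (s' i)).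
  have gK x : mperm (g x) = x by apply/mnmP => i; rewrite !mnm_ofE s'K.
  apply: (finite_of_size_inj (f := g)) (c1' k) (c1 k) => [x y _ _ e|x Xx].
    by rewrite -(gK x) e gK.
  by apply/box; rewrite gK.
have bb : (box_bound ex <= b)%N by exact: leq_maxl.
have bb' : (box_bound ex' <= b)%N by exact: leq_maxr.
have [_ _ v1] := @box_volume R n q blk ex blk_onto b 0%M S cnt bb c1.
have [_ _ v2] := @box_volume R n q blk ex' blk_onto b 0%M S cnt' bb' c1'.
have cc : cnt = cnt' by apply/funext.
by rewrite cc in v1; exact: cvg_unique v2 v1.
Qed.

End PermVolume.

Section EnvelopeVolume.
Variables (R : realType) (m q : nat).
Local Notation n := m.+1.
Local Notation V := 'rV[R]_m.+1.
Local Notation wi := (widen_ord (leqnSn m)).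
Variables (blk : 'I_q -> 'I_n) (ex : 'I_q -> multinom n) (M : nat).
Hypothesis M0 : (0 < M)%N.
Hypothesis Me : forall (j i : 'I_n), exists a, blk a = j /\ ex a = (mnm1 i *+ M)%M.
Local Notation blk0 := (@blk0 n q blk).
Local Notation cex := (clamp ex M).
Local Notation cex0 := (@ex0 n q cex).

Lemma clamp_onto j : exists a, blk a = j.
Proof. by have [a [<- _]] := Me j ord0; exists a. Qed.

Lemma blk0_onto j : exists a, blk0 a = j.
Proof. by exists (rshift q j); exact: blk0_r. Qed.

Lemma sum_hull_simplex (J : {set 'I_n}) : @sum_hull R n (q +
    n) blk0 cex0 J = @big_simplex R m M J.
Proof.
have deg0 a : (mdeg (cex0 a) <= M)%N.
  by rewrite /ex0; case: (fintype.split a) => e; [exact: mdeg_clamp|rewrite mdeg0].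
apply/seteqP; split => z.
  rewrite sum_hullE => -[l [l0 l1] <-]; split => [i|].
    by rewrite summxE; apply: sumr_ge0 => a _; rewrite !mxE mulr_ge0.
  under eq_bigr do rewrite summxE; rewrite exchange_big /=.
  rewrite natrM -sum1_card natr_sum mulr_suml.
  apply: (@le_trans _ _ (\sum_a l a * M%:R)).
    apply: ler_sum => a _; under eq_bigr do rewrite mxE.
    by rewrite -mulr_sumr sum_pt; apply: ler_wpM2l => //; rewrite ler_nat.
  rewrite (partition_big blk0 xpredT)//= [leRHS]big_mkcond; apply: ler_sum => j _.
  by rewrite -mulr_suml l1; case: (j \in J); rewrite ?mul0r.
move=> [z0 zs].
have hull0 j : conv_hull (@block_pts R n (q + n) blk0 cex0 j) 0.
  move=> C [_ sC]; apply: sC; exists (rshift q j) => /=.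
    by rewrite blk0_r eqxx.
  rewrite ex0_r; apply/rowP => i; rewrite !mxE; mnm.
  by [].
have hullM j i : conv_hull (@block_pts R n (q + n) blk0 cex0 j) (M%:R *: delta_mx 0 i).
  move=> C [_ sC]; apply: sC; have [a [aj ea]] := Me j i; exists (lshift n a) => /=.
    by rewrite blk0_l aj eqxx.
  rewrite ex0_l /clamp ea mdegMn mdeg1 mul1n leqnn.
  exact: pt_Me.
have [s0|sn] := eqVneq (\sum_i z 0 i) 0.
  exists (fun=> 0); first by move=> j _; exact: hull0.
  rewrite big1//; apply/rowP => i; rewrite mxE.
  move/eqP: s0; rewrite psumr_eq0 => [|k _//].
  by move=> /allP/(_ i (mem_index_enum i)) /eqP ->.
set s := \sum_i z 0 i in zs sn.
have s0 : 0 < s by rewrite lt_neqAle eq_sym sn; exact: sumr_ge0.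
have J1 : 0 < (#|J| * M)%:R :> R by exact: lt_le_trans zs.
have JN : 0 < (#|J|)%:R :> R by move: J1; rewrite natrM pmulr_lgt0// ltr0n.
have MN : 0 < M%:R :> R by rewrite ltr0n.
have t0 : 0 <= s / (#|J| * M)%:R by rewrite divr_ge0// ltW.
have t1 : s / (#|J| * M)%:R <= 1 by rewrite ler_pdivrMr// mul1r.
exists (fun=> (#|J|)%:R^-1 *: z).
  move=> j _.
  have Ew : conv_hull (@block_pts R n (q + n) blk0 cex0 j) (\row_i (z 0 i / s * M%:R)).
    apply: simplex_comb => [|i|i|]; first exact: hull_convex.
    - exact: hullM.
    - by rewrite divr_ge0// ltW.
    - by rewrite -mulr_suml divff.
  have := @hull_convex R m (@block_pts R n (q +
      n) blk0 cex0 j) _ _ (Itv01 t0 t1) (mem_set Ew) (mem_set (hull0 j)).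
  rewrite inE convE /= scaler0 addr0; congr conv_hull; apply/rowP => i; rewrite !mxE natrM.
  by field; rewrite !lt0r_neq0.
rewrite sumr_const; apply/rowP => i; rewrite mulmxnE mxE -mulr_natr.
by field; rewrite lt0r_neq0.
Qed.

(** The cyclic permutation bringing the height to the front. *)
Let s (i : 'I_n) : 'I_n := if unlift ord0 i is Some k then wi k else ord_max.

Let s_inj : injective s.
Proof.
move=> i k; rewrite /s; case: unliftP => [i' ->|->]; case: unliftP => [k' ->|->] //.
- by move=> /(congr1 val) /= e; congr lift; exact: val_inj.
- by move=> /eqP; rewrite wi_neq_max.
- by move=> /esym/eqP; rewrite wi_neq_max.
Qed.

Lemma envelope_volume (J : {set 'I_n}) : J != finset.set0 ->
  volume (@sum_hull R n (q + n) blk0 cex0 J) - volume (@sum_hull R n q blk cex J) =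
  integral_rV (minkowski_sum J (@dom R m q blk ex)) (@infc R m q blk ex J).
Proof.
move=> J0.
have [_ [_ [cT [[cT1 _ _ _ _] _]]]] :=
    box_generic blk0 (fun a => mperm s (cex0 a)) (box_bound (fun a => mperm s (cex0 a))).
have [_ [_ [cS [[cS1 _ _ _ _] _]]]] :=
    box_generic blk (fun a => mperm s (cex a)) (box_bound (fun a => mperm s (cex a))).
have [mT vT _] := @box_volume R n (q + n) blk0 _ blk0_onto _ 0%M J cT (leqnn _) cT1.
have [mS vS _] := @box_volume R n q blk _ clamp_onto _ 0%M J cS (leqnn _) cS1.
rewrite -(@perm_volume R n (q +
    n) blk0 cex0 s blk0_onto s_inj J) -(@perm_volume R n q blk cex s clamp_onto s_inj J).
set T' := sum_hull blk0 _ J in mT vT *; set S' := sum_hull blk _ J in mS vS *.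
have consE t (x : m.-tuple (measurableTypeR R)) :
    row_of_tuple (@tuple_cons R m (t, x)) = \row_i ext (row_of_tuple x) t 0 (s i).
  apply/rowP => i; rewrite [LHS]mxE [RHS]mxE /s; case: unliftP => [k ->|->].
    by rewrite ext_wi tnthS mxE; congr tnth; exact: val_inj.
  by rewrite ext_max tnth0.
have TE t x : T' (row_of_tuple (@tuple_cons R m (t,
    x))) <-> @big_simplex R m M J (ext (row_of_tuple x) t).
  by rewrite consE -sum_hull_simplex; exact: perm_sum_hull.
have SE t x : S' (row_of_tuple (@tuple_cons R m (t,
    x))) <-> @sumC R m q blk ex M J (ext (row_of_tuple x) t).
  by rewrite consE; exact: perm_sum_hull.
pose DT : set (n.-tuple (measurableTypeR R)) :=
    @row_of_tuple R n @^-1` T' `\` @row_of_tuple R n @^-1` S'.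
have vD : lebesgue_tuple n DT = (volume T' - volume S')%:E.
  have TS : (@row_of_tuple R n @^-1` T') `&` (@row_of_tuple R n @^-1` S') = @row_of_tuple R
      n @^-1` S'.
    apply: setIidr => tx; rewrite /preimage /=.
    have [t [x ->]] : exists t x, tx = @tuple_cons R m (t, x).
      exists (thead tx), [tuple of behead tx].
      by rewrite /tuple_cons /= -tuple_eta.
    by move=> /SE/(sumCE M0 Me J0)[+ _]; move/TE.
  have fin : (lebesgue_tuple n (@row_of_tuple R n @^-1` T') < +oo)%E by rewrite [X in (X <
      _)%E]vT ltry.
  have := @measureD _ _ _ (lebesgue_tuple n) _ _ mT mS fin.
  by rewrite TS => h; rewrite [LHS]h EFinB; congr (_ - _)%E; [exact: vT|exact: vS].
have := @cons_volume R m DT (minkowski_sum J (@dom R m q blk ex)) (@infc R m q blk ex J).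
rewrite vD => /(_ (measurableD mT mS)) h.
rewrite /integral_rV /Rintegral -h//.
- move=> x /(infcP M0 Me)[p [[pQ _] -> _]]; rewrite /cost summxE; apply: sumr_ge0 => j jJ.
  exact: hullQ_ge0 (pQ j jJ).1 _.
- move=> t x; rewrite -(simplex_diff M0 Me J0); split => -[h1 h2]; split; try exact/TE.
    by move=> h3; apply: h2; exact/SE.
  by move=> /SE.
Qed.

End EnvelopeVolume.

(** * Truncation and semicontinuity of the multiplicity *)

Section Truncation.
Variables (K : fieldType) (n : nat).
Local Notation P := (mpoly n K).
Implicit Types (u v s : P) (w : multinom n).

Definition high (B : nat) v := supported (fun w => (B <= mdeg w)%N) v.

Lemma high_mul B u v : high B v -> high B (u * v).
Proof.
move=> hv; apply: (supportedM (P := fun _ => True)) hv; last by [].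
by move=> w w' _ h; rewrite mdegD; apply: leq_trans h (leq_addl _ _).
Qed.

Lemma high1 v : mcoeff 0%M v = 0 -> high 1 v.
Proof. by move=> v0 w; rewrite lt0n mdeg_eq0; apply: contra => /eqP ->; rewrite v0. Qed.

Lemma high_exp v B : mcoeff 0%M v = 0 -> high B (v ^+ B).
Proof.
move=> v0; elim: B => [w _|B IH]; first by [].
rewrite exprS; apply: (supportedM _ (high1 v0) IH) => w w' h h'.
by rewrite mdegD -add1n leq_add.
Qed.

(** A truncated geometric series. *)
Lemma unit_at0_inv s B : unit_at0 s -> exists t, high B (t * s - 1).
Proof.
move=> s0; pose r := 1 - (mcoeff 0%M s)^-1 *: s.
have r0 : mcoeff 0%M r = 0 by rewrite mcoeffB mcoeff1 eqxx mcoeffZ mulVf// subrr.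
exists ((mcoeff 0%M s)^-1 *: (\sum_(i < B) r ^+ i)).
have -> : (mcoeff 0%M s)^-1 *: (\sum_(i < B) r ^+ i) * s - 1 = - 1 * r ^+ B.
  have e := subrX1 r B.
  have -> : (mcoeff 0%M s)^-1 *: (\sum_(i < B) r ^+ i) * s = (1 - r) * \sum_(i < B) r ^+ i.
    have -> : 1 - r = (mcoeff 0%M s)^-1 *: s by rewrite /r subKr.
    by rewrite -!scalerAl mulrC.
  have -> : (1 - r) * \sum_(i < B) r ^+ i = - (r ^+ B - 1) by rewrite e -[RHS]mulNr (opprB
      r 1).
  by ring.
exact/high_mul/high_exp.
Qed.

Variable f : 'I_n -> P.

(** The ideal (f) + m^B, with m the maximal ideal at the origin; its codimension is a matter of
    finitely many monomials. *)
Definition trunc_ideal (B : nat) v := exists h : 'I_n -> P, high B (v - \sum_j f j * h j).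

Lemma trunc_idealD B u v : trunc_ideal B u -> trunc_ideal B v -> trunc_ideal B (u + v).
Proof.
move=> [h hu] [h' hv]; exists (fun j => h j + h' j).
have -> : u + v - \sum_j f j * (h j + h' j) = (u - \sum_j f j * h j) +
    (v - \sum_j f j * h' j).
  by under eq_bigr do rewrite mulrDr; rewrite big_split opprD addrACA.
exact: supportedD.
Qed.

Lemma trunc_idealM B u v : trunc_ideal B v -> trunc_ideal B (u * v).
Proof.
move=> [h hv]; exists (fun j => u * h j).
have -> : u * v - \sum_j f j * (u * h j) = u * (v - \sum_j f j * h j).
  by rewrite mulrBr mulr_sumr; congr (_ - _); apply: eq_bigr => j _; rewrite mulrCA.
exact: high_mul.
Qed.

Lemma trunc_ideal_high B v : high B v -> trunc_ideal B v.
Proof. by move=> hv; exists (fun=> 0); rewrite big1 ?subr0// => j _; rewrite mulr0. Qed.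

Lemma trunc_ideal_subspace B : subspace (trunc_ideal B).
Proof.
split; first by apply: trunc_ideal_high; exact: supported_0.
by move=> a u v hu hv; apply: trunc_idealD => //; rewrite -mul_mpolyC; exact: trunc_idealM.
Qed.

Lemma trunc_ideal_unit B s v : unit_at0 s -> trunc_ideal B (s * v) -> trunc_ideal B v.
Proof.
move=> /(unit_at0_inv B)[t ht] /(trunc_idealM t) h.
have -> : v = t * (s * v) + (- v) * (t * s - 1) by ring.
by apply: trunc_idealD => //; apply: trunc_ideal_high; exact: high_mul.
Qed.

Lemma ideal_mem_trunc B v : ideal_mem f v -> trunc_ideal B v.
Proof. by move=> [h ->]; exists h; rewrite subrr; exact: supported_0. Qed.

Lemma loc_trunc B v : loc (@unit_at0 K n) f v -> trunc_ideal B v.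
Proof. by move=> [s [us fs]]; apply: trunc_ideal_unit us _; exact: ideal_mem_trunc. Qed.

Lemma degree_chain w : exists g : nat -> multinom n, [/\ forall k, (k <= mdeg w)%N ->
    mdeg (g k) = k,
  forall k k', (k <= k')%N -> (k' <= mdeg w)%N -> (g k <= g k')%M & g (mdeg w) = w].
Proof.
have [e we] : exists e, mdeg w = e by exists (mdeg w).
elim: e w we => [|e IH] w we.
  by exists (fun=> w); split => [k|k k' _ _|//];
      [rewrite we leqn0 => /eqP ->|exact/mnm_lepP].
have [i wi] : exists i, w i != 0%N.
  by apply/fintype.existsP; rewrite -negb_forall;
      apply: contra_eqN we => /fintype.forallP h; rewrite mdegE big1// => i _; apply/eqP;
          exact: h.
have w'e : mdeg (w - mnm1 i)%M = e.
  have : mdeg ((w - mnm1 i) + mnm1 i)%M = e.+1 by rewrite subm_add ?lt0n.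
  by rewrite mdegD mdeg1 addn1 => -[].
have [g [g1 g2 g3]] := IH _ w'e; rewrite w'e in g1 g2 g3.
exists (fun k => if (k <= e)%N then g k else w); rewrite we; split.
- move=> k; rewrite leq_eqVlt ltnS => /orP[/eqP ->|ke]; first by rewrite ltnn.
  by rewrite ke g1.
- move=> k k' kk k'e; case: (leqP k' e) => h'.
    by rewrite (leq_trans kk h') g2.
  case: (leqP k e) => hk; last by apply/mnm_lepP => i'.
  apply/mnm_lepP => i'; have /mnm_lepP/(_ i') := g2 k e hk (leqnn e).
  by rewrite g3 => h; apply: leq_trans h _; mnm; exact: leq_subr.
- by rewrite ltnn.
Qed.

(** A chain of divisors of x^w, one in each degree from 0 to e, is dependent. The member of least
    degree occurring in a relation is multiplied there by a unit at 0, so it lies in the ideal, and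
    so does x^w. *)
Lemma trunc_nilpotent e : codim_le (fun _ : P => True) (trunc_ideal e.+1) e ->
  forall w, mdeg w = e -> trunc_ideal e.+1 (mpolyX K w).
Proof.
move=> le w we; have [g [g1 g2 g3]] := degree_chain w; rewrite we in g1 g2 g3.
have sJ := trunc_ideal_subspace e.+1.
pose v (k : 'I_e.+1) : P := mpolyX K (g k).
have [th [[k0 thk] thJ]] : exists th : 'I_e.+1 ->
    K, (exists k, th k != 0) /\ trunc_ideal e.+1 (\sum_k th k *: v k).
  apply: contrapT => h.
  have ge : codim_ge (fun _ : P => True) (trunc_ideal e.+1) e.+1.
    exists v; split => // th thJ k; apply/eqP/negPn/negP => tk; apply: h; exists th;
        split => //.
    by exists k.
  by have := codim_le_ge sJ le ge; rewrite ltnn.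
case: (@arg_minnP _ k0 (fun k => th k != 0) (fun k => val k) thk) => k thk0 kmin.
have gk (l : 'I_e.+1) : (k <= l)%N ->
    mpolyX K (g l) = mpolyX K (g k) * mpolyX K (g l - g k)%M :> P.
  move=> kl; rewrite -mpolyXD; congr mpolyX; rewrite addmC submK//.
  by apply: g2 => //; rewrite -ltnS.
pose s : P := \sum_(l < e.+1 | (k <= l)%N) th l *: mpolyX K (g l - g k)%M.
have sE : \sum_l th l *: v l = s * mpolyX K (g k).
  rewrite (bigID (fun l : 'I_e.+1 => (k <= l)%N)) /= [X in _ + X]big1 ?addr0 => [|l kl];
      last first.
    have -> : th l = 0 by apply/eqP/negPn/negP => /kmin; exact/negP.
    by rewrite scale0r.
  rewrite /s mulr_suml; apply: eq_bigr => l kl; rewrite /v (gk l kl) -scalerAl;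
      congr (_ *: _).
  exact: mulrC.
have us : unit_at0 s.
  rewrite /unit_at0 /s raddf_sum (bigD1 k)//= big1 => [|l /andP[kl lk]];
      rewrite mcoeffZ mcoeffX.
    have -> : (g k - g k)%M = 0%M by apply/mnmP => i; mnm; rewrite subnn.
    by rewrite eqxx mulr1 addr0.
  case: eqP => [e0|_]; last by rewrite mulr0.
  exfalso; move/negP: lk; apply; apply/eqP/val_inj.
  have lE : g l = g k.
    have := submK (g2 k l kl (ltn_ord l)); rewrite e0 add0m => ->//.
  have el : mdeg (g l) = l by apply: g1; rewrite -ltnS.
  have ek : mdeg (g k) = k by apply: g1; rewrite -ltnS.
  by rewrite lE ek in el; exact: esym el.
have Jk : trunc_ideal e.+1 (mpolyX K (g k)).
  by apply: trunc_ideal_unit us _; rewrite -sE.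
have ke : (k <= e)%N by rewrite -ltnS.
rewrite -g3 -[g e](submK (g2 k e ke (leqnn e))) mpolyXD; exact: trunc_idealM.
Qed.

Lemma high_expand (e N : nat) (x : 'I_N -> multinom n) v :
  (forall w, mdeg w = e -> exists k, x k = w) -> high e.+1 v ->
  exists a : 'I_N -> P, (forall k, mcoeff 0%M (a k) = 0) /\ v = \sum_k a k * mpolyX K (x k).
Proof.
move=> xall hv; rewrite (mpolyE v) big_seq.
apply: (big_ind (fun v => exists a : 'I_N ->
    P, (forall k, mcoeff 0%M (a k) = 0) /\ v = \sum_k a k * mpolyX K (x k))).
- exists (fun=> 0); split => [k|]; first by rewrite mcoeff0.
  by rewrite big1// => k _; rewrite mul0r.
- move=> _ _ [a [a0 ->]] [b [b0 ->]]; exists (fun k => a k + b k); split => [k|].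
    by rewrite mcoeffD a0 b0 addr0.
  by rewrite -big_split; apply: eq_bigr => k _; rewrite mulrDl.
move=> w; rewrite mcoeff_msupp => /hv we.
have [g [g1 g2 g3]] := degree_chain w.
have [k kE] := xall (g e) (g1 e (ltnW we)).
exists (fun k' => if k' == k then mcoeff w v *: mpolyX K (w - g e)%M else 0); split.
  move=> k'; case: ifP => _; last by rewrite mcoeff0.
  rewrite mcoeffZ mcoeffX; case: eqP => [e0|_]; last by rewrite mulr0.
  have := submK (g2 e (mdeg w) (ltnW we) (leqnn _)); rewrite g3 e0 add0m => gw.
  by have := g1 e (ltnW we); rewrite gw => ew; rewrite ew ltnn in we.
rewrite (bigD1 k)//= eqxx big1 => [|k' /negPf ->]; last by rewrite mul0r.
rewrite addr0 kE -scalerAl -mpolyXD submK//.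
by have := g2 e (mdeg w) (ltnW we) (leqnn _); rewrite g3.
Qed.

(** The determinant trick: the vector X of monomials of degree e satisfies (1 - A) X = 0 modulo f,
    with A vanishing at 0, so det(1 - A) is a unit at 0 which multiplies each monomial into the
    ideal. *)
Lemma nakayama e : (forall w, mdeg w = e -> trunc_ideal e.+1 (mpolyX K w)) ->
  forall w, mdeg w = e -> loc (@unit_at0 K n) f (mpolyX K w).
Proof.
move=> hJ w we.
have [|N [sq [usq szq sqP]]] := @finite_bounded n (fun w => mdeg w = e) e.
  by move=> z <- i; exact: mdeg_ge.
pose x (k : 'I_(size sq)) := nth 0%M sq k.
have xd k : mdeg (x k) = e by apply/sqP; exact: mem_nth.
have xall w' : mdeg w' = e -> exists k, x k = w'.
  move=> /sqP ws; have ix : (index w' sq < size sq)%N by rewrite index_mem.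
  by exists (Ordinal ix); rewrite /x nth_index.
have /choice[h hP] k := hJ _ (xd k).
have /choice[a aP] k := high_expand xall (hP k).
pose A : 'M[P]_(size sq) := \matrix_(k, l) a k l.
pose X : 'cV[P]_(size sq) := \col_k mpolyX K (x k).
have AX k : ideal_mem f (((1%:M - A) *m X) k 0).
  exists (h k); rewrite mulmxBl mul1mx !mxE.
  have -> : \sum_j A k j * X j 0 = \sum_l a k l * mpolyX K (x l) by apply: eq_bigr => l _;
      rewrite !mxE.
  by rewrite -(aP k).2 opprB addrC subrK.
have dX k : ideal_mem f (\det (1%:M - A) * mpolyX K (x k)).
  have -> : \det (1%:M - A) * mpolyX K (x k) = (\adj (1%:M - A) *m ((1%:M - A) *m X)) k 0.
    by rewrite mulmxA mul_adj_mx mul_scalar_mx !mxE.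
  rewrite mxE; apply: (big_ind (ideal_mem f)); [exact: ideal_mem0|exact: ideal_memD|].
  by move=> l _; exact: ideal_memM.
have ud : unit_at0 (\det (1%:M - A)).
  rewrite /unit_at0.
  have -> : mcoeff 0%M (\det (1%:M - A)) = \det (map_mx (fun v : P =>
      mcoeff 0%M v) (1%:M - A)).
    by rewrite -det_map_mx.
  have -> : map_mx (fun v : P => mcoeff 0%M v) (1%:M - A) = 1%:M.
    apply/matrixP => k l; rewrite !mxE mcoeffB (aP k).1 subr0.
    by case: (k == l); rewrite ?mulr1n ?mulr0n ?mcoeff1 ?eqxx ?mcoeff0.
  by rewrite det1 oner_neq0.
have [k <-] := xall w we.
by exists (\det (1%:M - A)).
Qed.

Lemma loc_high e : (forall w, mdeg w = e -> loc (@unit_at0 K n) f (mpolyX K w)) ->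
  forall v, high e v -> loc (@unit_at0 K n) f v.
Proof.
move=> hw v hv; have sL := loc_subspace f (@unit_at0_mult K n).
rewrite (mpolyE v) big_seq; apply: subspace_sum => // w; rewrite mcoeff_msupp => /hv we.
apply: subspaceZ => //; have [g [g1 g2 g3]] := degree_chain w.
have := g2 e (mdeg w) we (leqnn _); rewrite g3 => /submK <-; rewrite mpolyXD.
by apply: locM; apply: hw; exact: g1.
Qed.

Lemma codim_leW (W W' : P -> Prop) d : (forall v, W v -> W' v) ->
  codim_le (fun _ : P => True) W d -> codim_le (fun _ : P => True) W' d.
Proof. by move=> WW [b [bE bP]]; exists b; split => // v _; have [c hc] := bP v I;
    exists c; exact: WW. Qed.

(** Finite determinacy: a bound e on the codimension modulo degree e + 1 puts m^e in the local
    ideal, so the truncation loses nothing. *)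
Lemma trunc_determined e : codim_le (fun _ : P => True) (trunc_ideal e.+1) e ->
  codim_le (fun _ : P => True) (loc (@unit_at0 K n) f) e /\
  forall v, high e v -> loc (@unit_at0 K n) f v.
Proof.
move=> le; have hw := nakayama (trunc_nilpotent le).
have lh := loc_high hw; split => //; apply: codim_leW le => v [h hv].
rewrite -[v](subrK (\sum_j f j * h j)); apply: (locD (@unit_at0_mult K n)).
  by apply: lh => w /hv; exact: ltnW.
by apply: (ideal_loc (@unit_at0_mult K n)); exists h.
Qed.

End Truncation.

Section OpenCodim.
Variables (K : fieldType) (n q : nat) (blk : 'I_q -> 'I_n) (ex : 'I_q -> multinom n).
Local Notation P := (mpoly n K).
Variables (Y : seq (multinom n)) (bs : 'I_n -> seq (multinom n)).
Hypothesis uY : uniq Y.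
Hypothesis ubs : forall j, uniq (bs j).

(* The congruence modulo the monomials outside [Y] makes this a condition on the
   rank of a matrix, which is open in c. *)
Definition span_on (c : 'I_q -> K) (v : P) := exists h : 'I_n -> P,
  (forall j, supported (fun w => w \in bs j) (h j)) /\
  forall y, y \in Y -> mcoeff y (v - \sum_j sparse_sys blk ex c j * h j) = 0.

(** Being spanned by the b_i and the products f_j x^w means full rank of a matrix with entries
    linear in c or constant; the witness is a maximal minor that is nonzero at [c0]. *)
Lemma open_codim (c0 : 'I_q -> K) d :
  codim_le (supported (fun w => w \in Y)) (span_on c0) d ->
  polycond (fun c => codim_le (supported (fun w => w \in Y)) (span_on c) d).
Proof.
move=> [b [bY bP]].
pose T : finType := {j : 'I_n & 'I_(size (bs j))}.
pose al (t : T) : multinom n := nth 0%M (bs (tag t)) (tagged t).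
pose y (s : 'I_(size Y)) := nth 0%M Y s.
pose ent (R : nzRingType) (c : 'I_q -> R) (emb : K ->
    R) (i : 'I_(d + #|T|)) (s : 'I_(size Y)) : R :=
  match fintype.split i with
  | inl i => emb (mcoeff (y s) (b i))
  | inr t => \sum_(a | (blk a == tag (enum_val t)) && ((ex a +
      al (enum_val t))%M == y s)) c a end.
pose Mx c : 'M[K]_(d + #|T|, size Y) := \matrix_(i, s) ent K c id i s.
have rowE c (t : 'I_#|T|) s : Mx c (rshift d t) s =
    mcoeff (y s) (sparse_sys blk ex c (tag (enum_val t)) * mpolyX K (al (enum_val t))).
  rewrite mxE /ent -[rshift d t]/(unsplit (inr t)) unsplitK /sparse_sys mulr_suml raddf_sum
      /= big_mkcondr.
  apply: eq_bigr => a _; rewrite -scalerAl -mpolyXD mcoeffZ mcoeffX.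
  by case: eqP => _; rewrite ?mulr1 ?mulr0.
have bE c i s : Mx c (lshift _ i) s = mcoeff (y s) (b i).
  by rewrite mxE /ent -[lshift _ i]/(unsplit (inl i)) unsplitK.
have msum (I : finType) (F : I ->
    P) y0 : mcoeff y0 (\sum_i F i) = \sum_i mcoeff y0 (F i) by rewrite raddf_sum.
have toh (be : T -> K) j : supported (fun w =>
    w \in bs j) (\sum_(k < size (bs j)) be (Tagged (fun j =>
        'I_(size (bs j))) k) *: mpolyX K (nth 0%M (bs j) k)).
  by apply: supported_sum => k _; apply: supportedZ; apply: supportedX; exact: mem_nth.
have sumh c (be : T -> K) : \sum_j sparse_sys blk ex c j * (\sum_(k < size (bs j)) be
    (Tagged (fun j => 'I_(size (bs j))) k) *: mpolyX K (nth 0%M (bs j) k)) =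
   \sum_(t : T) be t *: (sparse_sys blk ex c (tag t) * mpolyX K (al t)).
  under eq_bigr do rewrite mulr_sumr.
  rewrite (sig_big_dep xpredT (fun _ _ => true)
    (fun j k => sparse_sys blk ex c j * (be (Tagged (fun j =>
        'I_(size (bs j))) k) *: mpolyX K (nth 0%M (bs j) k)))) /=.
  by apply: eq_bigr => -[j k] _; rewrite -scalerAr.
have full0 : row_full (Mx c0).
  apply/row_fullP.
  have /choice[B BP] (s : 'I_(size Y)) : exists B : 'rV[K]_(d + #|T|), forall s',
      (B *m Mx c0) 0 s' = (s == s')%:R.
    have [|g [h [hb hy]]] := bP (mpolyX K (y s)); first by apply: supportedX;
        exact: mem_nth.
    pose be (t : T) := mcoeff (al t) (h (tag t)).
    exists (row_mx (\row_i g i) (\row_t be (enum_val t))) => s'.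
    have := hy (y s') (mem_nth _ (ltn_ord s')).
    have hE j : h j = \sum_(k < size (bs j)) be (Tagged (fun j =>
        'I_(size (bs j))) k) *: mpolyX K (nth 0%M (bs j) k).
      by rewrite {1}(supported_expand (ubs j) (hb j)) (big_nth 0%M) big_mkord.
    have -> : \sum_j sparse_sys blk ex c0 j * h j = \sum_(t : T) be t *:
        (sparse_sys blk ex c0 (tag t) * mpolyX K (al t)).
      by rewrite -sumh; apply: eq_bigr => j _; rewrite -hE.
    rewrite !mcoeffB mcoeffX !msum => /eqP; rewrite subr_eq0 subr_eq => /eqP e.
    have -> : (s == s')%:R = (y s == y s')%:R :> K.
      by rewrite /y nth_uniq.
    rewrite e mxE big_split_ord /= addrC; congr (_ + _); last first.
      by apply: eq_bigr => i _; rewrite row_mxEl bE mxE mcoeffZ.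
    rewrite [RHS](reindex _ (onW_bij _ (enum_val_bij T))) /=; apply: eq_bigr => t _.
    by rewrite row_mxEr rowE mxE mcoeffZ.
  exists (\matrix_(s, i) B s 0 i); apply/matrixP => s s'; rewrite [RHS]mxE -BP !mxE.
  by apply: eq_bigr => i _; rewrite mxE.
pose fr := fullrankfun full0.
pose D (R : nzRingType) (c : 'I_q -> R) (emb : K ->
    R) : 'M[R]_(size Y) := \matrix_(s, s') ent R c emb (fr s) s'.
pose G : mpoly q K := \det (\matrix_(s,
    s') ent (mpoly q K) (fun a => mpolyX K (mnm1 a)) (@mpolyC q K) (fr s) s').
have GE c : meval c G = \det (\matrix_(s, s') Mx c (fr s) s').
  rewrite -det_map_mx; congr (\det _); apply/matrixP => s s'; rewrite !mxE /ent.
  case: (fintype.split _) => i /=; first by rewrite mevalC.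
  by rewrite raddf_sum /=; apply: eq_bigr => a _; rewrite mevalXU.
have G0 : meval c0 G != 0.
  rewrite GE; have -> : \matrix_(s,
      s') Mx c0 (fr s) s' = rowsub fr (Mx c0) by apply/matrixP => s s'; rewrite !mxE.
  by have := fullrowsub_unit full0; rewrite unitmxE unitfE.
exists G; first by apply: contraNneq G0 => ->; rewrite meval0.
move=> c; rewrite GE => dc; exists b; split => // v vY.
pose S : 'M[K]_(size Y) := \matrix_(s, s') Mx c (fr s) s'.
have uS : S \in unitmx by rewrite unitmxE unitfE.
pose vr : 'rV[K]_(size Y) := \row_s mcoeff (y s) v.
pose co := vr *m invmx S.
have coE s' : mcoeff (y s') v = \sum_s co 0 s * Mx c (fr s) s'.
  have : vr = co *m S by rewrite /co mulmxKV.
  move=> /rowP/(_ s'); rewrite [LHS]mxE [X in _ = X]mxE => ->; apply: eq_bigr => s _.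
  by rewrite [S s s']mxE.
pose tot (i : 'I_(d + #|T|)) := \sum_(s | fr s == i) co 0 s.
have coE' s' : mcoeff (y s') v = \sum_i tot i * Mx c i s'.
  rewrite coE (partition_big fr xpredT)//=; apply: eq_bigr => i _.
  by rewrite mulr_suml; apply: eq_bigr => s /eqP ->.
exists (fun i => tot (lshift _ i)).
pose be (t : T) := tot (rshift d (enum_rank t)).
exists (fun j => \sum_(k < size (bs j)) be (Tagged (fun j =>
    'I_(size (bs j))) k) *: mpolyX K (nth 0%M (bs j) k)); split => // y0 y0Y.
have iy : (index y0 Y < size Y)%N by rewrite index_mem.
have y0E : y0 = y (Ordinal iy) by rewrite /y nth_index.
rewrite sumh y0E !mcoeffB !msum coE' big_split_ord /=.
have -> : \sum_i mcoeff (y (Ordinal iy)) (tot (lshift #|T| i) *: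
    b i) = \sum_i tot (lshift #|T| i) * Mx c (lshift #|T| i) (Ordinal iy).
  by apply: eq_bigr => i _; rewrite mcoeffZ bE.
rewrite (reindex _ (onW_bij _ (enum_val_bij T))) /=.
have -> : \sum_(t < #|T|) mcoeff (y (Ordinal iy)) (be (enum_val t) *:
    (sparse_sys blk ex c (tag (enum_val t)) * mpolyX K (al (enum_val t)))) =
   \sum_(t < #|T|) tot (rshift d t) * Mx c (rshift d t) (Ordinal iy).
  by apply: eq_bigr => t _; rewrite mcoeffZ rowE /be enum_valK.
by rewrite addrC addrK subrr.
Qed.

End OpenCodim.

(** * Multiplicity at the origin: lower bound *)

Section OpenTrunc.
Variables (K : fieldType) (n q : nat) (blk : 'I_q -> 'I_n) (ex : 'I_q -> multinom n).
Local Notation P := (mpoly n K).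
Local Notation sys := (sparse_sys blk ex).

Lemma high_split B (v : P) : exists t : P, supported (fun w => (mdeg w < B)%N) t /\
    high B (v - t).
Proof.
rewrite (mpolyE v); apply: (big_ind (fun v => exists t : P,
    supported (fun w => (mdeg w < B)%N) t /\ high B (v - t))).
- by exists 0; rewrite subr0; split; exact: supported_0.
- move=> u u' [t [ht hu]] [t' [ht' hu']]; exists (t + t'); split; first exact: supportedD.
  by rewrite opprD addrACA; exact: supportedD.
move=> w _; have [wB|wB] := ltnP (mdeg w) B.
  by exists (mcoeff w v *: mpolyX K w); rewrite subrr; split; [by apply: supportedZ;
      apply: supportedX|exact: supported_0].
by exists 0; rewrite subr0; split; [exact: supported_0|by apply: supportedZ;
    apply: supportedX].
Qed.

Lemma high_eq0 B (v : P) w : high B v -> (mdeg w < B)%N -> mcoeff w v = 0.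
Proof. by move=> hv wB; apply: contraTeq wB => /hv; rewrite -leqNgt. Qed.

Lemma finite_below B : exists N, finite_of_size (fun w : multinom n => (mdeg w < B)%N) N.
Proof.
by apply: (@finite_bounded n _ B) => z zB i; apply: leq_trans (mdeg_ge z i) (ltnW zB).
Qed.

Lemma open_trunc (c0 : 'I_q ->
    K) B d : codim_le (fun _ : P => True) (trunc_ideal (sys c0) B) d ->
  polycond (fun c => codim_le (fun _ : P => True) (trunc_ideal (sys c) B) d).
Proof.
move=> [b [_ bP]]; have [N [Y [uY _ YP]]] := finite_below B.
have msum (I : finType) (F : I ->
    P) y : mcoeff y (\sum_i F i) = \sum_i mcoeff y (F i) by rewrite raddf_sum.
apply: (@polycondW _ _ (fun c => codim_le (supported (fun w =>
    w \in Y)) (span_on blk ex Y (fun=> Y) c) d)).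
  move=> c [e [eY eP]]; exists e; split => // v _; have [t [tB vt]] := high_split B v.
  have [|g [h [hY hv]]] := eP t; first by apply: supportedW tB => w; exact: (YP w).1.
  exists g, h; have -> : v - \sum_i g i *: e i - \sum_j sys c j * h j =
    (v - t) + (t - \sum_i g i *: e i - \sum_j sys c j * h j) by ring.
  apply: supportedD vt _ => w; rewrite leqNgt; apply: contra => wB.
  by rewrite hv//; exact/YP.
apply: (@open_codim K n q blk ex Y (fun=> Y) uY (fun=> uY) c0 d).
have /choice[b' b'P] i := high_split B (b i).
exists b'; split => [i|v _]; first by apply: supportedW (b'P i).1 => w; exact: (YP w).1.
have [g [h hv]] := bP v I; have /choice[h' h'P] j := high_split B (h j).
exists g, h'; split => [j|y /YP yB]; first by apply: supportedW (h'P j).1 => w;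
    exact: (YP w).1.
apply: (high_eq0 (B := B)) yB; have -> : v - \sum_i g i *: b' i - \sum_j sys c0 j * h' j =
    (v - \sum_i g i *: b i - \sum_j sys c0 j * h j) + \sum_i g i *: (b i - b' i) +
        \sum_j sys c0 j * (h j - h' j).
  under [X in _ = _ + X + _]eq_bigr do rewrite scalerBr.
  under [X in _ = _ + X]eq_bigr do rewrite mulrBr.
  by rewrite !sumrB; ring.
apply: supportedD; last by apply: supported_sum => j _; apply: high_mul; exact: (h'P j).2.
by apply: supportedD hv _; apply: supported_sum => i _; apply: supportedZ; exact: (b'P i).2.
Qed.

(** Upper semicontinuity of the multiplicity: the truncated condition is open, and
    [trunc_determined] recovers the local ideal from it. *)
Lemma open_mult (c0 : 'I_q ->
    K) e : codim_le (fun _ : P => True) (loc (@unit_at0 K n) (sys c0)) e ->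
  polycond (fun c => codim_le (fun _ : P => True) (loc (@unit_at0 K n) (sys c)) e /\
    forall v, high e v -> loc (@unit_at0 K n) (sys c) v).
Proof.
move=> le; have /open_trunc := codim_leW (@loc_trunc _ _ _ e.+1) le.
by apply: polycondW => c; exact: trunc_determined.
Qed.

End OpenTrunc.

(** * Modules generated by the monomials of bounded degree *)

Section BallModule.
Variables (n q : nat) (blk : 'I_q -> 'I_n) (ex : 'I_q -> multinom n) (b : nat).

Definition ball_gens (l : 'I_#|{: bmultinom n b.+1}|) : multinom n := bmnm (enum_val l).
Definition ball_module := lattice_module blk ex ball_gens (fun=> 0%M).

Lemma ball_moduleP k x : ball_module k x <-> exists (u : multinom q) (y : multinom n),
  [/\ wdg blk u = k, (mdeg y <= b)%N & x = (y + wpt ex u)%M].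
Proof.
split=> [[[l u] <- <-]|[u [y [<- yb ->]]]].
  exists u, (ball_gens l); split; rewrite /dg /= ?add0m// -ltnS.
  by rewrite /ball_gens; case: (enum_val l).
have yb' : (mdeg y < b.+1)%N by [].
exists (enum_rank (BMultinom yb'), u); first by rewrite /dg add0m.
by rewrite /pt /= /ball_gens enum_rankK.
Qed.

Lemma ball_module_add k x a : ball_module k x ->
    ball_module (k + 'e_(blk a))%M (x + ex a)%M.
Proof. by move=> /(lattice_module_add 'e_a); rewrite wdg1 wpt1. Qed.

Hypothesis blk_onto : forall j, exists a, blk a = j.
Hypothesis bb : (n * box_bound ex <= b)%N.
Variable R : realType.

(** The counting function lies between those of two cubes, which have the same limits; the factor n
    in [bb] makes the smaller cube fit into the ball. *)
Lemma ball_generic : exists k0 D : nat, [/\ D%:R = mixed_volume (@block_pts R n q blk ex),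
  forall k, exists N, finite_of_size (ball_module k) N &
  forall (K : fieldType) k, large k0 k -> polycond (fun c : 'I_q -> K =>
    codim_le (supported (ball_module k))
      (relations blk ex ball_gens (fun=> 0%M) (fun _ _ => False) c n k) D /\
    codim_ge (supported (ball_module k))
      (relations blk ex ball_gens (fun=> 0%M) (fun _ _ => False) c n k) D)].
Proof.
have [k0 [D [cnt [c1 c2 c3 _ _]]]] :=
  @module_generic n q blk ex _ ball_gens (fun=> 0%M) (fun _ _ => False) (fun _ _ _ h =>
      h) (fun _ _ h => False_ind _ h).
have c1' k : finite_of_size (ball_module k) (cnt k).
  by apply: finite_of_size_ext (c1 k) => x; split => [[]//|h]; split.
have [_ [_ [cnt0 [[d1 _ _ _ _] _]]]] := box_generic blk ex (box_bound ex).
have [_ [_ [cnt1 [[e1 _ _ _ _] _]]]] := box_generic blk ex (box_bound ex + b).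
have lo k : (cnt0 k <= cnt k)%N.
  apply: (finite_of_size_inj (f :=
      id)) (d1 k) (c1' k) => // x /box_moduleP[u [y [uk yb ->]]].
  apply/ball_moduleP; exists u, y; split => //; apply: leq_trans bb; rewrite mdegE.
  by rewrite -[X in (_ <= X * _)%N]card_ord -sum_nat_const; apply: leq_sum => i _;
      exact: yb.
have hi k : (cnt k <= cnt1 k)%N.
  apply: (finite_of_size_inj (f :=
      id)) (c1' k) (e1 k) => // x /ball_moduleP[u [y [uk yb ->]]].
  apply/box_moduleP; exists u, y; split => // i.
  by apply: leq_trans (mdeg_ge y i) (leq_trans yb (leq_addl _ _)).
exists k0, D; split => [|k|K k kk]; [|by exists (cnt k)|exact: c3].
pose k := mnm_of (fun _ : 'I_n => k0).
apply: (@telescoped_limit R n D (fun S N => cnt (box_shift N k S)) (fun S =>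
    volume (@sum_hull R n q blk ex S))).
  move=> S; have [_ _ l0] := @box_volume R n q blk ex blk_onto _ k S cnt0 (leqnn _) d1.
  have [_ _ l1] := @box_volume R n q blk ex blk_onto _ k S cnt1 (leq_addr _ _) e1.
  apply: squeeze_cvgr l0 l1; near=> N; apply/andP; split.
    by rewrite ler_wpM2r ?invr_ge0 ?exprn_ge0// ler_nat.
  by rewrite ler_wpM2r ?invr_ge0 ?exprn_ge0// ler_nat.
by move=> N; apply: c2 => j; rewrite mnm_ofE.
Unshelve. all: by end_near.
Qed.

End BallModule.

Lemma codim_le_restrict (K : fieldType) (L : lmodType K) (E W : L ->
    Prop) d : subspace E -> subspace W ->
  codim_le (fun=> True) W d -> exists2 t, (t <= d)%N & codim_le E (fun v => E v /\ W v) t.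
Proof.
move=> sE sW le; have sEW : subspace (fun v => E v /\ W v).
  split; first by split; [exact: sE.1|exact: sW.1].
  by move=> a x y [Ex Wx] [Ey Wy]; split; [exact: sE.2|exact: sW.2].
case: (codim_dichotomy d.+1 sE sEW) => [[b [bE bP]]|[t td [h _]]]; last by exists t.
have ge : codim_ge (fun=> True) W d.+1.
  exists b; split => // c Wc; apply: bP; split => //.
  by apply: subspace_sum => // i _; exact: subspaceZ.
by have := codim_le_ge sW le ge; rewrite ltnn.
Qed.

Section LowerBound.
Variables (K : fieldType) (n q : nat) (blk : 'I_q -> 'I_n) (ex : 'I_q ->
    multinom n) (M : nat).
Local Notation P := (mpoly n K).
Local Notation blk0 := (@blk0 n q blk).
Local Notation ex0 := (@ex0 n q ex).
Hypothesis M0 : (0 < M)%N.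
Hypothesis Me : forall j i, exists a, blk a = j /\ ex a = ('e_i *+ M)%M.
Hypothesis exM : forall a, (mdeg (ex a) <= M)%N.

Lemma ex0M a : (mdeg (ex0 a) <= M)%N.
Proof.
by rewrite -(splitK a); case: (fintype.split a) => j /=; rewrite ?ex0_l ?ex0_r ?mdeg0.
Qed.

Variable b : nat.
Hypothesis bM : (n * M <= b)%N.
Local Notation V := (ball_module blk0 ex0 b).
Local Notation L := (ball_module blk ex b).

Lemma large_coord (x : multinom n) : (b < mdeg x)%N -> exists i, (M <= x i)%N.
Proof.
move=> bx; apply: contrapT => h; move: bx; apply/negP; rewrite -leqNgt; apply: leq_trans bM.
rewrite mdegE -[X in (_ <= X * M)%N]card_ord -sum_nat_const; apply: leq_sum => i _.
by rewrite leqNgt; apply/negP => /ltnW xi; apply: h; exists i.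
Qed.

Lemma strip_axis (x : multinom n) i : (M <= x i)%N ->
  exists2 x', (x' + 'e_i *+ M)%M = x & (mdeg x' + M)%N = mdeg x.
Proof.
move=> xi; have e : (x - 'e_i *+ M + 'e_i *+ M)%M = x.
  by apply/mnmP => l; mnm; have [<-|] := eqVneq i l; [lia|rewrite mul0n subn0 addn0].
by exists (x - 'e_i *+ M)%M => //; rewrite -{2}e mdegD mdegMn mdeg1 mul1n.
Qed.

Lemma mdeg_split (k : multinom n) : (0 < mdeg k)%N ->
    exists (j : 'I_n) (k' : multinom n), (k' + 'e_j)%M = k /\ (mdeg k').+1 = mdeg k :> nat.
Proof.
move=> k0; have [j kj] : exists j : 'I_n, (0 < k j)%N.
  apply: contrapT => h; move: k0; rewrite mdegE big1// => i _; apply/eqP;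
      rewrite -leqn0 leqNgt.
  by apply/negP => ki; apply: h; exists i.
exists j, (k - 'e_j)%M; rewrite subm_add//; split => //.
by rewrite -{2}(subm_add kj) mdegD mdeg1 addn1.
Qed.

Lemma ball_module_full k x : V k x <-> (mdeg x <= M * mdeg k + b)%N.
Proof.
split=> [/ball_moduleP[u [y [<- yb ->]]]|].
  rewrite mdegD addnC leq_add// /wdg /wpt !mdeg_sum big_distrr /=; apply: leq_sum => a _.
  by rewrite !mdegMn mdeg1 mul1n leq_mul2r ex0M orbT.
have [e ke] : exists e, mdeg k = e by exists (mdeg k).
elim: e k ke x => [|e IH] k ke x xk.
  apply/ball_moduleP; exists 0%M, x; split.
  - have -> : k = 0%M by apply/eqP; rewrite -mdeg_eq0 ke.
    by apply/mnmP => j; rewrite wdgE mnm0E big1// => a _; rewrite mnm0E.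
  - by rewrite ke muln0 in xk.
  - by apply/mnmP => i; mnm; rewrite wptE big1 ?addn0// => a _; rewrite mnm0E muln0.
have [|j [k' [kE k'e]]] := @mdeg_split k; first by rewrite ke.
have {}k'e : mdeg k' = e by move: k'e; rewrite ke => -[].
rewrite -kE.
have [xs|xb] := leqP (mdeg x) (M * e + b).
  have := IH k' k'e x; rewrite k'e =>
      /(_ xs) /(@ball_module_add _ _ _ _ _ _ _ (rshift q j)).
  by rewrite blk0_r ex0_r addm0.
have [i xi] := large_coord (leq_ltn_trans (leq_addl _ _) xb).
have [x' xE x'd] := strip_axis xi; rewrite -xE; have [a [<- <-]] := Me j i.
have h : V k' x' by apply: IH => //; move: xk; rewrite k'e ke -x'd; lia.
by have := ball_module_add (lshift n a) h; rewrite blk0_l ex0_l.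
Qed.

Lemma ball_module_top k x : (mdeg x <= M * mdeg k + b)%N ->
    (M * mdeg k + b < mdeg x + M)%N -> L k x.
Proof.
have [e ke] : exists e, mdeg k = e by exists (mdeg k).
elim: e k ke x => [|e IH] k ke x xk kx.
  apply/ball_moduleP; exists 0%M, x; split.
  - have -> : k = 0%M by apply/eqP; rewrite -mdeg_eq0 ke.
    by apply/mnmP => j; rewrite wdgE mnm0E big1// => a _; rewrite mnm0E.
  - by rewrite ke muln0 in xk.
  - by apply/mnmP => i; mnm; rewrite wptE big1 ?addn0// => a _; rewrite mnm0E muln0.
have [|j [k' [kE k'e]]] := @mdeg_split k; first by rewrite ke.
have {}k'e : mdeg k' = e by move: k'e; rewrite ke => -[].
rewrite -kE.
have [|i xi] := @large_coord x; first by rewrite ke in kx; lia.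
have [x' xE x'd] := strip_axis xi; rewrite -xE; have [a [<- <-]] := Me j i.
apply: ball_module_add; apply: IH => //.
  by move: xk; rewrite k'e ke -x'd; lia.
by move: kx; rewrite k'e ke -x'd; lia.
Qed.

Lemma ball_module_sub k x : L k x -> V k x.
Proof.
move=> /ball_moduleP[u [y [uk yb ->]]]; apply/ball_module_full.
rewrite -uk mdegD addnC leq_add// /wdg /wpt !mdeg_sum big_distrr /=; apply: leq_sum => a _.
by rewrite !mdegMn mdeg1 mul1n leq_mul2r exM orbT.
Qed.

Variable c : 'I_q -> K.
(** The system f itself as a special member of the larger family, with zero constant terms. *)
Let cc (a : 'I_(q + n)) : K := match fintype.split a with inl a => c a | inr _ => 0 end.

Lemma sparse_sys_pad j : sparse_sys blk0 ex0 cc j = sparse_sys blk ex c j.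
Proof.
rewrite sparse_sys0 /cc -[rshift q j]/(unsplit (inr j)) unsplitK mpolyC0 addr0.
congr (sparse_sys _ _ _ _); apply/funext => a.
by rewrite -[lshift n a]/(unsplit (inl a)) unsplitK.
Qed.

Local Notation f := (sparse_sys blk ex c).
Local Notation relV k :=
    (relations blk0 ex0 (@ball_gens n b) (fun=> 0%M) (fun _ _ => False) cc n k).
Local Notation relL k :=
    (relations blk ex (@ball_gens n b) (fun=> 0%M) (fun _ _ => False) c n k).

Lemma relV_E k (v : P) : relV k v <-> exists h : 'I_n -> P,
  (forall j, supported (below blk0 ex0 (@ball_gens n b) (fun=> 0%M) j k) (h j)) /\
      v = \sum_j f j * h j.
Proof.
have sE (h : 'I_n -> P) : \sum_(j < n | (j < n)%N) sparse_sys blk0 ex0 cc j * h j = \sum_j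
    f j * h j.
  by apply: eq_big => [j|j _]; rewrite ?ltn_ord// sparse_sys_pad.
split=> [[h [hb /supported0 /eqP]]|[h [hb ->]]].
  by rewrite subr_eq0 sE => /eqP ->; exists h; split => // j; apply: hb; exact: ltn_ord.
by exists h; rewrite sE subrr; split => //; exact: supported_0.
Qed.

(** Multipliers from the local ideal are cut off above degree M(|k| - 1) + b, where they belong to V
    in degree k - e_j. The remaining error has only terms in the top window, which is contained in
    L. *)
Lemma loc_bounded (k : multinom n) (v : P) : (forall j, (0 < k j)%N) ->
    supported (V k) v -> loc (@unit_at0 K n) f v ->
  exists h : 'I_n -> P,
  (forall j, supported (below blk0 ex0 (@ball_gens n b) (fun=> 0%M) j k) (h j)) /\
  supported (L k) (v - \sum_j f j * h j).
Proof.
move=> k0 vV /(@loc_trunc _ _ _ (M * mdeg k + b).+1)[h hv].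
pose B := (M * mdeg k + b - M).+1.
have kM (j : 'I_n) : (M <= M * mdeg k)%N.
  by rewrite -{1}[M]muln1 leq_mul2l (leq_trans (k0 j) (mdeg_ge k j)) orbT.
have /choice[h' h'P] j := high_split B (h j).
have h'b j : supported (below blk0 ex0 (@ball_gens n b) (fun=> 0%M) j k) (h' j).
  apply: supportedW (h'P j).1 => w wB; exists (k - 'e_j)%M; first exact: subm_add.
  apply/ball_module_full; have := congr1 mdeg (subm_add (k0 j)).
  rewrite mdegD mdeg1 addn1 => kE; move: wB (kM j); rewrite /B -kE; lia.
exists h'; split => // w w0; apply: ball_module_top.
  apply/ball_module_full; move: w w0; apply: supportedB => //; apply: supported_sum => j _.
  apply: (@supportedM _ _ (fun w => (mdeg w <= M)%N)) (h'b j).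
    move=> w w' wM [k' <- /ball_module_full h1]; apply/ball_module_full.
    by rewrite !mdegD mdeg1; lia.
  by apply: supported_sum => a _; apply: supportedZ; apply: supportedX.
have : high B (v - \sum_j f j * h' j).
  have -> : v - \sum_j f j * h' j = (v - \sum_j f j * h j) + \sum_j f j * (h j - h' j).
    by under [X in _ = _ + X]eq_bigr do rewrite mulrBr; rewrite sumrB; ring.
  apply: supportedD; first by apply: supportedW hv => z; rewrite /B; lia.
  by apply: supported_sum => j _; apply: high_mul; exact: (h'P j).2.
by move=> /(_ w w0); rewrite /B; lia.
Qed.

(** Two layers: modulo the local ideal V has dimension at most mu, and elements of the local ideal
    reduce to L by [loc_bounded], where d dimensions remain. *)
Lemma lower_bound_at (k : multinom n) mu d : (forall j, (0 < k j)%N) ->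
  codim_le (fun _ : P => True) (loc (@unit_at0 K n) f) mu ->
  codim_le (supported (L k)) (relL k) d ->
  exists2 t, (t <= mu + d)%N & codim_le (supported (V k)) (relV k) t.
Proof.
move=> k0 le [g [gL gP]].
have [t tmu [e [eV eP]]] :=
    codim_le_restrict (supported_subspace K (V k)) (loc_subspace f (@unit_at0_mult K n)) le.
have srV : subspace (relV k) by exact: relations_subspace.
exists (t + d)%N; first by rewrite leq_add2r.
pose W' (v : P) := supported (V k) v /\ exists h : 'I_n -> P,
  (forall j, supported (below blk0 ex0 (@ball_gens n b) (fun=> 0%M) j k) (h j)) /\
  supported (L k) (v - \sum_j f j * h j).
have LV (v : P) : supported (L k) v -> supported (V k) v by apply: supportedW;
    exact: ball_module_sub.
apply: (@codim_le_trans _ _ _ _ W') => //; last by move=> v [].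
  by exists e; split => // v /eP[co [h1 h2]]; exists co; split => //; exact: loc_bounded.
exists g; split.
  move=> i; split; first exact: LV.
  exists (fun=> 0); split => [j|]; first exact: supported_0.
  by rewrite big1 ?subr0// => j _; rewrite mulr0.
move=> v [vV [h [hb hv]]]; have [co [h2 [h2b /supported0 h2v]]] := gP _ hv; exists co.
apply/relV_E; exists (fun j => h j + h2 j); split.
  move=> j; apply: supportedD => //;
      apply: supportedW (h2b j (ltn_ord j)) => w [k' <- wk]; exists k' => //.
  exact: ball_module_sub.
under [RHS]eq_bigr do rewrite mulrDr.
have e2 : v - \sum_j f j * h j - \sum_i co i *: g i = \sum_j f j * h2 j.
  by move/eqP: h2v; rewrite subr_eq0 => /eqP ->; apply: eq_bigl => j; rewrite ltn_ord.
by rewrite big_split /= -e2; ring.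
Qed.

End LowerBound.

Section GenericLowerBound.
Variables (R : realType) (K : fieldType) (n q : nat) (blk : 'I_q -> 'I_n) (ex : 'I_q ->
    multinom n) (M : nat).
Local Notation P := (mpoly n K).
Hypothesis uncountableK : forall B : set K, countable B -> exists t, ~ B t.
Hypothesis i0 : 'I_n.
Hypothesis M0 : (0 < M)%N.
Hypothesis Me : forall j i, exists a, blk a = j /\ ex a = ('e_i *+ M)%M.
Hypothesis exM : forall a, (mdeg (ex a) <= M)%N.

(** The system with zero constant terms bounds a codimension in V by mu + DL; since such a bound is
    an open condition, it passes to generic constant terms, where the codimension is DV. *)
Theorem mult_lower_bound (DL DV : nat) :
  DL%:R = mixed_volume (@block_pts R n q blk ex) ->
  DV%:R = mixed_volume (@block_pts R n (q + n) (@blk0 n q blk) (@ex0 n q ex)) ->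
  polycond (fun c : 'I_q -> K => forall mu,
    codim_le (fun _ : P => True) (loc (@unit_at0 K n) (sparse_sys blk ex c)) mu ->
        (DV <= mu + DL)%N).
Proof.
move=> DLE DVE.
pose b := (n * M + (n * box_bound ex + n * box_bound (@ex0 n q ex)))%N.
have bM : (n * M <= b)%N by exact: leq_addr.
have onto j : exists a, blk a = j by have [a [aj _]] := Me j i0; exists a.
have onto0 j : exists a, @blk0 n q blk a = j by exists (rshift q j); exact: blk0_r.
have [|kL [DL' [/eqP + _ genL]]] := @ball_generic n q blk ex b onto _ R.
  by rewrite /b addnCA leq_addr.
rewrite -DLE eqr_nat => /eqP DD; subst DL'.
have [|kV [DV' [/eqP + finV genV]]] :=
    @ball_generic n (q + n) (@blk0 n q blk) (@ex0 n q ex) b onto0 _ R.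
  by rewrite /b addnA leq_addl.
rewrite -DVE eqr_nat => /eqP DD; subst DV'.
pose k := mnm_of (fun _ : 'I_n => (kL + kV).+1).
have kkL : large kL k by move=> j; rewrite mnm_ofE -addnS leq_addr.
have kkV : large kV k by move=> j; rewrite mnm_ofE -addSn leq_addl.
have k0 j : (0 < k j)%N by rewrite mnm_ofE.
apply: polycondW (genL K k kkL) => c [leL _] mu lemu.
have [t tmu leV] := @lower_bound_at K n q blk ex M M0 Me exM b bM c k mu DL k0 lemu leL.
apply: leq_trans tmu.
set cc := (X in relations _ _ _ _ _ X) in leV.
have [NY [Y [uY _ YP]]] := finV k.
have /choice[bs bsP] j : exists s : seq (multinom n), uniq s /\ forall w,
    below (@blk0 n q blk) (@ex0 n q ex) (@ball_gens n b) (fun=> 0%M) j k w <-> w \in s.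
  have [N' [s [us _ sP]]] := finV (k - 'e_j)%M; exists s; split => // w; rewrite -sP.
  split=> [[k' k'E]|h]; last by exists (k - 'e_j)%M => //; exact: subm_add.
  by have -> // : k' = (k - 'e_j)%M; rewrite -k'E addmK.
have relE (c' : 'I_(q + n) -> K) (v : P) : supported (fun w => w \in Y) v ->
    relations (@blk0 n q blk) (@ex0 n q ex) (@ball_gens n b) (fun=> 0%M) (fun _ _ =>
        False) c' n k v <->
    span_on (@blk0 n q blk) (@ex0 n q ex) Y bs c' v.
  move=> vY.
  have sE (h : 'I_n -> P) : \sum_(j < n | (j < n)%N) sparse_sys (@blk0 n q blk) (@ex0 n q
      ex) c' j * h j =
     \sum_j sparse_sys (@blk0 n q blk) (@ex0 n q ex) c' j * h j.
    by apply: eq_bigl => j; rewrite ltn_ord.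
  split=> [[h [hb /supported0]]|[h [hb hy]]].
    rewrite sE => e; exists h; split => [j|y _]; last by rewrite e mcoeff0.
    by apply: supportedW (hb j (ltn_ord j)) => w; exact: ((bsP j).2 w).1.
  have hb' j : supported (below (@blk0 n q blk) (@ex0 n q ex) (@ball_gens n b) (fun=> 0%M)
      j k) (h j).
    by apply: supportedW (hb j) => w; exact: ((bsP j).2 w).2.
  exists h; split => [j _|]; first exact: hb'.
  rewrite sE => w; have [wY|wY] := boolP (w \in Y); first by rewrite hy ?eqxx.
  move=> w0; apply: negP wY _; move: w w0; apply: supportedB => //;
      apply: supported_sum => j _.
  rewrite /sparse_sys mulr_suml; apply: supported_sum => a /eqP aj.
  apply: (@supportedM _ _ (fun w => w = @ex0 n q ex a) _ _ _ _ _ _ (hb' j)).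
    move=> w w' -> [k' k'E h']; apply/YP; rewrite addmC -k'E -aj; exact: ball_module_add.
  by apply: supportedZ; apply: supportedX.
have sY (c' : 'I_(q + n) ->
    K) : codim_le (supported (ball_module (@blk0 n q blk) (@ex0 n q ex) b k))
     (relations (@blk0 n q blk) (@ex0 n q ex) (@ball_gens n b) (fun=> 0%M) (fun _ _ =>
         False) c' n k) t <->
    codim_le (supported (fun w =>
        w \in Y)) (span_on (@blk0 n q blk) (@ex0 n q ex) Y bs c') t.
  have VY (v : P) : supported (ball_module (@blk0 n q blk) (@ex0 n q ex) b k) v <->
      supported (fun w => w \in Y) v.
    by split; apply: supportedW => w; have [] := YP w.
  split=> -[e [eV eP]]; exists e; split.
  - by move=> i; exact: ((VY _).1 (eV i)).
  - move=> v vY; have [g gP] := eP _ ((VY v).2 vY); exists g;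
      apply: (fun H => (relE _ _ H).1 gP).
    by apply: supportedB vY _; apply: supported_sum => i _; apply: supportedZ;
        exact: ((VY _).1 (eV i)).
  - by move=> i; exact: ((VY _).2 (eV i)).
  - move=> v vV; have vY := (VY v).1 vV; have [g gP] := eP _ vY; exists g;
      apply: (fun H => (relE _ _ H).2 gP).
    by apply: supportedB vY _; apply: supported_sum => i _; exact: supportedZ.
have /sY/(open_codim uY (fun j => (bsP j).1))/(polycondI (genV K k kkV)) pc := leV.
have [c' /(_ 0%N)[[_ ge] /sY le]] := countable_generic uncountableK (fun _ : nat => pc).
by apply: codim_le_ge le ge; exact: relations_subspace.
Qed.

End GenericLowerBound.

(** * The multiplicity in the field of fractions and the family of supports *)

Lemma fraction_cancel (F : fieldType) (p q r x y : F) : q != 0 ->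
  q * r * (p / q * x * y) = x * (y * p * r).
Proof. by move=> q0; field. Qed.

Lemma fraction_cancel2 (F : fieldType) (s t w : F) : t != 0 -> s != 0 ->
  (t * s)^-1 * (t * w) = w / s.
Proof. by move=> t0 s0; field; rewrite s0 t0. Qed.

Section Fractions.
Variables (K : fieldType) (n : nat).
Local Notation P := (mpoly n K).
Local Notation F := {fraction mpoly n K}.
Local Notation L := (loc (@unit_at0 K n)).
Implicit Types (f : 'I_n -> P) (v w s : P).

Lemma meval_at0 v : meval (fun=> 0) v = mcoeff 0%M v.
Proof.
rewrite mevalE [in RHS](mpolyE v) raddf_sum /=; apply: eq_bigr => w _.
rewrite mcoeffZ mcoeffX; congr (_ * _); have [->|w0] := eqVneq w 0%M.
  by rewrite big1// => i _; rewrite mnm0E expr0.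
have [i wi] : exists i, w i != 0%N.
  apply: contrapT => h; case/eqP: w0; apply/mnmP => i; rewrite mnm0E;
      apply/eqP/negPn/negP => wi.
  by apply: h; exists i.
by rewrite (bigD1 i)//= expr0n (negPf wi) mul0r.
Qed.

Lemma tofrac_neq0 s : unit_at0 s -> tofrac s != 0.
Proof. by rewrite tofrac_eq0; apply: contraNneq => ->; rewrite mcoeff0. Qed.

Lemma local_ringP (x : F) : local_ring (fun=> 0) x ->
    exists p q : P, unit_at0 q /\ x = tofrac p / tofrac q.
Proof. by move=> [p _ [q /=]]; rewrite meval_at0 => q0 <-; exists p, q. Qed.

Lemma local_ring_frac (p q : P) : unit_at0 q -> local_ring (fun=> 0) (tofrac p / tofrac q).
Proof. by move=> q0; exists p => //; exists q => //=; rewrite meval_at0. Qed.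

Lemma local_ideal_frac f w s : unit_at0 s ->
    local_ideal (fun=> 0) f (tofrac w / tofrac s) <-> L f w.
Proof.
move=> us; split.
  move=> [h /= hl]; have /choice[p /choice[q hpq]] j := local_ringP (hl j).
  move=> /(congr1 (fun x => x * tofrac s)); rewrite divfK ?tofrac_neq0// => e.
  pose r j := \prod_(i | i != j) q i.
  have rE j : \prod_i q i = q j * r j by rewrite (bigD1 j).
  exists (\prod_i q i); split.
    apply: (big_ind (@unit_at0 K n));
        [exact: (@unit_at0_mult K n).1|exact: (@unit_at0_mult K n).2|].
    by move=> j _; exact: (hpq j).1.
  exists (fun j => s * p j * r j); apply/eqP;
      rewrite -tofrac_eq rmorphM /= -e rmorph_sum /=; apply/eqP.
  rewrite mulr_suml mulr_sumr; apply: eq_bigr => j _.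
  have qj := tofrac_neq0 (hpq j).1; rewrite (hpq j).2 (rE j) !rmorphM /=.
  exact: fraction_cancel.
move=> [t [ut [h e]]]; exists (fun j => tofrac (h j) / tofrac (t * s)).
  by move=> j /=; apply: local_ring_frac; apply: (@unit_at0_mult K n).2.
under eq_bigr do rewrite mulrAC -rmorphM mulrC /=.
rewrite -mulr_sumr -rmorph_sum /=; under eq_bigr do rewrite mulrC.
have [t0 s0] := (tofrac_neq0 ut, tofrac_neq0 us).
rewrite -e !rmorphM /=.
by rewrite (fraction_cancel2 _ t0 s0).
Qed.

(** High powers of the maximal ideal lie in L, so denominators are invertible modulo L by
    polynomials, and a polynomial basis also spans the quotient of the local ring. *)
Lemma has_multiplicity0 f d B : codim_le (fun _ : P => True) (L f) d ->
    codim_ge (fun _ : P => True) (L f) d ->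
  (forall v, high B v -> L f v) -> has_multiplicity (fun=> 0) f d.
Proof.
move=> le ge hB; have sL := loc_subspace f (@unit_at0_mult K n).
have [b [_ bi bs]] := codim_basis sL le ge.
have u1 : unit_at0 (1 : P) by exact: (@unit_at0_mult K n).1.
have lcE (c : 'I_d -> K) : lin_comb (fun i => tofrac (b i)) c = tofrac (\sum_i c i *: b i).
  by rewrite /lin_comb rmorph_sum /=; apply: eq_bigr => i _; rewrite -rmorphM mul_mpolyC.
have frac1 v : tofrac v = tofrac v / tofrac (1 : P) by rewrite rmorph1 divr1.
exists (fun i => tofrac (b i)); split.
- by move=> i; rewrite frac1; exact: local_ring_frac.
- by move=> c; rewrite lcE frac1 local_ideal_frac//; exact: bi.
move=> g /local_ringP[p [q [uq ->]]]; have [t ht] := unit_at0_inv B uq.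
have [c cP] := bs (t * p) I; exists c.
have -> : tofrac p / tofrac q - lin_comb (fun i => tofrac (b i)) c =
    tofrac (p - q * \sum_i c i *: b i) / tofrac q.
  by rewrite lcE rmorphB rmorphM /= mulrBl [X in _ = _ - X]mulrAC divff ?mul1r//
      tofrac_neq0.
apply/local_ideal_frac => //.
have -> : p - q * \sum_i c i *: b i = q * (t * p - \sum_i c i *: b i) +
    (- p) * (t * q - 1) by ring.
apply: subspaceD => //; first exact: locM.
by apply: locM; exact: hB.
Qed.

(** Since (f) and (g) agree modulo m^(e+1), Nakayama's lemma puts m^e in the local ideal of g too;
    then each family lies in the local ideal of the other. *)
Lemma loc_high_perturb (f g : 'I_n -> P) e : (forall j, high e.+1 (f j - g j)) ->
  (forall v, high e v -> L f v) -> forall v, L f v <-> L g v.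
Proof.
move=> fg hf; have sub (f' g' : 'I_n -> P) : (forall j, L g' (f' j)) ->
    forall v, L f' v -> L g' v.
  move=> fg' v [s [us [h e']]]; apply: (loc_unit (@unit_at0_mult K n) us); rewrite e'.
  apply: subspace_sum => [|j _]; first exact: loc_subspace (@unit_at0_mult K n).
  by rewrite mulrC; exact: locM.
have gen (f' : 'I_n -> P) j : L f' (f' j) by apply: ideal_loc;
    [exact: unit_at0_mult|exact: ideal_mem_gen].
have hW v : high e.+1 v -> high e v by apply: supportedW => w; exact: ltnW.
have hg v : high e v -> L g v.
  apply: loc_high; apply: nakayama => w we.
  have /(@loc_trunc _ _ _ e.+1)[h hh] : L f (mpolyX K w) by apply: hf; apply: supportedX;
      rewrite we.
  exists h; have -> : mpolyX K w - \sum_j g j * h j = (mpolyX K w - \sum_j f j * h j) +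
      \sum_j h j * (f j - g j).
    rewrite -addrA; congr (_ + _); rewrite -sumrN -sumrN -big_split /=;
        apply: eq_bigr => j _; ring.
  by apply: supportedD hh _; apply: supported_sum => j _; exact: high_mul.
move=> v; split; apply: sub => j.
  by rewrite -[f j](subrK (g j)); apply: locD;
      [exact: unit_at0_mult|exact/hg/hW|exact: gen].
rewrite -[g j](subKr (f j)); apply: subspaceB;
    [exact: loc_subspace (@unit_at0_mult K n)|exact: gen|exact/hf/hW].
Qed.

End Fractions.

(** * Supports as indexed families of exponents *)

Section SupportConfig.
Variables (m : nat) (A : 'I_m.+1 -> {fset multinom m.+1}).
Local Notation n := m.+1.
Local Notation q := #|coef_index A|.

Definition sup_blk (k : 'I_q) : 'I_n := tag (enum_val k).
Definition sup_ex (k : 'I_q) : multinom n := val (tagged (enum_val k)).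

Lemma system_ofE (K : fieldType) (c : coef_index A -> K) j :
  system_of c j = sparse_sys sup_blk sup_ex (fun k => c (enum_val k)) j.
Proof.
transitivity (\sum_(j' | j' == j) \sum_(a : A j') c (Tagged (fun j =>
    A j) a) *: mpolyX K (val a)).
  by rewrite big_pred1_eq.
rewrite sig_big_dep /= (reindex _ (onW_bij _ (enum_val_bij (coef_index A)))) /=.
by apply: eq_big => [k|k _]; rewrite ?andbT// /sup_ex; case: (enum_val k).
Qed.

Lemma sup_exP k : sup_ex k \in A (sup_blk k).
Proof. exact: fsvalP. Qed.

Lemma sup_index j a : a \in A j -> exists k, sup_blk k = j /\ sup_ex k = a.
Proof.
move=> aA; exists (enum_rank (Tagged (fun j => A j) (FSetSub aA))).
by rewrite /sup_blk /sup_ex enum_rankK.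
Qed.

Lemma sup_strata : (forall Z : {set 'I_n}, (n <= #|Z| + #|meets_coord_subspace A Z|)%N) ->
  forall Z : {set 'I_n}, (n <= #|Z| + #|[set j | [exists a,
      (sup_blk a == j) && on_stratum sup_ex Z a]]%SET|)%N.
Proof.
move=> H2 Z; apply: leq_trans (H2 Z) _; rewrite leq_add2l; apply: subset_leq_card.
apply/fintype.subsetP => j; rewrite !inE => /fintype.existsP[a aZ].
have [k [kj ka]] := sup_index (valP a).
by apply/fintype.existsP; exists k; rewrite kj eqxx /on_stratum ka.
Qed.

Variable R : realType.

Lemma sup_block_pts : @block_pts R n q sup_blk sup_ex = fun j => supp_pts (A j).
Proof.
apply/funext => j; apply/seteqP; split => x.
  by move=> [a /= /eqP <- <-]; exists (sup_ex a) => //; exact: sup_exP.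
by move=> [a /= aA <-]; have [k [kj ka]] := sup_index aA; exists k; rewrite /= ?kj ?ka.
Qed.

Lemma block_pts0 r (blk : 'I_r -> 'I_n) (ex : 'I_r -> multinom n) :
  @block_pts R n (r + n) (@blk0 n r blk) (@ex0 n r ex) = fun j =>
      0 |` @block_pts R n r blk ex j.
Proof.
have pt0 : @pt_of R n 0%M = 0 by apply/rowP => i; rewrite !mxE mnm0E.
apply/funext => j; apply/seteqP; split => x.
  move=> [a /=]; rewrite -(splitK a); case: (fintype.split a) => a' /=.
    by rewrite blk0_l ex0_l => aj <-; right; exists a'.
  by rewrite ex0_r pt0 => _ <-; left.
move=> [->|[a /= aj <-]].
  by exists (rshift r j); rewrite /= ?blk0_r ?ex0_r.
by exists (lshift n a); rewrite /= ?blk0_l ?ex0_l.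
Qed.

End SupportConfig.

Section GenericMultiplicity.
Variables (R : realType) (K : fieldType).
Hypothesis uncountableK : forall B : set K, countable B -> exists t, ~ B t.

(** The bound known at one point spreads to an open set by [open_mult]; the value e found at that
    point serves for all c in this set. *)
Lemma mult_upper_bound n q (blk : 'I_q -> 'I_n) (ex : 'I_q ->
    multinom n) (i0 : 'I_n) (DL DV : nat) :
  (forall Z : {set 'I_n}, (n <= #|Z| + #|[set j | [exists a,
      (blk a == j) && on_stratum ex Z a]]%SET|)%N) ->
  (forall a, ex a != 0%M) ->
  DL%:R = mixed_volume (@block_pts R n q blk ex) ->
  DV%:R = mixed_volume (@block_pts R n (q + n) (@blk0 n q blk) (@ex0 n q ex)) ->
  (DL <= DV)%N /\ polycond (fun c : 'I_q -> K => exists2 e, (e <= DV - DL)%N &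
    codim_le (fun _ : mpoly n K => True) (loc (@unit_at0 K n) (sparse_sys blk ex c)) e /\
    forall v, high e v -> loc (@unit_at0 K n) (sparse_sys blk ex c) v).
Proof.
move=> strata ex_neq0 DLE DVE.
have [c _ ub] := mult_mixed_volume uncountableK strata ex_neq0 i0 (polycondT (fun _ =>
    I)) DLE DVE.
split.
  by apply: (ub 0%N); exists (fun=> 0); split => // c' _ [].
have sL := loc_subspace (sparse_sys blk ex c) (@unit_at0_mult K n).
have sT : subspace (fun _ : mpoly n K => True) by [].
case: (codim_dichotomy (DV - DL).+1 sT sL) => [/ub|[e eD [/open_mult le _]]]; first by lia.
by apply: polycondW le => c' [h1 h2]; exists e.
Qed.

Variables (m q : nat) (blk : 'I_q -> 'I_m.+1) (ex : 'I_q -> multinom m.+1).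
Local Notation n := m.+1.
Local Notation P := (mpoly n K).
Local Notation r := #|{: 'I_n * 'I_n}|.
Hypothesis strata : forall Z : {set 'I_n}, (n <= #|Z| + #|[set j | [exists a,
    (blk a == j) && on_stratum ex Z a]]%SET|)%N.
Hypothesis ex_neq0 : forall a, ex a != 0%M.

(* The supports A_j together with the points M e_i: the index [rshift q p] is the
   point M e_{p.2} of the support number p.1. *)
Definition axis_blk (a : 'I_(q + r)) : 'I_n :=
  match fintype.split a with inl a => blk a | inr p => (enum_val p).1 end.
Definition axis_ex M (a : 'I_(q + r)) : multinom n :=
  match fintype.split a with inl a => ex a | inr p => ('e_((enum_val p).2) *+ M)%M end.

Lemma axis_blk_l a : axis_blk (lshift r a) = blk a.
Proof. by rewrite /axis_blk -[lshift r a]/(unsplit (inl a)) unsplitK. Qed.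
Lemma axis_blk_r p : axis_blk (rshift q p) = (enum_val p).1.
Proof. by rewrite /axis_blk -[rshift q p]/(unsplit (inr p)) unsplitK. Qed.
Lemma axis_ex_l M a : axis_ex M (lshift r a) = ex a.
Proof. by rewrite /axis_ex -[lshift r a]/(unsplit (inl a)) unsplitK. Qed.
Lemma axis_ex_r M p : axis_ex M (rshift q p) = ('e_((enum_val p).2) *+ M)%M.
Proof. by rewrite /axis_ex -[rshift q p]/(unsplit (inr p)) unsplitK. Qed.

Lemma axis_pts M j i : exists a, axis_blk a = j /\ axis_ex M a = ('e_i *+ M)%M.
Proof. by exists (rshift q (enum_rank (j, i)));
    rewrite axis_blk_r axis_ex_r enum_rankK. Qed.

Lemma clamp_axis_pts M j i : exists a, axis_blk a = j /\
    clamp (axis_ex M) M a = ('e_i *+ M)%M.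
Proof.
have [a [aj ai]] := axis_pts M j i; exists a; split => //.
by rewrite /clamp ai mdegMn mdeg1 mul1n leqnn.
Qed.

Lemma clamp_axis_perturb M (c : 'I_(q + r) -> K) j :
  high M (sparse_sys blk ex (fun a =>
      c (lshift r a)) j - sparse_sys axis_blk (clamp (axis_ex M) M) c j).
Proof.
have hM i : high M (mpolyX K ('e_i *+ M)%M : P) by apply: supportedX;
    rewrite mdegMn mdeg1 mul1n.
rewrite /sparse_sys [X in _ - X]big_mkcond big_split_ord /= opprD addrA; apply: supportedB.
  rewrite [X in X - _]big_mkcond -sumrB; apply: supported_sum => a _.
  rewrite axis_blk_l; case: ifP => _; last by rewrite subrr; exact: supported_0.
  rewrite -scalerBr; apply: supportedZ; rewrite /clamp axis_ex_l; case: leqP => h.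
    by rewrite subrr; exact: supported_0.
  by apply: supportedB; [apply: supportedX; exact: ltnW|exact: hM].
apply: supported_sum => p _; case: ifP => _; last exact: supported_0.
apply: supportedZ; rewrite /clamp axis_ex_r; case: ifP => _; exact: hM.
Qed.

Lemma clamp_axis_strata M (Z : {set 'I_n}) :
  (n <= #|Z| + #|[set j | [exists a,
      (axis_blk a == j) && on_stratum (clamp (axis_ex M) M) Z a]]%SET|)%N.
Proof.
have [->|ZT] := eqVneq Z [set: 'I_n]%SET; first by rewrite cardsT card_ord leq_addr.
have [i iZ] : exists i, i \notin Z.
  apply: contrapT => h; case/eqP: ZT; apply/finset.setP => i; rewrite inE.
  by apply/negPn/negP => iZ; apply: h; exists i.
apply: leq_trans (leq_addl _ _); rewrite -[X in (X <= _)%N]card_ord -cardsT;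
    apply: subset_leq_card.
apply/fintype.subsetP => j _; rewrite inE; apply/fintype.existsP.
have [a [aj ai]] := clamp_axis_pts M j i; exists a; rewrite aj eqxx /on_stratum ai.
apply/fintype.forallP => i'; apply/implyP => i'Z; mnm.
by have [e|_] := eqVneq i i'; [rewrite e i'Z in iZ|rewrite mul0n].
Qed.

Lemma clamp_axis_neq0 M a : (0 < M)%N -> clamp (axis_ex M) M a != 0%M.
Proof.
move=> M0; have e0 i : ('e_i *+ M)%M != 0%M :> multinom n by rewrite -mdeg_eq0 mdegMn mdeg1
    mul1n -lt0n.
rewrite /clamp; case: ifP => _; last exact: e0.
by rewrite -(splitK a); case: (fintype.split a) => a' /=; rewrite ?axis_ex_l ?axis_ex_r.
Qed.

Lemma mixed_integralE (P' : 'I_n -> set 'rV[R]_m) (rho : 'I_n -> 'rV[R]_m ->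
    R) (F : {set 'I_n} -> R) :
  F finset.set0 = 0 ->
  (forall J, J != finset.set0 ->
      F J = integral_rV (minkowski_sum J P') (inf_convolution J P' rho)) ->
  \sum_(J : {set 'I_n}) (-1) ^+ (n - #|J|) * F J = mixed_integral P' rho.
Proof.
move=> F0 FJ; have cJ (J : {set 'I_n}) : (#|J| < n.+1)%N by rewrite ltnS -[X in (_ <=
    X)%N]card_ord max_card.
rewrite (partition_big (fun J : {set 'I_n} =>
    inord #|J| : 'I_n.+1) xpredT)//= big_ord_recl big1 ?add0r.
  rewrite /mixed_integral big_add1 big_mkord; apply: eq_bigr => k _; rewrite mulr_sumr.
  apply: eq_big => [J|J]; rewrite -val_eqE /= inordK//.
  by move=> /eqP Jk; rewrite Jk FJ// -cards_eq0 Jk.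
move=> J; rewrite -val_eqE /= inordK// cards_eq0 => /eqP ->.
by rewrite F0 mulr0.
Qed.

Variables (DL DV : nat).
Hypothesis DLE : DL%:R = mixed_volume (@block_pts R n q blk ex).
Hypothesis DVE : DV%:R = mixed_volume (@block_pts R n (q +
    n) (@blk0 n q blk) (@ex0 n q ex)).
Local Notation M := (DV - DL).+1.

(** With M one more than the bound DV - DL for A, truncation at degree M leaves the local ideal
    unchanged, and for the clamped supports upper and lower bounds meet at CV - CL. *)
Theorem generic_multiplicity : exists2 e : nat,
  e%:R = mixed_integral (@dom R m (q + r) axis_blk (axis_ex M))
           (fun j => lower_envelope (@hullQ R m (q + r) axis_blk (axis_ex M) j)) &
  polycond (fun c : 'I_q -> K =>
    codim_le (fun _ : P => True) (loc (@unit_at0 K n) (sparse_sys blk ex c)) e /\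
    codim_ge (fun _ : P => True) (loc (@unit_at0 K n) (sparse_sys blk ex c)) e /\
    forall v, high (DV - DL) v -> loc (@unit_at0 K n) (sparse_sys blk ex c) v).
Proof.
pose bA := axis_blk; pose eA := axis_ex M; pose eC := clamp eA M.
have onto j : exists a, bA a = j by have [a [aj _]] := axis_pts M j ord0; exists a.
have onto0 j : exists a, @blk0 n _ bA a = j by exists (rshift (q + r) j); exact: blk0_r.
have [CL [CLE _]] := @box_uniform R n (q + r) bA eC onto.
have [CV [CVE _]] := @box_uniform R n (q + r + n) _ (@ex0 n _ eC) onto0.
have eCM a : (mdeg (eC a) <= M)%N by exact: mdeg_clamp.
have [_ upA] := mult_upper_bound ord0 strata ex_neq0 DLE DVE.
have [LV upC] := mult_upper_bound ord0 (@clamp_axis_strata M) (fun a =>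
    clamp_axis_neq0 a (ltn0Sn _)) CLE CVE.
have loC := mult_lower_bound uncountableK ord0 (ltn0Sn _) (@clamp_axis_pts M) eCM CLE CVE.
exists (CV - CL)%N.
  rewrite natrB// CLE CVE /mixed_volume -sumrB.
  rewrite -(@mixed_integralE _ _ (fun J =>
      volume (@sum_hull R n _ (@blk0 n _ bA) (@ex0 n _ eC) J) - volume (@sum_hull R n _ bA
          eC J))).
  - by apply: eq_bigr => J _; rewrite mulrBr.
  (* For empty J both Minkowski sums reduce to the point 0. *)
  - apply/eqP; rewrite subr_eq0; apply/eqP; congr volume; apply/seteqP.
    by split => x [y _ <-]; (exists y => [j|]; [rewrite inE|]).
  - by move=> J J0; exact: envelope_volume (ltn0Sn _) (axis_pts M) _ J0.
apply: (polycond_forget uncountableK (r := r)).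
apply: polycondW (polycondI (polycond_pull (@lshift_inj q r) upA) (polycondI upC loC)).
move=> c [[e eM [_ hi]] [[e' e'C [leC _]] lo]].
have hi' v : high (DV - DL) v ->
    loc (@unit_at0 K n) (sparse_sys blk ex (fun a => c (lshift r a))) v.
  by move=> hv; apply: hi; apply: supportedW hv => w; exact: leq_trans.
have eqL := loc_high_perturb (@clamp_axis_perturb M c) hi'.
have e'E : e' = (CV - CL)%N by have := lo _ leC; lia.
have [t te [tle tge]] :=
    codim_exact (conj I (fun _ _ _ _ _ => I)) (loc_subspace _ (@unit_at0_mult K n)) leC.
have tE : t = (CV - CL)%N by have := lo _ tle; lia.
rewrite -e'E; split; first by apply: codim_leW leC => v /eqL.
split => //; rewrite e'E -tE; have [b [bT bP]] := tge; exists b; split => // g /eqL;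
    exact: bP.
Qed.

End GenericMultiplicity.

Lemma polycond_generic (R : realType) m (A : 'I_m.+1 -> {fset multinom m.+1})
    (Phi : ('I_m.+1 -> mpoly m.+1 R[i]) -> Prop) :
  (forall f g, f =1 g -> Phi f -> Phi g) ->
  polycond (fun c => Phi (sparse_sys (@sup_blk m A) (@sup_ex m A) c)) ->
      for_generic_system A Phi.
Proof.
move=> ext [G G0 GP].
exists [set c : coef_index A -> R[i] | meval (fun k => c (enum_val k)) G != 0]; split.
- exists [set G]; apply/seteqP; split => c /=; first by exists G.
  by move=> [_ ->].
- have [c cP] := @countable_generic _ (@complex_uncountable R) _ (fun _ : nat =>
    fun c => meval c G != 0) (fun _ => ex_intro2 _ _ G G0 (fun _ h => h)).
  exists (fun t => c (enum_rank t)) => /=; rewrite (_ : (fun k => _) = c);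
      first exact: (cP 0%N).
  by apply/funext => k; rewrite enum_valK.
move=> c /= /GP h _; apply: ext h => j; exact/esym/system_ofE.
Qed.

Local Open Scope complex_scope.

Theorem corollary13 (R : realType) (m : nat)
    (A : 'I_m.+1 -> {fset multinom m.+1})
    (H1 : forall j, mnm0 \notin A j)
    (H2 : forall I : {set 'I_m.+1},
      (m.+1 <= #|I| + #|meets_coord_subspace A I|)%N) :
  let M : R := mixed_volume (fun j => supp_pts0 (A j))
               - mixed_volume (fun j => supp_pts (A j)) + 1 in
  let Q j := conv_hull (supp_pts_simplex M (A j)) in
  for_generic_system A (fun f : 'I_m.+1 -> mpoly m.+1 R[i] =>
    exists2 d : nat, has_multiplicity (fun=> 0) f d &
      d%:R = mixed_integral (fun j => @proj_init R m @` axis_simplex (Q j))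
                            (fun j => lower_envelope (Q j))).
Proof.
move=> M Q; have strata := sup_strata H2.
have ex_neq0 (a : 'I_#|coef_index A|) : sup_ex a != 0%M.
  by apply: contraNneq (H1 (sup_blk a)) => <-; exact: sup_exP.
have onto := strata_onto strata.
have [DL [DLE _]] := @box_uniform R m.+1 _ (@sup_blk m A) (@sup_ex m A) onto.
have onto0 j : exists a, @blk0 m.+1 _ (@sup_blk m A) a = j by exists (rshift _ j);
    exact: blk0_r.
have [DV [DVE _]] := @box_uniform R m.+1 _ _ (@ex0 m.+1 _ (@sup_ex m A)) onto0.
have unc := @complex_uncountable R.
have [LV _] := mult_upper_bound unc ord0 strata ex_neq0 DLE DVE.
have [e eE pe] := generic_multiplicity unc strata ex_neq0 DLE DVE.
(* Both mixed volumes are natural numbers, so the real number M is one too and the M e_i are lattice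
   points. *)
have ME : M = (DV - DL).+1%:R.
  rewrite /M -natr1 natrB// DLE DVE block_pts0 sup_block_pts.
  by [].
have QE j : Q j = @hullQ R m _ (axis_blk (@sup_blk m A)) (axis_ex (@sup_ex m A) (DV -
    DL).+1) j.
  rewrite /Q /hullQ; congr conv_hull; rewrite ME; apply/seteqP; split => x.
    move=> [|[i _ <-]].
      rewrite -(congr1 (fun E => E j) (sup_block_pts A R)) => -[a /= aj <-];
          exists (lshift _ a).
        by rewrite /= axis_blk_l.
      by rewrite axis_ex_l.
    have [a [aj ai]] := axis_pts (@sup_blk m A) (@sup_ex m A) (DV - DL).+1 j i.
    by exists a; rewrite /= ?aj// ai pt_Me.
  move=> [a /=]; rewrite -(splitK a); case: (fintype.split a) => p /=.
    rewrite axis_blk_l axis_ex_l => pj <-; left;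
        rewrite -(congr1 (fun E => E j) (sup_block_pts A R)).
    by exists p.
  by rewrite axis_ex_r pt_Me => _ <-; right; exists (enum_val p).2.
apply: polycond_generic => [f g fg|]; first by have -> : f = g by exact/funext.
apply: polycondW pe => c [le [ge hi]]; exists e; first exact: has_multiplicity0 le ge hi.
by rewrite eE (funext QE).
Qed.
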